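(* Let $\alpha$ be a nonzero algebraic number and let $P(X)=a_kX^k+\cdots+a_1X+a_0\in\overline{\mathbb{Q}}[X]$ be a non-constant polynomial. Let $L=\mathbb{Q}(a_0,\dots,a_k,\alpha)$. If $\mathrm{Tr}_{L/\mathbb{Q}}(P(\alpha^n))\in\mathbb{Z}\setminus\{0\}$ for infinitely many natural numbers $n$, then either $\alpha$ is an algebraic integer, or for each $i=1,\dots,k$ one has $\mathrm{Tr}_{L/\mathbb{Q}}(a_i\alpha^{in})=0$ for infinitely many values of $n$.
   Context: $\overline{\mathbb{Q}}$ denotes the field of algebraic numbers; $\mathrm{Tr}_{L/\mathbb{Q}}$ is the field trace. *)

(* Defs.v *)
From HB Require Import structures.
From mathcomp Require Import all_boot all_order all_algebra all_field.
Set Implicit Arguments. Unset Strict Implicit. Unset Printing Implicit Defensive.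
Import Order.TTheory GRing.Theory Num.Theory.
Local Open Scope ring_scope.

Definition fieldTr (L : fieldExtType rat) (x : L) : rat :=
  \tr (passmx.mxof (vbasis fullv) (vbasis fullv) (amulr x)).

Definition infinitely_many (S : nat -> Prop) : Prop :=
  forall N : nat, exists n : nat, (N <= n)%N /\ S n.

(* Main.v *)
Require Import Defs.
From HB Require Import structures.
From mathcomp Require Import all_boot all_order all_algebra all_field.
From mathcomp Require Import perm mpoly ring lra zify.
From mathcomp Require boolp classical_sets.
From Stdlib Require Import Classical ClassicalEpsilon.
Set Implicit Arguments. Unset Strict Implicit. Unset Printing Implicit Defensive.
Import Order.TTheory GRing.Theory Num.Theory.
Local Open Scope ring_scope.

(** Write u(n) = Tr(P(alpha^n)) = sum_t a_t rho_t^n, where t runs over the pairs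
    (embedding sigma_j of L, exponent i), a_t = sigma_j(a_i) and rho_t = sigma_j(alpha)^i.
    Restricting n to a residue class modulo a suitable M merges the rho_t whose
    ratios are roots of unity: u(n) = sum_b c_b b^m with no b/b' a root of unity.
    If u(n) is integral infinitely often, then c_b = 0 whenever b is not an
    algebraic integer.  When alpha is not integral, sigma_j(alpha)^a =
    sigma_j'(alpha)^b forces a = b, so the b with c_b = 0 coming from a_i X^i
    (i >= 1) only involve that i, and Tr(a_i alpha^(in)) vanishes on the whole
    residue class.

    To see that c_b = 0, take a valuation ring O of the algebraic numbers not
    containing b, with residue characteristic p.  Dividing by a dominant b
    produces v-units gamma_i, with ratios that are not roots of unity, for which
    sum_i lambda_i gamma_i^n lies in p^n O for infinitely many n.  This
    contradicts a case of the p-adic subspace theorem.  It is proved by induction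
    on the number of terms, for coefficients lambda_i in a number ring that may
    vary with n but stay below p^(n/q) for every q.  By the induction hypothesis
    the lattice of the relations y with sum_i y_i gamma_i^n in p^n O has no very
    small minima.  A reduced basis of it then gives linear forms in which an
    auxiliary polynomial in many exponents n_1, n_2, ... (Siegel's lemma, with a
    second moment estimate instead of large deviations) has large index at
    points built from the gamma_i^n_h, contradicting Roth's lemma. *)

(** The descent must allow coefficients that move with [n], because the short vectors of the lattice
    of relations do. Its decisive gain is one exponent: placing a short relation in all the terms on
    top of reduced vectors for all but one term gives cofactors that save about [n/q0] against the
    trivial count, and every other constant is chosen so as to cost less. Sizes are recorded as
    powers of [w] with [w^q2 = p], rounded to multiples of [n]; only finitely many size patterns
    then occur, so the many exponents n_1, n_2, ... can share one. Roth's lemma asks here for a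
    bound on the multiplicity of integer polynomials at the points instead of a height; quotients
    [-Z_1 gamma_1^n/(Z_0 gamma_0^n)] with small coefficients satisfy it as soon as [gamma_1/gamma_0]
    is not a root of unity. No completion is used: [p]-adic smallness means that [x/p^n] lies in
    [O]. The imaginary unit is adjoined to the field, so that all archimedean places are complex and
    the lattices are modules over a Gaussian order. The number of blocks of variables is chosen
    after the tolerated deviation, which is why a second moment suffices. *)

Lemma fun_choice (A B : Type) (R : A -> B -> Prop) :
  (forall x, exists y, R x y) -> exists f, forall x, R x (f x).
Proof.
move=> H; exists (fun x => projT1 (constructive_indefinite_description _ (H x))) => x.
by case: constructive_indefinite_description.
Qed.

(** * Generalised Wronskians over a domain with derivations *)

Section Wronskian.
Variables (R : idomainType) (cst : {rmorphism algC -> R}) (r : nat).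
Variable dd : 'I_r -> R -> R.
Hypothesis ddD : forall i x y, dd i (x + y) = dd i x + dd i y.
Hypothesis ddM : forall i x y, dd i (x * y) = dd i x * y + x * dd i y.
Hypothesis dd_const : forall f g, g != 0 ->
  (forall i, dd i f * g = f * dd i g) -> exists c, f = cst c * g.

Definition cindep k (phi : 'I_k -> R) :=
  forall c : 'I_k -> algC, \sum_j cst (c j) * phi j = 0 -> forall j, c j = 0.

Definition dword (w : seq 'I_r) (x : R) := foldr dd x w.

Let dd0 i : dd i 0 = 0.
Proof. by apply: (addrI (dd i 0)); rewrite -ddD !addr0. Qed.

Let dd_sum i (I : finType) (F : I -> R) : dd i (\sum_j F j) = \sum_j dd i (F j).
Proof. exact: (big_morph (dd i) (ddD i) (dd0 i)). Qed.

(** Suppose the words [w] give a nonzero minor of size [k] but no word of length at most [k]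
    completes it. The cofactors [C] of the missing row then annihilate all derivatives of order at
    most [k]. Differentiating these relations shows that the [C j] have the same logarithmic
    derivatives, so by [dd_const] they are constant multiples of one of them, and the relation for
    the empty word is a constant linear relation between the [phi j]. The bound on the lengths
    controls the loss of index in Roth's lemma. *)
Lemma generalized_wronskian k (phi : 'I_k -> R) : cindep phi ->
  exists2 w : 'I_k -> seq 'I_r, forall l, (size (w l) <= l)%N &
    \det (\matrix_(l, j) dword (w l) (phi j)) != 0.
Proof.
elim: k phi => [|k IH] phi ind.
  by exists (fun=> [::]) => [[]//|]; rewrite det_mx00 oner_eq0.
have ind' : cindep (fun j : 'I_k => phi (widen_ord (leqnSn k) j)).
  move=> c Hc j; pose c' (i : 'I_k.+1) := if unlift ord_max i is Some j' then c j' else 0.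
  have lw (i : 'I_k) : widen_ord (leqnSn k) i = lift ord_max i.
    by apply: val_inj; rewrite /= /bump leqNgt ltn_ord.
  have := ind c' _ (widen_ord (leqnSn k) j); rewrite /c' lw liftK; apply.
  rewrite big_ord_recr /= unlift_none rmorph0 mul0r addr0 -[RHS]Hc.
  by apply: eq_bigr => i _; rewrite lw liftK.
have [w Hw Hdet] := IH _ ind'.
have [[w0 Hw0 Hn0]|Hall] := classic (exists2 w0 : seq 'I_r, (size w0 <= k)%N &
   \det (\matrix_(l < k.+1, j < k.+1) dword (if unlift ord_max l is Some l' then w l' else w0) (phi j)) != 0).
  exists (fun l => if unlift ord_max l is Some l' then w l' else w0) => // l.
  case: unliftP => [l' ->|->]; last by [].
  by rewrite (leq_trans (Hw l')) //= leq_addl.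
exfalso.
pose M w0 := \matrix_(l < k.+1, j < k.+1)
  dword (if unlift ord_max l is Some l' then w l' else w0) (phi j).
pose C j := cofactor (M [::]) ord_max j.
have HC w0 : (size w0 <= k)%N -> \sum_j C j * dword w0 (phi j) = 0.
  move=> Hs; have: \det (M w0) = 0.
    by apply: contra_not_eq Hall => Hn; exists w0.
  rewrite (expand_det_row _ ord_max) => Hd; rewrite -[RHS]Hd; apply: eq_bigr => j _.
  rewrite mulrC mxE unlift_none; congr (_ * _).
  rewrite /C /cofactor; congr (_ * \det _).
  by apply/matrixP => a b; rewrite !mxE liftK.
have Hlw (i : 'I_k) : lift ord_max i = widen_ord (leqnSn k) i.
  by apply: val_inj; rewrite /= /bump leqNgt ltn_ord.
have Cmax : C ord_max != 0.
  rewrite /C /cofactor mulf_neq0 ?signr_eq0 //.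
  congr (_ != 0): Hdet; congr (\det _); apply/matrixP => a b.
  by rewrite !mxE liftK Hlw.
(* The derivative of the relation for [w l] also contains the relation for [i :: w l]; this word
   still has length at most [k], so that part vanishes and only the derivatives of [C] remain. *)
have HdC i (l : 'I_k) : \sum_j dd i (C j) * dword (w l) (phi j) = 0.
  have := HC (w l) (leq_trans (Hw l) (ltnW (ltn_ord l))).
  move/(congr1 (dd i)); rewrite dd0 dd_sum.
  under eq_bigr do rewrite ddM.
  rewrite big_split /= => H; rewrite -[RHS]H.
  have := HC (i :: w l) _; rewrite /= => -> //; first by rewrite addr0.
  exact: leq_ltn_trans (Hw l) (ltn_ord l).
(* The vector [v] is 0 at the last index and is killed by the first [k] rows, whose minor is
   nonzero; hence it vanishes. *)
have Hprop i j : dd i (C j) * C ord_max = C j * dd i (C ord_max).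
  pose v j := dd i (C j) * C ord_max - C j * dd i (C ord_max).
  suff: v j = 0 by move/eqP; rewrite subr_eq0 => /eqP.
  have vmax : v ord_max = 0 by rewrite /v mulrC subrr.
  have vsum (l : 'I_k) : \sum_j v j * dword (w l) (phi j) = 0.
    rewrite (_ : \sum_j _ = (\sum_j dd i (C j) * dword (w l) (phi j)) * C ord_max
      - (\sum_j C j * dword (w l) (phi j)) * dd i (C ord_max)); last first.
      by rewrite !mulr_suml -sumrB; apply: eq_bigr => a _; rewrite /v; ring.
    by rewrite HdC HC ?(leq_trans (Hw l) (ltnW (ltn_ord l))) // !mul0r subr0.
  case: (unliftP ord_max j) => [j' ->|-> //].
  pose M0 := \matrix_(l < k, j0 < k) dword (w l) (phi (widen_ord (leqnSn k) j0)).
  pose vv := \col_(j0 < k) v (lift ord_max j0).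
  have Mv : M0 *m vv = 0.
    apply/matrixP => l b; rewrite !mxE.
    have := vsum l; rewrite big_ord_recr /= vmax mul0r addr0 => H; rewrite -[RHS]H.
    by apply: eq_bigr => a _; rewrite !mxE mulrC Hlw.
  have : \det M0 *: vv = 0.
    by rewrite -mul_scalar_mx -mul_adj_mx -mulmxA Mv mulmx0.
  move/matrixP/(_ j' 0); rewrite !mxE => /eqP; rewrite mulf_eq0 (negPf Hdet) /= => /eqP //.
have Hc j : exists c, C j = cst c * C ord_max by exact: dd_const Cmax (fun i => Hprop i j).
pose c j := projT1 (constructive_indefinite_description _ (Hc j)).
have Ec j : C j = cst (c j) * C ord_max.
  by rewrite /c; case: constructive_indefinite_description.
have := ind c _ ord_max; move=> Hi.
have c0 : c ord_max = 0.
  apply: Hi; have := HC [::] (leq0n _) => /= H.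
  have: C ord_max * (\sum_j cst (c j) * phi j) = 0.
    rewrite -[RHS]H mulr_sumr; apply: eq_bigr => j _.
    by rewrite [C j]Ec mulrA [C _ * _]mulrC.
  by move/eqP; rewrite mulf_eq0 (negPf Cmax) => /eqP.
by move: Cmax; rewrite Ec c0 rmorph0 mul0r eqxx.
Qed.

End Wronskian.

(** The independent family is extracted from [P] itself, so its own coordinate vectors are unit
    vectors (third clause). This is what makes the polynomials [psi] of [wronskian_data] independent
    as well. *)
Lemma independent_subfamily (R : comNzRingType) (cst : {rmorphism algC -> R}) n (P : 'I_n -> R) :
  exists k (f : 'I_k -> 'I_n) (c : 'I_n -> 'I_k -> algC),
  [/\ forall c' : 'I_k -> algC, \sum_j cst (c' j) * P (f j) = 0 -> forall j, c' j = 0,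
      forall i, P i = \sum_j cst (c i j) * P (f j),
      forall j j', c (f j) j' = (j == j')%:R & (k <= n)%N].
Proof.
suff: forall n (P : 'I_n -> R), exists k (f : 'I_k -> 'I_n) (c : 'I_n -> 'I_k -> algC),
  [/\ forall c' : 'I_k -> algC, \sum_j cst (c' j) * P (f j) = 0 -> forall j, c' j = 0,
      forall i, P i = \sum_j cst (c i j) * P (f j) & (k <= n)%N].
  move=> /(_ n P) [k [f [c [H1 H2 H3]]]]; exists k, f, c; split=> // j j'.
  apply/eqP; rewrite -subr_eq0; apply/eqP.
  apply: (H1 (fun j' => c (f j) j' - (j == j')%:R)).
  under eq_bigr do rewrite rmorphB mulrBl.
  rewrite sumrB -H2 (bigD1 j) //= eqxx rmorph1 mul1r big1 ?addr0 ?subrr // => i ij.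
  by rewrite eq_sym (negPf ij) rmorph0 mul0r.
move=> {}n {}P; elim: n P => [|n IH] P.
  by exists 0%N, (fun x => x), (fun _ _ => 0); split=> [c _ []|[]|].
have [k [f [c [H1 H2 H3]]]] := IH (fun i => P (lift ord_max i)).
have [[d Hd]|Hno] := classic (exists d : 'I_k -> algC, P ord_max = \sum_j cst (d j) * P (lift ord_max (f j))).
  exists k, (fun j => lift ord_max (f j)),
    (fun i => if unlift ord_max i is Some i' then c i' else d); split=> //.
    by move=> i; case: unliftP => [i' ->|->].
  exact: leqW.
exists k.+1, (fun j => if unlift ord_max j is Some j' then lift ord_max (f j') else ord_max),
  (fun i j => if unlift ord_max i is Some i' then
                if unlift ord_max j is Some j' then c i' j' else 0
              else (j == ord_max)%:R).
have Hl (i : 'I_k) : widen_ord (leqnSn k) i = lift ord_max i.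
  by apply: val_inj; rewrite /= /bump leqNgt ltn_ord.
split=> //.
- move=> c'; rewrite big_ord_recr /= unlift_none.
  under eq_bigr do rewrite Hl liftK.
  move=> Hs.
  have c'm : c' ord_max = 0.
    apply: contra_not_eq Hno => nz.
    exists (fun j => - (c' ord_max)^-1 * c' (lift ord_max j)).
    move/(congr1 (fun x => cst (c' ord_max)^-1 * x)): Hs.
    rewrite mulr0 mulrDr mulrA -rmorphM mulVf // rmorph1 mul1r => /addr0_eq <-.
    rewrite mulr_sumr -sumrN; apply: eq_bigr => j _.
    by rewrite rmorphM rmorphN; ring.
  move: Hs; rewrite c'm rmorph0 mul0r addr0 => /H1 Hk j.
  by case: (unliftP ord_max j) => [j' ->|->].
- move=> i; rewrite big_ord_recr /= !unlift_none.
  case: unliftP => [i' ->|->].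
    rewrite rmorph0 mul0r addr0 H2; apply: eq_bigr => j _; by rewrite Hl liftK.
  rewrite eqxx rmorph1 mul1r big1 ?add0r // => j _.
  have -> : (widen_ord (leqnSn k) j == ord_max) = false by rewrite Hl eq_sym (negPf (neq_lift _ _)).
  by rewrite rmorph0 mul0r.
Qed.

(** * Iterated polynomial rings over the algebraic numbers *)

Fixpoint tower (m : nat) : idomainType :=
  if m is m'.+1 then {poly (tower m')} : idomainType else algC : idomainType.

Fixpoint tcst (m : nat) : {rmorphism algC -> tower m} :=
  match m return {rmorphism algC -> tower m} with
  | 0 => idfun
  | m'.+1 => (polyC \o tcst m' : {rmorphism algC -> {poly tower m'}})
  end.

(** Variable [h] is the indeterminate adjoined in passing from [tower h] to [tower h.+1]. The last
    variable is thus the outermost one, which the induction of Roth's lemma eliminates. *)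
Fixpoint tder (m h : nat) : tower m -> tower m :=
  match m return tower m -> tower m with
  | 0 => fun => 0
  | m'.+1 => fun p : {poly tower m'} =>
      if h == m' then p^`() else map_poly (tder (m:=m') h) p
  end.

(* Divided derivatives, so that integrality of the coefficients is preserved. *)
Fixpoint thas (m : nat) (mu : nat -> nat) : tower m -> tower m :=
  match m return tower m -> tower m with
  | 0 => id
  | m'.+1 => fun p : {poly tower m'} => map_poly (thas (m:=m') mu) p^`N(mu m')
  end.

Fixpoint tint (m : nat) : tower m -> Prop :=
  match m return tower m -> Prop with
  | 0 => fun c => c \is a Num.int
  | m'.+1 => fun p : {poly tower m'} => forall i, tint p`_i
  end.

Fixpoint tdeg (m : nat) (D : nat -> nat) : tower m -> Prop :=
  match m return tower m -> Prop with
  | 0 => fun=> True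
  | m'.+1 => fun p : {poly tower m'} =>
      (size p <= (D m').+1)%N /\ forall i, tdeg D p`_i
  end.

Fixpoint tnorm (m : nat) : tower m -> algC :=
  match m return tower m -> algC with
  | 0 => fun c => `|c|
  | m'.+1 => fun p : {poly tower m'} => \sum_(i < size p) tnorm p`_i
  end.

(* [tvan xi n I p]: the index of [p] at [xi], with weight [n h] for the
   variable [h], is at least [I]. *)
Fixpoint tvan (m : nat) (xi : nat -> algC) (n : nat -> nat) (I : nat) : tower m -> Prop :=
  match m return tower m -> Prop with
  | 0 => fun c => (0 < I)%N -> c = 0
  | m'.+1 => fun p : {poly tower m'} =>
      forall j, tvan xi n (I - j * n m') (p^`N(j)).[tcst m' (xi m')]
  end.

Lemma thas0 m mu : thas mu (0 : tower m) = 0.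
Proof. by case: m => //= m; rewrite linear0 map_polyE polyseq0. Qed.

Lemma tder0 m h : tder h (0 : tower m) = 0.
Proof. by case: m => //= m; rewrite map_polyE polyseq0 deriv0 if_same. Qed.

Lemma coef_thas m mu (p : {poly tower m}) i :
  (thas (m:=m.+1) mu p : {poly tower m})`_i = thas mu p^`N(mu m)`_i.
Proof. by rewrite /= coef_map_id0 ?thas0. Qed.

Lemma thasD m mu (p q : tower m) : thas mu (p + q) = thas mu p + thas mu q.
Proof.
elim: m p q => //= m IH p q; apply/polyP => i.
by rewrite coefD !coef_map_id0 ?thas0 // nderivnD coefD IH.
Qed.

Lemma tderD m h (p q : tower m) : tder h (p + q) = tder h p + tder h q.
Proof.
elim: m p q => /= [|m IH] p q; first by rewrite addr0.
case: ifP => _; first by rewrite derivD.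
by apply/polyP => i; rewrite coefD !coef_map_id0 ?tder0 // coefD IH.
Qed.

Lemma tder_sum m h (I : Type) (r : seq I) (P : pred I) (F : I -> tower m) :
  tder h (\sum_(i <- r | P i) F i) = \sum_(i <- r | P i) tder h (F i).
Proof. exact: (big_morph (tder (m:=m) h) (tderD h) (tder0 m h)). Qed.

Lemma thas_sum m mu (I : Type) (r : seq I) (P : pred I) (F : I -> tower m) :
  thas mu (\sum_(i <- r | P i) F i) = \sum_(i <- r | P i) thas mu (F i).
Proof. exact: (big_morph (thas (m:=m) mu) (thasD mu) (thas0 m mu)). Qed.

Lemma tderM m h (p q : tower m) : tder h (p * q) = tder h p * q + p * tder h q.
Proof.
elim: m p q => /= [|m IH] p q; first by rewrite mul0r mulr0 addr0.
case: ifP => _; first by rewrite derivM.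
apply/polyP => i; rewrite coefD !coefM coef_map_id0 ?tder0 // coefM tder_sum -big_split /=.
by apply: eq_bigr => j _; rewrite IH !coef_map_id0 ?tder0.
Qed.

Lemma thas_cst m mu c x : thas mu (tcst m c * x) = tcst m c * thas mu x.
Proof.
elim: m x => //= m IH x; apply/polyP => i.
by rewrite coefCM !coef_map_id0 ?thas0 // -IH !coef_nderivn coefCM mulrnAr.
Qed.

Lemma tder_natmul m h (x : tower m) k : tder h (x *+ k) = tder h x *+ k.
Proof. by elim: k => [|k IH]; rewrite ?tder0 // !mulrS tderD IH. Qed.

Lemma thas_natmul m mu (x : tower m) k : thas mu (x *+ k) = thas mu x *+ k.
Proof. by elim: k => [|k IH]; rewrite ?thas0 // !mulrS thasD IH. Qed.

Definition bump_at (h : nat) (mu : nat -> nat) i := (mu i + (i == h))%N.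

Lemma eq_thas m mu mu' (x : tower m) : (forall i, (i < m)%N -> mu i = mu' i) ->
  thas mu x = thas mu' x.
Proof.
elim: m x => //= m IH x H; rewrite H //; apply/polyP => i.
by rewrite !coef_map_id0 ?thas0 //; apply: IH => j Hj; apply: H; rewrite ltnW.
Qed.

Lemma deriv_nderivn (R : nzRingType) (p : {poly R}) k : p^`N(k)^`() = p^`N(k.+1) *+ k.+1.
Proof.
apply/polyP => i; rewrite coefMn coef_deriv !coef_nderivn -!mulrnA addSnnS.
by congr (_ *+ _); rewrite [RHS]mulnC mul_bin_left addKn mulnC.
Qed.

Lemma tder_thas m h mu (x : tower m) : (h < m)%N ->
  tder h (thas mu x) = thas (bump_at h mu) x *+ (mu h).+1.
Proof.
elim: m x => //= m IH x; rewrite ltnS leq_eqVlt => /predU1P[->|Hh].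
  rewrite eqxx /bump_at eqxx addn1; apply/polyP => i.
  rewrite coefMn coef_deriv !coef_map_id0 ?thas0 // -thas_natmul -thas_natmul.
  rewrite -coef_deriv deriv_nderivn coefMn; apply: eq_thas => j Hj.
  by rewrite (ltn_eqF Hj) addn0.
rewrite ltn_eqF //; apply/polyP => i.
rewrite coefMn !coef_map_id0 ?thas0 ?tder0 // IH //.
by rewrite /bump_at [m == h]eq_sym ltn_eqF // addn0.
Qed.

Lemma thas_id m mu (x : tower m) : (forall i, (i < m)%N -> mu i = 0%N) -> thas mu x = x.
Proof.
elim: m x => //= m IH x H; apply/polyP => i.
by rewrite coef_map_id0 ?thas0 // H // nderivn0 IH // => j Hj; apply: H; rewrite ltnW.
Qed.

(** The Wronskian criterion speaks of iterated derivatives, the height estimates of divided ones;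
    they differ by a positive integer factor, which does not affect the nonvanishing of
    determinants. *)
Lemma tder_word m (w : seq 'I_m) :
  exists2 c, (0 < c)%N & forall x : tower m, foldr (fun i : 'I_m => tder (m:=m) i) x w =
    thas (fun h => count (fun i : 'I_m => val i == h) w) x *+ c.
Proof.
elim: w => [|h w [c Hc IH]] /=; first by exists 1%N => // x; rewrite thas_id.
exists ((count (fun i : 'I_m => val i == h) w).+1 * c)%N; first by rewrite muln_gt0.
move=> x; rewrite IH tder_natmul tder_thas // -mulrnA.
congr (_ *+ _); apply: eq_thas => i _; by rewrite /bump_at addnC eq_sym.
Qed.

Lemma coefM_top (R : nzRingType) (p q : {poly R}) a b :
  (size p <= a.+1)%N -> (size q <= b.+1)%N -> (p * q)`_(a + b) = p`_a * q`_b.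
Proof.
move=> sp sq; have La : (a < (a + b).+1)%N by rewrite ltnS leq_addr.
rewrite coefM (bigD1 (Ordinal La)) //= addKn big1 ?addr0 // => i ne.
have [lt|ge] := ltnP i a.
  by rewrite [q`_ _]nth_default ?mulr0 // (leq_trans sq) //; lia.
rewrite nth_default ?mul0r // (leq_trans sp) // ltn_neqAle ge andbT.
by apply: contra ne => /eqP e; apply/eqP/val_inj.
Qed.

(** Comparing top coefficients in the last variable, a nonzero [f] with the same logarithmic
    derivative as [g] has the degree of [g]. The combination of [f] and [g] that cancels the leading
    coefficients satisfies the same equation in smaller degree, so it is 0, and the induction goes
    on with the leading coefficients. *)
Lemma tder_const m (f g : tower m) : g != 0 ->
  (forall h, (h < m)%N -> tder h f * g = f * tder h g) ->
  exists c, f = tcst m c * g.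
Proof.
elim: m f g => [|m IH] f g g0 Hd.
  by exists (f / g); rewrite /= divfK.
rewrite /= in f g g0 Hd *.
have sderiv (p : {poly tower m}) : (size p^`() <= (size p).-2.+1)%N.
  have [->|p0] := eqVneq p 0; first by rewrite linear0 size_poly0.
  have := lt_size_deriv p0; case: (size p) => [|[|n]] //=; lia.
have HdX (f' : {poly tower m}) : f' != 0 -> f'^`() * g = f' * g^`() -> size f' = size g.
  move=> f0 H.
  have sf := polySpred f0; have sg := polySpred g0.
  set a := (size f').-1 in sf; set b := (size g).-1 in sg.
  have nz n : (n.+1)%:R != 0 :> tower m.
    by rewrite -(rmorph_nat (tcst m)) fmorph_eq0 pnatr_eq0.
  have la : f'`_a != 0 by rewrite -lead_coefE lead_coef_eq0.
  have lb : g`_b != 0 by rewrite -lead_coefE lead_coef_eq0.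
  have dz (p : {poly tower m}) : size p = 1%N -> p^`() = 0.
    by move=> /eqP /size_poly1P [c _ ->]; rewrite derivC.
  have cf (p q : {poly tower m}) n n' : size p = n.+2 -> size q = n'.+1 ->
      (p^`() * q)`_(n + n') = p`_n.+1 * q`_n' *+ n.+1.
    move=> sp sq; rewrite coefM_top ?sq // ?coef_deriv ?mulrnAl //.
    by apply: leq_trans (sderiv p) _; rewrite sp.
  rewrite sf sg; move: sf sg la lb.
  case: a => [|a]; case: b => [|b] // sf sg la lb.
    move: H; rewrite (dz f') // mul0r => /(congr1 (fun p : {poly tower m} => p`_(b + 0))).
    rewrite coef0 mulrC (cf _ _ b 0%N) // => /esym/eqP.
    by rewrite -mulr_natr !mulf_eq0 (negPf la) (negPf lb) (negPf (nz _)).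
    move: H; rewrite (dz g) // mulr0 => /(congr1 (fun p : {poly tower m} => p`_(a + 0))).
    rewrite coef0 (cf _ _ a 0%N) // => /eqP.
    by rewrite -mulr_natr !mulf_eq0 (negPf la) (negPf lb) (negPf (nz _)).
  move: H => /(congr1 (fun p : {poly tower m} => p`_(a + b.+1))).
  have E : (a + b.+1 = b + a.+1)%N by lia.
  rewrite (cf f' g a b.+1) // [f' * _]mulrC E (cf g f' b a.+1) // [g`_ _ * _]mulrC -[LHS]mulr_natr -[RHS]mulr_natr.
  move/(mulfI _) => H; have/eqP := H (mulf_neq0 la lb).
  rewrite -!(rmorph_nat (tcst m)) -subr_eq0 -rmorphB fmorph_eq0 subr_eq0 eqr_nat => /eqP e.
  by rewrite e.
have Hm := Hd m (ltnSn m); rewrite eqxx in Hm.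
have [f0|f0] := eqVneq f 0; first by exists 0; rewrite f0 rmorph0 mul0r.
have sfg := HdX f f0 Hm.
(* If the difference were nonzero, [HdX] would give it the degree of [g], although its top
   coefficient cancels. *)
have Elin : lead_coef g *: f = lead_coef f *: g.
  apply/eqP; rewrite -subr_eq0; apply/eqP; apply: contra_eq (erefl (size g)) => h0.
  rewrite -{1}(HdX _ h0); last first.
    rewrite derivB !derivZ !mulrBl -!scalerAl Hm.
    by congr (_ - _ *: _); rewrite mulrC.
  rewrite neq_ltn; apply/orP; left.
  rewrite [X in (_ < X)%N](polySpred g0) ltnS; apply/leq_sizeP => j Hj.
  rewrite coefB !coefZ; move: Hj; rewrite leq_eqVlt => /predU1P[<-|Hj].
    by rewrite !lead_coefE sfg mulrC subrr.
  by rewrite !nth_default ?mulr0 ?subrr ?sfg // (polySpred g0).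
have [||c Hc] := IH (lead_coef f) (lead_coef g).
- by rewrite lead_coef_eq0.
- move=> h Hh; have := Hd h (leqW Hh); rewrite ltn_eqF // => /(congr1 (fun p : {poly tower m} =>
    p`_((size f).-1 + (size g).-1))).
  have st (p : {poly tower m}) : p != 0 -> (size (map_poly (tder (m:=m) h) p) <= (size p).-1.+1)%N.
    by move=> p0; rewrite -(polySpred p0) size_poly.
  rewrite !coefM_top ?st -?polySpred // !coef_map_id0 ?tder0 //.
exists c; apply: (@mulfI _ (lead_coef g)%:P); first by rewrite polyC_eq0 lead_coef_eq0.
by rewrite /= mul_polyC Elin Hc -mul_polyC rmorphM mulrCA mulrA.
Qed.

(** Divided derivatives at [x] are Taylor coefficients at [x]; products therefore become
    convolutions, which is how the index is shown to be superadditive on products. *)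
Lemma nderivn_horner_comp (R : comNzRingType) (p : {poly R}) x j :
  p^`N(j).[x] = (p \Po ('X + x%:P))`_j.
Proof.
have -> : p \Po ('X + x%:P) = \sum_(i < size p) (p^`N(i).[x])%:P * 'X^i.
  rewrite /comp_poly addrC nderiv_taylor ?size_map_polyC //; last exact: mulrC.
  by apply: eq_bigr => i _; rewrite nderivn_map horner_map.
rewrite coef_sum; have [lt|ge] := ltnP j (size p).
  rewrite (bigD1 (Ordinal lt)) //= coefCM coefXn eqxx mulr1 big1 ?addr0 // => i ne.
  by rewrite coefCM coefXn eq_sym (negPf (_ : val i != j)) ?mulr0.
rewrite big1 => [|i _]; last by rewrite coefCM coefXn gtn_eqF ?mulr0 // (leq_trans _ ge).
rewrite nderivn_poly0 ?horner0 //.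
Qed.

(** * Integrality, degree and size of iterated polynomials *)

Lemma tint0 m : tint (0 : tower m).
Proof. by elim: m => //= m IH i; rewrite coef0. Qed.

Lemma tintD m (p q : tower m) : tint p -> tint q -> tint (p + q).
Proof.
elim: m p q => /= [p q|m IH p q Hp Hq i]; first exact: rpredD.
by rewrite coefD; apply: IH.
Qed.

Lemma tint_sum m (I : Type) (r : seq I) (P : pred I) (F : I -> tower m) :
  (forall i, P i -> tint (F i)) -> tint (\sum_(i <- r | P i) F i).
Proof. move=> H; elim/big_ind: _ => //; [exact: tint0 | exact: tintD]. Qed.

Lemma tint_cst m c : c \is a Num.int -> tint (tcst m c).
Proof. by elim: m => //= m IH Hc i; rewrite coefC; case: eqP => _; [exact: IH | exact: tint0]. Qed.

Lemma tintM m (p q : tower m) : tint p -> tint q -> tint (p * q).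
Proof.
elim: m p q => /= [p q|m IH p q Hp Hq i]; first exact: rpredM.
by rewrite coefM; apply: tint_sum => j _; apply: IH.
Qed.

Lemma tint_natmul m (p : tower m) k : tint p -> tint (p *+ k).
Proof. by move=> Hp; elim: k => [|k IH]; rewrite ?mulrS; [exact: tint0 | exact: tintD]. Qed.

Lemma tint_prod m (I : Type) (r : seq I) (P : pred I) (F : I -> tower m) :
  (forall i, P i -> tint (F i)) -> tint (\prod_(i <- r | P i) F i).
Proof.
move=> H; elim/big_ind: _ => //; last exact: tintM.
by rewrite -(rmorph1 (tcst m)); apply: tint_cst.
Qed.

Lemma tint_det m k (A : 'M[tower m]_k) : (forall i j, tint (A i j)) -> tint (\det A).
Proof.
move=> H; apply: tint_sum => s _; apply: tintM; last by apply: tint_prod.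
rewrite -[_ ^+ _](rmorph_sign (tcst m)); apply: tint_cst; exact: rpred_sign.
Qed.

Lemma tint_has m mu (p : tower m) : tint p -> tint (thas mu p).
Proof.
elim: m p => //= m IH p Hp i; rewrite coef_map_id0 ?thas0 //; apply: IH.
by rewrite coef_nderivn; apply: tint_natmul.
Qed.

Lemma tdeg0 m D : tdeg D (0 : tower m).
Proof. by elim: m => //= m IH; rewrite size_poly0; split=> // i; rewrite coef0. Qed.

Lemma tdegD m D (p q : tower m) : tdeg D p -> tdeg D q -> tdeg D (p + q).
Proof.
elim: m p q => //= m IH p q [sp Hp] [sq Hq]; split=> [|i]; last by rewrite coefD; apply: IH.
by rewrite (leq_trans (size_polyD _ _)) // geq_max sp.
Qed.

Lemma tdeg_sum m D (I : Type) (r : seq I) (P : pred I) (F : I -> tower m) :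
  (forall i, P i -> tdeg D (F i)) -> tdeg D (\sum_(i <- r | P i) F i).
Proof. move=> H; elim/big_ind: _ => //; [exact: tdeg0 | exact: tdegD]. Qed.

Lemma tdeg_cst m D c : tdeg D (tcst m c).
Proof.
elim: m => //= m IH; split; first by rewrite (leq_trans (size_polyC_leq1 _)).
by move=> i; rewrite coefC; case: eqP => _; [exact: IH | exact: tdeg0].
Qed.

Lemma tdegM m D D' (p q : tower m) : tdeg D p -> tdeg D' q ->
  tdeg (fun h => D h + D' h)%N (p * q).
Proof.
elim: m p q => //= m IH p q [sp Hp] [sq Hq]; split=> [|i].
  apply: leq_trans (size_polyMleq _ _) _; rewrite -subn1 leq_subLR.
  by apply: leq_trans (leq_add sp sq) _; rewrite addSn addnS add1n.
by rewrite coefM; apply: tdeg_sum => j _; apply: IH.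
Qed.

Lemma tdeg_le m D D' (p : tower m) : (forall h, (h < m)%N -> (D h <= D' h)%N) ->
  tdeg D p -> tdeg D' p.
Proof.
elim: m p => //= m IH p H [sp Hp]; split; first by rewrite (leq_trans sp) ?ltnS ?H.
by move=> i; apply: IH (Hp i) => h Hh; apply: H; rewrite ltnW.
Qed.

Lemma tdeg_natmul m D (p : tower m) k : tdeg D p -> tdeg D (p *+ k).
Proof. by move=> Hp; elim: k => [|k IH]; rewrite ?mulrS; [exact: tdeg0 | exact: tdegD]. Qed.

Lemma tdeg_prod m D k (F : 'I_k -> tower m) : (forall i, tdeg D (F i)) ->
  tdeg (fun h => k * D h)%N (\prod_i F i).
Proof.
elim: k F => [|k IH] F H; first by rewrite big_ord0 -(rmorph1 (tcst m)); apply: tdeg_cst.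
rewrite big_ord_recl; apply: tdeg_le (tdegM (H ord0) (IH _ (fun i => H _))) => h _.
by rewrite mulSn.
Qed.

Lemma tdeg_det m D k (A : 'M[tower m]_k) : (forall i j, tdeg D (A i j)) ->
  tdeg (fun h => k * D h)%N (\det A).
Proof.
move=> H; apply: tdeg_sum => s _; rewrite -[_ ^+ _](rmorph_sign (tcst m)).
have := tdegM (tdeg_cst m (fun=> 0%N) ((-1) ^+ perm.odd_perm s)) (tdeg_prod (fun i => H i (s i))).
exact: tdeg_le.
Qed.

Lemma tdeg_has m D mu (p : tower m) : tdeg D p -> tdeg D (thas mu p).
Proof.
elim: m p => //= m IH p [sp Hp]; split=> [|i].
  apply: leq_trans (size_poly _ _) _; apply: leq_trans (size_poly _ _) _.
  exact: leq_trans (leq_subr _ _) sp.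
rewrite coef_map_id0 ?thas0 //; apply: IH.
by rewrite coef_nderivn; apply: tdeg_natmul.
Qed.

Lemma tnorm_ge0 m (p : tower m) : 0 <= tnorm p.
Proof. by elim: m p => //= m IH p; apply: sumr_ge0. Qed.

Lemma tnorm0 m : tnorm (0 : tower m) = 0.
Proof. by case: m => [|m] /=; rewrite ?normr0 // size_poly0 big_ord0. Qed.

Lemma tnorm_widen m (p : {poly tower m}) n : (size p <= n)%N ->
  tnorm (m:=m.+1) p = \sum_(i < n) tnorm p`_i.
Proof.
move=> sp; rewrite /= (big_ord_widen n (fun i => tnorm p`_i) sp) big_mkcond /=.
apply: eq_bigr => i _; case: ltnP => // Hi; by rewrite nth_default // tnorm0.
Qed.

Lemma tnormD m (p q : tower m) : tnorm (p + q) <= tnorm p + tnorm q.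
Proof.
elim: m p q => [|m IH] p q; first exact: ler_normD.
rewrite (@tnorm_widen _ _ (maxn (size (p : {poly tower m})) (size (q : {poly tower m})))) ?size_polyD //.
rewrite (tnorm_widen (leq_maxl _ (size (q : {poly tower m})))).
rewrite (tnorm_widen (leq_maxr (size (p : {poly tower m})) _)) -big_split /=.
by apply: ler_sum => i _; rewrite coefD.
Qed.

Lemma tnorm_sum m (I : Type) (r : seq I) (P : pred I) (F : I -> tower m) :
  tnorm (\sum_(i <- r | P i) F i) <= \sum_(i <- r | P i) tnorm (F i).
Proof.
elim/big_rec2: _ => [|i x y _ H]; first by rewrite tnorm0.
by apply: le_trans (tnormD _ _) _; rewrite lerD2l.
Qed.

Lemma tnormM m (p q : tower m) : tnorm (p * q) <= tnorm p * tnorm q.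
Proof.
elim: m p q => [|m IH]; first by move=> p q; rewrite /= normrM.
change (forall p q : {poly tower m},
  tnorm (m:=m.+1) (p * q) <= tnorm (m:=m.+1) p * tnorm (m:=m.+1) q).
move=> p q; set a := size p; set b := size q.
have sM : (size (p * q)%R <= a + b)%N by rewrite (leq_trans (size_polyMleq _ _)) ?leq_pred.
rewrite (tnorm_widen sM) [X in _ <= X]/= mulr_suml.
apply: le_trans (_ : \sum_(i < a + b) \sum_(j < a) tnorm p`_j *
   (if (j <= i)%N then tnorm q`_(i - j) else 0) <= _).
  apply: ler_sum => i _; rewrite coefM.
  apply: le_trans (tnorm_sum _ _ _) _.
  rewrite (big_ord_widen_cond (a + b) predT (fun j => tnorm (p`_j * q`_(i - j)))) //.
  rewrite [X in _ <= X](big_ord_widen_cond (a + b) predT (fun j : nat => tnorm p`_j *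
   (if (j <= i)%N then tnorm q`_(i - j) else 0))) ?leq_addr //.
  rewrite big_mkcond [X in _ <= X]big_mkcond /=; apply: ler_sum => j _.
  rewrite ltnS; case: leqP => ji; case: ltnP => // ja.
  - by rewrite [p`_j]nth_default // mul0r tnorm0.
  - by rewrite mulr0.
rewrite exchange_big /=; apply: ler_sum => j _; rewrite -mulr_sumr.
apply: ler_wpM2l; first exact: tnorm_ge0.
rewrite -big_mkcond /=.
rewrite -(big_mkord (fun i => (j <= i)%N) (fun i => tnorm q`_(i - j))).
rewrite (big_cat_nat (n := j)) //=; last by rewrite (leq_trans (ltnW (ltn_ord j))) ?leq_addr.
rewrite big_nat_cond big_pred0 ?add0r; last by move=> i; rewrite ltnNge /=; case: (j <= i)%N; rewrite ?andbF.
rewrite -{1}[val j]add0n big_addn.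
rewrite (eq_bigr (fun i => tnorm q`_i)) => [|i _]; last by rewrite addnK.
under eq_bigl do rewrite leq_addl.
rewrite -(big_mkord xpredT (fun i => tnorm q`_i)) /=.
have le : (b <= a + b - j)%N by have := ltn_ord j; lia.
rewrite (big_cat_nat (n := b)) //= [X in _ + X]big_nat_cond [X in _ + X]big1 ?addr0 // => i.
by rewrite andbT => /andP[Hi _]; rewrite nth_default // tnorm0.
Qed.

Lemma tnormN m (p : tower m) : tnorm (- p) = tnorm p.
Proof.
elim: m p => /= [p|m IH p]; first exact: normrN.
by rewrite size_polyN; apply: eq_bigr => i _; rewrite coefN IH.
Qed.

Lemma tnorm_cst m c : tnorm (tcst m c) = `|c|.
Proof.
elim: m => //= m IH; rewrite -IH; have [->|nz] := eqVneq (tcst m c) 0.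
  by rewrite polyC0 size_poly0 big_ord0 tnorm0.
by rewrite size_polyC nz big_ord1 coefC.
Qed.

Lemma tnorm_natmul m (p : tower m) k : tnorm (p *+ k) <= tnorm p *+ k.
Proof.
elim: k => [|k IH]; first by rewrite !mulr0n tnorm0.
by rewrite !mulrS (le_trans (tnormD _ _)) // lerD2l.
Qed.

Lemma tnorm_prod m (I : Type) (r : seq I) (P : pred I) (F : I -> tower m) :
  tnorm (\prod_(i <- r | P i) F i) <= \prod_(i <- r | P i) tnorm (F i).
Proof.
elim/big_rec2: _ => [|i x y _ H]; first by rewrite -(rmorph1 (tcst m)) tnorm_cst normr1.
by apply: le_trans (tnormM _ _) _; rewrite ler_wpM2l ?tnorm_ge0.
Qed.

Lemma tnorm_det m k (A : 'M[tower m]_k) b : (forall i j, tnorm (A i j) <= b) ->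
  tnorm (\det A) <= (k`!)%:R * b ^+ k.
Proof.
move=> H; apply: le_trans (tnorm_sum _ _ _) _.
rewrite (_ : _ * _ = \sum_(s : 'S_k) b ^+ k); last first.
  by rewrite sumr_const card_Sn mulr_natl.
apply: ler_sum => s _; rewrite -[(-1) ^+ _](rmorph_sign (tcst m)).
apply: le_trans (tnormM _ _) _; rewrite tnorm_cst normr_sign mul1r.
apply: le_trans (tnorm_prod _ _ _) _; rewrite -[X in b ^+ X]card_ord -prodr_const.
by apply: ler_prod => i _; rewrite tnorm_ge0 /=.
Qed.

(** A divided derivative of order [r] multiplies the coefficient that it moves to degree [i] by a
    binomial coefficient at most [2^(r+i)], and [r + i] does not exceed the degree. One such factor
    occurs for each variable. *)
Lemma tnorm_has m D mu (p : tower m) : tdeg D p ->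
  tnorm (thas mu p) <= 2 ^+ (\sum_(h < m) D h)%N * tnorm p.
Proof.
elim: m p => [|m IH]; first by move=> p _; rewrite big_ord0 mul1r.
change (forall p : {poly tower m}, tdeg (m:=m.+1) D p ->
  tnorm (thas (m:=m.+1) mu p) <= 2 ^+ (\sum_(h < m.+1) D h)%N * tnorm (m:=m.+1) p).
move=> p [sp Hp]; rewrite (tnorm_widen sp) (@tnorm_widen _ _ (D m).+1); last first.
  by have [] := @tdeg_has m.+1 D mu p (conj sp Hp).
pose r := mu m; pose B i := if (i <= D m)%N then 2 ^+ (\sum_(h < m.+1) D h)%N * tnorm p`_i else 0.
have HB i : tnorm (thas (m:=m.+1) mu p : {poly tower m})`_i <= B (r + i)%N.
  rewrite coef_thas coef_nderivn thas_natmul -/r /B.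
  case: leqP => Hi; last by rewrite nth_default ?(leq_trans sp) // thas0 mul0rn tnorm0.
  apply: le_trans (tnorm_natmul _ _) _; rewrite -[X in X <= _]mulr_natl big_ord_recr /= exprD -mulrA [X in _ <= X]mulrCA.
  apply: ler_pM; [exact: ler0n|exact: tnorm_ge0| |exact: IH (Hp _)].
  rewrite -natrX ler_nat.
  apply: leq_trans (_ : 2 ^ (r + i) <= _)%N; last by rewrite leq_exp2l.
  rewrite -[2%N]/(1 + 1)%N expnDn (bigD1 (Ordinal (leq_addr i r : (r < (r + i).+1)%N))) //=.
  by rewrite !exp1n !muln1 leq_addr.
have B0 i : 0 <= B i by rewrite /B; case: ifP => // _; rewrite mulr_ge0 ?exprn_ge0 ?tnorm_ge0.
apply: le_trans (_ : \sum_(i < (D m).+1) B (r + i)%N <= _).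
  by apply: ler_sum => i _; exact: HB.
rewrite mulr_sumr -(big_mkord xpredT (fun i => B (r + i)%N)).
rewrite (eq_bigr (fun i => B (i + r)%N)) => [|i _]; last by rewrite addnC.
rewrite -{1}[(D m).+1](addnK r) -(big_addn 0 ((D m).+1 + r) r xpredT B) add0n.
rewrite -(big_mkord xpredT (fun i => 2 ^+ (\sum_(h < m.+1) D h)%N * tnorm p`_i)).
have Etl : \sum_((D m).+1 <= i < (D m).+1 + r) B i = 0.
  by rewrite big_nat_cond big1 // => i; rewrite andbT => /andP[Hi _]; rewrite /B leqNgt Hi.
apply: le_trans (_ : \sum_(0 <= i < (D m).+1 + r) B i <= _).
  have [le|gt] := leqP r ((D m).+1 + r); last by rewrite ltnNge leq_addl in gt.
  by rewrite [X in _ <= X](big_cat_nat (n := r)) //= lerDr sumr_ge0.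
rewrite (big_cat_nat (n := (D m).+1)) ?leq_addr //= Etl addr0.
by rewrite big_nat [X in _ <= X]big_nat; apply: ler_sum => i; rewrite /B ltnS => /= ->.
Qed.

(** * The index behaves like a valuation *)

Section Vanishing.
Variables (xi : nat -> algC) (n : nat -> nat).

Lemma tvan_zero m I : tvan xi n I (0 : tower m).
Proof. by elim: m I => //= m IH I j; rewrite linear0 horner0. Qed.

Lemma tvanI0 m (p : tower m) : tvan xi n 0 p.
Proof. by elim: m p => //= m IH p j; rewrite sub0n. Qed.

Lemma tvanW m I I' (p : tower m) : (I' <= I)%N -> tvan xi n I p -> tvan xi n I' p.
Proof.
elim: m I I' p => /= [I I' p le H I0|m IH I I' p le H j].
  by apply: H; apply: leq_trans I0 le.
by apply: IH (H j); rewrite leq_sub2r.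
Qed.

Lemma tvanD m I (p q : tower m) : tvan xi n I p -> tvan xi n I q -> tvan xi n I (p + q).
Proof.
elim: m I p q => /= [I p q Hp Hq I0|m IH I p q Hp Hq j]; first by rewrite Hp // Hq // addr0.
by rewrite nderivnD hornerD; apply: IH.
Qed.

Lemma tvan_sum m I (J : Type) (r : seq J) (P : pred J) (F : J -> tower m) :
  (forall i, P i -> tvan xi n I (F i)) -> tvan xi n I (\sum_(i <- r | P i) F i).
Proof. move=> H; elim/big_ind: _ => //; [exact: tvan_zero | exact: tvanD]. Qed.

Lemma tvanM m I J (p q : tower m) : tvan xi n I p -> tvan xi n J q -> tvan xi n (I + J) (p * q).
Proof.
elim: m I J p q => /= [I J p q Hp Hq|m IH I J p q Hp Hq j].
  by rewrite addn_gt0 => /orP[/Hp ->|/Hq ->]; rewrite ?mul0r ?mulr0.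
rewrite nderivn_horner_comp rmorphM coefM; apply: tvan_sum => i _ /=.
rewrite -!nderivn_horner_comp; apply: tvanW (IH _ _ _ _ (Hp i) (Hq (j - i)%N)).
by have := ltn_ord i; rewrite ltnS => /subnK {1}<-; rewrite mulnDl; lia.
Qed.

Lemma tvan_prod m (J : Type) (r : seq J) (P : pred J) (F : J -> tower m) (f : J -> nat) :
  (forall i, P i -> tvan xi n (f i) (F i)) ->
  tvan xi n (\sum_(i <- r | P i) f i)%N (\prod_(i <- r | P i) F i).
Proof. move=> H; elim/big_ind2: _ => //; [exact: tvanI0 | by move=> *; exact: tvanM]. Qed.

Lemma tvan_cstM m I c (p : tower m) : tvan xi n I p -> tvan xi n I (tcst m c * p).
Proof. by move=> H; rewrite -[I]add0n; apply: tvanM H; apply: tvanI0. Qed.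

Lemma tvan_cstM_inv m I c (p : tower m) : c != 0 -> tvan xi n I (tcst m c * p) -> tvan xi n I p.
Proof.
by move=> c0 /(tvan_cstM c^-1); rewrite mulrA -rmorphM mulVf // rmorph1 mul1r.
Qed.

Lemma tvan_natmul m I k (p : tower m) : tvan xi n I p -> tvan xi n I (p *+ k).
Proof. by move=> H; elim: k => [|k IH]; rewrite ?mulrS; [exact: tvan_zero | exact: tvanD]. Qed.

(** Every term of the determinant takes one entry from each column, so bounds that depend on the
    column only add up. *)
Lemma tvan_det m k (A : 'M[tower m]_k) (f : 'I_k -> nat) :
  (forall i j, tvan xi n (f j) (A i j)) -> tvan xi n (\sum_j f j)%N (\det A).
Proof.
move=> H; apply: tvan_sum => s _; rewrite -[(-1) ^+ _](rmorph_sign (tcst m)).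
apply: tvan_cstM; rewrite (reindex_inj (@perm_inj _ s)) /=.
by apply: tvan_prod => i _.
Qed.

Lemma thas_horner m mu (q : {poly tower m}) x :
  (map_poly (thas (m:=m) mu) q).[tcst m x] = thas mu q.[tcst m x].
Proof.
rewrite (horner_coef_wide _ (size_poly _ _)) horner_coef thas_sum; apply: eq_bigr => i _.
by rewrite coef_map_id0 ?thas0 // ![_ * tcst m x ^+ i]mulrC -rmorphXn thas_cst.
Qed.

Lemma nderivn_nderivn (R : nzRingType) (p : {poly R}) r j :
  p^`N(r)^`N(j) = p^`N(r + j) *+ 'C(r + j, r).
Proof.
apply/polyP => i; rewrite coefMn !coef_nderivn -!mulrnA addnA; congr (_ *+ _).
have H a b : (('C(a + b, a) * (a`! * b`!) = (a + b)`!))%N by rewrite -{2}[b](addKn a) bin_fact ?leq_addr.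
apply/eqP; rewrite -(eqn_pmul2r (_ : 0 < r`! * j`! * i`!)%N) ?muln_gt0 ?fact_gt0 //.
have H1 := H r (j + i)%N; have H2 := H j i; have H3 := H (r + j)%N i; have H4 := H r j.
rewrite addnA in H1.
by apply/eqP; nia.
Qed.

Lemma tvan_has m I (mu : nat -> nat) (p : tower m) : tvan xi n I p ->
  tvan xi n (I - \sum_(h < m) mu h * n h) (thas mu p).
Proof.
elim: m I p => [I p H|m IH I p H]; first by rewrite big_ord0 subn0.
have E (q : {poly tower m}) j : (map_poly (thas (m:=m) mu) q)^`N(j) = map_poly (thas (m:=m) mu) q^`N(j).
  by apply/polyP => i; rewrite coef_nderivn !coef_map_id0 ?thas0 // coef_nderivn thas_natmul.
rewrite /= => j; rewrite E thas_horner nderivn_nderivn hornerMn thas_natmul.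
apply: tvan_natmul; apply: tvanW (IH _ _ (H (mu m + j)%N)).
by rewrite big_ord_recr /= mulnDl; lia.
Qed.

End Vanishing.

(** * Roth's lemma *)

(* Replaces the lower bound [n / z] on the height of [x] in Roth's lemma. *)
Definition root_mult_bound (x : algC) (n z : nat) :=
  forall (q : {poly algC}) t, q != 0 -> q \is a polyOver Num.int ->
    ('X - x%:P) ^+ t %| q -> 2 ^+ (t * n) <= (tnorm (m:=1) q) ^+ z.

(** The coefficient at the exponents [a]. In Roth's lemma it turns the factor in the first variables
    into a nonzero integer and leaves an integer polynomial in the last variable. *)
Fixpoint tcoef (m : nat) (a : nat -> nat) : tower m -> algC :=
  match m return tower m -> algC with
  | 0 => id
  | m'.+1 => fun p : {poly tower m'} => tcoef (m:=m') a p`_(a m')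
  end.

Lemma tcoef_sum m a (I : Type) (r : seq I) (P : pred I) (F : I -> tower m) :
  tcoef a (\sum_(i <- r | P i) F i) = \sum_(i <- r | P i) tcoef a (F i).
Proof. by elim: m F => //= m IH F; rewrite coef_sum IH. Qed.

Lemma tcoef0 m a : tcoef a (0 : tower m) = 0.
Proof. by elim: m => //= m IH; rewrite coef0. Qed.

Lemma tcoefM_cst m a (p : tower m) c : tcoef a (p * tcst m c) = tcoef a p * c.
Proof. by elim: m p => //= m IH p; rewrite coefMC IH. Qed.

Lemma tcoef_int m a (p : tower m) : tint p -> tcoef a p \is a Num.int.
Proof. by elim: m p => //= m IH p Hp; apply: IH. Qed.

Lemma tcoef_norm m a (p : tower m) : `|tcoef a p| <= tnorm p.
Proof.
elim: m p => //= m IH p; apply: le_trans (IH _) _.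
have [lt|ge] := ltnP (a m) (size p).
  by rewrite (bigD1 (Ordinal lt)) //= lerDl sumr_ge0 // => i _; exact: tnorm_ge0.
by rewrite nth_default // tnorm0 sumr_ge0 // => i _; exact: tnorm_ge0.
Qed.

Lemma tcoef_neq0 m (p : tower m) : p != 0 -> exists a, tcoef a p != 0.
Proof.
elim: m p => [p p0|m IH p p0]; first by exists (fun=> 0%N).
have [a Ha] := IH (lead_coef (p : {poly tower m})) ltac:(by rewrite lead_coef_eq0).
pose a' i := if i == m then (size (p : {poly tower m})).-1 else a i.
exists a'; rewrite /= /a' eqxx -/a' -lead_coefE; congr (_ != 0): Ha.
move: (lead_coef _) => q; rewrite -/a'.
suff H k (x : tower k) : (k <= m)%N -> tcoef a x = tcoef a' x by apply: H.
elim: k x => //= k IHk x Hk; by rewrite /a' ltn_eqF // -/a' IHk // ltnW.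
Qed.

Lemma fact_le_pow2 k : (k`! <= 2 ^ (k * k))%N.
Proof.
elim: k => // k IH; rewrite factS; apply: leq_trans (leq_mul (ltn_expl k (isT : 1 < 2)%N) IH) _.
by rewrite -expnD leq_exp2l //; nia.
Qed.

Lemma nderivn_order (q : {poly algC}) x t r : q = r * ('X - x%:P) ^+ t -> ~~ root r x ->
  q^`N(t).[x] != 0.
Proof.
move=> -> Hr; rewrite nderivn_horner_comp rmorphM rmorphXn /= rmorphB /= comp_polyX comp_polyC addrK.
by rewrite coefMXn ltnn subnn -nderivn_horner_comp nderivn0.
Qed.

Lemma tder1_word (w : seq 'I_1) :
  exists2 c, (0 < c)%N & forall q : {poly algC},
    foldr (fun i : 'I_1 => tder (m:=1) i) q w = q^`N(size w) *+ c.
Proof.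
have [c Hc H] := tder_word w; exists c => // q; rewrite H; congr (_ *+ _).
rewrite /= (_ : count _ w = size w); last first.
  by rewrite -count_predT; apply: eq_count => i; rewrite (ord1 i).
by apply/polyP => i; rewrite coef_map_id0.
Qed.

Lemma tnorm_coef_le m (p : {poly tower m}) i : tnorm p`_i <= tnorm (m:=m.+1) p.
Proof.
have [lt|ge] := ltnP i (size p).
  by rewrite /= (bigD1 (Ordinal lt)) //= lerDl sumr_ge0 // => j _; exact: tnorm_ge0.
by rewrite nth_default // tnorm0 tnorm_ge0.
Qed.

Lemma det_scale_rows (R : idomainType) k (A : 'M[R]_k) (c : 'I_k -> nat) :
  \det (\matrix_(l, j) (A l j *+ c l)) != 0 -> \det A != 0.
Proof.
apply: contra_neq => A0; rewrite (_ : \matrix_(l, j) _ = diag_mx (\row_l (c l)%:R) *m A).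
  by rewrite det_mulmx A0 mulr0.
by apply/matrixP => l j; rewrite mul_diag_mx !mxE mulr_natl.
Qed.

Lemma count_ord_sum m (w : seq 'I_m) (n : nat -> nat) b : (forall i, (i < m)%N -> n i <= b)%N ->
  (\sum_(h < m) count (fun i : 'I_m => val i == h) w * n h <= size w * b)%N.
Proof.
move=> Hb; elim: w => [|a w IH]; first by rewrite big1.
rewrite /= mulSn; under eq_bigr do rewrite mulnDl.
rewrite big_split /= leq_add // (bigD1 a) //= eqxx mul1n big1 ?addn0 ?Hb // => i ne.
by rewrite val_eqE eq_sym (negPf ne).
Qed.

(** Write [p] as the sum of [phi j] times [psi j], where the [phi j] are independent coefficients of
    [p] and the [psi j] independent polynomials in the last variable. The matrix of mixed
    derivatives of [p] is then a product of two Wronskian matrices, one in the first [m] variables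
    and one in the last, so its determinant separates the last variable from the others. *)
Lemma wronskian_data m (p : {poly tower m}) : p != 0 ->
  exists k (mu : 'I_k -> nat -> nat) (o : 'I_k -> nat) (W1 : tower m) (W2 : {poly algC}),
  [/\ (0 < k <= size p)%N,
      forall l n b, (forall i, (i < m)%N -> n i <= b)%N -> (\sum_(h < m) mu l h * n h <= l * b)%N,
      forall l, (o l <= l)%N, W1 != 0 /\ W2 != 0 &
      \det (\matrix_(l < k, s < k) map_poly (thas (m:=m) (mu l)) p^`N(o s)) =
        W1%:P * map_poly (tcst m) W2 /\
      exists f : 'I_k -> nat, W1 = \det (\matrix_(l < k, j < k) thas (mu l) p`_(f j))].
Proof.
move=> p0; set s := size p.
have [k [f [c [Hind Hdec Hcf kle]]]] := independent_subfamily (tcst m) (fun i : 'I_s => p`_i).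
pose phi j := p`_(f j).
pose psi j : {poly algC} := \poly_(i < s) (if insub i is Some i' then c i' j else 0).
have psiE j (i : 'I_s) : (psi j)`_i = c i j.
  by rewrite coef_poly ltn_ord valK.
have pE : p = \sum_j (phi j)%:P * map_poly (tcst m) (psi j).
  apply/polyP => i; rewrite coef_sum.
  have [lt|ge] := ltnP i s; last first.
    rewrite nth_default // big1 // => j _.
    by rewrite coefCM coef_map /= coef_poly ltnNge ge rmorph0 mulr0.
  rewrite -[i]/(val (Ordinal lt)) Hdec; apply: eq_bigr => j _.
  by rewrite coefCM coef_map psiE mulrC.
have k0 : (0 < k)%N.
  case: k f c Hind Hdec Hcf kle phi psi psiE pE => // f c _ _ _ _ phi psi _ pE.
  by move: p0; rewrite pE big_ord0 eqxx.
have [w Hw Wn0] : exists2 w : 'I_k -> seq 'I_m, forall l, (size (w l) <= l)%N &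
    \det (\matrix_(l, j) dword (fun i : 'I_m => tder (m:=m) i) (w l) (phi j)) != 0.
  apply: (@generalized_wronskian _ (tcst m) m (fun i : 'I_m => tder (m:=m) i)).
  - by move=> i x y; exact: tderD.
  - by move=> i x y; exact: tderM.
  - move=> x y y0 H; apply: tder_const => // h Hh; exact: (H (Ordinal Hh)).
  - exact: Hind.
have [v Hv Vn0] : exists2 v : 'I_k -> seq 'I_1, forall l, (size (v l) <= l)%N &
    \det (\matrix_(l, j) dword (fun i : 'I_1 => tder (m:=1) i : {poly algC} -> {poly algC}) (v l) (psi j)) != 0.
  apply: (@generalized_wronskian _ (tcst 1) 1 (fun i : 'I_1 => tder (m:=1) i)).
  - by move=> i x y; exact: (@tderD 1).
  - by move=> i x y; exact: (@tderM 1).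
  - move=> x y y0 H; apply: (@tder_const 1) => // h Hh; exact: (H (Ordinal Hh)).
  - move=> d Hd j.
    have := congr1 (fun q : {poly algC} => q`_(f j)) Hd.
    rewrite coef_sum coef0 (bigD1 j) //= big1 => [|i ne].
      by rewrite addr0 coefCM psiE Hcf eqxx mulr1.
    by rewrite coefCM psiE Hcf eq_sym (negPf ne) mulr0.
pose mu l h := count (fun i : 'I_m => val i == h) (w l).
pose W1 := \det (\matrix_(l < k, j < k) thas (mu l) (phi j)).
pose W2 := \det (\matrix_(l < k, j < k) (psi j)^`N(size (v l))).
have W10 : W1 != 0.
  have Hc l : exists c, forall x : tower m,
      foldr (fun i : 'I_m => tder (m:=m) i) x (w l) = thas (mu l) x *+ c.
    by have [c0 _ H] := tder_word (w l); exists c0.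
  have [cc Hcc] := fun_choice Hc.
  apply: (@det_scale_rows _ _ _ cc); congr (\det _ != 0): Wn0; apply/matrixP => l j.
  by rewrite !mxE -Hcc.
have W20 : W2 != 0.
  have Hc l : exists c, forall q : {poly algC},
      foldr (fun i : 'I_1 => tder (m:=1) i) q (v l) = q^`N(size (v l)) *+ c.
    by have [c0 _ H] := tder1_word (v l); exists c0.
  have [cc Hcc] := fun_choice Hc.
  apply: (@det_scale_rows _ _ _ cc); congr (\det _ != 0): Vn0; apply/matrixP => l j.
  by rewrite !mxE -Hcc.
exists k, mu, (fun l => size (v l)), W1, W2; split=> //.
- by rewrite k0.
- move=> l n b Hb; apply: leq_trans (count_ord_sum (w l) Hb) _.
  by rewrite leq_mul2r Hw orbT.
split; last by exists (fun j => val (f j)).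
have -> : W1%:P = \det (map_mx polyC (\matrix_(l < k, j < k) thas (mu l) (phi j))).
  by rewrite det_map_mx.
have -> : map_poly (tcst m) W2 = \det (map_mx (map_poly (tcst m)) (\matrix_(l < k, j < k) (psi j)^`N(size (v l))))^T.
  by rewrite det_tr det_map_mx.
rewrite -det_mulmx; congr (\det _); apply/matrixP => l s'.
rewrite !mxE {1}pE linear_sum /=.
have mapD (x y : {poly tower m}) : map_poly (thas (m:=m) (mu l)) (x + y) =
   map_poly (thas (m:=m) (mu l)) x + map_poly (thas (m:=m) (mu l)) y.
  by apply/polyP => i; rewrite coefD !coef_map_id0 ?thas0 // coefD thasD.
rewrite (big_morph _ mapD (_ : _ 0 = 0)); last first.
  by apply/polyP => i; rewrite coef_map_id0 ?thas0 // coef0 thas0.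
apply: eq_bigr => j _; rewrite !mxE; apply/polyP => i.
rewrite coef_map_id0 ?thas0 // coef_nderivn !coefCM !coef_map /= coef_nderivn.
by rewrite mulrC -mulrnAl -rmorphMn thas_cst mulrC.
Qed.

(** Only the first [c] terms are kept, about a proportion [1/(8h)] of all. For these, [s n] is at
    most [I/8] and [G] at most [I/4], so each term is at least [I/2]; the square of [h] appears
    because the proportion of terms and their size both carry a factor [1/h]. *)
Lemma sum_trunc_lower (k I G n eN h e D : nat) :
  (0 < h)%N -> (n * D = eN)%N -> (0 < k)%N -> (k <= (e * D).+1)%N -> (0 < e * D)%N ->
  (e * eN <= h * I)%N -> (4 * G <= I)%N ->
  (k * (e * eN) <= 16 * (h * h) * \sum_(s < k) (I - G - s * n))%N.
Proof.
move=> h0 Hn k0 Hk eD HI HG.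
pose c := (k.-1 %/ (8 * h)).+1.
have ck : (c <= k)%N by rewrite /c; apply: leq_ltn_trans (leq_div _ _) _; rewrite prednK.
have Hc : (k <= 8 * h * c)%N.
  rewrite /c; have := ltn_ceil k.-1 (_ : 0 < 8 * h)%N; rewrite muln_gt0 h0 => /(_ isT).
  by rewrite mulnC prednK.
apply: leq_trans (_ : 16 * (h * h) * \sum_(s < c) (I - G - s * n) <= _)%N; last first.
  rewrite leq_mul2l; apply/orP; right.
  rewrite -(big_mkord xpredT (fun s => I - G - s * n)%N) -[X in (_ <= X)%N](big_mkord xpredT (fun s => I - G - s * n)%N).
  by rewrite (big_cat_nat (n := c) (p := k)) //= leq_addr.
have Ht (s : 'I_c) : (I <= 2 * (I - G - s * n))%N.
  have Hs : (8 * h * s <= k.-1)%N.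
    have := ltn_ord s; rewrite {2}/c ltnS => H; apply: leq_trans (leq_trunc_div k.-1 (8 * h)).
    by rewrite mulnC leq_mul2r H orbT.
  have Hs2 : (8 * h * s <= e * D)%N by lia.
  have : (8 * h * (s * n) <= h * I)%N by apply: leq_trans HI; rewrite -Hn; nia.
  have : (8 * h * (s * n) = h * (8 * (s * n)))%N by ring.
  move=> ->; rewrite leq_pmul2l // => H8; lia.
have : (c * I <= 2 * \sum_(s < c) (I - G - s * n))%N.
  rewrite big_distrr /= -{1}[c]card_ord -sum_nat_const.
  by apply: leq_sum => s _; exact: Ht.
set T := (\sum_(s < c) _)%N => HT.
apply: leq_trans (leq_mul Hc HI) _.
have -> : (8 * h * c * (h * I) = 8 * (h * h) * (c * I))%N by ring.
have -> : (16 * (h * h) * T = 8 * (h * h) * (2 * T))%N by ring.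
by rewrite leq_mul2l HT orbT.
Qed.

(** Both [h], the inverse of the excluded index ratio, and [e], a common factor of the degrees, vary
    in the induction: a Wronskian of size [k] multiplies the degrees by [k]. Its index is at least
    [k e N/(16 h^2)]. The factor in the last variable is proportional to an integer polynomial, so
    its multiplicity at [xi m] uses up at most three quarters of this; the rest falls on [W1], which
    has one variable fewer, with [64 h^2] in place of [h]. *)
Theorem roth_lemma m h z : (0 < h)%N -> exists2 Om, (0 < Om)%N &
  forall (n D : nat -> nat) (xi : nat -> algC) (N e : nat) (p : tower m) (l I : nat),
  (0 < N)%N -> (0 < e)%N ->
  (forall i, (i < m)%N -> n i * D i = N)%N ->
  (forall i, (i < m)%N -> Om <= n i)%N ->
  (forall i, (i.+1 < m)%N -> Om * n i <= n i.+1)%N ->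
  (forall i, (i < m)%N -> root_mult_bound (xi i) (n i) z) ->
  tint p -> p != 0 -> tdeg (fun i => e * D i)%N p ->
  tnorm p <= 2 ^+ l -> (Om * l <= e * N)%N -> (e * N <= h * I)%N ->
  ~ tvan xi n I p.
Proof.
elim: m h z => [|m IH] h z h0.
  exists 1%N => // n D xi N e p l I N0 e0 _ _ _ _ _ p0 _ _ _ HI /= H.
  have I0 : (0 < I)%N by move: HI; rewrite lt0n; case: I {H} => //; rewrite muln0 leqn0 muln_eq0; lia.
  by move: p0; rewrite (H I0) eqxx.
have [|Om' Om'0 {}IH] := IH (64 * (h * h))%N z; first by rewrite !muln_gt0 h0.
(* [B] dominates the constant of the induction hypothesis, the loss through multiplicity and [h].
   The factor [m + 4] of [Om] is the sum of 2, 1 and [m + 1], the multiples of [e N] that bound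
   [Om * k], [Om * l] and [Om * E]. *)
pose B := (Om' + 64 * (h * h) * z + h)%N.
have B0 : (0 < B)%N by rewrite /B addn_gt0 h0 orbT.
exists ((m + 4) * B * 4)%N; first by rewrite !muln_gt0 B0 addn_gt0 orbT.
set Om := ((m + 4) * B * 4)%N.
have BOm : (B <= Om)%N by rewrite /Om mulnAC mulnC leq_pmulr // muln_gt0 addn_gt0 orbT.
have Om'B : (Om' <= B)%N by rewrite /B -addnA leq_addr.
move=> n D xi N e p l I N0 e0 HnD Hn Hrat Hxi pint p0 pdeg pnorm Hl HI Hvan.
rewrite /= in p pint p0 pdeg pnorm Hvan.
have Om0 : (0 < Om)%N by rewrite /Om !muln_gt0 B0 addn_gt0 orbT.
have [k [mu [o [W1 [W2 [/andP[k0 ksz] Hmu Ho [W10 W20] [HW [f HW1]]]]]]]] := wronskian_data p0.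
have [psz pcoef] := pdeg.
have kle : (k <= (e * D m).+1)%N := leq_trans ksz psz.
have Dm0 : (0 < D m)%N by have := HnD m (ltnSn m); case: (D m) => //; lia.
have eD0 : (0 < e * D m)%N by rewrite muln_gt0 e0.
have nm := HnD m (ltnSn m).
pose E := (\sum_(i < m.+1) e * D i)%N.
have HE : (Om * E <= m.+1 * (e * N))%N.
  rewrite /E big_distrr /=; apply: leq_trans (_ : \sum_(i < m.+1) e * N <= _)%N; last first.
    by rewrite sum_nat_const card_ord.
  apply: leq_sum => i _.
  have := Hn i (ltn_ord i); rewrite -(HnD i (ltn_ord i)) => Hni; nia.
have Hk : (Om * k <= 2 * (e * N))%N.
  have := Hn m (ltnSn m) => Hnm; rewrite -nm.
  apply: leq_trans (_ : n m * (2 * (e * D m)) <= _)%N; last by rewrite (_ : _ * _ = 2 * (e * (n m * D m)))%N //; ring.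
  apply: leq_mul => //; lia.
have HB : (4 * (B * (k + l + E)) <= e * N)%N.
  rewrite -(leq_pmul2l (_ : 0 < m + 4)%N) ?addn_gt0 ?orbT //.
  have -> : ((m + 4) * (4 * (B * (k + l + E))) = Om * (k + l + E))%N by rewrite /Om; ring.
  rewrite !mulnDr; apply: leq_trans (leq_add (leq_add Hk Hl) HE) _.
  by rewrite (_ : 2 * (e * N) + e * N + m.+1 * (e * N) = (m + 4) * (e * N))%N //; ring.
(* [2 ^ Lw] bounds the sizes of both determinants: the summand [k] comes from [k!], and [E] from the
   binomial factors of the divided derivatives. *)
pose Lw := (k * (k + l + E))%N.
(* index of the Wronskian from below *)
pose b := if m is m'.+1 then n m' else 0%N.
have Hb : (forall i, (i < m)%N -> n i <= b)%N.
  have Hmon i : (i.+1 < m.+1)%N -> (n i <= n i.+1)%N.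
    by move=> Hi; apply: leq_trans (Hrat i Hi); rewrite leq_pmull.
  rewrite /b; case: (m) Hmon => // m' Hmon i; rewrite ltnS => Hi.
  rewrite -(subnKC Hi); have: (i + (m' - i) <= m')%N by rewrite subnKC.
  elim: (m' - i)%N => [|d IHd] Hd; first by rewrite addn0.
  rewrite addnS in Hd *; apply: leq_trans (IHd (ltnW Hd)) _; apply: Hmon; rewrite !ltnS. exact: ltnW.
pose G := (k.-1 * b)%N.
have HG : (4 * G <= I)%N.
  have HbN : (Om * b <= n m)%N.
    rewrite /b; case: (m) Hrat => [|m'] Hrat; rewrite ?muln0 //; exact: Hrat.
  have H1 : (Om * G <= e * N)%N.
    rewrite /G mulnCA -nm; apply: leq_trans (_ : e * D m * n m <= _)%N.
      by apply: leq_mul => //; lia.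
    by rewrite -mulnA [(D m * _)%N]mulnC.
  rewrite -(leq_pmul2l h0); apply: leq_trans HI; apply: leq_trans H1.
  rewrite mulnA leq_mul2r; apply/orP; right.
  have : (h <= B)%N by rewrite /B leq_addl.
  rewrite /Om; nia.
pose Wm := \det (\matrix_(l < k, s < k) map_poly (thas (m:=m) (mu l)) p^`N(o s)).
pose mu' l s i := if i == m then o s else mu l i : nat.
have HWm (a s : 'I_k) : map_poly (thas (m:=m) (mu a)) p^`N(o s) = thas (m:=m.+1) (mu' a s) p.
  rewrite /= /mu' eqxx; apply/polyP => i; rewrite !coef_map_id0 ?thas0 //.
  by apply: eq_thas => j Hj; rewrite ltn_eqF.
pose S := (\sum_(s < k) (I - G - s * n m))%N.
have WmV : tvan xi n S (Wm : tower m.+1).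
  apply: (@tvan_det xi n m.+1 k _ (fun s : 'I_k => I - G - s * n m)%N) => a s.
  rewrite mxE HWm; apply: tvanW (tvan_has (mu' a s) (Hvan : tvan (m:=m.+1) xi n I p)).
  rewrite big_ord_recr /= /mu' eqxx -subnDA leq_sub2l //.
  rewrite [X in (X + _ <= _)%N](eq_bigr (fun i : 'I_m => mu a i * n i)%N) => [|i _]; last first.
    by rewrite ltn_eqF.
  apply: leq_add; last by rewrite leq_mul2r Ho orbT.
  apply: leq_trans (Hmu a n b Hb) _; rewrite leq_mul2r; apply/orP; right.
  by rewrite -ltnS prednK // ltn_ord.
have Wmint : tint (Wm : tower m.+1).
  by apply: (@tint_det m.+1) => a s; rewrite mxE HWm; apply: tint_has.
have powb q : q <= (k`!)%:R * (2 ^+ (E + l)) ^+ k -> q <= 2 ^+ Lw :> algC.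
  move=> H; apply: le_trans H _; rewrite /Lw -exprM -!natrX -natrM ler_nat.
  apply: leq_trans (leq_mul (fact_le_pow2 k) (leqnn _)) _.
  by rewrite -expnD leq_exp2l //; nia.
have Wmnorm : tnorm (Wm : tower m.+1) <= 2 ^+ Lw.
  apply: powb; apply: (@tnorm_det m.+1) => a s; rewrite mxE HWm.
  apply: le_trans (tnorm_has (m:=m.+1) (mu' a s) (p:=p) (conj psz pcoef)) _.
  by rewrite exprD ler_wpM2l // exprn_ge0.
have W1int : tint W1 by rewrite HW1; apply: tint_det => a j; rewrite mxE; apply: tint_has; exact: pint.
have W1deg : tdeg (fun i => k * e * D i)%N W1.
  rewrite HW1; apply: (@tdeg_le m (fun h => k * (e * D h))%N) => [i _|].
    by rewrite mulnA.
  by apply: tdeg_det => a j; rewrite mxE; apply: tdeg_has; exact: pcoef.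
have W1norm : tnorm W1 <= 2 ^+ Lw.
  apply: powb; rewrite HW1; apply: tnorm_det => a j; rewrite mxE.
  apply: le_trans (tnorm_has (mu a) (pcoef (f j))) _.
  rewrite exprD; apply: ler_pM; rewrite ?exprn_ge0 ?tnorm_ge0 //.
    by apply: ler_weXn2l; rewrite ?ler1n // /E big_ord_recr leq_addr.
  by apply: le_trans pnorm; exact: (@tnorm_coef_le m p (f j)).
have [a Ha] := tcoef_neq0 W10.
(* A nonzero coefficient of [W1] makes of [Wm] an integer polynomial proportional to [W2], to which
   the multiplicity bound applies. *)
pose q := map_poly (tcoef (m:=m) a) Wm.
have qE : q = tcoef a W1 *: W2.
  apply/polyP => i; rewrite coef_map_id0 ?tcoef0 // /Wm HW coefCM coef_map /= coefZ.
  by rewrite tcoefM_cst.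
have q0 : q != 0 by rewrite qE scaler_eq0 negb_or Ha.
have qint : q \is a polyOver Num.int.
  by apply/polyOverP => i; rewrite coef_map_id0 ?tcoef0 //; apply: tcoef_int; exact: Wmint.
have qnorm : tnorm (m:=1) q <= 2 ^+ Lw.
  apply: le_trans Wmnorm; rewrite (@tnorm_widen 0 q (size Wm)) ?size_poly //=.
  by apply: ler_sum => i _; rewrite coef_map_id0 ?tcoef0 //; exact: tcoef_norm.
have [t [r Hr qr]] := multiplicity_XsubC W2 (xi m).
have {Hr} Hr : ~~ root r (xi m) by move: Hr; rewrite W20.
have tb : (t * n m <= z * Lw)%N.
  have Hdiv : ('X - (xi m)%:P) ^+ t %| q by rewrite qE qr scalerAl dvdp_mull.
  have H := Hxi m (ltnSn m) q t q0 qint Hdiv.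
  have : (2 : algC) ^+ (t * n m) <= 2 ^+ (z * Lw).
    apply: le_trans H _; rewrite mulnC exprM lerXn2r ?nnegrE ?exprn_ge0 ?(@tnorm_ge0 1) //.
  by rewrite -!natrX ler_nat leq_exp2l.
(* With [t] the exact multiplicity of [xi m] in [W2], the divided derivative of order [t] in the
   last variable isolates [W1] up to a nonzero constant. *)
have V1 : tvan xi n (S - t * n m) W1.
  have := WmV t; rewrite /Wm HW mul_polyC nderivnZ hornerZ nderivn_map horner_map /=.
  rewrite mulrC; apply: tvan_cstM_inv; exact: nderivn_order qr Hr.
apply: (IH n D xi N (k * e)%N W1 Lw (S - t * n m)%N) V1 => //.
- by rewrite muln_gt0 k0.
- by move=> i Hi; apply: HnD; rewrite ltnW.
- by move=> i Hi; apply: leq_trans (Hn i (ltnW Hi)); apply: leq_trans Om'B BOm.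
- move=> i Hi; apply: leq_trans (Hrat i (ltnW Hi)); rewrite leq_mul2r; apply/orP; right.
  exact: leq_trans Om'B BOm.
- by move=> i Hi; apply: Hxi; rewrite ltnW.
- rewrite /Lw mulnCA -mulnA leq_mul2l; apply/orP; right; apply: leq_trans HB.
  by apply: leq_trans (leq_mul Om'B (leqnn _)) _; rewrite leq_pmull.
have HS : (k * (e * N) <= 16 * (h * h) * S)%N.
  exact: (@sum_trunc_lower k I G (n m) N h e (D m)).
have Ht : (64 * (h * h) * (t * n m) <= 3 * (k * (e * N)))%N.
  apply: leq_trans (leq_mul (leqnn _) tb) _.
  rewrite /Lw (_ : _ * (z * _) = k * (64 * (h * h) * z * (k + l + E)))%N; last by ring.
  rewrite [X in (_ <= X)%N]mulnCA leq_mul2l; apply/orP; right.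
  apply: leq_trans (_ : e * N <= _)%N; last by rewrite leq_pmull.
  apply: leq_trans HB; have H64 : (64 * (h * h) * z <= B)%N by rewrite /B -addnA addnCA leq_addr.
  by apply: leq_trans (leq_mul H64 (leqnn _)) _; rewrite leq_pmull.
rewrite mulnBr -mulnA.
have -> : (64 * (h * h) * S = 4 * (16 * (h * h) * S))%N by ring.
move: HS Ht; move: (k * (e * N))%N (16 * (h * h) * S)%N (64 * (h * h) * (t * n m))%N => x y u.
clear; lia.
Qed.

(** * Valuation rings of the algebraic numbers *)

Record valuation_ring (O : algC -> Prop) : Prop := ValuationRing {
  vr1 : O 1;
  vrB : forall x y, O x -> O y -> O (x - y);
  vrM : forall x y, O x -> O y -> O (x * y);
  vrV : forall x, ~ O x -> O x^-1 }.

(** * Existence of valuation rings avoiding a nonintegral number *)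

Section ValuationRingExists.
Variable b : algC.
Hypothesis bNint : b \notin Aint.
Let y := b^-1.

Let b0 : b != 0.
Proof. by apply: contraNneq bNint => ->; exact: Aint0. Qed.
Let yb : y * b = 1. Proof. exact: mulVf. Qed.

Let good (A : algC -> Prop) :=
  [/\ A 1, forall u v, A u -> A v -> A (u - v), forall u v, A u -> A v -> A (u * v), A y & ~ A b].

Let good_sum A (I : Type) (r : seq I) (F : I -> algC) : good A ->
  (forall i, A (F i)) -> A (\sum_(i <- r) F i).
Proof.
move=> gA H; have [A1 AB AM _ _] := gA.
have A0 : A 0 by rewrite -(subrr 1); apply: AB.
apply: (big_ind A) => [//|u v Hu Hv|i _]; last exact: H.
rewrite -[v]opprK; apply: (AB) => //.
by rewrite -sub0r; apply: AB.
Qed.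

Let adjoin (A : algC -> Prop) x u := exists2 p : {poly algC}, forall i, A p`_i & u = p.[x].

Let adjoin_ring A x : good A -> ~ adjoin A x b -> good (adjoin A x).
Proof.
move=> gA Hb; have [A1 AB AM Ay Ab] := gA.
have A0 : A 0 by rewrite -(subrr 1); apply: AB.
split=> //.
- by exists 1; rewrite ?hornerC // => i; rewrite coef1; case: eqP.
- move=> u v [p Hp ->] [q Hq ->]; exists (p - q); rewrite ?hornerD ?hornerN // => i.
  by rewrite coefB; apply: AB.
- move=> u v [p Hp ->] [q Hq ->]; exists (p * q); rewrite ?hornerM // => i.
  by rewrite coefM; apply: good_sum => // j; apply: AM.
- by exists y%:P; rewrite ?hornerC // => i; rewrite coefC; case: eqP.
Qed.

(** If [b] were an integer polynomial in [b^-1], multiplying by a power of [b] would give a monic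
    integer equation for [b]. *)
Let base_good : good (adjoin (fun u => u \is a Num.int) y).
Proof.
split.
- by exists 1; rewrite ?hornerC // => i; rewrite coef1 natr_int.
- move=> u v [p Hp ->] [q Hq ->]; exists (p - q); rewrite ?hornerD ?hornerN // => i.
  by rewrite coefB rpredB.
- move=> u v [p Hp ->] [q Hq ->]; exists (p * q); rewrite ?hornerM // => i.
  by rewrite coefM; apply: rpred_sum => j _; apply: rpredM.
- by exists 'X; rewrite ?hornerX // => i; rewrite coefX natr_int.
case=> p Hp Eb; move/negP: bNint; apply.
set n := size p.
pose s := \poly_(i < n) p`_(n.-1 - i).
apply: (@root_monic_Aint ('X^n - s)).
- rewrite /root hornerD hornerN hornerXn horner_poly subr_eq0; apply/eqP.
  case En : n => [|k].
    have p0 : p = 0 by apply/eqP; rewrite -size_poly_eq0 -/n En.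
    by move: b0; rewrite Eb p0 horner0 eqxx.
  rewrite exprS {1}Eb horner_coef -/n En mulr_suml (reindex_inj rev_ord_inj) /=.
  apply: eq_bigr => i _; rewrite subSS -mulrA; congr (_ * _).
  have ik : (i <= k)%N by rewrite -ltnS.
  have -> : b ^+ k = b ^+ (k - i) * b ^+ i by rewrite -exprD subnK.
  by rewrite mulrA -exprMn yb expr1n mul1r.
- rewrite monicE lead_coefDl ?lead_coefXn // size_polyN size_polyXn ltnS; exact: size_poly.
- apply/polyOverP => i; rewrite coefB coefXn rpredB ?natr_int // coef_poly.
  by case: ifP => _; [exact: Hp | exact: rpred0].
Qed.

(** Inverting all the [1 - y a] does not capture [b]. In a maximal subring these elements are
    therefore units already, that is, [y] lies in the Jacobson radical. *)
Let localize_ring A : good A ->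
  good (fun u => exists v a, [/\ A v, A a, 1 - y * a != 0 & u = v / (1 - y * a)]).
Proof.
move=> gA; have [A1 AB AM Ay Ab] := gA.
have A0 : A 0 by rewrite -(subrr 1); apply: (AB).
have AD u v : A u -> A v -> A (u + v).
  by move=> Hu Hv; rewrite -[v]opprK; apply: (AB) => //; rewrite -sub0r; apply: (AB).
have nz a : A a -> 1 - y * a != 0.
  move=> Ha; apply: contra_notN Ab => /eqP /subr0_eq e.
  by rewrite -[b]mulr1 e mulrA [b * y]mulrC yb mul1r.
have prodE a a' : (1 - y * a) * (1 - y * a') = 1 - y * (a + a' - y * a * a') by ring.
have Ap a a' : A a -> A a' -> A (a + a' - y * a * a').
  by move=> Ha Ha'; apply: (AB); [exact: AD | apply: (AM) => //; exact: AM].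
have As a : A a -> A (1 - y * a) by move=> Ha; apply: (AB) => //; exact: AM.
split.
- by exists 1, 0; split; rewrite ?mulr0 ?subr0 ?oner_eq0 ?divr1.
- move=> u v [u1 [a [Hu1 Ha na ->]]] [v1 [a' [Hv1 Ha' na' ->]]].
  exists (u1 * (1 - y * a') - v1 * (1 - y * a)), (a + a' - y * a * a').
  split; [by apply: (AB); apply: (AM) => //; exact: As | exact: Ap | exact: (nz _ (Ap _ _ Ha Ha'))|].
  by rewrite -prodE; field; apply/andP.
- move=> u v [u1 [a [Hu1 Ha na ->]]] [v1 [a' [Hv1 Ha' na' ->]]].
  exists (u1 * v1), (a + a' - y * a * a').
  split; [exact: AM | exact: Ap | exact: (nz _ (Ap _ _ Ha Ha'))|].
  by rewrite -prodE; field; apply/andP.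
- by exists y, 0; split; rewrite ?mulr0 ?subr0 ?oner_eq0 ?divr1.
case=> v [a [Hv Ha na Eb]]; apply: Ab.
have : b * (1 - y * a) = v by rewrite {1}Eb divfK.
rewrite mulrBr mulr1 mulrA [b * y]mulrC yb mul1r => /eqP; rewrite subr_eq => /eqP ->.
exact: AD.
Qed.

(** Chevalley's argument. In a maximal subring that contains [y] but not [b], suppose that neither
    [x] nor [x^-1] is present. Adjoining either one captures [b], so 1 is [y] times a polynomial in
    [x], and also [y] times a polynomial in [x^-1]. The larger of the two degrees can always be
    lowered by means of the other relation, and degree 0 is impossible. *)
Lemma valuation_ring_exists : exists2 O, valuation_ring O & ~ O b.
Proof.
pose T := {A : algC -> Prop | good A}.
pose R (A B : T) := boolp.asbool (forall u, sval A u -> sval B u).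
have [A HA] : exists A : T, forall B, R A B -> B = A.
  apply: (@classical_sets.Zorn T R).
  - by move=> A; apply/boolp.asboolP.
  - by move=> A B C /boolp.asboolP H1 /boolp.asboolP H2; apply/boolp.asboolP => u /H1 /H2.
  - move=> [A gA] [B gB] /boolp.asboolP /= H1 /boolp.asboolP /= H2.
    have E : A = B by apply: boolp.funext => u; apply: boolp.propext; split; [exact: H1 | exact: H2].
    by case: B / E gB {H1 H2} => gB; congr exist; apply: boolp.Prop_irrelevance.
  move=> C tot.
  have [[A0 CA0]|Cempty] := classic (exists A, C A); last first.
    by exists (exist _ _ base_good) => s Cs; case: Cempty; exists s.
  have gU : good (fun u => exists2 A, C A & sval A u).
    have two u v A B : C A -> C B -> sval A u -> sval B v -> exists D, [/\ C D, sval D u & sval D v].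
      move=> CA CB Hu Hv; have [/boolp.asboolP H|/boolp.asboolP H] := tot _ _ CA CB.
        by exists B; split=> //; exact: H.
      by exists A; split=> //; exact: H.
    split.
    - by exists A0 => //; case: A0 {CA0} => A [].
    - move=> u v [A CA Hu] [B CB Hv]; have [D [CD Du Dv]] := two _ _ _ _ CA CB Hu Hv.
      by exists D => //; case: (D) Du Dv => A' [_ AB _ _ _] /= Du Dv; exact: AB.
    - move=> u v [A CA Hu] [B CB Hv]; have [D [CD Du Dv]] := two _ _ _ _ CA CB Hu Hv.
      by exists D => //; case: (D) Du Dv => A' [_ _ AM _ _] /= Du Dv; exact: AM.
    - by exists A0 => //; case: A0 {CA0} => A [].
    - by case=> [[A [? ? ? ? Ab]]] _ /= /Ab.
  by exists (exist _ _ gU) => A CA; apply/boolp.asboolP => u Hu /=; exists A.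
case: A HA => A gA HA; have [A1 AB AM Ay Ab] := gA.
have maxA B : good B -> (forall u, A u -> B u) -> forall u, B u -> A u.
  move=> gB AB' u Bu; have := HA (exist _ B gB); move/(_ (boolp.asboolT AB')) => /(congr1 sval) /= E.
  by rewrite -E.
have A0 : A 0 by rewrite -(subrr 1); apply: (AB).
have AD u v : A u -> A v -> A (u + v).
  by move=> Hu Hv; rewrite -[v]opprK; apply: (AB) => //; rewrite -sub0r; apply: (AB).
have nz a : A a -> 1 - y * a != 0.
  move=> Ha; apply: contra_notN Ab => /eqP /subr0_eq e.
  by rewrite -[b]mulr1 e mulrA [b * y]mulrC yb mul1r.
have Aunit a : A a -> A (1 - y * a)^-1.
  move=> Ha; apply: (maxA _ (localize_ring gA)).
    by move=> u Hu; exists u, 0; split; rewrite ?mulr0 ?subr0 ?oner_eq0 ?divr1.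
  by exists 1, a; split; rewrite ?nz ?mul1r.
exists A => //; split=> // x xA; apply: NNPP => xVA.
have x0 : x != 0 by apply: contra_notN xA => /eqP ->.
pose Pn n x := exists p : {poly algC}, [/\ forall i, A p`_i, (size p <= n.+1)%N & y * p.[x] = 1].
have exP z : ~ A z -> exists n, Pn n z.
  move=> zA; have [[p Hp Eb]|no] := classic (adjoin A z b).
    by exists (size p), p; split=> //; rewrite -Eb.
  case: zA; apply: (maxA _ (adjoin_ring gA no)).
    by move=> u Hu; exists u%:P; rewrite ?hornerC // => i; rewrite coefC; case: eqP.
  by exists 'X; rewrite ?hornerX // => i; rewrite coefX; case: eqP.
have P0 z : ~ Pn 0%N z.
  case=> p [Hp sp E]; apply: Ab; suff -> : b = p`_0 by [].
  have := size1_polyC sp => Ep; move: E; rewrite {1}Ep hornerC => E.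
  by rewrite -[b]mulr1 -E mulrA [b * y]mulrC yb mul1r.
have red n m z : z != 0 -> (m <= n.+1)%N -> Pn n.+1 z -> Pn m z^-1 -> Pn n z.
  move=> z0 mn [p [Hp sp Ep]] [d [Hd sd Ed]].
  pose w := (1 - y * d`_0)^-1.
  exists (\poly_(i < n.+1) (p`_i + y * p`_n.+1 * w * d`_(n.+1 - i))); split.
  - move=> i; rewrite coef_poly; case: ifP => // _; apply: AD => //.
    by do ![apply: (AM) => //]; exact: Aunit.
  - exact: size_poly.
  have Edz : \sum_(i < n.+1) d`_(n.+1 - i) * z ^+ i = z ^+ n.+1 * (b - d`_0).
    have <- : d.[z^-1] = b by rewrite -[LHS]mul1r -yb mulrAC Ed mul1r.
    rewrite (@horner_coef_wide _ n.+2) ?(leq_trans sd) // [\sum_(i < n.+2) _]big_ord_recl expr0 mulr1 [X in X - _]addrC addrK.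
    rewrite (reindex_inj rev_ord_inj) /= mulr_sumr; apply: eq_bigr => i _.
    have ik : (i < n.+1)%N by [].
    have -> : bump 0 i = i.+1 by [].
    have -> : z ^+ n.+1 = z ^+ (n.+1 - i.+1) * z ^+ i.+1 by rewrite -exprD subnK.
    by rewrite subKn // exprVn mulrCA mulfK ?expf_neq0.
  have Hw : y * w * (b - d`_0) = 1.
    by rewrite mulrAC mulrBr yb mulrC /w mulVf ?nz.
  rewrite horner_poly.
  have -> : \sum_(i < n.+1) (p`_i + y * p`_n.+1 * w * d`_(n.+1 - i)) * z ^+ i =
    \sum_(i < n.+1) p`_i * z ^+ i + y * p`_n.+1 * w * \sum_(i < n.+1) d`_(n.+1 - i) * z ^+ i.
    by rewrite mulr_sumr -big_split /=; apply: eq_bigr => i _; rewrite mulrDl !mulrA.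
  rewrite Edz -[RHS]Ep (horner_coef_wide _ sp) [\sum_(i < n.+2) _]big_ord_recr /=; congr (y * (_ + _)).
  rewrite -[RHS]mulr1 -Hw.
  by rewrite [y * p`__]mulrC -!mulrA; congr (_ * _); rewrite [RHS]mulrCA; congr (_ * _); rewrite mulrCA.
have key s : forall n m z, (n + m <= s)%N -> z != 0 -> Pn n z -> ~ Pn m z^-1.
  elim: s => [|s IH] n m z.
    by rewrite leqn0 addn_eq0 => /andP[/eqP -> _] _ /P0.
  move=> Hs z0 H1 H2.
  have [le|lt] := leqP m n.
    case: n Hs H1 le => [|n] Hs H1 le; first by case: (P0 _ H1).
    by apply: (IH n m z _ z0 (red _ _ _ z0 le H1 H2)) => //; lia.
  case: m Hs H2 lt => [|m] Hs H2 lt //.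
  have H1' : Pn n z^-1^-1 by rewrite invrK.
  have H2' := red _ _ _ (invr_neq0 z0) (ltnW lt) H2 H1'.
  by apply: (IH n m z) => //; lia.
have [n Hn] := exP _ xA; have [m Hm] := exP _ xVA.
exact: (key _ n m x (leqnn _) x0 Hn Hm).
Qed.

End ValuationRingExists.

(** Content 1 guarantees, for every prime, a coefficient not divisible by it; [residue_power] finds
    its exponent in this way. *)
Lemma primitive_int_poly (x : algC) :
  exists f : {poly int}, zcontents f = 1 /\ (map_poly intr f).[x] = 0.
Proof.
have [q [_ qmon Hq]] := minCpolyP x.
have [f [a a0 E]] := rat_poly_scale q.
have q0 : q != 0 := monic_neq0 qmon.
have f0 : f != 0.
  by apply: contraNneq q0 => f0; rewrite E f0 map_polyE /= polyseq0 /= scaler0.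
exists (zprimitive f); split; first by rewrite zcontents_primitive f0.
have /rootP : root (map_poly ratr q) x by rewrite Hq dvdpp.
rewrite E linearZ /= -map_poly_comp /= (eq_map_poly (ratr_int _)) hornerZ => /eqP.
rewrite mulf_eq0 fmorph_eq0 invr_eq0 intr_eq0 (negPf a0) /= => /eqP.
rewrite {1}(zpolyEprim f) linearZ /= hornerZ => /eqP.
by rewrite mulf_eq0 intr_eq0 zcontents_eq0 (negPf f0) => /eqP.
Qed.

(** * Units and residue characteristic of a valuation ring *)

Section ValuationRing.
Variables (O : algC -> Prop).
Hypothesis vO : valuation_ring O.

Lemma vr0 : O 0. Proof. by rewrite -(subrr 1); apply: (vrB vO); exact: vr1. Qed.
Lemma vrN x : O x -> O (- x).
Proof. by move=> Ox; rewrite -sub0r; apply: (vrB vO) => //; exact: vr0. Qed.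
Lemma vrD x y : O x -> O y -> O (x + y).
Proof. by move=> Ox Oy; rewrite -[y]opprK; apply: (vrB vO) => //; exact: vrN. Qed.
Lemma vr_sum (I : Type) (r : seq I) (P : pred I) (F : I -> algC) :
  (forall i, P i -> O (F i)) -> O (\sum_(i <- r | P i) F i).
Proof. by move=> H; apply: (big_ind O) => //; [exact: vr0 | exact: vrD]. Qed.
Lemma vr_prod (I : Type) (r : seq I) (P : pred I) (F : I -> algC) :
  (forall i, P i -> O (F i)) -> O (\prod_(i <- r | P i) F i).
Proof. by move=> H; apply: (big_ind O) => //; [exact: vr1 | exact: (vrM vO)]. Qed.
Lemma vrX x k : O x -> O (x ^+ k).
Proof. by move=> Ox; elim: k => [|k IH]; rewrite ?exprS; [exact: vr1 | exact: (vrM vO)]. Qed.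
Lemma vr_nat k : O k%:R.
Proof. by elim: k => [|k IH]; [exact: vr0 | rewrite mulrS; apply: vrD => //; exact: vr1]. Qed.
Lemma vr_intr (k : int) : O k%:~R.
Proof. by case: k => k; [exact: vr_nat | rewrite NegzE rmorphN; apply: vrN; exact: vr_nat]. Qed.
Lemma vr_int x : x \is a Num.int -> O x.
Proof. by move/intrP => [k ->]; exact: vr_intr. Qed.

(** Valuation rings are integrally closed: if [x] were outside, its inverse would be inside, and a
    monic equation divided by a power of [x] would write [x] as a polynomial in [x^-1]. *)
Lemma vr_Aint x : x \in Aint -> O x.
Proof.
move=> xA; apply: NNPP => nO.
have x0 : x != 0 by apply: contra_notN nO => /eqP ->; exact: vr0.
have OV : O x^-1 := vrV vO nO.
apply: nO; pose q := minCpoly x.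
have qi : q \is a polyOver Num.int := xA.
have qm : q \is monic := minCpoly_monic x.
have /rootP := root_minCpoly x; rewrite -/q horner_coef.
have sq : (1 < size q)%N by rewrite size_minCpoly.
case: (size q) (lead_coefE q) sq => [|[|n]] //= Eq _.
rewrite big_ord_recr /= -Eq (monicP qm) mul1r addrC => /eqP; rewrite addr_eq0 => /eqP E.
have -> : x = - (\sum_(i < n.+1) q`_i * x^-1 ^+ (n - i)).
  apply: (@mulIf _ (x ^+ n)); first by rewrite expf_neq0.
  rewrite -exprS E mulNr mulr_suml; congr (- _); apply: eq_bigr => i _.
  have ik : (i <= n)%N by rewrite -ltnS.
  have -> : x ^+ n = x ^+ (n - i) * x ^+ i by rewrite -exprD subnK.
  by rewrite exprVn mulrA mulfVK ?expf_neq0.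
apply: vrN; apply: vr_sum => i _; apply: (vrM vO); last exact: vrX.
by apply: vr_int; exact: (polyOverP qi).
Qed.

(** Nonunits are closed under addition: one of the quotients [x/y] and [y/x] lies in [O], and then
    the sum divides one of the summands. A nonunit is described by its inverse lying outside [O]; as
    [0^-1] is 0, this describes nonzero elements only. *)
Lemma vrVD x y : x != 0 -> y != 0 -> x + y != 0 -> O x -> O y -> ~ O x^-1 -> ~ O y^-1 -> ~ O (x + y)^-1.
Proof.
move=> x0 y0 xy0; wlog H : x y x0 y0 xy0 / O (x / y).
  move=> W Ox Oy Nx Ny; have [H|H] := classic (O (x / y)); first exact: W.
  rewrite addrC; apply: W => //; first by rewrite addrC.
  by rewrite -[y / x]invrK invf_div; exact: vrV.
move=> Ox Oy Nx Ny Nxy; apply: Ny.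
have -> : y^-1 = (1 + x / y) * (x + y)^-1.
  by apply: (@mulIf _ (x + y)) => //; rewrite divfK // mulrDr mulVf // addrC mulrC.
by apply: (vrM vO) => //; apply: vrD => //; exact: vr1.
Qed.

Lemma vr_horner_split (f : {poly int}) y j : O y -> exists2 w, O w &
  (map_poly intr f).[y] = \sum_(i < j) (f`_i)%:~R * y ^+ i + y ^+ j * ((f`_j)%:~R + y * w).
Proof.
move=> Oy; pose n := maxn (size f) j.+1.
exists (\sum_(i < n - j.+1) (f`_(i + j.+1))%:~R * y ^+ i).
  by apply: vr_sum => i _; apply: (vrM vO); [exact: vr_intr | exact: vrX].
rewrite (@horner_coef_wide _ n); last by rewrite (leq_trans (size_poly _ _)) // leq_maxl.
under eq_bigr do rewrite coef_map /=.
rewrite -(big_mkord xpredT (fun i => (f`_i)%:~R * y ^+ i)) (big_cat_nat (n := j.+1)) //=; last exact: leq_maxr.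
rewrite big_mkord big_ord_recr /= -addrA; congr (_ + _).
rewrite mulrDr [y ^+ j * _]mulrC; congr (_ + _).
rewrite mulrA -exprSr mulr_sumr -{1}[j.+1]add0n big_addn big_mkord.
by apply: eq_bigr => i _; rewrite exprD [y ^+ i * _]mulrC mulrCA.
Qed.

Section Residue.
Variable b : algC.
Hypothesis nOb : ~ O b.
Let y := b^-1.
Let b0 : b != 0.
Proof. by apply: contra_notN nOb => /eqP ->; exact: vr0. Qed.
Let Oy : O y. Proof. exact: vrV. Qed.

(** If all nonzero integers were units, the lowest nonzero coefficient of an integer equation for
    [b^-1] would put [b] in [O]. A nonunit integer has a nonunit prime factor. *)
Lemma residue_prime : exists2 p, prime p & ~ O (p%:R)^-1.
Proof.
have [k k0 Nk] : exists2 k : int, k != 0 & ~ O (k%:~R)^-1.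
  apply: NNPP => H; have {}H (k : int) : k != 0 -> O (k%:~R)^-1.
    by move=> k0; apply: NNPP => Hk; apply: H; exists k.
  have [f [cf fy]] := primitive_int_poly y.
  have [j fj Hj] : exists2 j, f`_j != 0 & forall i, (i < j)%N -> f`_i = 0.
    have ex : exists j, f`_j != 0.
      exists (size f).-1; rewrite -lead_coefE lead_coef_eq0.
      by apply: contra_eq_neq cf => ->; rewrite zcontents0.
    exists (ex_minn ex); case: ex_minnP => // j H1 H2 i ij.
    by apply/eqP; apply: contraTT ij => /H2; rewrite -leqNgt.
  have [w Ow E] := vr_horner_split f j Oy.
  move: E; rewrite fy big1 => [|i _]; last by rewrite Hj // mul0r.
  rewrite add0r => /esym/eqP; rewrite mulf_eq0 expf_eq0 invr_eq0 (negPf b0) andbF /= addr_eq0 => /eqP E.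
  have fj0 : (f`_j)%:~R != 0 :> algC by rewrite intr_eq0.
  apply: nOb; have -> : b = (- w) * ((f`_j)%:~R)^-1.
    by apply: (@mulIf _ (f`_j)%:~R) => //; rewrite divfK // E mulrN mulrA mulfV // mul1r.
  by apply: (vrM vO); [exact: vrN | exact: H].
have {k k0 Nk} [k k0 Nk] : exists2 k, (0 < k)%N & ~ O (k%:R)^-1.
  exists `|k|%N; first by rewrite absz_gt0.
  case: k k0 Nk => k // k0 Nk; rewrite NegzE rmorphN invrN in Nk.
  by move=> H; apply: Nk; apply: vrN.
apply: NNPP => H; apply: Nk; elim/ltn_ind: k k0 => k IH k0.
have [k1|k1] := leqP k 1.
  by have -> : k = 1%N; [by apply/eqP; rewrite eqn_leq k1 | rewrite invr1; exact: vr1].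
have pp := pdiv_prime k1; have pk := pdiv_dvd k.
rewrite -(divnK pk) natrM invfM; apply: (vrM vO); last first.
  by apply: NNPP => Np; apply: H; exists (pdiv k).
by apply: IH; rewrite ?divn_gt0 ?prime_gt0 ?pdiv_leq // ltn_Pdiv // prime_gt1.
Qed.
End Residue.

Section Prime.
Variable p : nat.
Hypotheses (pp : prime p) (Np : ~ O (p%:R)^-1).

Lemma vr_coprime_unit (k : int) : ~~ (p %| k)%Z -> O (k%:~R)^-1.
Proof.
move=> Npk; have cop : gcdz p k = 1.
  by apply/eqP; rewrite -[_ == _]/(coprimez p k) coprimezE prime_coprime.
have [u [v E]] := Bezoutz p k; rewrite cop in E.
have k0 : k%:~R != 0 :> algC by rewrite intr_eq0; apply: contraNneq Npk => ->; exact: dvdz0.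
have p0 : p%:R != 0 :> algC by rewrite pnatr_eq0 -lt0n prime_gt0.
apply: NNPP => Nk.
have EC : u%:~R * p%:R + v%:~R * k%:~R = 1 :> algC.
  by rewrite -[p%:R]/((Posz p)%:~R) -!intrM -intrD E.
have [u0|u0] := eqVneq u 0.
  apply: Nk; suff -> : (k%:~R)^-1 = v%:~R :> algC by exact: vr_intr.
  by apply: (@mulIf _ k%:~R) => //; rewrite mulVf // -[LHS]EC u0 mulr0z mul0r add0r.
have [v0|v0] := eqVneq v 0.
  apply: Np; suff -> : (p%:R)^-1 = u%:~R :> algC by exact: vr_intr.
  by apply: (@mulIf _ p%:R) => //; rewrite mulVf // -[LHS]EC v0 mulr0z mul0r addr0.
have nzM (z : int) (x : algC) : z != 0 -> x != 0 -> ~ O x^-1 -> ~ O (z%:~R * x)^-1.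
  move=> z0 x0 Nx H; apply: Nx; have -> : x^-1 = z%:~R * (z%:~R * x)^-1.
    by rewrite invfM mulrA mulfV ?mul1r // intr_eq0.
  by apply: (vrM vO) => //; exact: vr_intr.
apply: (@vrVD (u%:~R * p%:R) (v%:~R * k%:~R)).
- by rewrite mulf_neq0 // intr_eq0.
- by rewrite mulf_neq0 // intr_eq0.
- by rewrite EC oner_eq0.
- by apply: (vrM vO); [exact: vr_intr | exact: vr_nat].
- by apply: (vrM vO); exact: vr_intr.
- exact: nzM.
- exact: nzM.
by rewrite EC invr1; exact: vr1.
Qed.

(** On the integers [O] induces the [p]-adic valuation, because integers prime to [p] are units by
    Bezout. *)
Lemma vr_int_dvd (k : int) e : O (k%:~R / p%:R ^+ e) -> (p ^ e %| `|k|)%N.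
Proof.
have p0 : p%:R != 0 :> algC by rewrite pnatr_eq0 -lt0n prime_gt0.
have [->|k0] := eqVneq k 0; first by rewrite dvdn0.
move=> Hk; have ak0 : (0 < `|k|)%N by rewrite absz_gt0.
have [c cop E] := pfactor_coprime pp ak0.
have [le|lt] := leqP e (logn p `|k|).
  by rewrite E dvdn_mull // dvdn_exp2l.
case: Np; set a := logn p `|k| in E lt *.
have Oc : O (c%:R)^-1.
  apply: (@vr_coprime_unit c); rewrite -prime_coprime //.
have c0 : c%:R != 0 :> algC.
  by rewrite pnatr_eq0; apply: contraTneq ak0 => c0; rewrite E c0 mul0n.
have Hs : O (c%:R * p%:R ^+ a / p%:R ^+ e).
  have -> : c%:R * p%:R ^+ a = `|k|%N%:R :> algC by rewrite E natrM natrX.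
  case: (intP k) Hk => [|n|n] Hk; rewrite ?absz0 ?mul0r; first exact: vr0.
    exact: Hk.
  by move: Hk; rewrite abszN mulrNz mulNr => /vrN; rewrite opprK.
have -> : (p%:R)^-1 = (c%:R)^-1 * (c%:R * p%:R ^+ a / p%:R ^+ e) * p%:R ^+ (e - a).-1 :> algC.
  rewrite -!mulrA mulKf //; apply: (@mulIf _ p%:R) => //; rewrite mulVf //.
  have -> : p%:R ^+ a * ((p%:R ^+ e)^-1 * p%:R ^+ (e - a).-1) * p%:R =
    p%:R ^+ a * p%:R ^+ (e - a).-1.+1 / p%:R ^+ e :> algC by rewrite exprSr; ring.
  by rewrite prednK ?subn_gt0 // -exprD subnKC ?mulfV ?expf_neq0 // ltnW.
by apply: (vrM vO); [apply: (vrM vO) | apply: vrX; exact: vr_nat].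
Qed.

(** This is the rank one property in the form needed. In a primitive equation for [y], let [j] be
    the first index whose coefficient is prime to [p]: the terms from [j] on are [y^j] times a unit,
    and those before [j] are divisible by [p]. *)
Lemma residue_power b : ~ O b -> exists2 s, (0 < s)%N & O (b^-1 ^+ s / p%:R).
Proof.
move=> nOb; pose y := b^-1; have Oy : O y by exact: vrV.
have b0 : b != 0 by apply: contra_notN nOb => /eqP ->; exact: vr0.
have p0 : p%:R != 0 :> algC by rewrite pnatr_eq0 -lt0n prime_gt0.
have [f [cf fy]] := primitive_int_poly y.
have ex : exists j, ~~ (p %| f`_j)%Z.
  apply: NNPP => H; have : (p%:Z %| zcontents f)%Z.
    rewrite dvdz_contents; apply/polyOverP => i; apply/negPn/negP => Hi.
    by apply: H; exists i.
  by rewrite cf dvdz1 => /eqP E; move: (prime_gt1 pp); rewrite -[p]/(absz p%:Z) E.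
have [j fj Hj] : exists2 j, ~~ (p %| f`_j)%Z & forall i, (i < j)%N -> (p %| f`_i)%Z.
  exists (ex_minn ex); case: ex_minnP => // j H1 H2 i ij.
  by apply: contraTT ij => /H2; rewrite -leqNgt.
have [w Ow E] := vr_horner_split f j Oy; rewrite fy in E.
have fj0 : (f`_j)%:~R != 0 :> algC.
  by rewrite intr_eq0; apply: contraNneq fj => ->; exact: dvdz0.
have Ofj := vr_coprime_unit fj.
set u := (f`_j)%:~R + y * w in E.
have [Nu0 OuV] : u != 0 /\ O u^-1.
  have [w0|w0] := eqVneq w 0; first by rewrite /u w0 mulr0 addr0.
  have y0 : y != 0 by rewrite invr_eq0.
  have Nyw : ~ O (y * w)^-1.
    by move=> H; apply: nOb; have -> : b = w * (y * w)^-1;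
      [rewrite invfM mulrCA mulfV // mulr1 invrK | exact: (vrM vO)].
  have u0 : u != 0.
    apply/eqP => u0; apply: Nyw; have -> : y * w = - (f`_j)%:~R.
      by apply/eqP; rewrite -addr_eq0 addrC -/u u0.
    by rewrite invrN; exact: vrN.
  split=> //; apply: NNPP => Nu.
  apply: (@vrVD u (- (y * w))) => //.
  - by rewrite oppr_eq0 mulf_neq0.
  - by rewrite /u addrK.
  - by apply: vrD; [exact: vr_intr | exact: (vrM vO)].
  - by apply: vrN; exact: (vrM vO).
  - by rewrite invrN => H; apply: Nyw; rewrite -[_^-1]opprK; exact: vrN.
  by rewrite /u addrK.
have Eyj : y ^+ j / p%:R = (- (\sum_(i < j) (f`_i)%:~R / p%:R * y ^+ i)) * u^-1.
  apply: (@mulIf _ u) => //; rewrite divfK // -[LHS]mulrA [_ * u]mulrC mulrA.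
  apply: (@mulIf _ p%:R) => //; rewrite divfK // mulNr mulr_suml.
  apply/eqP; rewrite -addr_eq0 addrC; apply/eqP; rewrite [RHS]E; congr (_ + _).
  by apply: eq_bigr => i _; rewrite mulrAC divfK.
have Oyj : O (y ^+ j / p%:R).
  rewrite Eyj; apply: (vrM vO) => //; apply: vrN; apply: vr_sum => i _.
  apply: (vrM vO); last exact: vrX.
  have /dvdzP [q ->] := Hj i (ltn_ord i).
  by rewrite intrM -[(Posz p)%:~R]/(p%:R) mulfK //; exact: vr_intr.
exists j => //; rewrite lt0n; apply: contra_notN Np => /eqP j0.
by move: Oyj; rewrite j0 mul1r.
Qed.

End Prime.
End ValuationRing.

(** * Orders of number fields *)

(* The ring [A] is only a presentation of the order: the embeddings [sg j] need not
   be injective, but have the same kernel. *)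
Record number_ring (A : comNzRingType) (g : nat) (sg : 'I_g -> {rmorphism A -> algC})
    (om : 'I_g -> A) : Prop := NumberRing {
  nr_ker : forall j j' a, sg j a = 0 -> sg j' a = 0;
  nr_span : forall a, exists z : 'I_g -> int,
    forall j, sg j a = \sum_i (z i)%:~R * sg j (om i);
  nr_unit : (\matrix_(i, j) sg j (om i)) \in unitmx;
  nr_Aint : forall j a, sg j a \in Aint }.

Section NumberRing.
Variables (A : comNzRingType) (g : nat) (sg : 'I_g -> {rmorphism A -> algC}) (om : 'I_g -> A).
Hypothesis nrA : number_ring sg om.

Let Omega : 'M[algC]_g := \matrix_(i, j) sg j (om i).

Lemma nr_mulmx (a : A) : exists X : 'M[int]_g,
  map_mx intr X *m Omega = Omega *m diag_mx (\row_j sg j a).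
Proof.
have H i : exists z : 'I_g -> int, forall j, sg j (om i * a) = \sum_k (z k)%:~R * sg j (om k).
  exact: nr_span.
have [z Hz] := fun_choice H.
exists (\matrix_(i, k) z i k); apply/matrixP => i j.
rewrite mul_mx_diag !mxE -rmorphM Hz; apply: eq_bigr => k _; by rewrite !mxE.
Qed.

Lemma det_nr_mulmx (a : A) (X : 'M[int]_g) :
  map_mx intr X *m Omega = Omega *m diag_mx (\row_j sg j a) ->
  (\det X)%:~R = \prod_j sg j a.
Proof.
move=> E; have := congr1 (fun M => \det M) E; rewrite !det_mulmx det_map_mx det_diag mulrC.
have uO : \det Omega != 0 by rewrite -unitfE -[_ \is a _]/(Omega \in unitmx); exact: (nr_unit nrA).
move/(mulfI uO) => ->; by apply: eq_bigr => j _; rewrite mxE.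
Qed.

(** The Smith normal form turns congruence modulo the rows of [X] into congruences modulo the
    diagonal entries, whose product is the determinant up to sign. *)
Lemma int_lattice_index (X : 'M[int]_g) C (F : 'I_C -> 'rV[int]_g) : \det X != 0 ->
  (forall i i', (exists w, F i - F i' = w *m X) -> i = i') -> (C <= `|\det X|)%N.
Proof.
move=> dX HF; have [L uL [R uR [d _ E]]] := int_Smith_normal_form X.
pose D : 'M[int]_g := \matrix_(i, j) (d`_i *+ (i == j :> nat)).
have ED : D = diag_mx (\row_i d`_i).
  by apply/matrixP => i j; rewrite !mxE val_eqE.
pose dd (i : nat) := absz (d`_i)%R.
have detE : `|\det X|%N = (\prod_(i < g) (dd i))%N.
  have unit1 (M : 'M[int]_g) : M \in unitmx -> `|\det M|%N = 1%N.
    by rewrite unitmxE => /orP[/eqP ->|/eqP ->].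
  rewrite E -/D !det_mulmx !abszM (unit1 L) // (unit1 R) // muln1 mul1n ED det_diag.
  rewrite (big_morph absz abszM (_ : absz 1 = 1%N)) //.
  by apply: eq_bigr => i _; rewrite mxE.
have dnz i : (0 < (dd i))%N || (g <= i)%N.
  case: (ltnP i g) => [Hi|_]; rewrite ?orbT // orbF.
  have : (0 < `|\det X|)%N by rewrite absz_gt0.
  by rewrite detE (bigD1 (Ordinal Hi)) //= muln_gt0 => /andP[].
pose V (u : 'rV[int]_g) := u *m invmx R.
pose cl u : {dffun forall i : 'I_g, 'I_((dd i).-1.+1)} :=
  [ffun i : 'I_g => inord (absz (modz (V u 0 i) (Posz (dd i))))].
have dpos (i : 'I_g) : (0 < (dd i))%N by have := dnz i; rewrite [(g <= i)%N]leqNgt ltn_ord orbF.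
have clP u u' : cl u = cl u' -> exists w, u - u' = w *m X.
  move=> Ec; pose w : 'rV[int]_g := \row_i divz (V u 0 i - V u' 0 i) d`_i.
  have Hw : V (u - u') = w *m D.
    apply/matrixP => a i; rewrite (ord1 a) ED mul_mx_diag [RHS]mxE [w _ _]mxE [X in _ * X]mxE.
    rewrite divzK.
      by rewrite /V mulmxBl mxE [X in _ + X]mxE.
    have := congr1 (fun f : {dffun forall i : 'I_g, 'I_((dd i).-1.+1)} => val (f i)) Ec.
    rewrite !ffunE /=.
    have mpos (x : int) : 0 <= modz x (Posz (dd i)) by rewrite modz_ge0 // eqz_nat -lt0n.
    have mlt (x : int) : (absz (modz x (Posz (dd i))) < (dd i).-1.+1)%N.
      rewrite prednK // -ltz_nat gez0_abs //; apply: ltz_pmod; by rewrite ltz_nat.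
    rewrite !inordK // => Em.
    have : modz (V u 0 i) (Posz (dd i)) = modz (V u' 0 i) (Posz (dd i)).
      by rewrite -(gez0_abs (mpos _)) Em gez0_abs.
    by move/eqP; rewrite eqz_mod_dvd /dvdz absz_nat.
  exists (w *m invmx L); rewrite E -/D !mulmxA mulmxKV // -Hw /V mulmxKV //.
have inj : injective (fun i => cl (F i)) by move=> i i' /clP /HF.
rewrite -[C]card_ord; apply: leq_trans (leq_card _ inj) _.
rewrite card_dep_ffun detE foldrE big_map -(big_enum _ _ _ (fun i : 'I_g => (dd i))) /=.
by apply: eq_leq; apply: eq_bigr => i _; rewrite card_ord prednK.
Qed.

Lemma nr_neq0 j j' a : sg j a != 0 -> sg j' a != 0.
Proof. apply: contra_neq; exact: (nr_ker nrA). Qed.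

Lemma nr_norm_int a : \prod_j sg j a \is a Num.int.
Proof. by have [X /det_nr_mulmx <-] := nr_mulmx a; exact: intr_int. Qed.

Lemma nr_norm_ge1 a j : sg j a != 0 -> 1 <= \prod_j `|sg j a|.
Proof.
move=> ja; rewrite -normr_prod norm_intr_ge1 ?nr_norm_int //.
by apply/prodf_neq0 => j' _; exact: nr_neq0 ja.
Qed.

(** Multiplication by [a] is an integer matrix whose determinant is the norm of [a], so the norm
    bounds the number of classes modulo [a]. *)
Lemma nr_incongruent a j0 C (F : 'I_C -> A) : sg j0 a != 0 ->
  (forall i i', (exists c, forall j, sg j (F i - F i') = sg j (c * a)) -> i = i') ->
  C%:R <= \prod_j `|sg j a|.
Proof.
move=> a0 HF; have [X EX] := nr_mulmx a; have dX := det_nr_mulmx EX.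
have dX0 : \det X != 0.
  rewrite -(intr_eq0 algC) dX; apply/prodf_neq0 => j _; exact: nr_neq0 a0.
have [z Hz] := fun_choice (fun i => nr_span nrA (F i)).
rewrite -normr_prod -dX -intr_norm -[C%:R]/((Posz C)%:~R) ler_int.
rewrite -[`|_|]/(Posz `|\det X|%N) lez_nat.
apply: (@int_lattice_index X C (fun i => \row_k z i k)) => // i i' [w Ew].
apply: HF; exists (\sum_k om k *~ w 0 k) => j.
have Esum (u : 'rV[int]_g) (b : A) : (forall j, sg j b = \sum_k (u 0 k)%:~R * sg j (om k)) ->
    forall j, sg j b = (map_mx intr u *m Omega) 0 j.
  by move=> H j'; rewrite H mxE; apply: eq_bigr => k _; rewrite !mxE.
rewrite rmorphB (Esum (\row_k z i k) (F i)); last by move=> j'; rewrite Hz; apply: eq_bigr => k _; rewrite mxE.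
rewrite (Esum (\row_k z i' k) (F i')); last by move=> j'; rewrite Hz; apply: eq_bigr => k _; rewrite mxE.
have -> : forall x y : algC, x - y = x - y by [].
transitivity ((map_mx intr (\row_k z i k - \row_k z i' k) *m Omega) 0 j).
  by rewrite map_mxB mulmxBl !mxE.
rewrite Ew map_mxM -mulmxA EX mulmxA mul_mx_diag !mxE rmorphM; congr (_ * _).
by rewrite rmorph_sum; apply: eq_bigr => k _; rewrite !mxE rmorphMz mulrzl.
Qed.

End NumberRing.

(** A rational relation exists for reasons of dimension. Once it is integral, it is divided by [p]
    as long as possible, which lowers the sum of the absolute values. *)
Lemma int_dependence g (v : 'I_g.+1 -> 'I_g -> int) (p : nat) : prime p ->
  exists c : 'I_g.+1 -> int, (exists i, ~~ (p %| `|c i|)%N) /\ forall k, \sum_i c i * v i k = 0.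
Proof.
move=> pp; pose V : 'M[rat]_(g.+1, g) := \matrix_(i, k) (v i k)%:~R.
have [u u0 uV] : exists2 u : 'rV[rat]_g.+1, u != 0 & u *m V = 0.
  have : kermx V != 0.
    by rewrite -mxrank_eq0 mxrank_ker subn_eq0 -ltnNge ltnS rank_leq_col.
  by move/rowV0Pn => [u /sub_kermxP Hu u0]; exists u.
pose P n := exists2 c : 'I_g.+1 -> int, (\sum_i `|c i| <= n)%N &
   (exists i, c i != 0) /\ forall k, \sum_i c i * v i k = 0.
have [n Pn] : exists n, P n.
  pose dn := \prod_i denq (u 0 i).
  have H i : exists c : int, c%:~R = dn%:~R * u 0 i.
    exists (numq (u 0 i) * \prod_(i' | i' != i) denq (u 0 i')).
    by rewrite /dn [in RHS](bigD1 i) //= !intrM numqE; ring.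
  have [c Hc] := fun_choice H.
  exists (\sum_i `|c i|)%N, c => //; split.
    have /rV0Pn [i ui] := u0; exists i; rewrite -(intr_eq0 rat) Hc mulf_neq0 // intr_eq0.
    by apply/prodf_neq0 => k _; exact: denq_neq0.
  move=> k; apply/eqP; rewrite -(intr_eq0 rat) rmorph_sum /=; apply/eqP.
  have := congr1 (fun M : 'rV_g => dn%:~R * M 0 k) uV; rewrite !mxE mulr0 => H0; rewrite -[RHS]H0.
  by rewrite mulr_sumr; apply: eq_bigr => i _; rewrite intrM Hc !mxE mulrA.
elim/ltn_ind: n Pn => n IH [c Hn [[i0 ci0] Hc]].
have [Hp|Hp] := boolP [forall i, (p %| `|c i|)%N]; last first.
  by exists c; split=> //; move: Hp; rewrite negb_forall => /existsP.
move/forallP: Hp => Hp.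
pose c' i := divz (c i) p.
have Ec i : c i = c' i * p by rewrite /c' divzK // dvdzE; exact: Hp.
have p0 : (p : int) != 0 by rewrite eqz_nat -lt0n prime_gt0.
apply: (IH (\sum_i `|c' i|)%N); last first.
  exists c' => //; split; first by exists i0; apply: contraNneq ci0 => e; rewrite Ec e mul0r.
  move=> k; apply: (mulIf p0); rewrite mul0r -[RHS](Hc k) mulr_suml.
  by apply: eq_bigr => i _; rewrite mulrAC -Ec.
apply: leq_trans Hn; rewrite (bigD1 i0) //= [X in (_ < X)%N](bigD1 i0) //= -addSn leq_add //.
  rewrite [in X in (_ < X)%N]Ec abszM /= ltn_Pmulr ?prime_gt1 // absz_gt0.
  by apply: contraNneq ci0 => e; rewrite Ec e mul0r.
by apply: leq_sum => i _; rewrite [in X in (_ <= X)%N]Ec abszM /= leq_pmulr ?prime_gt0.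
Qed.

(** * Local degree and residue classes at the place of a valuation ring *)

Section ResidueBasis.
Variables (A : comNzRingType) (g : nat) (sg : 'I_g -> {rmorphism A -> algC}) (om : 'I_g -> A).
Hypothesis nrA : number_ring sg om.
Variables (O : algC -> Prop) (p : nat) (j0 : 'I_g).
Hypotheses (vO : valuation_ring O) (pp : prime p) (Np : ~ O (p%:R)^-1).

Definition nr_frac x := exists (a : A) (q : nat), (0 < q)%N /\ x * q%:R = sg j0 a.

Let p0 : p%:R != 0 :> algC.
Proof. by rewrite pnatr_eq0 -lt0n prime_gt0. Qed.

Lemma vr_sg j a : O (sg j a).
Proof. apply: vr_Aint => //; exact: (nr_Aint nrA). Qed.

Let pfrac x := exists (a : A) k, x * p%:R ^+ k = sg j0 a.

Let indep s (e : 'I_s -> algC) := [/\ forall i, O (e i), forall i, pfrac (e i) &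
  forall z : 'I_s -> int, O ((\sum_i (z i)%:~R * e i) / p%:R) -> forall i, (p %| `|z i|)%N].

Let O_div_le x k k' : (k <= k')%N -> O (x / p%:R ^+ k') -> O (x / p%:R ^+ k).
Proof.
move=> le H; have -> : x / p%:R ^+ k = x / p%:R ^+ k' * p%:R ^+ (k' - k).
  have E : p%:R ^+ k' = p%:R ^+ (k' - k) * p%:R ^+ k :> algC by rewrite -exprD subnK.
  by rewrite E invfM -[RHS]mulrA; congr (x * _); rewrite mulrAC mulVf ?mul1r ?expf_neq0.
by apply: (vrM vO) => //; apply: vrX => //; exact: vr_nat.
Qed.

Let indep_drop s (e : 'I_s.+1 -> algC) : indep e -> indep (fun i => e (widen_ord (leqnSn s) i)).
Proof.
case=> eO ef ez; split=> // z Hz i.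
pose z' (i : 'I_s.+1) := if insub (val i) is Some i' then z i' else 0.
have Ez' (i' : 'I_s) : z' (widen_ord (leqnSn s) i') = z i' by rewrite /z' /= valK.
have := ez z'; rewrite big_ord_recr /= {2}/z' insubF /= ?ltnn // mul0r addr0.
by under eq_bigr do rewrite Ez'; move=> /(_ Hz (widen_ord (leqnSn s) i)); rewrite Ez'.
Qed.

Let indep_le s (e : 'I_s -> algC) : indep e -> (s <= g)%N.
Proof.
suff H (f : 'I_g.+1 -> algC) : ~ indep f.
  elim: s e => // s IH e He; have := IH _ (indep_drop He); rewrite leq_eqVlt => /predU1P[E|//].
  by move: e He {IH}; rewrite E => e /H.
case=> eO ef ez.
have Hk i : exists k, exists a : A, f i * p%:R ^+ k = sg j0 a.
  by have [a [k H]] := ef i; exists k, a.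
have [k Hka] := fun_choice Hk.
pose M := (\max_i k i)%N.
have Ha i : exists z : 'I_g -> int, f i * p%:R ^+ M = \sum_l (z l)%:~R * sg j0 (om l).
  have [a Ea] := Hka i; have [z Hz] := nr_span nrA ((p%:R ^+ (M - k i)) * a).
  exists z; rewrite -Hz rmorphM rmorphXn rmorph_nat -Ea mulrCA -exprD subnK //.
  by apply: leq_bigmax.
have [v Hv] := fun_choice Ha.
have [c [[i Hi] Hc]] := int_dependence v pp.
have H0 : \sum_i (c i)%:~R * f i = 0.
  apply: (@mulIf _ (p%:R ^+ M)); first by rewrite expf_neq0.
  rewrite mul0r mulr_suml.
  under eq_bigr do rewrite -mulrA Hv mulr_sumr.
  rewrite exchange_big big1 //= => l _.
  under eq_bigr do rewrite mulrA -intrM.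
  by rewrite -mulr_suml -rmorph_sum /= Hc mul0r.
by move: Hi; rewrite ez // H0 mul0r; exact: vr0.
Qed.

(** A maximal family of local integers independent modulo [p]; its length [s] is bounded by the
    degree because of [int_dependence]. Maximality means that every local integer is an integer
    combination modulo [p], and iteration gives the same modulo [p^k]. The denominators of the
    family are powers of [p], with a common exponent [t]; a denominator prime to [p] is removed by
    Bezout. *)
Lemma residue_basis : exists s t (e : 'I_s -> algC) (a : 'I_s -> A),
  [/\ (0 < s)%N, forall i, O (e i), forall i, e i * p%:R ^+ t = sg j0 (a i),
    forall k (z : 'I_s -> int), O ((\sum_i (z i)%:~R * e i) / p%:R ^+ k) ->
      forall i, (p ^ k %| `|z i|)%N &
    forall k x, nr_frac x -> O x ->
      exists z : 'I_s -> int, O ((x - \sum_i (z i)%:~R * e i) / p%:R ^+ k)].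
Proof.
pose Q s := boolp.asbool (exists e : 'I_s -> algC, indep e).
have exQ : exists s, Q s.
  exists 1%N; apply/boolp.asboolP; exists (fun=> 1); split=> [_|_|z].
  - exact: vr1.
  - by exists 1, 0%N; rewrite rmorph1 mulr1.
  by rewrite big_ord1 mulr1 => H i; rewrite (ord1 i); apply: (vr_int_dvd vO pp Np (e:=1)).
have Qg s : Q s -> (s <= g)%N by move/boolp.asboolP => [e /indep_le].
pose s := ex_maxn exQ Qg.
have [Qs maxs] : Q s /\ forall s', Q s' -> (s' <= s)%N by rewrite /s; case: ex_maxnP.
have s0 : (0 < s)%N.
  apply: maxs; apply/boolp.asboolP; exists (fun=> 1); split=> [_|_|z].
  - exact: vr1.
  - by exists 1, 0%N; rewrite rmorph1 mulr1.
  by rewrite big_ord1 mulr1 => H i; rewrite (ord1 i); apply: (vr_int_dvd vO pp Np (e:=1)).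
have /boolp.asboolP [e [eO ef ez]] := Qs.
have Hk i : exists k, exists a : A, e i * p%:R ^+ k = sg j0 a.
  by have [a [k H]] := ef i; exists k, a.
have [kk Hka] := fun_choice Hk; have [a Ha] := fun_choice Hka.
pose t := (\max_i kk i)%N.
have gen1 x : pfrac x -> O x -> exists z : 'I_s -> int, O ((x - \sum_i (z i)%:~R * e i) / p%:R).
  move=> xf xO; apply: NNPP => Hno.
  suff : (s.+1 <= s)%N by rewrite ltnn.
  apply: maxs; apply/boolp.asboolP.
  exists (fun i => if unlift ord_max i is Some i' then e i' else x); split.
  - by move=> i; case: unliftP => [i' _|_].
  - by move=> i; case: unliftP => [i' _|_].
  move=> z; rewrite big_ord_recr /= unlift_none.
  have Hl (i : 'I_s) : widen_ord (leqnSn s) i = lift ord_max i.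
    by apply: val_inj; rewrite /= /bump leqNgt ltn_ord.
  under eq_bigr do rewrite Hl liftK.
  set w := z ord_max => H.
  have [pw|npw] := boolP (p %| `|w|)%N.
    have Hw : O (w%:~R * x / p%:R).
      have /dvdzP [q Eq] : (p %| w)%Z by [].
      by rewrite Eq intrM -[(Posz p)%:~R]/(p%:R) mulrAC mulfK //; apply: (vrM vO) => //; exact: vr_intr.
    have := vrB vO H Hw; rewrite -mulrBl addrK => /ez Hz i.
    by case: (unliftP ord_max i) => [i' ->|->].
  case: Hno; have /eqP cop : coprimez p w by rewrite coprimezE prime_coprime.
  have [u [v E]] := Bezoutz p w; rewrite cop in E.
  have EC : u%:~R * p%:R + v%:~R * w%:~R = 1 :> algC.
    by rewrite -[p%:R]/((Posz p)%:~R) -!intrM -intrD E.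
  exists (fun i => - (v * z (lift ord_max i))).
  have -> : x - \sum_i (- (v * z (lift ord_max i)))%:~R * e i =
     u%:~R * x * p%:R + v%:~R * (\sum_i (z (lift ord_max i))%:~R * e i + w%:~R * x).
    have -> : \sum_i (- (v * z (lift ord_max i)))%:~R * e i =
        - (v%:~R * \sum_i (z (lift ord_max i))%:~R * e i).
      by rewrite mulr_sumr -sumrN; apply: eq_bigr => i _; rewrite mulrNz intrM; ring.
    have Ex : x = (u%:~R * p%:R + v%:~R * w%:~R) * x by rewrite EC mul1r.
    by rewrite {1}Ex; ring.
  rewrite mulrDl mulfK // -[X in _ + X]mulrA; apply: vrD => //; apply: (vrM vO) => //; exact: vr_intr.
have genp k x : pfrac x -> O x -> exists z : 'I_s -> int, O ((x - \sum_i (z i)%:~R * e i) / p%:R ^+ k).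
  elim: k x => [|k IH] x xf xO.
    by exists (fun=> 0); rewrite big1 ?subr0 ?divr1 // => i _; rewrite mul0r.
  have [z Hz] := gen1 x xf xO.
  have [z' Hz'] : exists z' : 'I_s -> int,
      O (((x - \sum_i (z i)%:~R * e i) / p%:R - \sum_i (z' i)%:~R * e i) / p%:R ^+ k).
    apply: IH => //; have [b [l El]] := xf.
    exists (p%:R ^+ t * b - p%:R ^+ l * \sum_i p%:R ^+ (t - kk i) * a i *~ z i), (l + t).+1.
    rewrite exprS mulrA divfK // rmorphB !rmorphM rmorph_sum !rmorphXn !rmorph_nat.
    have -> : \sum_i sg j0 (p%:R ^+ (t - kk i) * a i *~ z i) = (\sum_i (z i)%:~R * e i) * p%:R ^+ t.
      rewrite mulr_suml; apply: eq_bigr => i _.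
      rewrite rmorphMz rmorphM rmorphXn rmorph_nat -Ha -mulrzl -!mulrA; congr (_ * _).
      by rewrite mulrCA -exprD subnK // leq_bigmax.
    rewrite -El exprD; move: (\sum_i (z i)%:~R * e i) (p%:R ^+ l : algC) (p%:R ^+ t : algC) => S P R.
    by rewrite mulrBl [S * (P * R)]mulrCA [R * (x * P)]mulrC [x * (P * R)]mulrA.
  exists (fun i => z i + p%:Z * z' i).
  suff -> : x - \sum_i (z i + p%:Z * z' i)%:~R * e i =
     p%:R * ((x - \sum_i (z i)%:~R * e i) / p%:R - \sum_i (z' i)%:~R * e i).
    by rewrite exprS invfM mulrACA mulfV // mul1r.
  rewrite mulrBr mulrCA mulfV // mulr1 -addrA -opprD; congr (_ - _).
  rewrite mulr_sumr -big_split /=; apply: eq_bigr => i _.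
  by rewrite intrD intrM -[(Posz p)%:~R]/(p%:R) mulrDl mulrA.
exists s, t, e, (fun i => p%:R ^+ (t - kk i) * a i); split=> //.
- move=> i; rewrite rmorphM rmorphXn rmorph_nat -Ha mulrCA -exprD subnK //.
  by apply: leq_bigmax.
- elim=> [|k IH] z Hz i; first by rewrite dvd1n.
  have Hz1 : O ((\sum_i (z i)%:~R * e i) / p%:R) by rewrite -[p%:R]expr1; apply: O_div_le Hz.
  have H1 := ez z Hz1.
  have Ez i' : z i' = divz (z i') p * p by rewrite divzK // dvdzE; exact: H1.
  have := IH (fun i => divz (z i) p) _ i; rewrite {2}(Ez i) abszM expnSr dvdn_pmul2r ?prime_gt0 //; apply.
  suff -> : (\sum_i (divz (z i) p)%:~R * e i) / p%:R ^+ k = (\sum_i (z i)%:~R * e i) / p%:R ^+ k.+1 by [].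
  rewrite exprS invfM mulrA; congr (_ / _); apply: (@mulIf _ p%:R) => //; rewrite divfK // mulr_suml.
  by apply: eq_bigr => i' _; rewrite [in RHS]Ez intrM [RHS]mulrAC.
move=> k x [b [q [q0 Eb]]] xO.
have [c cop Eq] := pfactor_coprime pp q0.
have xcf : pfrac (x * c%:R).
  by exists b, (logn p q); rewrite -mulrA -natrX -natrM -Eq.
have [z Hz] := genp k _ xcf (vrM vO xO (vr_nat vO _)).
have /eqP copz : coprimez (p ^ k)%N c by rewrite coprimezE /= coprimeXl.
have [u [v E]] := Bezoutz (p ^ k)%N c; rewrite copz in E.
have EC : u%:~R * p%:R ^+ k + v%:~R * c%:R = 1 :> algC.
  by rewrite -natrX -[(p ^ k)%:R]/((Posz (p ^ k)%N)%:~R) -[c%:R]/((Posz c)%:~R) -!intrM -intrD E.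
exists (fun i => v * z i).
have -> : x - \sum_i (v * z i)%:~R * e i =
  u%:~R * x * p%:R ^+ k + v%:~R * (x * c%:R - \sum_i (z i)%:~R * e i).
  have Ex : x = (u%:~R * p%:R ^+ k + v%:~R * c%:R) * x by rewrite EC mul1r.
  have -> : \sum_i (v * z i)%:~R * e i = v%:~R * \sum_i (z i)%:~R * e i.
    by rewrite mulr_sumr; apply: eq_bigr => i _; rewrite intrM mulrA.
  by rewrite {1}Ex; ring.
rewrite mulrDl mulfK ?expf_neq0 // -[X in _ + X]mulrA; apply: vrD => //.
  by apply: (vrM vO) => //; exact: vr_intr.
by apply: (vrM vO) => //; exact: vr_intr.
Qed.

End ResidueBasis.

Section PadicNorm.
Variables (A : comNzRingType) (g : nat) (sg : 'I_g -> {rmorphism A -> algC}) (om : 'I_g -> A).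
Hypothesis nrA : number_ring sg om.
Variables (O : algC -> Prop) (p : nat) (j0 : 'I_g).
Hypotheses (vO : valuation_ring O) (pp : prime p) (Np : ~ O (p%:R)^-1).

Let p0 : p%:R != 0 :> algC.
Proof. by rewrite pnatr_eq0 -lt0n prime_gt0. Qed.

Lemma vr_div_le x k k' : (k <= k')%N -> O (x / p%:R ^+ k') -> O (x / p%:R ^+ k).
Proof.
move=> le H.
have E : p%:R ^+ k' = p%:R ^+ (k' - k) * p%:R ^+ k :> algC by rewrite -exprD subnK.
have -> : x / p%:R ^+ k = x / p%:R ^+ k' * p%:R ^+ (k' - k).
  by rewrite E invfM -[RHS]mulrA; congr (x * _); rewrite mulrAC mulVf ?mul1r ?expf_neq0.
by apply: (vrM vO) => //; apply: vrX => //; exact: vr_nat.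
Qed.

(* [s] is the local degree of the number field at the place of [O], hence the
   norm bound and the number of residue classes match exactly. *)
Lemma padic_norm_and_classes : exists s t, [/\ (0 < s)%N,
  forall a K, sg j0 a != 0 -> O (sg j0 a / p%:R ^+ K) ->
    p%:R ^+ (s * (K - t)) <= \prod_j `|sg j a| &
  forall k, exists cl : algC -> {ffun 'I_s -> 'I_(p ^ k).-1.+1}, forall x y,
    nr_frac sg j0 x -> O x -> nr_frac sg j0 y -> O y -> cl x = cl y -> O ((x - y) / p%:R ^+ k)].
Proof.
have [s [t [e [b [s0 eO eb eind egen]]]]] := residue_basis nrA j0 vO pp Np.
exists s, t; split=> //.
  move=> a K a0 aK; have [lt|le] := ltnP K t.
    have -> : (K - t = 0)%N by apply/eqP; rewrite subn_eq0 ltnW.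
    by rewrite muln0 expr0; exact: (nr_norm_ge1 nrA a0).
  (* The [p^(s(K-t))] combinations of the basis with digits below [p^(K-t)], multiplied by [p^t] to
     lie in the ring, are pairwise incongruent modulo [a], so their number is at most the norm. *)
  pose T : finType := {ffun 'I_s -> 'I_(p ^ (K - t))}.
  pose F (f : T) : A := \sum_i b i *+ f i.
  have -> : p%:R ^+ (s * (K - t)) = #|T|%:R :> algC.
    by rewrite card_ffun !card_ord -natrX mulnC expnM.
  apply: (@nr_incongruent _ _ _ _ nrA a j0 #|T| (fun i => F (enum_val i)) a0).
  move=> i i' [c Hc]; apply: enum_val_inj; apply/ffunP => l; apply: val_inj.
  move: (enum_val i) (enum_val i') Hc => f f' Hc.
  have HFE (h : T) : sg j0 (F h) = (\sum_i (h i)%:R * e i) * p%:R ^+ t.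
    rewrite /F rmorph_sum mulr_suml; apply: eq_bigr => r _.
    by rewrite rmorphMn -eb -mulrA mulr_natl.
  pose z r := (f r : int) - (f' r : int).
  have : O ((\sum_r (z r)%:~R * e r) / p%:R ^+ (K - t)).
    have -> : (\sum_r (z r)%:~R * e r) / p%:R ^+ (K - t) = sg j0 c * (sg j0 a / p%:R ^+ K).
      rewrite mulrA -rmorphM -Hc rmorphB !HFE -mulrBl.
      have -> : p%:R ^+ K = p%:R ^+ (K - t) * p%:R ^+ t :> algC by rewrite -exprD subnK.
      rewrite invfM mulrA mulrAC mulfK ?expf_neq0 //; congr (_ / _).
      rewrite -sumrB; apply: eq_bigr => r _; by rewrite rmorphB /= mulrBl.
    by apply: (vrM vO) => //; exact: (vr_sg nrA).
  move/eind => /(_ l); rewrite /z.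
  move=> Hd.
  have /eqP : modz (Posz (f l)) (Posz (p ^ (K - t))) == modz (Posz (f' l)) (Posz (p ^ (K - t))).
    by rewrite eqz_mod_dvd dvdzE.
  by rewrite !modz_nat => -[]; rewrite !modn_small //.
move=> k.
have Hz (x : algC) : exists z : 'I_s -> int, nr_frac sg j0 x -> O x ->
    O ((x - \sum_i (z i)%:~R * e i) / p%:R ^+ k).
  have [[xf xO]|no] := classic (nr_frac sg j0 x /\ O x).
    by have [z Hz] := egen k x xf xO; exists z.
  by exists (fun=> 0) => xf xO; case: no.
have [z Hz'] := fun_choice Hz.
exists (fun x => [ffun i => inord (absz (modz (z x i) (Posz (p ^ k))))]) => x y xf xO yf yO E.
have pk0 : (0 < p ^ k)%N by rewrite expn_gt0 prime_gt0.
have Ezz i : exists q, z x i - z y i = q * Posz (p ^ k).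
  have := congr1 (fun f : {ffun 'I_s -> 'I_(p ^ k).-1.+1} => val (f i)) E.
  rewrite !ffunE /=.
  have mpos (u : int) : 0 <= modz u (Posz (p ^ k)) by rewrite modz_ge0 // eqz_nat -lt0n.
  have mlt (u : int) : (absz (modz u (Posz (p ^ k))) < (p ^ k).-1.+1)%N.
    by rewrite prednK // -ltz_nat gez0_abs //; apply: ltz_pmod; rewrite ltz_nat.
  rewrite !inordK // => Em.
  have : modz (z x i) (Posz (p ^ k)) = modz (z y i) (Posz (p ^ k)).
    by rewrite -(gez0_abs (mpos _)) Em gez0_abs.
  by move/eqP; rewrite eqz_mod_dvd => /dvdzP [q Hq]; exists q.
have [q Hq] := fun_choice Ezz.
have -> : (x - y) / p%:R ^+ k = (x - \sum_i (z x i)%:~R * e i) / p%:R ^+ k -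
    (y - \sum_i (z y i)%:~R * e i) / p%:R ^+ k + \sum_i (q i)%:~R * e i.
  rewrite -mulrBl; apply: (@mulIf _ (p%:R ^+ k)); first by rewrite expf_neq0.
  rewrite [RHS]mulrDl !divfK ?expf_neq0 // mulr_suml.
  have -> : \sum_i (q i)%:~R * e i * p%:R ^+ k = \sum_i (z x i)%:~R * e i - \sum_i (z y i)%:~R * e i.
    rewrite -sumrB; apply: eq_bigr => i _.
    by rewrite -mulrBl -rmorphB /= Hq intrM -[(Posz (p ^ k))%:~R]/((p ^ k)%:R) natrX mulrAC.
  by move: (\sum_i (z x i)%:~R * e i) (\sum_i (z y i)%:~R * e i) => X Y;
    by rewrite opprB [RHS]addrC [RHS]addrA [X - Y + _]addrC !addrA !subrK.
apply: (vrD vO); first by apply: (vrB vO); exact: Hz'.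
by apply: (vr_sum vO) => i _; apply: (vrM vO) => //; exact: vr_intr.
Qed.

Lemma nr_frac_alg a : nr_frac sg j0 (sg j0 a).
Proof. by exists a, 1%N; rewrite mulr1. Qed.

Lemma nr_fracD x y : nr_frac sg j0 x -> nr_frac sg j0 y -> nr_frac sg j0 (x + y).
Proof.
move=> [a [q [q0 Ea]]] [b [r [r0 Eb]]]; exists (a *+ r + b *+ q), (q * r)%N.
rewrite muln_gt0 q0 r0; split=> //.
rewrite natrM rmorphD !rmorphMn /= -Ea -Eb -[(x * _) *+ r]mulr_natr -[(y * _) *+ q]mulr_natr.
by rewrite mulrDl mulrA [q%:R * _]mulrC [y * _]mulrA.
Qed.

Lemma nr_fracM x y : nr_frac sg j0 x -> nr_frac sg j0 y -> nr_frac sg j0 (x * y).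
Proof.
move=> [a [q [q0 Ea]]] [b [r [r0 Eb]]]; exists (a * b), (q * r)%N.
by rewrite muln_gt0 q0 r0; split=> //; rewrite natrM rmorphM -Ea -Eb mulrACA.
Qed.

Lemma nr_fracX x k : nr_frac sg j0 x -> nr_frac sg j0 (x ^+ k).
Proof.
move=> H; elim: k => [|k IH]; last by rewrite exprS; apply: nr_fracM.
by rewrite expr0 -(rmorph1 (sg j0)); exact: nr_frac_alg.
Qed.

Lemma nr_frac_sum (I : Type) (r : seq I) (P : pred I) (F : I -> algC) :
  (forall i, P i -> nr_frac sg j0 (F i)) -> nr_frac sg j0 (\sum_(i <- r | P i) F i).
Proof.
move=> H; apply: (big_ind (nr_frac sg j0)) => //; last exact: nr_fracD.
by rewrite -(rmorph0 (sg j0)); exact: nr_frac_alg.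
Qed.

End PadicNorm.

(** * Reduction of lattices over the Gaussian integers *)

(** The order generated by [kp] times the imaginary unit; [kp] will be such that this multiple comes
    from the number ring. *)
Definition gauss (kp : nat) (q : algC) := exists a b : int, q = a%:~R + 'i * (kp%:R * b%:~R).

Lemma gauss_round kp (x : algC) : (0 < kp)%N -> exists2 q, gauss kp q & `|x - q| <= kp.+1%:R.
Proof.
move=> kp0; have k0 : kp%:R != 0 :> algC by rewrite pnatr_eq0 -lt0n.
pose y := 'Im x / kp%:R.
exists ((Num.floor ('Re x))%:~R + 'i * (kp%:R * (Num.floor y)%:~R)).
  by exists (Num.floor ('Re x)), (Num.floor y).
have E : x - ((Num.floor ('Re x))%:~R + 'i * (kp%:R * (Num.floor y)%:~R)) =
   ('Re x - (Num.floor ('Re x))%:~R) + 'i * (kp%:R * (y - (Num.floor y)%:~R)).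
  by rewrite {1}[x]Crect !mulrBr [kp%:R * y]mulrC divfK // addrACA opprD.
rewrite E; apply: le_trans (ler_normD _ _) _; rewrite !normrM normCi mul1r normr_nat.
have H (r : algC) : r \is Num.real -> `|r - (Num.floor r)%:~R| <= 1.
  move=> Rr; have /andP[H1 H2] := real_floor_itv Rr.
  rewrite ger0_norm ?subr_ge0 // lerBlDl; apply: ltW; by rewrite intrD in H2.
rewrite -natr1 addrC; apply: lerD; last by apply: H; exact: Creal_Re.
rewrite -[X in _ <= X]mulr1; apply: ler_wpM2l => //; apply: H.
by rewrite rpredM ?Creal_Im // rpredV realn.
Qed.

Lemma argmax_norm (I : finType) (f : I -> algC) (i0 : I) : exists i, forall j, `|f j| <= `|f i|.
Proof.
suff H (s : seq I) : i0 \in s -> exists i, forall j, j \in s -> `|f j| <= `|f i|.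
  by have [|i Hi] := H (enum I); rewrite ?mem_enum //; exists i => j; apply: Hi; rewrite mem_enum.
move=> _; elim: s => [|x s [i Hi]]; first by exists i0.
have [le|le] := orP (real_leVge (normr_real (f x)) (normr_real (f i))).
  by exists i => j; rewrite inE => /predU1P[->|/Hi].
by exists x => j; rewrite inE => /predU1P[->|/Hi/le_trans->].
Qed.

Section Reduction.
Variables (I : finType) (b kp : nat).
Hypotheses (b1 : (1 < b)%N) (kp0 : (0 < kp)%N).
Local Notation V := {ffun I -> algC^o}.
Variables (L : V -> Prop) (T : nat).
Hypothesis LG : forall v w q, L v -> L w -> gauss kp q -> L (v - q *: w).
Hypothesis Lge1 : forall v, L v -> v != 0 -> exists i, 1 <= `|v i|.
Hypothesis Lspan : forall f : I -> algC, (exists i, f i != 0) ->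
  exists v, [/\ L v, forall i, `|v i| < b%:R ^+ T & \sum_i f i * v i != 0].

(** The terms [1 + l * 2^l] bound a new vector minus its part along the echelon basis, the last term
    the rounding errors against the earlier vectors. *)
Fixpoint Kred l : nat := if l is l'.+1 then (1 + l' * 2 ^ l' + kp.+1 * (l'.+1) * Kred l')%N else 1%N.

Definition small (v : V) e := forall i, `|v i| < b%:R ^+ e.

Let inS (C : {set I}) (E : I -> V) (y : V) := y = \sum_(c in C) y c *: E c.

(** [C] holds the pivot coordinates, [E] is the echelon basis at these pivots of the span of the
    lattice vectors [Y], and [b^(be c)] is, up to a factor [b], the successive minimum reached when
    [c] became a pivot. As in Davenport's lemma, the box with sides [b^(be c)] is adapted to the
    lattice: the pivot coordinates of the [Y] lie in a bounded multiple of it, while by [ri_box] no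
    nonzero lattice vector of the span fits in a small multiple. [B] is the largest minimum so far,
    below which nothing leaves the span. *)
Record red_inv (l : nat) (C : {set I}) (E Y : I -> V) (be : I -> nat) (B : nat) : Prop := {
  ri_card : #|C| = l;
  ri_E : forall c c', c \in C -> c' \in C -> E c c' = (c == c')%:R;
  ri_Eb : forall c i, c \in C -> `|E c i| <= 2 ^+ l;
  ri_YL : forall c, c \in C -> L (Y c);
  ri_YS : forall c, c \in C -> inS C E (Y c);
  ri_Yb : forall c c', c \in C -> c' \in C -> `|Y c c'| <= (Kred l)%:R * b%:R ^+ be c';
  ri_YB : forall c i, c \in C -> `|Y c i| <= (Kred l)%:R * b%:R ^+ B;
  ri_gen : forall y, inS C E y -> exists x : I -> algC, y = \sum_(c in C) x c *: Y c;
  ri_box : forall z, L z -> inS C E z -> z != 0 ->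
     exists2 c, c \in C & b%:R ^+ be c <= (b * l * 2 ^ l)%:R * `|z c|;
  ri_be : forall c, c \in C -> (be c <= B <= T)%N;
  ri_wit : forall c, c \in C -> exists v, [/\ L v, v != 0 & small v (be c)];
  ri_min : forall v e, L v -> ~ inS C E v -> small v e -> (B <= e)%N }.

Let inS_lin C E y z t : inS C E y -> inS C E z -> inS C E (y + t *: z).
Proof.
move=> Hy Hz; rewrite /inS {1}Hy {1}Hz scaler_sumr -big_split /=.
by apply: eq_bigr => c _; rewrite !ffunE scalerDl scalerA.
Qed.

Let inS_E (C : {set I}) (E : I -> V) (x : I -> algC) : (forall c c', c \in C -> c' \in C -> E c c' = (c == c')%:R) ->
  inS C E (\sum_(c in C) x c *: E c).
Proof.
move=> HE; apply: eq_bigr => c cC; congr (_ *: _).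
rewrite sum_ffunE (bigD1 c) //= big1 ?addr0 => [|c' /andP[c'C ne]].
  by rewrite !ffunE HE // eqxx /GRing.scale /= mulr1.
by rewrite !ffunE HE // (negPf ne) /GRing.scale /= mulr0.
Qed.

Lemma red_step l C E Y be B : red_inv l C E Y be B -> (l < #|I|)%N ->
  exists C' E' Y' be' B', red_inv l.+1 C' E' Y' be' B'.
Proof.
move=> R lI; have [Ccard HE HEb HYL HYS HYb HYB Hgen Hbox Hbe Hwit Hmin] := R.
have [c0 c0C] : exists c0, c0 \notin C.
  apply: NNPP => H; move: lI; rewrite -Ccard ltnNge => /negP; apply.
  by apply: subset_leq_card; apply/subsetP => c _; apply: contra_notT H => Hc; exists c.
have [v0 [Lv0 v0T v0S]] : exists v, [/\ L v, small v T & ~ inS C E v].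
  (* This linear form vanishes on the span of [E] and is nonzero at [c0], so [Lspan] provides a
     lattice vector outside the span. *)
  pose f i : algC := if i == c0 then 1 else if i \in C then - E i c0 else 0.
  have [|v [Lv vT Hv]] := Lspan (f:=f).
    by exists c0; rewrite /f eqxx oner_eq0.
  exists v; split=> // HS; move/eqP: Hv; apply.
  rewrite (bigD1 c0) //= {1}/f eqxx mul1r {1}HS sum_ffunE [X in _ + X](bigID (fun i => i \in C)) /=.
  rewrite [X in _ + (_ + X)]big1 ?addr0 => [|i /andP[ne iC]]; last first.
    by rewrite /f (negPf ne) (negPf iC) mul0r.
  rewrite [X in _ + X](eq_big (fun i => i \in C) (fun i => - (v i *: E i) c0)).
  - by rewrite sumrN subrr.
  - by move=> i; case iC : (i \in C); rewrite ?andbF // andbT; apply: contraNneq c0C => <-.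
  move=> i /andP[ne iC]; rewrite /f (negPf ne) iC !ffunE /GRing.scale /=; ring.
pose P e := boolp.asbool (exists v, [/\ L v, small v e & ~ inS C E v]).
have exP : exists e, P e by exists T; apply/boolp.asboolP; exists v0.
pose B' := ex_minn exP.
have [/boolp.asboolP [v [Lv vB' vS]] B'min] : P B' /\ forall e, P e -> (B' <= e)%N.
  by rewrite /B'; case: ex_minnP.
have B'T : (B' <= T)%N by apply: B'min; apply/boolp.asboolP; exists v0.
have BB' : (B <= B')%N by apply: Hmin vB'.
(* Removing the part along [E] makes the vector vanish at the old pivots. The new pivot is a
   coordinate of largest modulus, so [En] is bounded by 1 and the bound on [E] at most doubles. *)
pose w := v - \sum_(c in C) v c *: E c.
have wC c : c \in C -> w c = 0.
  move=> cC; rewrite !ffunE sum_ffunE (bigD1 c) //= big1 ?addr0 => [|c' /andP[c'C ne]].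
    by rewrite !ffunE HE // eqxx /GRing.scale /= mulr1 subrr.
  by rewrite !ffunE HE // (negPf ne) /GRing.scale /= mulr0.
have [cn Hcn] := argmax_norm w c0.
have wcn : w cn != 0.
  apply/eqP => H; apply: vS; apply/eqP; rewrite -subr_eq0; apply/eqP/ffunP => i.
  rewrite [RHS]ffunE; apply/eqP; rewrite -normr_le0; apply: le_trans (Hcn i) _.
  by rewrite H normr0.
have cnC : cn \notin C by apply: contra wcn => /wC ->.
have cC_ne c : c \in C -> (c == cn) = false.
  by move=> cC; apply/negbTE; apply: contraNneq cnC => <-.
pose En := (w cn)^-1 *: w.
have Enb i : `|En i| <= 1.
  by rewrite ffunE normrM normfV mulrC ler_pdivrMr ?normr_gt0 // mul1r.
have Encn : En cn = 1 by rewrite ffunE /GRing.scale /= mulVf.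
have EnC c : c \in C -> En c = 0 by move=> cC; rewrite ffunE (wC _ cC) scaler0.
have Enw : w cn *: En = w by rewrite scalerA mulfV // scale1r.
have wE : w = v - \sum_(c in C) v c *: E c by [].
clearbody En; clearbody w.
pose E' c := if c == cn then En else E c - E c cn *: En.
pose C' := cn |: C.
have E'C c : c \in C -> E' c = E c - E c cn *: En by move=> cC; rewrite /E' cC_ne.
have E'n : E' cn = En by rewrite /E' eqxx.
have C'sum (F : I -> V) : \sum_(c in C') F c = F cn + \sum_(c in C) F c by rewrite big_setU1.
have HE' c c' : c \in C' -> c' \in C' -> E' c c' = (c == c')%:R.
  rewrite !inE => /predU1P[->|cC] /predU1P[->|c'C].
  - by rewrite E'n Encn eqxx.
  - by rewrite E'n EnC // eq_sym cC_ne.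
  - by rewrite E'C // !ffunE Encn /GRing.scale /= mulr1 subrr cC_ne.
  - by rewrite E'C // !ffunE EnC // /GRing.scale /= mulr0 subr0 HE.
have S'E y : inS C' E' y <-> inS C E (y - (y cn - \sum_(c in C) y c * E c cn) *: En).
  have key : \sum_(c in C') y c *: E' c =
      (y cn - \sum_(c in C) y c * E c cn) *: En + \sum_(c in C) y c *: E c.
    rewrite C'sum E'n scalerBl -addrA; congr (_ + _).
    rewrite scaler_suml -sumrN -big_split /=; apply: eq_bigr => c cC.
    by rewrite E'C // scalerBr scalerA addrC.
  have key2 t : \sum_(c in C) (y - t *: En) c *: E c = \sum_(c in C) y c *: E c.
    by apply: eq_bigr => c cC; rewrite !ffunE EnC // /GRing.scale /= mulr0 subr0.
  rewrite /inS key2 key; split=> H; first by rewrite [X in X - _]H addrC addKr.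
  by rewrite -H addrC subrK.
have SC y : inS C E y -> inS C' E' y.
  move=> Hy; apply/S'E; have -> : y cn = \sum_(c in C) y c * E c cn.
    by rewrite {1}Hy sum_ffunE; apply: eq_bigr => c _; rewrite ffunE.
  by rewrite subrr scale0r subr0.
have En_S' : inS C' E' En.
  apply/S'E; rewrite big1 => [|c cC]; last by rewrite EnC // mul0r.
  rewrite subr0 Encn scale1r subrr /inS big1 // => c _; by rewrite ffunE scale0r.
have vS' : inS C' E' v.
  have -> : v = \sum_(c in C) v c *: E c + w cn *: En by rewrite Enw wE addrC subrK.
  by apply: inS_lin => //; apply: SC; exact: inS_E.
have HYS' c : c \in C -> inS C' E' (Y c) by move=> cC; apply: SC; exact: HYS.
have [x Hx] := Hgen _ (inS_E v HE).
(* Rounding the coordinates keeps [Yn] in the lattice; besides the part along [En], only bounded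
   multiples of the earlier [Y c] are left. *)
have [q Hq] := fun_choice (fun c => let: ex_intro2 q g n := gauss_round (x c) kp0 in ex_intro _ q (conj g n)).
pose Yn := v - \sum_(c in C) q c *: Y c.
have YnE : Yn = w cn *: En + \sum_(c in C) (x c - q c) *: Y c.
  rewrite Enw wE Hx /Yn -addrA; congr (_ + _).
  by rewrite -sumrN -sumrN -big_split /=; apply: eq_bigr => c _; rewrite scalerBl addKr.
have LYn : L Yn /\ inS C' E' Yn.
  rewrite /Yn -big_enum; have : {subset enum C <= C} by move=> c; rewrite mem_enum.
  elim: (enum C) => [|c s IH] sC; first by rewrite big_nil subr0.
  have [|L1 S1] := IH; first by move=> c' H; apply: sC; rewrite inE H orbT.
  have cC : c \in C by apply: sC; rewrite inE eqxx.
  have -> : v - \sum_(i <- c :: s) q i *: Y i = (v - \sum_(i <- s) q i *: Y i) - q c *: Y c.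
    by rewrite big_cons opprD addrCA addrC.
  split.
    by apply: LG => //; [exact: HYL | have [] := Hq c].
  by rewrite -scaleNr; apply: inS_lin => //; exact: HYS'.
have [Ln YnS] := LYn.
have K1 : (Kred l <= Kred l.+1)%N by rewrite /=; lia.
have bpos e : 0 <= b%:R ^+ e :> algC by rewrite exprn_ge0.
have bmono e e' : (e <= e')%N -> b%:R ^+ e <= b%:R ^+ e' :> algC.
  by move=> le; apply: ler_weXn2l => //; rewrite -[1]/(1%:R) ler_nat ltnW.
have sumY c' F : (forall c, c \in C -> `|Y c c'| <= F) ->
    `|\sum_(c in C) ((x c - q c) *: Y c) c'| <= (kp.+1 * l)%:R * F.
  move=> HF; apply: le_trans (ler_norm_sum _ _ _) _.
  rewrite mulnC natrM -mulrA -[l]Ccard mulr_natl -sumr_const; apply: ler_sum => c cC.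
  rewrite ffunE normrM; apply: ler_pM => //; [by have [] := Hq c | exact: HF].
have YnC c' : c' \in C -> `|Yn c'| <= (Kred l.+1)%:R * b%:R ^+ be c'.
  move=> c'C; rewrite YnE ffunE sum_ffunE [X in X + _]ffunE (EnC _ c'C) scaler0 add0r.
  apply: le_trans (sumY _ ((Kred l)%:R * b%:R ^+ be c') _) _; first by move=> c cC; exact: HYb.
  rewrite mulrA -natrM; apply: ler_wpM2r => //; rewrite ler_nat /=; nia.
have YnB i : `|Yn i| <= (Kred l.+1)%:R * b%:R ^+ B'.
  rewrite YnE ffunE sum_ffunE; apply: le_trans (ler_normD _ _) _.
  have -> : (Kred l.+1)%:R * b%:R ^+ B' = (1 + l * 2 ^ l)%:R * b%:R ^+ B' +
      (kp.+1 * l.+1 * Kred l)%:R * b%:R ^+ B' :> algC by rewrite -mulrDl -natrD.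
  apply: lerD; last first.
    apply: le_trans (sumY _ ((Kred l)%:R * b%:R ^+ B') _) _.
      move=> c cC; apply: le_trans (HYB c i cC) _; apply: ler_wpM2l; [exact: ler0n | exact: bmono].
    rewrite mulrA -natrM; apply: ler_wpM2r => //; rewrite ler_nat; nia.
  rewrite Enw wE !ffunE sum_ffunE natrD mulrDl mul1r; apply: le_trans (ler_normB _ _) _.
  apply: lerD; first exact: ltW (vB' i).
  apply: le_trans (ler_norm_sum _ _ _) _.
  rewrite mulnC natrM -mulrA mulrC -mulrA mulr_natl -Ccard -sumr_const mulrC natrX.
  apply: ler_sum => c cC; rewrite ffunE normrM mulrC; apply: ler_pM => //; first exact: ltW (vB' c).
  by apply: le_trans (HEb c i cC) _; rewrite Ccard.
have Ycn c i : c \in C -> `|Y c i| <= (Kred l.+1)%:R * b%:R ^+ B'.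
  move=> cC; apply: le_trans (HYB c i cC) _; apply: ler_pM; rewrite ?ler0n ?ler_nat //; exact: bmono.
pose Y' c := if c == cn then Yn else Y c.
pose be' c := if c == cn then B' else be c.
have Y'C c : c \in C -> Y' c = Y c by move=> cC; rewrite /Y' cC_ne.
have be'C c : c \in C -> be' c = be c by move=> cC; rewrite /be' cC_ne.
have Y'n : Y' cn = Yn by rewrite /Y' eqxx.
have be'n : be' cn = B' by rewrite /be' eqxx.
exists C', E', Y', be', B'; split.
- by rewrite cardsU1 cnC Ccard.
- exact: HE'.
- move=> c i; rewrite !inE => /predU1P[->|cC].
    rewrite E'n; apply: le_trans (Enb i) _; by rewrite -natrX ler1n expn_gt0.
  rewrite E'C // !ffunE; apply: le_trans (ler_normB _ _) _; rewrite exprS mulrDl mul1r.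
  apply: lerD; first exact: HEb.
  rewrite normrM -[X in _ <= X]mulr1; apply: ler_pM => //; exact: HEb.
- by move=> c; rewrite !inE => /predU1P[->|cC]; [rewrite Y'n | rewrite Y'C //; exact: HYL].
- by move=> c; rewrite !inE => /predU1P[->|cC]; [rewrite Y'n | rewrite Y'C //; exact: HYS'].
- move=> c c'; rewrite !inE => /predU1P[->|cC] /predU1P[->|c'C]; rewrite ?Y'n ?be'n.
  + exact: YnB.
  + by rewrite be'C //; exact: YnC.
  + by rewrite Y'C //; exact: Ycn.
  rewrite Y'C // be'C //; apply: le_trans (HYb c c' cC c'C) _.
  by apply: ler_wpM2r => //; rewrite ler_nat.
- by move=> c i; rewrite !inE => /predU1P[->|cC]; [rewrite Y'n; exact: YnB | rewrite Y'C //; exact: Ycn].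
- move=> y /S'E /Hgen [z Hz].
  set t := (y cn - _) in Hz; pose t' := t / w cn.
  have Ey : y = t' *: Yn + \sum_(c in C) (z c - t' * (x c - q c)) *: Y c.
    rewrite YnE scalerDr scalerA divfK // -addrA.
    have -> : t' *: (\sum_(c in C) (x c - q c) *: Y c) +
       \sum_(c in C) (z c - t' * (x c - q c)) *: Y c = \sum_(c in C) z c *: Y c.
      rewrite scaler_sumr -big_split /=; apply: eq_bigr => c _.
      by rewrite scalerA -scalerDl addrC subrK.
    by rewrite -Hz addrC subrK.
  exists (fun c => if c == cn then t' else z c - t' * (x c - q c)).
  rewrite C'sum eqxx Y'n [LHS]Ey; congr (_ + _); apply: eq_bigr => c cC.
  by rewrite cC_ne // Y'C.
- move=> z Lz zS' z0; have [zS|zS] := classic (inS C E z).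
    have [c cC Hc] := Hbox z Lz zS z0; exists c; first by rewrite !inE cC orbT.
    rewrite be'C //; apply: le_trans Hc _; apply: ler_wpM2r => //; rewrite ler_nat expnS; nia.
  apply: NNPP => Hno.
  have Hlt c : c \in C' -> (b * l.+1 * 2 ^ l.+1)%:R * `|z c| < b%:R ^+ be' c.
    move=> cC'; rewrite real_ltNge ?realM ?realX ?normr_real ?realn //.
    by apply/negP => H; apply: Hno; exists c.
  (* With all pivot coordinates small, the bound on the echelon basis makes every coordinate of [z]
     smaller than [b^(B'-1)], against the minimality of [B']. *)
  have zb i : b%:R * `|z i| < b%:R ^+ B'.
    have {1}-> : z = \sum_(c in C') z c *: E' c by [].
    have cl0 : 0 < (l.+1 * 2 ^ l.+1)%:R :> algC by rewrite ltr0n muln_gt0 /= expn_gt0.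
    rewrite -(ltr_pM2l cl0) mulrA -natrM.
    apply: le_lt_trans (_ : _ <= \sum_(c in C') (b * l.+1 * 2 ^ l.+1)%:R * `|z c| * 2 ^+ l.+1) _.
      rewrite sum_ffunE mulnC mulnA -mulr_suml -mulr_sumr -mulrA; apply: ler_wpM2l => //.
      apply: le_trans (ler_norm_sum _ _ _) _; rewrite mulr_suml; apply: ler_sum => c cC'.
      rewrite ffunE normrM; apply: ler_wpM2l => //.
      have : `|E' c i| <= 2 ^+ l.+1.
        move: cC'; rewrite !inE => /predU1P[->|cC].
          rewrite E'n; apply: le_trans (Enb i) _; by rewrite -natrX ler1n expn_gt0.
        rewrite E'C // !ffunE; apply: le_trans (ler_normB _ _) _; rewrite exprS mulrDl mul1r.
        apply: lerD; first exact: HEb.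
        rewrite normrM -[X in _ <= X]mulr1; apply: ler_pM => //; exact: HEb.
      by [].
    have -> : (l.+1 * 2 ^ l.+1)%:R * b%:R ^+ B' = \sum_(c in C') b%:R ^+ B' * 2 ^+ l.+1 :> algC.
      rewrite sumr_const cardsU1 cnC Ccard add1n -mulr_natl natrM natrX; ring.
    apply: ltr_sum; first by apply/hasP; exists cn; rewrite ?mem_index_enum ?inE ?eqxx.
    move=> c cC'; rewrite ltr_pM2r ?exprn_gt0 ?ltr0n //; apply: lt_le_trans (Hlt c cC') _.
    move: cC'; rewrite !inE => /predU1P[->|cC]; rewrite ?be'n // be'C //; apply: bmono.
    by have /andP[H _] := Hbe c cC; exact: leq_trans H BB'.
  have B'0 : (0 < B')%N.
    rewrite lt0n; apply/eqP => B'0; have [i Hi] := Lge1 Lz z0.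
    have := zb i; rewrite B'0 expr0 => H.
    have : b%:R * `|z i| < `|z i| by apply: lt_le_trans H Hi.
    rewrite -subr_gt0 -{1}[`|z i|]mul1r -mulrBl pmulr_lgt0; last exact: lt_le_trans ltr01 Hi.
    by rewrite subr_gt0 -[1]/(1%:R) ltr_nat ltnNge ltnW.
  have : (B' <= B'.-1)%N; last by rewrite leqNgt prednK // leqnn.
  apply: B'min; apply/boolp.asboolP; exists z; split=> // i.
  have b0 : 0 < b%:R :> algC by rewrite ltr0n ltnW.
  by rewrite -(ltr_pM2l b0) -exprS prednK.
- move=> c; rewrite !inE => /predU1P[->|cC]; first by rewrite be'n leqnn.
  by rewrite be'C //; have /andP[H _] := Hbe c cC; rewrite (leq_trans H BB').
- move=> c; rewrite !inE => /predU1P[->|cC]; last by rewrite be'C //; exact: Hwit.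
  rewrite be'n; exists v; split=> //; apply: contra_notN vS => /eqP ->.
  by rewrite /inS big1 // => c' _; rewrite ffunE scale0r.
move=> u e Lu uS' ue; apply: B'min; apply/boolp.asboolP; exists u; split=> // uS; apply: uS'; exact: SC.
Qed.

(** The fourth clause ties each side of the box to a nonzero lattice vector in the cube with that
    side: this is how the absence of small relations becomes a lower bound for [be]. The last
    clause, combined with a box principle, bounds the sum of the [be] from above. *)
Lemma lattice_reduction : exists (be : I -> nat) (Y : I -> V),
  [/\ forall c, L (Y c), forall c i, `|Y c i| <= (Kred #|I|)%:R * b%:R ^+ be i,
      forall y, exists x : I -> algC, y = \sum_c x c *: Y c,
      forall c, (be c <= T)%N /\ exists v, [/\ L v, v != 0 & small v (be c)] &
      forall z, L z -> z != 0 -> exists c, b%:R ^+ be c <= (b * #|I| * 2 ^ #|I|)%:R * `|z c|].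
Proof.
have H l : (l <= #|I|)%N -> exists C E Y be B, red_inv l C E Y be B.
  elim: l => [|l IH] Hl; last first.
    by have [C [E [Y [be [B R]]]]] := IH (ltnW Hl); exact: red_step R Hl.
  exists set0, (fun=> 0), (fun=> 0), (fun=> 0%N), 0%N.
  split=> //; rewrite ?cards0 //; try (by move=> c; rewrite inE); try (by move=> c c'; rewrite inE).
  - by move=> y ->; exists (fun=> 0); rewrite !big_set0.
  - by move=> z _ ->; rewrite big_set0 eqxx.
have [C [E [Y [be [B R]]]]] := H #|I| (leqnn _).
have CT : C = setT by apply/eqP; rewrite eqEcard subsetT cardsT (ri_card R) leqnn.
have all_in c : c \in C by rewrite CT inE.
have allS y : inS C E y.
  rewrite /inS; apply/ffunP => i; rewrite sum_ffunE (bigD1 i) //= big1 ?addr0 => [|c /andP[_ ne]].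
    by rewrite !ffunE (ri_E R) // eqxx /GRing.scale /= mulr1.
  by rewrite !ffunE (ri_E R) // (negPf ne) /GRing.scale /= mulr0.
exists be, Y; split.
- by move=> c; exact: (ri_YL R).
- by move=> c i; exact: (ri_Yb R).
- move=> y; have [x ->] := ri_gen R (allS y); exists x.
  by apply: eq_bigl => c; rewrite all_in.
- move=> c; have /andP[H1 H2] := ri_be R (all_in c); split; first exact: leq_trans H1 H2.
  exact: (ri_wit R).
by move=> z Lz z0; have [c _ Hc] := ri_box R Lz (allS z) z0; exists c.
Qed.

End Reduction.

(** * The auxiliary polynomial *)

(** Box principle with coefficients in [0,u). As [#|X| * B] is at most [u], every equation takes
    values below [u^2]; with more than twice as many unknowns as equations, two choices have the
    same values. *)
Lemma siegel_pigeonhole (T U : finType) (X : {set T}) (Y : {set U}) (M : U -> T -> nat) u B :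
  (forall e a, a \in X -> (M e a <= B)%N) -> (1 < u)%N -> (#|X| * B <= u)%N -> (2 * #|Y| < #|X|)%N ->
  exists c : T -> int, [/\ exists a, c a != 0, forall a, c a != 0 -> a \in X,
    forall a, (`|c a| <= u)%N & forall e, e \in Y -> \sum_a c a * (M e a)%:Z = 0].
Proof.
move=> MB u1 uB YX; pose S1 : finType := {x | x \in X}; pose S2 : finType := {y | y \in Y}.
have u0 : (0 < u)%N by exact: ltnW.
have uu : (0 < u * u)%N by rewrite muln_gt0 u0.
pose val1 (f : {ffun S1 -> 'I_u}) a : nat := if insub a is Some x then f x else 0%N.
have val1u f a : (val1 f a < u)%N by rewrite /val1; case: insubP.
have val1X f a : a \notin X -> val1 f a = 0%N by rewrite /val1; case: insubP => // x ->.
pose sm f e := (\sum_a val1 f a * M e a)%N.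
have smu f e : (sm f e < u * u)%N.
  rewrite /sm (bigID (mem X)) /= [X in (_ + X)%N]big1 ?addn0 => [|a /val1X -> //].
  apply: leq_ltn_trans (_ : #|X| * (u.-1 * B) < _)%N.
    rewrite -sum_nat_const; apply: leq_sum => a aX; apply: leq_mul; last exact: MB.
    by rewrite -ltnS prednK.
  rewrite mulnCA; apply: leq_ltn_trans (leq_mul (leqnn _) uB) _.
  by rewrite ltn_mul2r u0 ltn_predL.
pose F (f : {ffun S1 -> 'I_u}) : {ffun S2 -> 'I_(u * u)} := [ffun y => Ordinal (smu f (val y))].
have [f [f' [ne E]]] : exists f f', f != f' /\ F f = F f'.
  apply: NNPP => no; have inj : injective F.
    move=> f f' E; apply/eqP/negPn/negP => ne; apply: no; by exists f, f'.
  have := leq_card _ inj; rewrite !card_ffun !card_ord /S1 /S2 !card_sig leqNgt => /negP; apply.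
  have -> : #|[pred x | x \in X]| = #|X| by apply: eq_card => x; rewrite !inE.
  have -> : #|[pred x | x \in Y]| = #|Y| by apply: eq_card => x; rewrite !inE.
  by rewrite -[X in (X ^ _)%N]/(u ^ 2)%N -expnM ltn_exp2l.
exists (fun a => (val1 f a)%:Z - (val1 f' a)%:Z); split.
- have [x Hx] : exists x, f x != f' x.
    apply: NNPP => no; move/eqP: ne; apply; apply/ffunP => x; apply/eqP/negPn/negP => H.
    by apply: no; exists x.
  exists (val x); rewrite subr_eq0 eqz_nat /val1.
  by rewrite valK.
- move=> a; apply: contraR => aX; by rewrite !val1X.
- move=> a; have := val1u f a; have := val1u f' a; lia.
move=> e eY; have := congr1 (fun h : {ffun S2 -> _} => val (h (Sub e eY))) E.
rewrite !ffunE /= /sm => H.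
under eq_bigr => a _ do rewrite mulrBl -!PoszM.
rewrite sumrB -![\sum_(i : T) Posz _]/(\sum_(i : T) Posz _).
by apply/eqP; rewrite subr_eq0 -!(big_morph Posz PoszD (erefl : Posz 0 = 0)) H.
Qed.

Section Auxiliary.
Variables (m d : nat) (n D : nat -> nat) (N r mu E : nat).
Hypotheses (m0 : (0 < m)%N) (N0 : (0 < N)%N) (r0 : (0 < r)%N).
Hypothesis HnD : forall h, (h < m)%N -> (n h * D h = N)%N.
Hypotheses (Hmu : (d.+1 * mu = m * N)%N) (HE : (r * E = m * N)%N).
Hypothesis Hm : (4 * (d.+1 * r ^ 2) <= m)%N.

Definition expo := {ffun 'I_m * 'I_d.+1 -> 'I_N.+1}.
Definition block_homog (a : expo) := [forall h, (\sum_i a (h, i))%N == D h].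
Definition wt (a : expo) i := (\sum_(h < m) n h * a (h, i))%N.
(** [mu] is the mean of each weight [wt a i] over the block-homogeneous exponents, [E] the tolerated
    deviation. *)
Definition typical (a : expo) := [forall i, mu - E <= wt a i <= mu + E]%N.

Let swap h i i' (a : expo) : expo :=
  [ffun k => if k.1 == h then a (h, tperm i i' k.2) else a k].

Let swapK h i i' : involutive (swap h i i').
Proof.
move=> a; apply/ffunP => -[k l]; rewrite !ffunE /=; case: eqP => [->|//].
by rewrite eqxx tpermK.
Qed.

Let swapS h i i' a : block_homog (swap h i i' a) = block_homog a.
Proof.
suff Esw k : (\sum_l swap h i i' a (k, l) = \sum_l a (k, l))%N.
  by rewrite /block_homog; apply: eq_forallb => k; rewrite Esw.
under eq_bigr do rewrite ffunE /=; have [->|//] := eqVneq k h.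
by rewrite [RHS](reindex_inj (@perm_inj _ (tperm i i'))).
Qed.

Let dev h i (a : expo) : int := d.+1%:Z * (a (h, i) : nat)%:Z - (D h)%:Z.

(** Exchanging two variables of block [h] preserves homogeneity, so the sum does not depend on the
    index used in that block; over all the indices, the deviations of one block add up to 0. *)
Let dev_cross h h' i : h != h' -> \sum_(a | block_homog a) dev h i a * dev h' i a = 0.
Proof.
move=> ne.
have eqT i' : \sum_(a | block_homog a) dev h i' a * dev h' i a = \sum_(a | block_homog a) dev h i a * dev h' i a.
  rewrite (reindex_inj (inv_inj (swapK h i i'))) /=; apply: eq_big => [a|a _]; first exact: swapS.
  rewrite /dev !ffunE /= eqxx tpermR [h' == h]eq_sym (negPf ne) //.
have : \sum_i' \sum_(a | block_homog a) dev h i' a * dev h' i a = 0.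
  rewrite exchange_big big1 // => a /forallP /(_ h) /eqP Ha.
  rewrite -mulr_suml /dev sumrB -mulr_sumr sumr_const card_ord.
  rewrite -(big_morph Posz PoszD (erefl : Posz 0 = 0)) Ha -mulr_natl; lia.
rewrite (eq_bigr _ (fun i' _ => eqT i')) sumr_const card_ord => /eqP.
by rewrite mulrn_eq0 /= => /eqP.
Qed.

Let dev_bound (h : 'I_m) i a : block_homog a -> ((n h)%:Z * dev h i a) ^+ 2 <= (d.+1%:Z * N%:Z) ^+ 2.
Proof.
move=> /forallP /(_ h) /eqP Ha; rewrite -(HnD (ltn_ord h)) -[_ ^+ 2]real_normK ?num_real //.
rewrite PoszM mulrCA lerXn2r ?nnegrE ?normr_ge0 ?mulr_ge0 // normrM [`|Posz _|]ger0_norm //.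
apply: ler_wpM2l => //; have : (a (h, i) <= D h)%N by rewrite -Ha (bigD1 i) //= leq_addr.
by rewrite /dev; move: (a _ : nat) (D h) => x y; nia.
Qed.

Let second_moment i :
  \sum_(a | block_homog a) ((d.+1 * wt a i)%:Z - (m * N)%:Z) ^+ 2 <= #|block_homog|%:Z * (m%:Z * (d.+1%:Z * N%:Z) ^+ 2).
Proof.
have E1 a : (d.+1 * wt a i)%:Z - (m * N)%:Z = \sum_(h < m) (n h)%:Z * dev h i a.
  rewrite /wt /dev PoszM (big_morph Posz PoszD (erefl : Posz 0 = 0)).
  under [in RHS]eq_bigr => h _ do rewrite mulrBr mulrCA -[(n h)%:Z * (D h)%:Z]PoszM HnD // -[(n h)%:Z * (a (h, i) : nat)%:Z]PoszM.
   by rewrite sumrB -mulr_sumr sumr_const card_ord -mulr_natl natz [Posz (m * N)]PoszM.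
under eq_bigr => a _ do rewrite E1 expr2 mulr_suml.
under eq_bigr => a _ do under eq_bigr => h _ do rewrite mulr_sumr.
rewrite exchange_big /=; under eq_bigr => h _ do rewrite exchange_big /=.
apply: le_trans (_ : _ <= \sum_(h < m) #|block_homog|%:Z * (d.+1%:Z * N%:Z) ^+ 2) _; last first.
  rewrite sumr_const card_ord -mulr_natl mulrCA natz.  by [].
apply: ler_sum => h _; rewrite (bigD1 h) //= [X in _ + X]big1 ?addr0 => [|h' ne].
  have EZ k (x : int) : Posz k * x = x *+ k by rewrite -mulr_natl natz.
  rewrite EZ -sumr_const; apply: ler_sum => a aS; rewrite -expr2.
  exact: dev_bound.
under eq_bigr => a _ do rewrite mulrACA; by rewrite -mulr_sumr dev_cross 1?eq_sym // mulr0.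
Qed.

(** Chebyshev's inequality for each of the [d.+1] weights, followed by a union bound. [Hm] brings
    the proportion down to 1/4, which leaves more than twice as many typical unknowns as atypical
    equations. *)
Lemma few_atypical : (4 * #|[set a | block_homog a && ~~ typical a]| <= #|[set a | block_homog a]|)%N.
Proof.
pose bad i := [set a | block_homog a && ~~ (mu - E <= wt a i <= mu + E)%N].
have hc : #|[set a | block_homog a]| = #|block_homog| by apply: eq_card => a; rewrite !inE.
have Hi i : (#|bad i| * m <= r ^ 2 * #|block_homog|)%N.
  have H1 : (#|bad i|%:Z * (d.+1%:Z * E%:Z) ^+ 2 <= #|block_homog|%:Z * (m%:Z * (d.+1%:Z * N%:Z) ^+ 2)).
    apply: le_trans (second_moment i).
    rewrite [X in _ <= X](bigID (fun a => a \in bad i)) /=; apply: ler_wpDr.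
      by apply: sumr_ge0 => a _; exact: sqr_ge0.
    rewrite -natz mulr_natl -sumr_const [X in _ <= X](eq_bigl (mem (bad i))) => [|a]; last first.
      by rewrite !inE; case: (block_homog a).
    apply: ler_sum => a; rewrite inE => /andP[_]; rewrite -Hmu => H.
    rewrite !PoszM -mulrBr !exprMn; apply: ler_wpM2l; first exact: sqr_ge0.
    move: H; move: (wt a i) => w; rewrite negb_and -!ltnNge => /orP[]; clear; nia.
  have H2 : (#|bad i| * E ^ 2 <= #|block_homog| * (m * N ^ 2))%N.
    by move: H1; move: (#|bad i|) (#|block_homog|) => x y; rewrite !exprMn mulrCA [X in _ <= X]mulrCA [X in _ <= X]mulrCA; nia.
  have H3 : (#|bad i| * m * (m * N ^ 2) <= r ^ 2 * #|block_homog| * (m * N ^ 2))%N.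
    have -> : (#|bad i| * m * (m * N ^ 2) = r ^ 2 * (#|bad i| * E ^ 2))%N.
      have HE2 : (r ^ 2 * E ^ 2 = m ^ 2 * N ^ 2)%N by rewrite -!expnMn HE.
      by rewrite [RHS]mulnCA HE2; ring.
    by rewrite -mulnA leq_mul2l H2 orbT.
  by move: H3; rewrite leq_pmul2r // muln_gt0 m0 expn_gt0 N0.
have Hb : (#|[set a | block_homog a && ~~ typical a]| <= \sum_i #|bad i|)%N.
  apply: leq_trans (_ : #|\bigcup_i bad i| <= _)%N; last first.
    elim/big_rec2: _ => [|i x y _ H]; first by rewrite cards0.
    by apply: leq_trans (leq_card_setU _ _) _; rewrite leq_add2l.
  apply: subset_leq_card; apply/subsetP => a; rewrite inE negb_forall => /andP[aS /existsP[i Hi']].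
  by apply/bigcupP; exists i; rewrite ?inE // aS.
have H4 : (#|[set a | block_homog a && ~~ typical a]| * m <= d.+1 * r ^ 2 * #|block_homog|)%N.
  apply: leq_trans (leq_mul Hb (leqnn _)) _; rewrite big_distrl /= -mulnA.
  rewrite -[X in (_ <= X * _)%N]card_ord -sum_nat_const; apply: leq_sum => i _; exact: Hi.
rewrite hc; move: H4; move: (#|[set a | _]|) (#|block_homog|) => x y H4.
have H5 : (d.+1 * r ^ 2 * (4 * x) <= d.+1 * r ^ 2 * y)%N.
  apply: leq_trans H4; rewrite mulnC -mulnA [(_ * m)%N]mulnC.
  apply: leq_trans (_ : x * (4 * (d.+1 * r ^ 2)) <= _)%N; first by rewrite mulnCA mulnA.
  by rewrite mulnC leq_mul2r Hm orbT.
by move: H5; rewrite leq_pmul2l // muln_gt0 /= expn_gt0 r0.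
Qed.

(** The coefficient of the expansion in the differences [b_i - b_0] inside each block. The variable
    0 is left out because homogeneity determines its exponent. *)
Definition binom_wt (a e : expo) := (\prod_(h < m) \prod_(i < d.+1 | i != ord0) 'C(a (h, i), e (h, i)))%N.

Lemma card_homog : (#|[set a | block_homog a]| <= 2 ^ (d.+1 * \sum_(h < m) D h))%N.
Proof.
apply: leq_trans (_ : #|family (fun k : 'I_m * 'I_d.+1 => [pred v : 'I_N.+1 | v <= D k.1])%N| <= _)%N.
  apply: subset_leq_card; apply/subsetP => a; rewrite inE => /forallP H; apply/familyP => -[h i].
  by rewrite inE /= -(eqP (H h)) (bigD1 i) //= leq_addr.
rewrite card_family foldrE big_map big_enum /=.
apply: leq_trans (_ : \prod_(k : 'I_m * 'I_d.+1) 2 ^ D k.1 <= _)%N.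
  apply: leq_prod => k _; apply: leq_trans (_ : (D k.1).+1 <= _)%N; last exact: ltn_expl.
  have -> : (D k.1).+1 = #|'I_(D k.1).+1| by rewrite card_ord.
  have inj : {in [pred v : 'I_N.+1 | v <= D k.1]%N &, injective (fun v : 'I_N.+1 => inord v : 'I_(D k.1).+1)}.
    by move=> v w; rewrite !inE => Hv Hw /(congr1 val); rewrite /= !inordK // => /val_inj.
  by rewrite -(card_in_image inj); exact: max_card.
rewrite -(pair_bigA _ (fun (h : 'I_m) (i : 'I_d.+1) => 2 ^ D h)%N) /=.
under eq_bigr do rewrite prod_nat_const card_ord -expnM.
by rewrite -expn_sum -big_distrl mulnC.
Qed.

(** Typical exponents carry the polynomial, which keeps it small at the archimedean places. Only
    typical exponents survive in the expansion in differences, which makes it divisible by a high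
    power of [p]. The bound on the coefficients multiplies the number of unknowns, at most
    [2^(d.+1 * SD)], by the size [2^SD] of the binomial entries. *)
Lemma auxiliary_polynomial : exists c : expo -> int,
  [/\ exists a, c a != 0, forall a, c a != 0 -> block_homog a && typical a,
      forall a, (`|c a| <= 2 ^ (d.+2 * \sum_(h < m) D h))%N &
      forall e, block_homog e -> ~~ typical e -> \sum_a c a * (binom_wt a e)%:Z = 0].
Proof.
pose SD := (\sum_(h < m) D h)%N.
have D0 h : (h < m)%N -> (0 < D h <= N)%N.
  move=> hm; have := HnD hm; case: (D h) => [|k]; first by rewrite muln0; lia.
  move=> <- /=; rewrite leq_pmull //; by have := HnD hm; case: (n h) => //; lia.
have SD0 : (0 < SD)%N by rewrite /SD (bigD1 (Ordinal m0)) //= addn_gt0; have /andP[->] := D0 0%N m0.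
pose X := [set a | block_homog a && typical a]; pose Y := [set a | block_homog a && ~~ typical a].
have XY : (#|X| + #|Y| = #|[set a | block_homog a]|)%N.
  rewrite -(cardsID [set a | typical a] [set a | block_homog a]); congr (_ + _)%N; apply: eq_card => a;
  by rewrite !inE // andbC.
have S0 : (0 < #|[set a | block_homog a]|)%N.
  apply/card_gt0P; exists [ffun k : 'I_m * 'I_d.+1 => if k.2 == ord0 then inord (D k.1) else ord0].
  rewrite inE; apply/forallP => h; rewrite (bigD1 ord0) //= big1 => [|i ne].
    by rewrite ffunE /= addn0 inordK // ltnS; have /andP[] := D0 h (ltn_ord h).
  by rewrite ffunE /= (negPf ne).
have [||||c [c0 cX cb cY]] := @siegel_pigeonhole expo expo X Y (fun e a => binom_wt a e)
    (2 ^ (d.+2 * SD)) (2 ^ SD).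
- move=> e a; rewrite inE => /andP[aS _]; rewrite /binom_wt /SD expn_sum; apply: leq_prod => h _.
  apply: leq_trans (_ : \prod_(i < d.+1 | i != ord0) 2 ^ a (h, i) <= _)%N.
    apply: leq_prod => i _; rewrite -[X in (_ <= X ^ _)%N]/(1 + 1)%N expnDn.
    have [lt|ge] := ltnP (a (h, i)) (e (h, i)); first by rewrite bin_small.
    by rewrite (bigD1 (inord (e (h, i)))) //= !exp1n !muln1 inordK ?leq_addr.
  rewrite -expn_sum leq_exp2l // -(eqP (forallP aS h)) [X in (_ <= X)%N](bigD1 ord0) //=.
  exact: leq_addl.
- by rewrite -[1%N]/(2 ^ 0)%N ltn_exp2l // muln_gt0.
- rewrite -[(d.+2)]addn1 mulnDl mul1n expnD leq_mul2r; apply/orP; right.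
  apply: leq_trans card_homog; rewrite -XY; exact: leq_addr.
- have := few_atypical; move: S0; rewrite -/Y -XY; move: (#|X|) (#|Y|) => x y.   lia.
exists c; split=> //; first by move=> a /cX; rewrite inE.
by move=> e eS et; apply: cY; rewrite inE eS.
Qed.

End Auxiliary.

(** * Taylor expansion of the auxiliary polynomial *)

(** The list may repeat monomials, so sums and products need no collection of like terms. *)
Definition coef_sum_le k (F : {mpoly algC[k]}) (B : algC) :=
  exists2 s : seq (algC * 'X_{1..k}), F = \sum_(x <- s) x.1 *: 'X_[x.2] & \sum_(x <- s) `|x.1| <= B.

Lemma coef_sum_le_coef k (F : {mpoly algC[k]}) B W : coef_sum_le F B -> `|F@_W| <= B.
Proof.
move=> [s -> sB]; rewrite raddf_sum /=; apply: le_trans sB; apply: le_trans (ler_norm_sum _ _ _) _.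
apply: ler_sum => x _; rewrite mcoeffZ mcoeffX normrM -[X in _ <= X]mulr1; apply: ler_wpM2l => //.
by case: eqP => _; rewrite ?normr1 ?normr0.
Qed.

Lemma coef_sum_leX k c i : coef_sum_le (c *: 'X_i : {mpoly algC[k]}) `|c|.
Proof. by exists [:: (c, U_(i)%MM)]; rewrite !big_seq1. Qed.

Lemma coef_sum_leC k c : coef_sum_le (c%:MP : {mpoly algC[k]}) `|c|.
Proof. by exists [:: (c, 0%MM)]; rewrite !big_seq1 // mpolyX0 -mul_mpolyC mulr1. Qed.

Lemma coef_sum_leW k (F : {mpoly algC[k]}) B B' : B <= B' -> coef_sum_le F B -> coef_sum_le F B'.
Proof. by move=> le [s E H]; exists s => //; exact: le_trans H le. Qed.

Lemma coef_sum_leD k (F G : {mpoly algC[k]}) B C :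
  coef_sum_le F B -> coef_sum_le G C -> coef_sum_le (F + G) (B + C).
Proof.
move=> [s -> sB] [t -> tC]; exists (s ++ t); first by rewrite big_cat.
by rewrite big_cat /=; apply: lerD.
Qed.

Lemma coef_sum_leM k (F G : {mpoly algC[k]}) B C :
  coef_sum_le F B -> coef_sum_le G C -> coef_sum_le (F * G) (B * C).
Proof.
move=> [s -> sB] [t -> tC]; exists [seq (x.1 * y.1, (x.2 + y.2)%MM) | x <- s, y <- t].
  rewrite big_allpairs_dep /= mulr_suml; apply: eq_bigr => x _; rewrite mulr_sumr; apply: eq_bigr => y _.
  by rewrite mpolyXD -scalerAl -scalerAr scalerA.
rewrite big_allpairs_dep /=; apply: le_trans (ler_pM _ _ sB tC); rewrite ?sumr_ge0 //.
rewrite mulr_suml; apply: ler_sum => x _; rewrite mulr_sumr; apply: ler_sum => y _.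
by rewrite normrM.
Qed.

Lemma coef_sum_le_sum k (I : Type) (r : seq I) (P : pred I) (F : I -> {mpoly algC[k]}) B :
  (forall i, P i -> coef_sum_le (F i) (B i)) ->
  coef_sum_le (\sum_(i <- r | P i) F i) (\sum_(i <- r | P i) B i).
Proof.
move=> H; apply: (big_rec2 (fun F B => coef_sum_le F B)) => [|i x y Pi]; last by apply: coef_sum_leD; apply: H.
by exists [::]; rewrite !big_nil.
Qed.

Lemma coef_sum_le_prod k (I : Type) (r : seq I) (P : pred I) (F : I -> {mpoly algC[k]}) B :
  (forall i, P i -> coef_sum_le (F i) (B i)) ->
  coef_sum_le (\prod_(i <- r | P i) F i) (\prod_(i <- r | P i) B i).
Proof.
move=> H; apply: (big_rec2 (fun F B => coef_sum_le F B)) => [|i x y Pi]; last by apply: coef_sum_leM; apply: H.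
by have := coef_sum_leC k 1; rewrite normr1.
Qed.

Lemma coef_sum_le_exp k (F : {mpoly algC[k]}) B j : coef_sum_le F B -> coef_sum_le (F ^+ j) (B ^+ j).
Proof. move=> H; elim: j => [|j IH]; last by rewrite !exprS; exact: coef_sum_leM.
by have := coef_sum_leC k 1; rewrite normr1 mpolyC1. Qed.

Section Graded.
Variables (O : algC -> Prop) (p : nat) (k : nat) (wt : 'X_{1..k} -> nat).
Hypotheses (vO : valuation_ring O) (pp : prime p).
Hypothesis wtD : forall u v, wt (u + v)%MM = (wt u + wt v)%N.

Definition graded_in K (F : {mpoly algC[k]}) := forall W, O (F@_W / p%:R ^+ (K - wt W)).

Lemma graded_inD K F G : graded_in K F -> graded_in K G -> graded_in K (F + G).
Proof. by move=> HF HG W; rewrite mcoeffD mulrDl; apply: (vrD vO). Qed.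

Lemma graded_in_sum K (I : Type) (r : seq I) (P : pred I) (F : I -> {mpoly algC[k]}) :
  (forall i, P i -> graded_in K (F i)) -> graded_in K (\sum_(i <- r | P i) F i).
Proof.
move=> H; apply: (big_ind (graded_in K)) => //; last exact: graded_inD.
by move=> W; rewrite mcoeff0 mul0r; exact: (vr0 vO).
Qed.

Lemma graded_inW K K' F : (K' <= K)%N -> graded_in K F -> graded_in K' F.
Proof. by move=> le H W; apply: vr_div_le (H W) => //; rewrite leq_sub2r. Qed.

Lemma graded_inM K K' F G : graded_in K F -> graded_in K' G -> graded_in (K + K') (F * G).
Proof.
move=> HF HG W; rewrite mcoeffM mulr_suml; apply: (vr_sum vO) => /= -[u v] /= /eqP EW.
apply: (@vr_div_le O p vO pp _ _ ((K - wt u) + (K' - wt v))); first by have := congr1 wt EW; rewrite wtD => ->; lia.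
by rewrite exprD invfM mulrACA; apply: (vrM vO).
Qed.

Lemma graded_inC c : O c -> graded_in 0 c%:MP.
Proof.
move=> Oc W; rewrite sub0n expr0 divr1 mcoeffC.
by apply: (vrM vO) => //; exact: (vr_nat vO).
Qed.

Lemma graded_in_prod (I : Type) (r : seq I) (P : pred I) (F : I -> {mpoly algC[k]}) (K : I -> nat) :
  (forall i, P i -> graded_in (K i) (F i)) ->
  graded_in (\sum_(i <- r | P i) K i) (\prod_(i <- r | P i) F i).
Proof.
move=> H; apply: (big_rec2 (fun K F => graded_in K F)) => [|i x y Pi]; last by apply: graded_inM; apply: H.
by rewrite -mpolyC1; apply: graded_inC; exact: (vr1 vO).
Qed.

Lemma graded_in_exp K F j : graded_in K F -> graded_in (j * K) (F ^+ j).
Proof.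
move=> H; elim: j => [|j IH]; last by rewrite exprS mulSn; exact: graded_inM.
rewrite expr0 mul0n -mpolyC1; apply: graded_inC; exact: (vr1 vO).
Qed.

End Graded.

Section Taylor.
Variables (m d : nat) (n D : nat -> nat) (N : nat).
Local Notation expo := (expo m d N).

Definition multiform (R : comNzRingType) (c : expo -> int) (b : 'I_m -> 'I_d.+1 -> R) : R :=
  \sum_a ((c a)%:~R : R) * \prod_h \prod_i b h i ^+ a (h, i).

Lemma multiform_morph (R S : comNzRingType) (f : {rmorphism R -> S}) c b :
  f (multiform c b) = multiform c (fun h i => f (b h i)).
Proof.
rewrite rmorph_sum; apply: eq_bigr => a _; rewrite rmorphM rmorph_int rmorph_prod; congr (_ * _).
apply: eq_bigr => h _; rewrite rmorph_prod; apply: eq_bigr => i _; exact: rmorphXn.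
Qed.

Let off0 (f : expo) h := (\sum_(i | i != ord0) f (h, i))%N.

(** Each [b h i] is expanded around [b h ord0] by the binomial theorem; homogeneity in a block then
    collects the powers of [b h ord0] into a single exponent that depends on [f] only. *)
Lemma multiform_taylor (R : comNzRingType) (c : expo -> int) (b : 'I_m -> 'I_d.+1 -> R) :
  (forall a, c a != 0 -> block_homog D a) ->
  multiform c b = \sum_(f : expo | [forall h, f (h, ord0) == ord0])
    ((\sum_a c a * (binom_wt a f)%:Z)%:~R : R) *
    \prod_h (b h ord0 ^+ (D h - off0 f h) * \prod_(i | i != ord0) (b h i - b h ord0) ^+ f (h, i)).
Proof.
have ES (F : expo -> int) : ((\sum_a F a)%:~R : R) = \sum_a ((F a)%:~R : R) by exact: rmorph_sum.
move=> cS; under [RHS]eq_bigr => f _ do rewrite ES mulr_suml.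
rewrite exchange_big /=; apply: eq_bigr => a _; have [->|ca] := eqVneq (c a) 0.
  by rewrite mulr0z mul0r big1 // => f _; rewrite mul0r.
rewrite (eq_bigr (fun f : expo => ((c a)%:~R : R) * ((binom_wt a f)%:R *
    \prod_h (b h ord0 ^+ (D h - off0 f h) * \prod_(i | i != ord0) (b h i - b h ord0) ^+ f (h, i)))));
  last by move=> f _; rewrite mulrA; congr (_ * _); exact: intrM.
rewrite -mulr_sumr; congr (_ * _).
have aS := cS a ca.
pose T (k : 'I_m * 'I_d.+1) (j : 'I_N.+1) : R := if k.2 == ord0 then (j == ord0)%:R * b k.1 ord0 ^+ a k
  else (b k.1 ord0 ^+ (a k - j) * (b k.1 k.2 - b k.1 ord0) ^+ j) *+ 'C(a k, j).
transitivity (\prod_k \sum_j T k j).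
  rewrite pair_bigA /=; apply: eq_bigr => -[h i] _; rewrite /T /=; case: eqP => [->|_].
    by rewrite -mulr_suml (bigD1 ord0) //= big1 ?addr0 ?mul1r // => j /negPf ->.
  have -> : b h i = b h ord0 + (b h i - b h ord0) by rewrite addrC subrK.
  have aN : (a (h, i) <= N)%N by rewrite -ltnS.
  rewrite exprDn (big_ord_widen N.+1 (fun j => (b h ord0 ^+ (a (h, i) - j) * (b h i - b h ord0) ^+ j) *+ 'C(a (h, i), j))) //.
  rewrite big_mkcond /= addrAC subrr add0r; apply: eq_bigr => j _; case: ifP => // /negbT; rewrite -leqNgt => lt.
  by rewrite bin_small.
rewrite bigA_distr_bigA (bigID (fun f : expo => [forall h, f (h, ord0) == ord0])) /= [X in _ + X]big1 ?addr0; last first.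
  move=> f; rewrite negb_forall => /existsP[h /negPf Hf].
  by rewrite (bigD1 (h, ord0)) //= {1}/T /= Hf mul0r mul0r.
apply: eq_bigr => f /forallP f0.
transitivity (\prod_h \prod_i T (h, i) (f (h, i))).
  by rewrite pair_bigA; apply: eq_bigr => -[h i].
rewrite /binom_wt.
rewrite natr_prod -big_split /=; apply: eq_bigr => h _.
rewrite (bigD1 ord0) //= {1}/T /= (f0 h) mul1r.
rewrite (eq_bigr (fun i => (b h ord0 ^+ (a (h, i) - f (h, i)) * (b h i - b h ord0) ^+ f (h, i)) *+
  'C(a (h, i), f (h, i)))); last by move=> i /negPf ne; rewrite /T /= ne.
have [[i /andP[i0 lt]]|no] := classic (exists i, (i != ord0) && (a (h, i) < f (h, i))%N).
  by rewrite (bigD1 i) //= [in RHS](bigD1 i) //= bin_small // mulr0n !(mul0r, mulr0).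
have le i : i != ord0 -> (f (h, i) <= a (h, i))%N.
  by move=> i0; rewrite leqNgt; apply/negP => lt; apply: no; exists i; rewrite i0.
under eq_bigr => i _ do rewrite -mulr_natl; rewrite !big_split /= prodrXr natr_prod.
rewrite mulrCA; congr (_ * _); rewrite mulrA -exprD; congr (_ ^+ _ * _).
have -> : D h = (a (h, ord0) + \sum_(i | i != ord0) a (h, i))%N.
  by rewrite -(eqP (forallP aS h)) (bigD1 ord0).
by rewrite sumnB // addnBA //; apply: leq_sum.
Qed.

End Taylor.

Lemma mpolyC_int k (z : int) : (z%:~R)%:MP = z%:~R :> {mpoly algC[k]}.
Proof.
case: z => a; first exact: mpolyC_nat.
by rewrite NegzE !mulrNz mpolyCN; congr (- _); exact: mpolyC_nat.
Qed.

(** * Divisibility and size of the auxiliary polynomial in adapted coordinates *)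

Section Evaluation.
Variables (m d : nat) (n D : nat -> nat) (N r mu E : nat).
Hypotheses (m0 : (0 < m)%N) (N0 : (0 < N)%N).
Hypothesis HnD : forall h, (h < m)%N -> (n h * D h = N)%N.
Hypothesis muE : (E <= mu)%N.
Local Notation expo := (expo m d N).
Local Notation binom_wt := (@binom_wt m d N).
Local Notation SD := (\sum_(h < m) D h)%N.

Variable c : expo -> int.
Hypothesis cS : forall a, c a != 0 -> block_homog D a && typical n mu E a.
Hypothesis cB : forall a, (`|c a| <= 2 ^ (d.+2 * SD))%N.
Hypothesis cE : forall e, block_homog D e -> ~~ typical n mu E e -> \sum_a c a * (binom_wt a e)%:Z = 0.

Lemma block_degree_le h : (h < m)%N -> (D h <= N)%N.
Proof.
move=> hm; have H := HnD hm; rewrite -H leq_pmull // lt0n; apply/eqP => H0.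
by move: N0; rewrite -H H0.
Qed.

(** Adjusting the exponent of the variable 0 makes [f] block-homogeneous without changing its Taylor
    coefficient, so [cE] forces the adjusted exponent to be typical. *)
Lemma taylor_support (f : expo) : \sum_a c a * (binom_wt a f)%:Z != 0 ->
  exists e, [/\ block_homog D e, typical n mu E e & forall h i, i != ord0 -> e (h, i) = f (h, i)].
Proof.
move=> Hf; have [a Ha] : exists a, c a * (binom_wt a f)%:Z != 0.
  by apply: NNPP => no; move/eqP: Hf; apply; apply: big1 => a _; apply/eqP/negPn/negP => H; apply: no; exists a.
move: Ha; rewrite mulf_eq0 negb_or eqz_nat -lt0n => /andP[ca bf].
have /andP[aS _] := cS ca.
have le h i : i != ord0 -> (f (h, i) <= a (h, i))%N.
  move=> i0; rewrite -bin_gt0; move: bf.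
  by rewrite /binom_wt (bigD1 h) //= (bigD1 i) //= !muln_gt0 => /andP[/andP[]].
pose off h := (\sum_(i | i != ord0) f (h, i))%N.
have offD h : (off h <= D h)%N.
  rewrite -(eqP (forallP aS h)) [X in (_ <= X)%N](bigD1 ord0) //=.
  by apply: leq_trans (leq_addl _ _); apply: leq_sum => i; exact: le.
pose e : expo := [ffun k : 'I_m * 'I_d.+1 => if k.2 == ord0 then inord (D k.1 - off k.1)%N else f k].
have ef h i : i != ord0 -> e (h, i) = f (h, i) by rewrite ffunE /= => /negPf ->.
have eS : block_homog D e.
  apply/forallP => h; rewrite (bigD1 ord0) //= (eq_bigr (fun i => f (h, i) : nat)); last by move=> i /ef ->.
  rewrite ffunE /= inordK ?subnK // ltnS; apply: leq_trans (leq_subr _ _) _; exact: block_degree_le.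
exists e; split=> //; apply/negPn/negP => /(cE eS) /eqP; apply/negP; congr (_ != 0): Hf.
apply: eq_bigr => a' _; congr (_ * Posz _); apply: eq_bigr => h _; apply: eq_bigr => i i0; by rewrite ef.
Qed.

Local Notation k := #|{: 'I_m * 'I_d.+1}|.
Definition tvar_idx (h : 'I_m) (l : 'I_d.+1) : 'I_k := enum_rank (h, l).
(** Only the variables with [l = ord0] count: they become multiples of [X_h - xi_h] in the passage
    to Roth's lemma, where this weight is the index. *)
Definition index_wt (W : 'X_{1..k}) : nat := (\sum_(h < m) n h * W (tvar_idx h ord0))%N.
Definition linear_forms (B : 'I_m -> 'I_d.+1 -> 'I_d.+1 -> algC) h i : {mpoly algC[k]} :=
  \sum_l B h i l *: 'X_(tvar_idx h l).

Lemma index_wtD u v : index_wt (u + v)%MM = (index_wt u + index_wt v)%N.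
Proof. by rewrite /index_wt -big_split; apply: eq_bigr => h _; rewrite mnmDE mulnDr. Qed.

Lemma index_wt1 (h : 'I_m) (l : 'I_d.+1) : index_wt U_(tvar_idx h l)%MM = if l == ord0 then n h else 0%N.
Proof.
rewrite /index_wt (bigD1 h) //= big1 => [|h' ne].
  by rewrite mnm1E (inj_eq enum_rank_inj) xpair_eqE eqxx addn0; case: eqP; rewrite ?muln1 ?muln0.
by rewrite mnm1E (inj_eq enum_rank_inj) xpair_eqE [h == h']eq_sym (negPf ne) muln0.
Qed.

Section Padic.
Variables (O : algC -> Prop) (p : nat).
Hypotheses (vO : valuation_ring O) (pp : prime p).

Lemma graded_in_scaled_var K b (h : 'I_m) (l : 'I_d.+1) : O (b / p%:R ^+ (K - (if l == ord0 then n h else 0%N))) ->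
  graded_in O p index_wt K (b *: 'X_(tvar_idx h l)).
Proof.
move=> Hb W; rewrite mcoeffZ mcoeffX -index_wt1 in Hb *; case: eqP => [<-|_]; rewrite ?mulr1 //.
by rewrite mulr0 mul0r; exact: (vr0 vO).
Qed.

(** A difference of two forms in block [h] is divisible by [p^(n h)] except at the variable [ord0],
    which has weight [n h]. Typical exponents give a total of at least [mu - E] for each of the [d]
    indices [i != ord0]. *)
Lemma multiform_graded (B : 'I_m -> 'I_d.+1 -> 'I_d.+1 -> algC) :
  (forall h i l, O (B h i l)) ->
  (forall (h : 'I_m) i l, l != ord0 -> O ((B h i l - B h ord0 l) / p%:R ^+ n h)) ->
  graded_in O p index_wt (d * (mu - E)) (multiform c (linear_forms B)).
Proof.
move=> OB HB; rewrite (@multiform_taylor m d D N); last by move=> a /cS /andP[].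
apply: (graded_in_sum vO) => f _.
have [->|Hf] := eqVneq (\sum_a c a * (binom_wt a f)%:Z) 0.
  rewrite mul0r => W; rewrite mcoeff0 mul0r; exact: (vr0 vO).
have [e [eS et ef]] := taylor_support Hf.
have b0 h : graded_in O p index_wt 0 (linear_forms B h ord0).
  apply: (graded_in_sum vO) => l _; apply: graded_in_scaled_var.
  by rewrite sub0n expr0 divr1.
have bd (h : 'I_m) i : graded_in O p index_wt (n h) (linear_forms B h i - linear_forms B h ord0).
  rewrite -sumrB; apply: (graded_in_sum vO) => l _; rewrite -scalerBl; apply: graded_in_scaled_var.
  case: eqP => [_|/eqP l0]; last by rewrite subn0; exact: HB.
  by rewrite subnn expr0 divr1; exact: (vrB vO).
have G1 := graded_in_prod vO pp index_wtD.
have G2 := graded_inM vO pp index_wtD.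
have G3 := graded_in_exp vO pp index_wtD.
apply: (@graded_inW O p k index_wt vO pp (0 + \sum_(h < m) (0 + \sum_(i | i != ord0) f (h, i) * n h))%N); last first.
  apply: (G2); first by rewrite -mpolyC_int; apply: graded_inC => //; exact: (vr_intr vO).
  apply: (G1) => h _; apply: (G2); first by have := G3 _ _ (D h - \sum_(i | i != ord0) f (h, i))%N (b0 h); rewrite muln0.
  by apply: (G1) => i _; apply: (G3); exact: bd.
rewrite add0n (eq_bigr (fun h : 'I_m => \sum_(i | i != ord0) n h * e (h, i))%N); last first.
  by move=> h _; rewrite add0n; apply: eq_bigr => i i0; rewrite mulnC ef.
rewrite exchange_big /= -[X in (X * _)%N](_ : #|[pred i : 'I_d.+1 | i != ord0]| = d); last first.
  by rewrite (cardC1 ord0) card_ord.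
rewrite -sum_nat_const; apply: leq_sum => i _; by have /andP[] := forallP et i.
Qed.

End Padic.

Section Archimedean.
Variables (GG : 'I_d.+1 -> algC) (Q : algC) (CG : nat) (B : 'I_m -> 'I_d.+1 -> 'I_d.+1 -> algC).
Variables (w : algC) (x : 'I_d.+1 -> nat).
Hypotheses (GB : forall i, `|GG i| <= 2 ^+ CG) (QB : `|Q| <= 2 ^+ CG) (w1 : 1 <= w).
Hypothesis BB : forall (h : 'I_m) i l, `|B h i l| <= w ^+ (x i * n h).

(** The forms have powers of [gam i] as denominators. Since every weight is within [E] of [mu], one
    common factor clears them, and only exponents at most [2 * E] of [GG] and [Q] remain: the cost
    is proportional to [E] and not to [mu]. *)
Definition scaled_multiform := \sum_(a : expo)
  ((c a)%:~R * \prod_i (GG i ^+ (mu + E - wt n a i) * Q ^+ (wt n a i - (mu - E))))%:MP *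
  \prod_h \prod_i linear_forms B h i ^+ a (h, i).

Lemma scaled_multiform_bound : coef_sum_le scaled_multiform
  (2 ^+ ((3 * d + 4) * SD + 2 * CG * E * d.+1) * w ^+ ((\sum_i x i) * (mu + E))).
Proof.
have w0 : 0 <= w by exact: le_trans ler01 w1.
have ge0_2 e : 0 <= 2 ^+ e :> algC by rewrite exprn_ge0.
pose C0 := 2 ^+ (d.+2 * SD + 2 * CG * E * d.+1) * (2 ^+ (d.+1 * SD) * w ^+ ((\sum_i x i) * (mu + E))).
have C00 : 0 <= C0 by rewrite /C0 !mulr_ge0 ?exprn_ge0.
apply: (@coef_sum_leW _ _ (\sum_(a : expo) (if block_homog D a then C0 else 0))).
  rewrite -big_mkcond sumr_const -[X in X <= _]mulr_natl.
  rewrite [X in _ <= X](_ : _ = 2 ^+ (d.+1 * SD) * C0); last first.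
    rewrite /C0 !mulrA -2!exprD; congr (_ * _); congr (_ ^+ _); move: SD => S; ring.
  apply: ler_wpM2r => //; rewrite -natrX ler_nat; apply: leq_trans (@card_homog m d D N).
  by apply: subset_leq_card; apply/subsetP => a; rewrite !inE.
apply: coef_sum_le_sum => a _; have [ca|ca] := eqVneq (c a) 0.
  rewrite ca mulr0z mul0r mpolyC0 mul0r; exists [::]; rewrite !big_nil //; by case: ifP.
have /andP[aS /forallP at_] := cS ca; rewrite aS.
have wtE i : (mu - E <= wt n a i <= mu + E)%N by exact: at_.
apply: coef_sum_leM.
  apply: coef_sum_leW (coef_sum_leC _ _); rewrite normrM exprD; apply: ler_pM => //.
    by rewrite -intr_norm -natrX -[_%:R]/((Posz _)%:~R) ler_int -abszE lez_nat; exact: cB.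
  rewrite normr_prod [(2 * CG * E * d.+1)%N]mulnC mulnC exprM -[X in _ ^+ X]card_ord -prodr_const.
  apply: ler_prod => i _; rewrite normr_ge0 normrM !normrX.
  have -> : 2 ^+ (2 * CG * E) = (2 ^+ CG) ^+ (mu + E - wt n a i) * (2 ^+ CG) ^+ (wt n a i - (mu - E)) :> algC.
    rewrite -!exprM -exprD -mulnDr; congr (_ ^+ _); have /andP[] := wtE i; move: (wt n a i) => v ? ?.
    have -> : (mu + E - v + (v - (mu - E)) = 2 * E)%N by lia.
    by ring.
  by apply: ler_pM; rewrite ?exprn_ge0 // lerXn2r ?nnegrE.
apply: (@coef_sum_leW _ _ (\prod_(h < m) \prod_(i < d.+1) (2 ^+ d.+1 * w ^+ (x i * n h)) ^+ a (h, i))); last first.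
  apply: coef_sum_le_prod => h _; apply: coef_sum_le_prod => i _; apply: coef_sum_le_exp.
  apply: (@coef_sum_leW _ _ (\sum_(l < d.+1) `|B h i l|)); last first.
    by apply: coef_sum_le_sum => l _; exact: coef_sum_leX.
  apply: le_trans (_ : _ <= \sum_(l < d.+1) w ^+ (x i * n h)) _; first by apply: ler_sum => l _.
  rewrite sumr_const card_ord -[X in X <= _]mulr_natl; apply: ler_wpM2r; first by rewrite exprn_ge0.
  by rewrite -natrX ler_nat ltnW // ltn_expl.
rewrite (eq_bigr (fun h : 'I_m => 2 ^+ (d.+1 * D h) * \prod_(i < d.+1) w ^+ (x i * n h * a (h, i)))).
  rewrite big_split /= prodrXr -big_distrr /=; apply: ler_wpM2l => //.
  rewrite exchange_big /= (eq_bigr (fun i => w ^+ (x i * wt n a i))).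
    rewrite prodrXr; apply: ler_weXn2l => //; rewrite big_distrl /=; apply: leq_sum => i _.
    by rewrite leq_mul2l; have /andP[_ ->] := wtE i; rewrite orbT.
  move=> i _; rewrite prodrXr /wt big_distrr /=; congr (_ ^+ _); apply: eq_bigr => h _; by rewrite mulnA.
move=> h _; rewrite -(eqP (forallP aS h)) big_distrr /= -prodrXr -big_split /=; apply: eq_bigr => i _.
by rewrite exprMn -!exprM.
Qed.

End Archimedean.
Section CoefficientVanishes.
Variables (A : comNzRingType) (g : nat) (sg : 'I_g -> {rmorphism A -> algC}) (om : 'I_g -> A).
Hypothesis nrA : number_ring sg om.
Variables (O : algC -> Prop) (p : nat) (j0 : 'I_g) (s t : nat).
Hypotheses (vO : valuation_ring O) (pp : prime p).
Hypothesis Hnorm : forall a K, sg j0 a != 0 -> O (sg j0 a / p%:R ^+ K) ->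
    p%:R ^+ (s * (K - t)) <= \prod_j `|sg j a|.
Variables (gam : 'I_d.+1 -> algC) (G : 'I_d.+1 -> A) (Q CG q2 : nat) (w : algC).
Hypotheses (Q0 : (0 < Q)%N) (HG : forall i, sg j0 (G i) = Q%:R * gam i).
Hypotheses (Ogam : forall i, O (gam i)) (Ogam' : forall i, O (gam i)^-1) (gam0 : forall i, gam i != 0).
Hypotheses (GB : forall i j, `|sg j (G i)| <= 2 ^+ CG) (QB : (Q <= 2 ^ CG)%N).
Hypotheses (w1 : 1 <= w) (wq : w ^+ q2 = p%:R).
Variables (be : 'I_m -> 'I_d.+1 -> 'I_d.+1 -> A) (x : 'I_d.+1 -> 'I_g -> nat).
Hypothesis beB : forall (h : 'I_m) i l j, `|sg j (be h i l)| <= w ^+ (x i j * n h).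
Hypothesis beO : forall (h : 'I_m) i i' l, l != ord0 ->
  O ((sg j0 (be h i l) * gam i' ^+ n h - sg j0 (be h i' l) * gam i ^+ n h) / p%:R ^+ n h).

Let B (h : 'I_m) i l := (gam i)^-1 ^+ n h * sg j0 (be h i l).

(** A nonzero coefficient would be, up to the fixed factor [C], the image of an element [xA] of the
    ring. Divisibility by a power of [p] bounds its norm from below, the size of the polynomial at
    all embeddings bounds it from above; the two are compared after raising to the power [q2], since
    [w^q2 = p]. *)
Lemma small_index_coef_zero I W :
  (((3 * d + 4) * SD + 2 * CG * E * d.+1) * g * q2 + (\sum_j \sum_i x i j) * (mu + E) <
    s * q2 * (d * (mu - E) - I - t))%N -> (index_wt W < I)%N ->
  (multiform c (linear_forms B))@_W = 0.
Proof.
set u := ((3 * d + 4) * SD + 2 * CG * E * d.+1)%N => Hnum HW.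
(* The polynomial is built over the ring itself, so that all conjugates of a coefficient are
   available at once. *)
pose FA : {mpoly A[k]} := \sum_(a : expo)
  ((c a)%:~R * \prod_i (G i ^+ (mu + E - wt n a i) * Q%:R ^+ (wt n a i - (mu - E))))%:MP *
  \prod_h \prod_i (\sum_l (be h i l)%:MP * 'X_(tvar_idx h l)) ^+ a (h, i).
have FAj j : map_mpoly (sg j) FA = scaled_multiform (fun i => sg j (G i)) Q%:R (fun h i l => sg j (be h i l)).
  rewrite rmorph_sum; apply: eq_bigr => a _; rewrite rmorphM /= map_mpolyC rmorph_prod; congr (_ * _).
    congr (mpolyC _ _); etransitivity; first exact: (rmorphM (sg j)).
    rewrite rmorph_int rmorph_prod; congr (_ * _).
    by apply: eq_bigr => i _; rewrite rmorphM !rmorphXn /= rmorph_nat.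
  apply: eq_bigr => h _; rewrite rmorph_prod; apply: eq_bigr => i _; rewrite rmorphXn; congr (_ ^+ _).
  rewrite rmorph_sum; apply: eq_bigr => l _; by rewrite rmorphM /= map_mpolyC map_mpolyX mul_mpolyC.
pose C := Q%:R ^+ (2 * E * d.+1) * \prod_i gam i ^+ (mu + E).
have C0 : C != 0.
  rewrite mulf_neq0 ?expf_neq0 ?pnatr_eq0 -?lt0n //; by apply/prodf_neq0 => i _; exact: expf_neq0.
have F0 : scaled_multiform (fun i => sg j0 (G i)) Q%:R (fun h i l => sg j0 (be h i l)) =
    C%:MP * multiform c (linear_forms B).
  rewrite /multiform mulr_sumr; apply: eq_bigr => a _; have [->|ca] := eqVneq (c a) 0.
    by rewrite !(mulr0z, mul0r, mpolyC0, mulr0).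
  have /andP[aS /forallP at_] := cS ca.
  have lf h i : linear_forms B h i = ((gam i)^-1 ^+ n h)%:MP * linear_forms (fun h i l => sg j0 (be h i l)) h i.
    by rewrite mulr_sumr; apply: eq_bigr => l _; rewrite mul_mpolyC scalerA.
  have -> : \prod_h \prod_i linear_forms B h i ^+ a (h, i) = (\prod_i (gam i)^-1 ^+ wt n a i)%:MP *
      \prod_h \prod_i linear_forms (fun h i l => sg j0 (be h i l)) h i ^+ a (h, i).
    under eq_bigr => h _ do under eq_bigr => i _ do rewrite lf exprMn.
    under eq_bigr => h _ do rewrite big_split /=.
    rewrite big_split /=; congr (_ * _); rewrite exchange_big /= rmorph_prod; apply: eq_bigr => i _.
    rewrite /wt -prodrXr rmorph_prod; apply: eq_bigr => h _; by rewrite -rmorphXn /= exprM.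
  rewrite mulrA mulrA; congr (_ * _).
  rewrite -mpolyC_int -!rmorphM /=; apply: (congr1 (@mpolyC _ _)).
  rewrite [RHS]mulrAC mulrC; congr (_ * _); rewrite /C -mulrA -big_split /=.
  rewrite [(2 * E * d.+1)%N]mulnC mulnC exprM -[X in _ ^+ X](card_ord d.+1) -prodr_const -big_split /=; apply: eq_bigr => i _.
  rewrite HG exprMn; have /andP[] := at_ i; move: (wt n a i) => v v1 v2.
  have -> : Q%:R ^+ (2 * E) = Q%:R ^+ (mu + E - v) * Q%:R ^+ (v - (mu - E)) :> algC.
    by rewrite -exprD; congr (_ ^+ _); lia.
  have -> : gam i ^+ (mu + E) * (gam i)^-1 ^+ v = gam i ^+ (mu + E - v).
    by rewrite -{1}(subnK v2) exprD exprVn mulfK ?expf_neq0.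
  by rewrite mulrAC.
apply/eqP/negPn/negP => H0; pose xA := FA@_W.
have xAE j : sg j xA = (scaled_multiform (fun i => sg j (G i)) Q%:R (fun h i l => sg j (be h i l)))@_W.
  by rewrite -FAj mcoeff_map_mpoly.
have xA0 : sg j0 xA != 0 by rewrite xAE F0 mcoeffCM mulf_neq0.
have OC : O C.
  apply: (vrM vO); first by apply: (vrX vO); exact: (vr_nat vO).
  by apply: (vr_prod vO) => i _; exact: (vrX vO).
have Hgr : O (sg j0 xA / p%:R ^+ (d * (mu - E) - index_wt W)).
  rewrite xAE F0 mcoeffCM -mulrA; apply: (vrM vO) => //; apply: (multiform_graded vO pp).
    move=> h i l; apply: (vrM vO); [exact: (vrX vO) | exact: (vr_sg nrA)].
  move=> h i l l0.
  have -> : B h i l - B h ord0 l = (gam i)^-1 ^+ n h * (gam ord0)^-1 ^+ n h *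
     (sg j0 (be h i l) * gam ord0 ^+ n h - sg j0 (be h ord0 l) * gam i ^+ n h).
    rewrite /B !exprVn; have := expf_neq0 (n h) (gam0 i); have := expf_neq0 (n h) (gam0 ord0).
    move: (gam i ^+ n h) (gam ord0 ^+ n h) (sg j0 _) (sg j0 _) => a b u' v a0 b0.
    by field; rewrite a0 b0.
  rewrite -[X in O X]mulrA; apply: (vrM vO); last exact: beO.
  by apply: (vrM vO); exact: (vrX vO).
have Hlow := Hnorm xA0 Hgr.
have Hup : \prod_j `|sg j xA| <= 2 ^+ (u * g) * w ^+ ((\sum_j \sum_i x i j) * (mu + E)).
  have -> : 2 ^+ (u * g) = \prod_(j < g) 2 ^+ u :> algC by rewrite prodr_const card_ord exprM.
  rewrite big_distrl /= -prodrXr -big_split /=; apply: ler_prod => j _.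
  rewrite normr_ge0 xAE; apply: coef_sum_le_coef; apply: scaled_multiform_bound => //.
  by rewrite ger0_norm ?ler0n // -natrX ler_nat.
have : p%:R ^+ (s * (d * (mu - E) - index_wt W - t) * q2) <= p%:R ^+ (u * g * q2 + (\sum_j \sum_i x i j) * (mu + E)) :> algC.
  rewrite exprM; apply: le_trans (_ : _ <= (2 ^+ (u * g) * w ^+ ((\sum_j \sum_i x i j) * (mu + E))) ^+ q2) _.
    have L0 : 0 <= p%:R ^+ (s * (d * (mu - E) - index_wt W - t)) :> algC by rewrite exprn_ge0.
    have H := le_trans Hlow Hup; by rewrite lerXn2r // nnegrE (le_trans L0 H).
  rewrite exprMn -[X in X * _]exprM -[X in _ * X]exprM [X in w ^+ X]mulnC [X in _ * X]exprM wq exprD.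
  apply: ler_wpM2r; first by rewrite exprn_ge0.
  by rewrite -!natrX ler_nat; case: (u * g * q2)%N => // e; rewrite leq_exp2r // prime_gt1.
rewrite -!natrX ler_nat leq_exp2l ?prime_gt1 // leqNgt => /negP; apply; apply: leq_trans Hnum _.
rewrite mulnAC leq_mul2r; apply/orP; right; rewrite leq_mul2l; apply/orP; right.
by rewrite leq_sub2r // leq_sub2l // ltnW.
Qed.

End CoefficientVanishes.
End Evaluation.

(** * From vanishing coefficients to a polynomial of large index *)

Fixpoint tvar (m h : nat) : tower m :=
  match m return tower m with
  | 0 => 0
  | m'.+1 => if h == m' then 'X : {poly tower m'} else (tvar m' h)%:P
  end.

Fixpoint tmon (m : nat) (a : nat -> nat) : tower m :=
  match m return tower m with
  | 0 => 1
  | m'.+1 => (tmon m' a)%:P * 'X^(a m') : {poly tower m'}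
  end.

Lemma tmonE m a : tmon m a = \prod_(h < m) tvar m h ^+ a h.
Proof.
elim: m => [|m IH]; first by rewrite big_ord0.
rewrite big_ord_recr /= eqxx IH; congr (_ * _); rewrite rmorph_prod; apply: eq_bigr => h _.
by rewrite ltn_eqF // rmorphXn.
Qed.

Lemma tint_mon m a : tint (tmon m a).
Proof.
elim: m => [|m IH i] /=; first exact: rpred1.
by rewrite coefCM coefXn; case: eqP => _; rewrite ?mulr1 ?mulr0 //; exact: tint0.
Qed.

Lemma tdeg_mon m (D a : nat -> nat) : (forall h, (h < m)%N -> (a h <= D h)%N) -> tdeg D (tmon m a).
Proof.
elim: m => [|m IH] H //=; split=> [|i].
  apply: leq_trans (size_polyMleq _ _) _; rewrite size_polyXn addnS /=.
  by apply: leq_trans (leq_add (size_polyC_leq1 _) (H m (ltnSn m))) _.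
rewrite coefCM coefXn; case: eqP => _; rewrite ?mulr1 ?mulr0; last exact: tdeg0.
by apply: IH => h hm; apply: H; rewrite ltnW.
Qed.

Lemma tnorm_mon m a : tnorm (tmon m a) <= 1.
Proof.
elim: m => [|m IH] /=; first by rewrite normr1.
rewrite -/(tnorm (m:=m.+1) _) (@tnorm_widen m _ (a m).+1); last first.
  apply: leq_trans (size_polyMleq _ _) _; rewrite size_polyXn addnS /=.
  by apply: leq_trans (leq_add (size_polyC_leq1 _) (leqnn _)) _.
rewrite big_ord_recr /= big1 ?add0r => [|i _]; first by rewrite coefCM coefXn eqxx mulr1.
by rewrite coefCM coefXn ltn_eqF // mulr0 tnorm0.
Qed.

Lemma tcoef_mon m (b a : nat -> nat) : tcoef b (tmon m a) = [forall h : 'I_m, b h == a h]%:R.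
Proof.
elim: m => [|m IH] /=; first by rewrite (_ : [forall h, _] = true) //; apply/forallP => -[].
rewrite coefCM coefXn; case: eqP => [E|ne].
  rewrite mulr1 IH; congr (nat_of_bool _)%:R; apply/forallP/forallP => H h; last exact: (H (widen_ord (leqnSn m) h)).
  have [hm|] := ltnP h m; first exact: (H (Ordinal hm)).
  move=> mh; have hm : h = m :> nat by apply/eqP; rewrite eqn_leq mh -ltnS ltn_ord.
  by rewrite hm; apply/eqP.
rewrite mulr0 tcoef0; case: forallP => // /(_ ord_max) /eqP E; by case: ne.
Qed.

Lemma tvan_var m xi n h : (h < m)%N -> tvan xi n (n h) (tvar m h - tcst m (xi h)).
Proof.
elim: m => // m IH; rewrite ltnS leq_eqVlt => /orP[/eqP ->|hm] /= j.
  rewrite eqxx; case: j => [|j]; last by rewrite mulSn subnDA subnn sub0n; exact: tvanI0.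
  by rewrite nderivn0 !hornerE subrr; exact: tvan_zero.
rewrite (ltn_eqF hm) -polyCB nderivnC; case: j => [|j]; last by rewrite horner0; exact: tvan_zero.
by rewrite hornerC subn0; exact: IH.
Qed.

Lemma digits_inj k B (f g : 'I_k -> nat) : (forall i, f i < B)%N -> (forall i, g i < B)%N ->
  (\sum_i f i * B ^ i = \sum_i g i * B ^ i)%N -> f =1 g.
Proof.
elim: k f g => [|k IH] f g fB gB; first by move=> _ [].
rewrite !big_ord_recl !expn0 !muln1.
have E (h : 'I_k.+1 -> nat) : (\sum_(i < k) h (lift ord0 i) * B ^ bump 0 i = B * \sum_(i < k) h (lift ord0 i) * B ^ i)%N.
  by rewrite big_distrr /=; apply: eq_bigr => i _; rewrite /bump add1n expnS mulnCA.
rewrite !E => H; have B0 : (0 < B)%N by apply: leq_ltn_trans (fB ord0).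
have f0 : f ord0 = g ord0.
  by have := congr1 (modn^~ B) H; rewrite ![(_ + B * _)%N]addnC ![(B * _)%N]mulnC !modnMDl !modn_small.
move: H; rewrite f0 => /addnI /eqP; rewrite eqn_pmul2l // => /eqP H i.
case: (unliftP ord0 i) => [j|] -> //.
by apply: (IH (fun j => f (lift ord0 j)) (fun j => g (lift ord0 j))).
Qed.

Section TransferAlgebra.
Variables (m d : nat) (N : nat) (T : comNzRingType) (cs : {rmorphism algC -> T}).
Local Notation expo := (expo m d.+1 N).
Variables (c : expo -> int) (B : 'I_m -> 'I_d.+2 -> 'I_d.+2 -> algC) (z : 'I_m -> 'I_d.+2 -> algC).
Variables (xi : 'I_m -> algC) (X : 'I_m -> T) (u : 'I_m -> 'I_d.+2 -> T).
Let o1 : 'I_d.+2 := lift ord0 ord0.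
Hypothesis B_unit : forall h, \matrix_(i, l) B h i l \in unitmx.
Hypothesis zB : forall h l, l != ord0 -> \sum_i z h i * B h i l = 0.
Hypotheses (z0 : forall h, z h ord0 != 0) (zxi : forall h : 'I_m, xi h = - (z h o1 / z h ord0)).

(** The coordinate 1 is set to 1, the higher ones are free, and coordinate 0 is solved for so that
    the combination with coefficients [z] is a multiple of [X_h - xi_h]. By [zB] this combination
    involves only the adapted coordinate [ord0], which is therefore proportional to [X_h - xi_h]. *)
Definition test_point (h : 'I_m) (i : 'I_d.+2) : T :=
  if i == ord0 then X h - \sum_(i' : 'I_d.+2 | (1 < i')%N) cs (z h i' / z h ord0) * u h i'
  else if i == lift ord0 ord0 then 1 else u h i.
Local Notation b := test_point.

Let binv h := invmx (\matrix_(i, l) B h i l).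
Let tau (h : 'I_m) (l : 'I_d.+2) : T := \sum_i cs (binv h l i) * b h i.

Let tauE h i : \sum_l cs (B h i l) * tau h l = b h i.
Proof.
under eq_bigr => l _ do rewrite mulr_sumr; rewrite exchange_big /=.
transitivity (\sum_j cs ((i == j)%:R) * b h j); last first.
  rewrite (bigD1 i) //= eqxx rmorph1 mul1r big1 ?addr0 // => j /negPf ne.
  by rewrite eq_sym ne rmorph0 mul0r.
apply: eq_bigr => j _; under eq_bigr => l _ do rewrite mulrA -rmorphM /=.
rewrite -mulr_suml -rmorph_sum; congr (cs _ * _).
have := mulmxV (B_unit h) => /matrixP /(_ i j); rewrite !mxE => <-; by apply: eq_bigr => l _; rewrite mxE.
Qed.

Lemma not01 (i : 'I_d.+2) : (i != ord0) && (i != lift ord0 ord0) = (1 < i)%N.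
Proof. by case: i => [[|[|i]] Hi]. Qed.

Let zb h : \sum_i cs (z h i) * b h i = cs (z h ord0) * (X h - cs (xi h)).
Proof.
have rest : \sum_(i : 'I_d.+2 | (1 < i)%N) cs (z h i) * b h i =
    cs (z h ord0) * \sum_(i : 'I_d.+2 | (1 < i)%N) cs (z h i / z h ord0) * u h i.
  rewrite mulr_sumr; apply: eq_bigr => i; rewrite -not01 => /andP[/negPf n0 /negPf n1].
  by rewrite /b n0 n1 mulrA -rmorphM mulrC [z h ord0 * _]mulrC divfK // mulrC.
rewrite (bigD1 ord0) //= (bigD1 o1) //= (eq_bigl _ _ not01) rest {1}/b eqxx {1}/b eqxx /= mulr1.
rewrite zxi rmorphN opprK mulrBr mulrDr -rmorphM [z h ord0 * _]mulrC divfK //.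
by rewrite [cs (z h o1) + _]addrC addrA subrK.
Qed.

Let kap h := \sum_i z h i * B h i ord0.

Let tau0 h : cs (kap h) * tau h ord0 = cs (z h ord0) * (X h - cs (xi h)).
Proof.
rewrite -zb; under [RHS]eq_bigr => i _ do rewrite -tauE mulr_sumr.
rewrite exchange_big /= (bigD1 ord0) //= [X in _ + X]big1 ?addr0 => [|l l0].
  rewrite /kap rmorph_sum mulr_suml; apply: eq_bigr => i _; by rewrite rmorphM mulrA.
under eq_bigr => i _ do rewrite mulrA -rmorphM /=.
by rewrite -mulr_suml -rmorph_sum zB // rmorph0 mul0r.
Qed.

Let kap0 h : kap h != 0.
Proof.
apply/eqP => k0; have /eqP := z0 h; apply.
have E : (\row_i z h i) *m (\matrix_(i, l) B h i l) = 0.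
  apply/rowP => l; rewrite !mxE; under eq_bigr => i _ do rewrite !mxE.
  by have [->|l0] := eqVneq l ord0; [exact: k0 | exact: zB].
have := congr1 (mulmxr (invmx (\matrix_(i, l) B h i l))) E.
by rewrite /= mulmxK // mul0mx => /rowP /(_ ord0); rewrite !mxE.
Qed.

Lemma multiform_test_point : exists (t : 'I_m -> 'I_d.+2 -> T) (k : 'I_m -> algC),
  (forall h, t h ord0 = cs (k h) * (X h - cs (xi h))) /\
  let F := multiform c (linear_forms B) in
  multiform c b = \sum_(W <- msupp F) cs F@_W * \prod_h \prod_l t h l ^+ W (tvar_idx h l).
Proof.
exists tau, (fun h => z h ord0 / kap h); split.
  move=> h; have := congr1 ( *%R (cs (kap h)^-1)) (tau0 h).
  by rewrite mulrA -rmorphM mulVf // rmorph1 mul1r => ->; rewrite mulrA -rmorphM [_^-1 * _]mulrC.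
move=> F; pose ev : {rmorphism {mpoly algC[#|{: 'I_m * 'I_d.+2}|]} -> T} := mmap cs (fun k => tau (enum_val k).1 (enum_val k).2).
have -> : multiform c b = ev F.
  rewrite multiform_morph; apply: eq_bigr => a _; congr (_ * _); apply: eq_bigr => h _; apply: eq_bigr => i _.
  congr (_ ^+ _); rewrite -tauE rmorph_sum; apply: eq_bigr => l _.
  by rewrite /ev /= mmapZ mmapX mmap1U /tvar_idx enum_rankK.
apply: eq_bigr => W _; congr (_ * _); rewrite /mmap1 pair_bigA /=.
rewrite (reindex (@enum_rank _)) /=; last by apply: onW_bij; exact: enum_rank_bij.
by apply: eq_bigr => -[h l] _; rewrite enum_rankK.
Qed.

Lemma multiform_point_monomials U (k : 'I_m -> 'I_d.+2 -> nat) : (forall h i, u h i = U ^+ k h i) ->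
  multiform c b = \sum_a ((c a)%:~R : T) * (\prod_h b h ord0 ^+ a (h, ord0) *
    U ^+ (\sum_h \sum_(i : 'I_d.+2 | (1 < i)%N) k h i * a (h, i))).
Proof.
move=> uE; apply: eq_bigr => a _; congr (_ * _); rewrite -prodrXr -big_split /=.
apply: eq_bigr => h _; rewrite (bigD1 ord0) //=; congr (_ * _).
rewrite (bigD1 (lift ord0 ord0)) //= (eq_bigl _ _ not01) {1}/b eqxx /= expr1n mul1r -prodrXr.
by apply: eq_bigr => i; rewrite -not01 => /andP[/negPf n0 /negPf n1]; rewrite exprM /b n0 n1 uE.
Qed.

End TransferAlgebra.

Section Transfer.
Variables (m d : nat) (n D : nat -> nat) (N : nat) (xi : nat -> algC).
Hypotheses (nm : n m = 0%N) (xim : xi m = 0).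
Local Notation expo := (expo m d.+1 N).
Variables (c : expo -> int) (B : 'I_m -> 'I_d.+2 -> 'I_d.+2 -> algC) (z : 'I_m -> 'I_d.+2 -> algC).
Hypotheses (c0 : exists a, c a != 0) (cS : forall a, c a != 0 -> block_homog D a).
Hypothesis B_unit : forall h, \matrix_(i, l) B h i l \in unitmx.
Hypothesis zB : forall h l, l != ord0 -> \sum_i z h i * B h i l = 0.
Hypotheses (z0 : forall h, z h ord0 != 0).
Hypothesis zxi : forall h : 'I_m, xi h = - (z h (lift ord0 ord0) / z h ord0).
Variable I : nat.
Hypothesis HI : forall W, (index_wt n W < I)%N -> (multiform c (linear_forms B))@_W = 0.

(** Kronecker substitution: exponents are at most [N], so in base [N.+1] different exponents of the
    free coordinates give different powers of one extra variable. *)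
Let kk (h : 'I_m) (i : 'I_d.+2) := (N.+1 ^ enum_rank (h, i))%N.
Let Pb : tower m.+1 := multiform c (test_point (tcst m.+1) z
  (fun h => tvar m.+1 h) (fun h i => 'X^(kk h i) : {poly tower m})).

Let Pb_van : tvan (m:=m.+1) xi n I Pb.
Proof.
have [t [k [t0 E]]] := @multiform_test_point m d N (tower m.+1) (tcst m.+1) c B z (fun h => xi h)
  (fun h => tvar m.+1 h) (fun h i => 'X^(kk h i) : {poly tower m}) B_unit zB z0 zxi.
rewrite /Pb E; apply: tvan_sum => W _.
have [lt|le] := ltnP (index_wt n W) I; first by rewrite HI // rmorph0 mul0r; exact: tvan_zero.
apply: tvan_cstM; apply: tvanW le _; apply: tvan_prod => h _; rewrite (bigD1 ord0) //=.
rewrite -[(_ * _)%N]addn0; apply: (@tvanM xi n m.+1); last exact: tvanI0.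
rewrite t0 exprMn -rmorphXn; apply: tvan_cstM.
elim: (W _) => [|j IH]; first by rewrite muln0; exact: tvanI0.
by rewrite mulnS exprS; apply: (@tvanM xi n m.+1) => //; apply: tvan_var; rewrite ltnW // ltnS.
Qed.

Let dg (a : expo) (k : 'I_#|{: 'I_m * 'I_d.+2}|) : nat :=
  if (1 < (enum_val k).2)%N then (a (enum_val k) : nat) else 0%N.
Let phi (a : expo) := (\sum_k dg a k * N.+1 ^ k)%N.

Let phi_inj a a' : block_homog D a -> block_homog D a' -> (forall h, a (h, ord0) = a' (h, ord0)) ->
  phi a = phi a' -> a = a'.
Proof.
move=> aS aS' H0 Hphi.
have dgB e k : (dg e k < N.+1)%N by rewrite /dg; case: ifP => // _.
have dgE := digits_inj (dgB a) (dgB a') Hphi.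
have H2 h (i : 'I_d.+2) : (1 < i)%N -> a (h, i) = a' (h, i).
  move=> i1; have := dgE (enum_rank (h, i)); rewrite /dg enum_rankK /= i1; exact: val_inj.
apply/ffunP => -[h i]; have [->|i0] := eqVneq i ord0; first exact: H0.
have [->|i1] := eqVneq i (lift ord0 ord0); last by apply: H2; rewrite -not01 i0.
have DE (e : expo) : block_homog D e -> D h = (e (h, ord0) + (e (h, lift ord0 ord0) + \sum_(j : 'I_d.+2 | (1 < j)%N) e (h, j)))%N.
  by move=> eS; rewrite -(eqP (forallP eS h)) (bigD1 ord0) //= (bigD1 (lift ord0 ord0)) //= (eq_bigl _ _ (@not01 d)).
apply: val_inj => /=; have := DE _ aS; rewrite (DE _ aS') H0.
rewrite (eq_bigr (fun j => a (h, j) : nat)) => [/addnI /addIn -> //|j j1]; by rewrite H2.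
Qed.

Let phi_sum a : phi a = (\sum_h \sum_(i : 'I_d.+2 | (1 < i)%N) kk h i * a (h, i))%N.
Proof.
rewrite /phi; under [RHS]eq_bigr => h _ do rewrite big_mkcond /=.
rewrite pair_bigA (reindex (@enum_rank _)) /=; last by apply: onW_bij; exact: enum_rank_bij.
by apply: eq_bigr => -[h i] _; rewrite /dg enum_rankK /kk /=; case: ifP => _ //; rewrite mulnC.
Qed.

Let lead (a : expo) (h : nat) : nat := if insub h is Some h' then a (h', ord0) else 0%N.

(** At the lowest power of the extra variable, only the term [X_h] of coordinate 0 contributes. The
    quotients of the [z] disappear, and the coefficient is an integer polynomial. *)
Let Pb_coef e : (forall a, c a != 0 -> (e <= phi a)%N) ->
  (Pb : {poly tower m})`_e = \sum_(a | phi a == e) tcst m (c a)%:~R * tmon m (lead a).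
Proof.
move=> He; pose R0 (a : expo) : {poly tower m} := \prod_h (test_point (tcst m.+1) z (fun h => tvar m.+1 h)
  (fun h i => 'X^(kk h i) : {poly tower m}) h ord0 : {poly tower m}) ^+ a (h, ord0).
have -> : (Pb : {poly tower m}) = \sum_a (tcst m (c a)%:~R)%:P * (R0 a * 'X^(phi a)).
  have H := @multiform_point_monomials m d N (tower m.+1) (tcst m.+1) c z (fun h => tvar m.+1 h)
    (fun h i => 'X^(kk h i) : {poly tower m}) ('X : {poly tower m}) kk (fun h i => erefl).
  etransitivity; first exact: H.
  apply: eq_bigr => a _; rewrite -phi_sum; congr (_ * _).
  by rewrite -(rmorph_int (tcst m.+1)).
rewrite [RHS]big_mkcond coef_sum; apply: eq_bigr => a _; rewrite coefCM.
have [->|ca] := eqVneq (c a) 0; first by rewrite mulr0z rmorph0 !mul0r if_same.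
rewrite coefMXn; case: eqP => [->|ne]; last first.
  have -> : (e < phi a)%N by rewrite ltn_neqAle He // andbT; apply/eqP => E; case: ne.
  by rewrite mulr0.
rewrite ltnn subnn; congr (_ * _); rewrite -horner_coef0 /R0.
rewrite (horner_prod) tmonE; apply: eq_bigr => h _; rewrite horner_exp /lead.
rewrite insubT //= => hm; congr (_ ^+ _); last by congr (nat_of_ord (a (_, _))); apply: val_inj.
rewrite /test_point eqxx hornerD hornerN horner_sum big1 => [|i _].
  by rewrite subr0 ltn_eqF // hornerC.
by rewrite hornerCM hornerXn expr0n /kk expn_eq0 /= mulr0.
Qed.

(** The extra variable has weight 0 and is evaluated at 0, so its lowest coefficient inherits the
    index. It is nonzero because exponents with equal [phi] differ at coordinate 0, hence give
    different monomials. *)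
Lemma roth_transfer : exists p : tower m,
  [/\ tint p, p != 0, tdeg D p, tnorm p <= \sum_a `|(c a)%:~R| & tvan xi n I p].
Proof.
pose P e := [exists a, (c a != 0) && (phi a == e)].
have exP : exists e, P e by have [a ca] := c0; exists (phi a); apply/existsP; exists a; rewrite ca eqxx.
have [e /existsP[a0 /andP[ca0 /eqP Ea0]] He] := ex_minnP exP.
have {}He a : c a != 0 -> (e <= phi a)%N.
  by move=> ca; apply: He; apply/existsP; exists a; rewrite ca eqxx.
have pE := Pb_coef He; exists ((Pb : {poly tower m})`_e); split.
- rewrite pE; apply: tint_sum => a _; apply: tintM; last exact: tint_mon.
  by apply: tint_cst; exact: intr_int.
- apply/eqP => p0; have := congr1 (tcoef (lead a0)) p0; rewrite tcoef0 pE tcoef_sum.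
  rewrite (bigD1 a0) ?Ea0 //= big1 ?addr0 => [|a /andP[/eqP ea ne]].
    rewrite mulrC tcoefM_cst tcoef_mon (_ : [forall h, _] = true); last by apply/forallP.
    by rewrite mul1r => /eqP; rewrite intr_eq0 (negPf ca0).
  rewrite mulrC tcoefM_cst tcoef_mon; have [->|ca] := eqVneq (c a) 0; first by rewrite mulr0.
  case: forallP => [H|]; last by rewrite mul0r.
  case/eqP: ne; apply: (phi_inj (cS ca) (cS ca0)); last by rewrite ea Ea0.
  move=> h; apply: val_inj; have /eqP := H h; rewrite /lead insubT //= => hm.
  by rewrite (_ : Sub _ _ = h) //; exact: val_inj.
- rewrite pE; apply: tdeg_sum => a _.
  have [->|ca] := eqVneq (c a) 0; first by rewrite mulr0z rmorph0 mul0r; exact: tdeg0.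
  apply: (@tdeg_le _ (fun h => 0 + D h)%N) => //; apply: tdegM; first exact: tdeg_cst.
  apply: tdeg_mon => h hm; rewrite /lead insubT /= -(eqP (forallP (cS ca) (Ordinal hm))).
  by rewrite (bigD1 ord0) //= leq_addr.
- rewrite pE; apply: le_trans (tnorm_sum _ _ _) _; rewrite big_mkcond /=; apply: ler_sum => a _.
  case: ifP => // _; apply: le_trans (tnormM _ _) _; rewrite tnorm_cst -[X in _ <= X]mulr1.
  by apply: ler_wpM2l => //; exact: tnorm_mon.
have := Pb_van e; rewrite nm muln0 subn0 xim rmorph0 horner_coef0 coef_nderivn addn0 binn mulr1n.
by [].
Qed.

End Transfer.

(** * The contradiction with Roth's lemma *)

(** Since [X] is smaller than [q2 * d * s], the main terms differ by at least one whole [mu]. The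
    four error terms, from [S], [E], [I] and [t], cost at most [mu/8] each. *)
Lemma parameter_inequality d q2 s t X C1 C2 m N r E mu n0 S I :
  (d.+1 * mu = m * N)%N -> (r * E = m * N)%N -> (n0 * S <= m * N)%N -> (8 * d.+1 * (s * q2) * I = N)%N ->
  (8 * d.+1 * C1 <= n0)%N -> (8 * d.+1 * (C2 + 2 * (s * q2 * d)) <= r)%N -> (8 * d.+1 * (s * q2 * t) <= N)%N ->
  (X < q2 * d * s)%N -> (0 < N)%N -> (0 < m)%N ->
  (C1 * S + C2 * E + X * (mu + E) < s * q2 * (d * (mu - E) - I - t))%N.
Proof.
move=> Hmu HE HS HI H1 H2 H3 HX N0 m0.
have cancel u : (8 * d.+1 * u <= m * N)%N -> (8 * u <= mu)%N.
  by rewrite -Hmu [(8 * _)%N]mulnC -mulnA leq_pmul2l.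
have k1 : (8 * (C1 * S) <= mu)%N.
  by apply: cancel; rewrite mulnA; apply: leq_trans (leq_mul H1 (leqnn S)) HS.
have k2 : (8 * ((C2 + 2 * (s * q2 * d)) * E) <= mu)%N.
  by apply: cancel; rewrite mulnA -HE leq_mul.
have k3 : (8 * (s * q2 * I) <= mu)%N by apply: cancel; rewrite mulnA HI leq_pmull.
have k4 : (8 * (s * q2 * t) <= mu)%N by apply: cancel; apply: leq_trans H3 _; rewrite leq_pmull.
have mu0 : (0 < mu)%N by rewrite lt0n; apply/eqP => E0; move: Hmu; rewrite E0 muln0; nia.
have HX' : (X.+1 * (mu + E) <= q2 * d * s * (mu + E))%N by rewrite leq_mul2r HX orbT.
rewrite !mulnBr mulnA [(s * q2 * (d * _))%N]mulnA.
move: HX' k2; rewrite (_ : q2 * d * s = s * q2 * d)%N; last by ring.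
rewrite mulSn !mulnDr mulnDl -[(2 * _ * E)%N]mulnA.
move: k1 k3 k4; move: (C1 * S)%N (s * q2 * I)%N (s * q2 * t)%N (C2 * E)%N (X * mu)%N (X * E)%N (s * q2 * d)%N => a b c e f h D.
move: (D * mu)%N (D * E)%N => u v; lia.
Qed.

Section Package.
Variables (A : comNzRingType) (g : nat) (sg : 'I_g -> {rmorphism A -> algC}) (om : 'I_g -> A).
Hypothesis nrA : number_ring sg om.
Variables (O : algC -> Prop) (p : nat) (j0 : 'I_g) (s t : nat).
Hypotheses (vO : valuation_ring O) (pp : prime p).
Hypothesis Hnorm : forall a K, sg j0 a != 0 -> O (sg j0 a / p%:R ^+ K) ->
    p%:R ^+ (s * (K - t)) <= \prod_j `|sg j a|.
Variables (d : nat) (gam : 'I_d.+2 -> algC) (G : 'I_d.+2 -> A) (Q CG q2 : nat) (w : algC).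
Hypotheses (Q0 : (0 < Q)%N) (HG : forall i, sg j0 (G i) = Q%:R * gam i).
Hypotheses (Ogam : forall i, O (gam i)) (Ogam' : forall i, O (gam i)^-1) (gam0 : forall i, gam i != 0).
Hypotheses (GB : forall i j, `|sg j (G i)| <= 2 ^+ CG) (QB : (Q <= 2 ^ CG)%N).
Hypotheses (w1 : 1 <= w) (wq : w ^+ q2 = p%:R).
Variables (x : 'I_d.+2 -> 'I_g -> nat) (zz : nat).

(* For [l != ord0] the forms [be _ l] vanish at [Z] and are proportional to
   [gam _ ^+ n] modulo [p ^ n].  Since [w ^ q2 = p], their sizes are recorded by
   the integers [x i j * n]. *)
Definition package n (Z : 'I_d.+2 -> A) (be : 'I_d.+2 -> 'I_d.+2 -> A) :=
  [/\ forall i, sg j0 (Z i) != 0,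
      forall l, l != ord0 -> \sum_i sg j0 (Z i) * sg j0 (be i l) = 0,
      \matrix_(i, l) sg j0 (be i l) \in unitmx,
      (forall i l j, `|sg j (be i l)| <= w ^+ (x i j * n)) /\
      (forall i i' l, l != ord0 ->
        O ((sg j0 (be i l) * gam i' ^+ n - sg j0 (be i' l) * gam i ^+ n) / p%:R ^+ n)) &
      root_mult_bound (- (sg j0 (Z (lift ord0 ord0)) * gam (lift ord0 ord0) ^+ n /
                          (sg j0 (Z ord0) * gam ord0 ^+ n))) n zz].

Hypothesis x_small : (\sum_j \sum_i x i j < q2 * d.+1 * s)%N.

(** All the packages share the size pattern [x], so a rapidly increasing sequence of exponents can
    be used in one auxiliary polynomial. Its coefficients of small index vanish, and the transferred
    integer polynomial contradicts Roth's lemma at the points [xi]. *)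
Lemma no_packages : ~ forall n0, exists n, (n0 <= n)%N /\ exists Z be, package n Z be.
Proof.
move=> Hpk; have [nn Hnn] := fun_choice Hpk.
have sq0 : (0 < s * q2)%N by move: x_small; rewrite mulnAC; lia.
pose C1 := ((3 * d.+1 + 4) * g * q2)%N; pose C2 := (2 * CG * d.+2 * g * q2)%N.
(* The order of the choices matters: the tolerance [r] comes from the sizes, the number [m] of
   blocks from [r], the constant of Roth's lemma from [m] and [hR], and the exponents [f h] come
   last. *)
have [r [r0 rC rd]] : exists r, [/\ (0 < r)%N, (8 * d.+2 * (C2 + 2 * (s * q2 * d.+1)) <= r)%N & (d.+2 <= r)%N].
  by exists (8 * d.+2 * (C2 + 2 * (s * q2 * d.+1)) + d.+2)%N; rewrite leq_addr leq_addl addnS.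
have [hR hRE] : exists hR, hR = (8 * d.+2 * (s * q2))%N by exists (8 * d.+2 * (s * q2))%N.
have hR0 : (0 < hR)%N by rewrite hRE muln_gt0.
have [m mE] : exists m, m = (4 * (d.+2 * r ^ 2))%N by exists (4 * (d.+2 * r ^ 2))%N.
have m0 : (0 < m)%N by rewrite mE muln_gt0 muln_gt0 expn_gt0 r0.
have [Om [Om0 HOm]] := @roth_lemma m hR zz hR0.
pose base := (8 * d.+2 * C1 + Om * ((2 * d.+1 + 3) * m) + 8 * d.+2 * (s * q2 * t) + Om)%N.
pose f := fix f h := if h is h'.+1 then nn (Om * f h' + base)%N else nn base.
have fb h : (base <= f h)%N.
  by case: h => [|h] /=; [have [H _] := Hnn base | have [H _] := Hnn (Om * f h + base)%N; apply: leq_trans H; exact: leq_addl].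
have fpk h : exists Z be, package (f h) Z be.
  by case: h => [|h] /=; [have [_ H] := Hnn base | have [_ H] := Hnn (Om * f h + base)%N].
have fS h : (Om * f h <= f h.+1)%N.
  by have [H _] := Hnn (Om * f h + base)%N; apply: leq_trans H; exact: leq_addr.
have fOm h : (Om <= f h)%N by apply: leq_trans (fb h); rewrite /base leq_addl.
have f0 h : (0 < f h)%N by exact: leq_trans Om0 (fOm h).
have fmono h : (f 0%N <= f h)%N.
  elim: h => // h IH; apply: leq_trans IH _; apply: leq_trans (fS h); by rewrite leq_pmull.
have [Z HZ] := fun_choice fpk; have [be Hbe] := fun_choice HZ.
pose n h := if (h < m)%N then f h else 0%N.
pose xi h := if (h < m)%N then - (sg j0 (Z h (lift ord0 ord0)) * gam (lift ord0 ord0) ^+ f h /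
                          (sg j0 (Z h ord0) * gam ord0 ^+ f h)) else 0.
pose Pn := (\prod_(h < m) f h)%N.
have Pn0 : (0 < Pn)%N by apply: prodn_gt0 => h.
(* [N] is divisible by all the exponents and by [d.+2], [r] and [hR], so that the [D h], [mu], [E]
   and [I] are exact quotients. *)
pose N := (d.+2 * r * hR * Pn)%N.
have N0 : (0 < N)%N by rewrite /N !muln_gt0 r0 hR0 Pn0.
pose D h := (N %/ n h)%N.
have nE h : (h < m)%N -> n h = f h by rewrite /n => ->.
have HnD h : (h < m)%N -> (n h * D h = N)%N.
  move=> hm; rewrite mulnC divnK // nE // /N /Pn (bigD1 (Ordinal hm)) //= mulnCA.
  exact: dvdn_mulr.
pose mu := (m * (r * hR * Pn))%N; pose E := (m * (d.+2 * hR * Pn))%N; pose I := (d.+2 * r * Pn)%N.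
have Hmu : (d.+2 * mu = m * N)%N by rewrite /mu /N; ring.
have HE : (r * E = m * N)%N by rewrite /E /N; ring.
have HI : (hR * I = N)%N by rewrite /I /N; ring.
pose S := (\sum_(h < m) D h)%N.
have HS : (f 0%N * S <= m * N)%N.
  rewrite /S big_distrr /= -[X in (_ <= X * _)%N]card_ord -sum_nat_const; apply: leq_sum => h _.
  by rewrite -(HnD h (ltn_ord h)) leq_mul2r nE // fmono orbT.
have [c [c0 cS cB cE]] := @auxiliary_polynomial m d.+1 n D N r mu E m0 N0 r0 HnD Hmu HE (eq_leq (esym mE)).
have EM : (E <= mu)%N.
  by rewrite /E /mu leq_mul2l -!mulnA leq_mul2r rd !orbT.
pose B (h : 'I_m) i l := (gam i)^-1 ^+ n h * sg j0 (be h i l).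
have Hpar : (((3 * d.+1 + 4) * S + 2 * CG * E * d.+2) * g * q2 + (\sum_j \sum_i x i j) * (mu + E) <
    s * q2 * (d.+1 * (mu - E) - I - t))%N.
  have -> : (((3 * d.+1 + 4) * S + 2 * CG * E * d.+2) * g * q2 = C1 * S + C2 * E)%N by rewrite /C1 /C2; ring.
  apply: (@parameter_inequality d.+1 q2 s t _ C1 C2 m N r E mu (f 0%N) S I) => //; first by rewrite -hRE.
  - by apply: leq_trans (fb 0%N); rewrite /base; clear; lia.
  - apply: leq_trans (_ : f 0%N <= _)%N; first by apply: leq_trans (fb 0%N); rewrite /base -addnA addnCA leq_addr.
    have Hf : (f 0%N <= Pn)%N.
      rewrite /Pn (bigD1 (Ordinal m0)) //= leq_pmulr //; by apply: prodn_gt0 => h.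
    apply: leq_trans Hf _; rewrite /N leq_pmull // !muln_gt0 r0 hR0 //.
have Hz (W : 'X_{1..#|{: 'I_m * 'I_d.+2}|}) : (index_wt n W < I)%N -> (multiform c (linear_forms B))@_W = 0.
  move=> HW; apply: (small_index_coef_zero m0 N0 HnD EM cS cB cE nrA vO pp Hnorm Q0 HG Ogam Ogam' gam0 GB QB w1 wq
    (be := fun h : 'I_m => be h) (x := x) _ _ Hpar HW) => h i.
  - by move=> l j; rewrite nE //; have [_ _ _ [H _] _] := Hbe h.
  - by move=> i' l l0; rewrite nE //; have [_ _ _ [_ H] _] := Hbe h; apply: H.
pose z (h : 'I_m) i := sg j0 (Z h i) * gam i ^+ n h.
have z0 h : z h ord0 != 0 by have [H _ _ _ _] := Hbe h; rewrite mulf_neq0 ?expf_neq0.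
have nm : n m = 0%N by rewrite /n ltnn.
have xim : xi m = 0 by rewrite /xi ltnn.
have zxi (h : 'I_m) : xi h = - (z h (lift ord0 ord0) / z h ord0) by rewrite /xi /z ltn_ord nE.
have zB h l : l != ord0 -> \sum_i z h i * B h i l = 0.
  move=> l0; have [_ H _ _ _] := Hbe h; rewrite -[RHS](H l l0); apply: eq_bigr => i _.
  by rewrite /z /B exprVn mulrA mulfK ?expf_neq0.
have Bu h : \matrix_(i, l) B h i l \in unitmx.
  have -> : \matrix_(i, l) B h i l = diag_mx (\row_i (gam i)^-1 ^+ n h) *m \matrix_(i, l) sg j0 (be h i l).
    by apply/matrixP => i l; rewrite mul_diag_mx !mxE.
  rewrite unitmx_mul; have [_ _ -> _ _] := Hbe h; rewrite andbT unitmxE det_diag unitfE.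
  by apply/prodf_neq0 => i _; rewrite mxE expf_neq0 // invr_eq0.
have cS1 a : c a != 0 -> block_homog D a by move=> /cS /andP[].
have [q [qi q0 qd qn qv]] := @roth_transfer m d n D N xi nm xim c B z c0 cS1 Bu zB z0 zxi I Hz.
(* The logarithmic size [(2 * d.+1 + 3) * S] is [d.+2 * S] for the number of exponents plus
   [d.+3 * S] for the coefficients. *)
apply: (HOm n D xi N 1%N q ((2 * d.+1 + 3) * S)%N I) qv => //.
- by move=> i im; rewrite nE.
- by move=> i im; rewrite !nE // ltnW.
- by move=> i im; rewrite nE // /xi im; have [_ _ _ _ H] := Hbe i.
- by apply: tdeg_le qd => h _; rewrite mul1n.
- apply: le_trans qn _; rewrite (bigID (fun a => block_homog D a)) /= [X in _ + X]big1 ?addr0; last first.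
    by move=> a aS; have [->|/cS1] := eqVneq (c a) 0; [rewrite mulr0z normr0 | rewrite (negPf aS)].
  apply: le_trans (_ : _ <= \sum_(a : expo m d.+1 N | block_homog D a) 2 ^+ (d.+3 * S)) _.
    apply: ler_sum => a _; rewrite -intr_norm -natrX -[_%:R]/((Posz _)%:~R) ler_int -abszE lez_nat; exact: cB.
  rewrite sumr_const -[X in X <= _]mulr_natl; have -> : ((2 * d.+1 + 3) * S = d.+2 * S + d.+3 * S)%N by ring.
  rewrite exprD; apply: ler_wpM2r; first by rewrite exprn_ge0.
  rewrite -natrX ler_nat; apply: leq_trans (@card_homog m d.+1 D N).
  by apply: subset_leq_card; apply/subsetP => a; rewrite !inE.
- rewrite mul1n; have : (Om * ((2 * d.+1 + 3) * m) * S <= f 0%N * S)%N.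
    by rewrite leq_mul2r; apply/orP; right; apply: leq_trans (fb 0%N); rewrite /base; lia.
  move=> H; have := leq_trans H HS; rewrite (_ : Om * ((2 * d.+1 + 3) * m) * S = m * (Om * ((2 * d.+1 + 3) * S)))%N; last by ring.
  by rewrite leq_pmul2l.
- by rewrite mul1n HI.
Qed.

End Package.

(** * Multiplicity of the roots of integer polynomials *)

Definition ratio_root_free (x : algC) := forall k, (0 < k)%N -> x ^+ k != 1.

Lemma dvdp_XsubC_expP (q : {poly algC}) x t :
  reflect (forall k, (k < t)%N -> q^`N(k).[x] = 0) (('X - x%:P) ^+ t %| q).
Proof.
apply: (iffP idP) => [/dvdpP [r ->] k kt|H].
  rewrite nderivn_horner_comp rmorphM rmorphXn /= rmorphB /= comp_polyX comp_polyC addrK.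
  by rewrite coefMXn kt.
have E : q \Po ('X + x%:P) = drop_poly t (q \Po ('X + x%:P)) * 'X^t.
  rewrite -[LHS](poly_take_drop t) [take_poly _ _](_ : _ = 0) ?add0r //.
  apply/polyP => k; rewrite coef_take_poly coef0; case: ifP => // kt.
  by rewrite -nderivn_horner_comp H.
have := congr1 (fun r => r \Po ('X - x%:P)) E.
rewrite -comp_polyA rmorphM rmorphXn /= comp_polyD comp_polyX comp_polyC subrK comp_polyXr => ->.
exact: dvdp_mulIr.
Qed.

(** Each factor [X - x] enlarges the sum of the moduli of the coefficients at least by the factor
    [|x| - 1]: apply the triangle inequality to [x S = S X - S (X - x)]. *)
Lemma coef_sum_root_power (q : {poly algC}) x t : ('X - x%:P) ^+ t %| q -> 1 <= `|x| ->
  (`|x| - 1) ^+ t * `|lead_coef q| <= tnorm (m:=1) q.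
Proof.
move=> /dvdpP [r ->] x1; rewrite lead_coefM lead_coef_exp lead_coefXsubC expr1n mulr1.
elim: t => [|t IH].
  rewrite mul1r expr0 mulr1; have [->|r0] := eqVneq r 0; first by rewrite lead_coef0 normr0 (tnorm0 1).
  have : (0 < size r)%N by rewrite lt0n size_poly_eq0.
  rewrite /= lead_coefE; case: (size r) => // n _ /=; rewrite big_ord_recr /= lerDr.
  by apply: sumr_ge0 => i _.
set S := r * _ in IH; rewrite [('X - _) ^+ t.+1]exprSr mulrA -/S exprS -mulrA.
apply: le_trans (ler_wpM2l _ IH) _; first by rewrite subr_ge0.
have xE : tnorm (m:=1) (tcst 1 x * S) = `|x| * tnorm (m:=1) S.
  have sz : size (tcst 1 x * S) = size S by rewrite /= mul_polyC size_scale // -normr_gt0 (lt_le_trans ltr01).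
  rewrite /= -/(tcst 1 x) sz mulr_sumr; apply: eq_bigr => i _; by rewrite coefCM normrM.
rewrite mulrBl mul1r lerBlDr -xE.
have -> : tcst 1 x * S = - (S * ('X - x%:P)) + S * 'X by rewrite mulrBr opprB subrK mulrC.
apply: le_trans (@tnormD 1 _ _) _; rewrite (@tnormN 1); apply: lerD => //.
rewrite (@tnorm_widen 0 (S * 'X) (size S).+1); last first.
  by have [->|S0] := eqVneq S 0; rewrite ?mul0r ?size_poly0 // size_mulX.
rewrite big_ord_recl /= coefMX eqxx normr0 add0r; apply: ler_sum => i _; by rewrite coefMX.
Qed.

Section ConjugateMultiplicity.
Variables (A : comNzRingType) (g : nat) (sg : 'I_g -> {rmorphism A -> algC}) (om : 'I_g -> A).
Hypothesis nrA : number_ring sg om.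

(** Multiplied by a power of the denominator, a divided derivative of an integer polynomial at such
    a quotient is the image of a ring element, and vanishing of images does not depend on the
    embedding. *)
Lemma conj_multiplicity j j' a b (q : {poly algC}) t : sg j b != 0 -> q \is a polyOver Num.int ->
  ('X - (sg j a / sg j b)%:P) ^+ t %| q -> ('X - (sg j' a / sg j' b)%:P) ^+ t %| q.
Proof.
move=> b0 qi /dvdp_XsubC_expP H; apply/dvdp_XsubC_expP => k kt; have := H k kt.
have b0' := nr_neq0 nrA j' b0.
have [c Hc] : exists c : nat -> int, forall i, (q^`N(k))`_i = (c i)%:~R.
  apply: (@fun_choice nat int (fun i z => (q^`N(k))`_i = z%:~R)) => i; apply/intrP.
  by rewrite coef_nderivn; apply: rpredMn; exact: (polyOverP qi).
pose n := size q^`N(k).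
have E i : sg i b != 0 -> q^`N(k).[sg i a / sg i b] * sg i b ^+ n =
    sg i (\sum_(l < n) (c l)%:~R * (a ^+ l * b ^+ (n - l))).
  move=> bi; rewrite horner_coef mulr_suml rmorph_sum; apply: eq_bigr => l _.
  rewrite !rmorphM rmorph_int !rmorphXn Hc -!mulrA; congr (_ * _).
  rewrite expr_div_n -mulrA; congr (_ * _).
  have -> : sg i b ^+ n = sg i b ^+ l * sg i b ^+ (n - l) by rewrite -exprD subnKC // ltnW.
  by rewrite mulKf // expf_neq0.
move=> H0; have := E j b0; rewrite H0 mul0r => /esym /(nr_ker nrA j').
rewrite -(E j' b0') => /eqP; rewrite mulf_eq0 (negPf (expf_neq0 _ b0')) orbF; by move/eqP.
Qed.

End ConjugateMultiplicity.

Section ValuationMultiplicity.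
Variables (O : algC -> Prop) (p : nat).
Hypotheses (vO : valuation_ring O) (pp : prime p) (Np : ~ O (p%:R)^-1).

(** Multiplied by [y^t], with [y] the inverse of [x], the polynomial has coefficients divisible by
    [p^(tn)]. The factors [y X - 1] have constant term -1, so they can be cancelled without losing
    divisibility; the cofactor has the leading coefficient of [q], a nonzero integer. *)
Lemma vr_root_power (q : {poly algC}) x t n : q != 0 -> q \is a polyOver Num.int ->
  ('X - x%:P) ^+ t %| q -> x != 0 -> O (x^-1 / p%:R ^+ n) -> p%:R ^+ (t * n) <= tnorm (m:=1) q.
Proof.
move=> q0 qi /dvdpP [r qE] x0 Hx; pose y := x^-1; pose c : algC := p%:R ^+ (t * n).
have p0 : p%:R != 0 :> algC by rewrite pnatr_eq0 -lt0n prime_gt0.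
have c0 : c != 0 by exact: expf_neq0.
have Oy : O y.
  have -> : y = x^-1 / p%:R ^+ n * p%:R ^+ n by rewrite divfK ?expf_neq0.
  by apply: (vrM vO) => //; apply: (vrX vO); exact: (vr_nat vO).
pose inc (f : {poly algC}) := forall i, O (f`_i / c).
have step f : inc ((y *: 'X - 1) * f) -> inc f.
  have E i : f`_i = y * ('X * f)`_i - ((y *: 'X - 1) * f)`_i.
    by rewrite mulrBl mul1r coefB -scalerAl coefZ opprB addrC subrK.
  move=> Hf; elim=> [|i IH]; rewrite E mulrBl; apply: (vrB vO) => //; rewrite coefXM /=.
    by rewrite mulr0 mul0r; exact: (vr0 vO).
  by rewrite -mulrA; apply: (vrM vO).
have steps k f : inc ((y *: 'X - 1) ^+ k * f) -> inc f.
  elim: k f => [|k IH] f; first by rewrite expr0 mul1r.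
  by rewrite exprS -mulrA => /step /IH.
have Hr : inc r.
  apply: (steps t); have -> : (y *: 'X - 1) ^+ t * r = y ^+ t *: q.
    rewrite qE -[y *: 'X - 1](_ : y *: ('X - x%:P) = _); last first.
      by rewrite scalerBr -[y *: x%:P]mul_polyC -polyCM mulVf.
    by rewrite exprZn -scalerAl [_ * r]mulrC.
  move=> i; rewrite coefZ mulrAC; apply: (vrM vO); last by apply: (vr_int vO); exact: (polyOverP qi).
  by rewrite /c mulnC exprM -expr_div_n; exact: (vrX vO).
have lq : lead_coef q = lead_coef r.
  by rewrite qE lead_coefM lead_coef_exp lead_coefXsubC expr1n mulr1.
have /intrP [z Ez] : lead_coef q \is a Num.int by rewrite lead_coefE; exact: (polyOverP qi).
have := Hr (size r).-1; rewrite -lead_coefE -lq Ez => /(vr_int_dvd vO pp Np) Hd.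
have z0 : (0 < `|z|)%N by rewrite absz_gt0 -(intr_eq0 algC) -Ez lead_coef_eq0.
apply: le_trans (_ : _ <= `|lead_coef q|) _; last first.
  have := coef_sum_root_power (t := 0) (x := 1) (q := q); rewrite expr0 mul1r; apply; first exact: dvd1p.
  by rewrite normr1.
rewrite Ez -intr_norm -natrX -[_%:R]/((Posz _)%:~R) ler_int -abszE lez_nat; exact: dvdn_leq.
Qed.

End ValuationMultiplicity.

Lemma expr_unbounded (c : algC) (M : nat) : 1 < c -> exists2 k, (0 < k)%N & M%:R <= c ^+ k.
Proof.
move=> c1; have e0 : 0 < c - 1 by rewrite subr_gt0.
have [k Hk] : exists k, M%:R / (c - 1) < k%:R by exists (Num.Def.archi_bound (M%:R / (c - 1))); apply: archi_boundP; rewrite divr_ge0 // ltW.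
have B j : 1 + j%:R * (c - 1) <= c ^+ j.
  elim: j => [|j IH]; first by rewrite mul0r addr0.
  have H : c * (1 + j%:R * (c - 1)) <= c ^+ j.+1 by rewrite exprS ler_wpM2l // ltW // (lt_trans ltr01).
  apply: le_trans H; rewrite -subr_ge0.
  have -> : c * (1 + j%:R * (c - 1)) - (1 + j.+1%:R * (c - 1)) = j%:R * (c - 1) ^+ 2.
    by rewrite -natr1; ring.
  by rewrite mulr_ge0 // exprn_ge0 // ltW.
exists k.+1 => //; apply: le_trans (B k.+1); apply: ler_wpDl => //.
rewrite -ler_pdivrMr //; apply: ltW; apply: lt_le_trans Hk _; by rewrite ler_nat.
Qed.

Section RatioMultiplicity.
Variables (A : comNzRingType) (g : nat) (sg : 'I_g -> {rmorphism A -> algC}) (om : 'I_g -> A).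
Hypothesis nrA : number_ring sg om.
Variables (j0 : 'I_g) (G0 G1 : A).
Hypotheses (G00 : sg j0 G0 != 0) (G10 : sg j0 G1 != 0).
Hypothesis rho_free : ratio_root_free (sg j0 G1 / sg j0 G0).

Lemma bounded_pigeonhole (a : nat -> A) (C : algC) : (forall k j, `|sg j (a k)| <= C) ->
  exists k l, (k < l)%N /\ sg j0 (a k) = sg j0 (a l).
Proof.
move=> aC; have [z Hz] := fun_choice (fun k => nr_span nrA (a k)).
pose Om := \matrix_(i, j) sg j (om i); have Ou : Om \in unitmx := nr_unit nrA.
have zE k i : (z k i)%:~R = \sum_j sg j (a k) * invmx Om j i.
  have E : (\row_i (z k i)%:~R) *m Om = \row_j sg j (a k).
    by apply/rowP => j; rewrite !mxE Hz; apply: eq_bigr => l _; rewrite !mxE.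
  have := congr1 (mulmxr (invmx Om)) E; rewrite /= mulmxK // => /rowP /(_ i); rewrite !mxE => ->.
  by apply: eq_bigr => j _; rewrite mxE.
pose B := \sum_i \sum_j C * `|invmx Om j i|.
have C0 : 0 <= C by exact: le_trans (aC 0%N j0).
have zB k i : `|(z k i)%:~R| <= B.
  apply: le_trans (_ : _ <= \sum_j C * `|invmx Om j i|) _; last first.
    rewrite /B [X in _ <= X](bigD1 i) //= lerDl.
    by apply: sumr_ge0 => l _; apply: sumr_ge0 => j _; rewrite mulr_ge0.
  rewrite zE; apply: le_trans (ler_norm_sum _ _ _) _; apply: ler_sum => j _; rewrite normrM; exact: ler_wpM2r.
have B0 : 0 <= B by apply: sumr_ge0 => i _; apply: sumr_ge0 => j _; rewrite mulr_ge0.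
have [M HM] : exists M, B < M%:R by exists (Num.Def.archi_bound B); exact: archi_boundP.
have zM0 k i : (absz (z k i) < M)%N.
  rewrite -(ltr_nat algC); apply: le_lt_trans HM; apply: le_trans (zB k i).
  by rewrite -intr_norm -abszE.
have zM k i : (absz (z k i + M%:Z)%R < (2 * M).+1)%N by have := zM0 k i; lia.
pose T : finType := {ffun 'I_g -> 'I_(2 * M).+1}.
pose F (k : 'I_(#|T|.+1)) : T := [ffun i => Ordinal (zM k i)].
have [k [l [ne E]]] : exists k l, k != l /\ F k = F l.
  apply: NNPP => no; have inj : injective F.
    by move=> k l E; apply/eqP/negPn/negP => ne; apply: no; exists k, l.
  by have := leq_card _ inj; rewrite card_ord ltnn.
have {}E : sg j0 (a k) = sg j0 (a l).
  rewrite !Hz; apply: eq_bigr => i _; congr (_%:~R * _).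
  have := congr1 (fun f : T => val (f i)) E; rewrite !ffunE /=.
  have := zM0 k i; have := zM0 l i; move: (z k i) (z l i) => u v; clear; case: u => u; case: v => v; lia.
move: ne; rewrite neq_ltn => /orP[lt|lt]; [by exists k, l | by exists l, k].
Qed.

(** Kronecker's theorem. If [rho] were integral, its powers reduced modulo its minimal polynomial
    and multiplied by a fixed power of [G0] would lie in the ring with bounded conjugates. Two of
    them would coincide, making [rho] a root of unity. *)
Lemma kronecker : (forall j, `|sg j G1| <= `|sg j G0|) -> sg j0 G1 / sg j0 G0 \notin Aint.
Proof.
move=> le; apply/negP => rA; set rho := _ / _ in rA.
have [f Ef] := floorpP (rA : minCpoly rho \is a polyOver Num.int).
have fmon : f \is monic.
  have E : lead_coef (map_poly intr f) = (lead_coef f)%:~R :> algC by rewrite lead_coef_map_inj //; exact: intr_inj.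
  have := minCpoly_monic rho; rewrite Ef monicE.
  by rewrite E -[1]/(1%:~R) eqr_int monicE.
have fr : (map_poly intr f).[rho] = 0 by rewrite -Ef; apply/rootP; exact: root_minCpoly.
pose e := size f; pose rem k : {poly int} := Pdiv.Ring.rmodp 'X^k f.
have remE k : rho ^+ k = (map_poly intr (rem k)).[rho].
  have := Pdiv.RingMonic.rdivp_eq fmon 'X^k => /(congr1 (fun h => (map_poly intr h).[rho])).
  by rewrite map_polyXn hornerXn rmorphD rmorphM /= hornerD hornerM fr mulr0 add0r.
have remS k : (size (rem k) <= e)%N by apply: ltnW; apply: Pdiv.Ring.ltn_rmodpN0; exact: monic_neq0.
pose a k := \sum_(i < e) ((rem k)`_i)%:~R * (G1 ^+ i * G0 ^+ (e - i)).
have aE k : sg j0 (a k) = rho ^+ k * sg j0 G0 ^+ e.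
  rewrite remE (@horner_coef_wide _ e); last by rewrite (leq_trans (size_poly _ _)).
  rewrite rmorph_sum mulr_suml; apply: eq_bigr => i _; rewrite coef_map_id0 //.
  rewrite rmorphM rmorph_int rmorphM !rmorphXn -mulrA; congr (_ * _).
  have -> : sg j0 G0 ^+ e = sg j0 G0 ^+ i * sg j0 G0 ^+ (e - i) by rewrite -exprD subnKC // ltnW.
  by rewrite mulrA -exprMn divfK.
have aj k j : sg j (a k) * sg j G0 ^+ k = sg j G1 ^+ k * sg j G0 ^+ e.
  have : sg j0 (a k * G0 ^+ k - G1 ^+ k * G0 ^+ e) = 0.
    rewrite rmorphB !rmorphM !rmorphXn aE mulrAC -exprMn divfK //; exact: subrr.
  by move/(nr_ker nrA j)/eqP; rewrite rmorphB !rmorphM !rmorphXn subr_eq0 => /eqP.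
pose C := \sum_j `|sg j G0| ^+ e.
have [|k [l [kl E]]] := @bounded_pigeonhole a C.
  move=> k j; apply: le_trans (_ : `|sg j G0| ^+ e <= C); last first.
    by rewrite /C (bigD1 j) //= lerDl; apply: sumr_ge0 => i _; exact: exprn_ge0.
  have G0j : sg j G0 != 0 := nr_neq0 nrA j G00.
  have p0 : 0 < `|sg j G0| ^+ k by rewrite exprn_gt0 // normr_gt0.
  rewrite -(ler_pM2r p0) -normrX -normrM aj normrM !normrX mulrC; apply: ler_wpM2l; first exact: exprn_ge0.
  by rewrite lerXn2r ?nnegrE.
move: E; rewrite !aE => /(mulIf (expf_neq0 _ G00)) E.
have r0 : rho != 0 by rewrite mulf_neq0 ?invr_eq0.
have lk : (0 < l - k)%N by rewrite subn_gt0.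
move/eqP: (rho_free lk); apply; apply: (mulIf (expf_neq0 k r0)).
by rewrite -exprD subnK ?mul1r // ltnW.
Qed.

Lemma norm_lower_bound q p n Z j : (forall j', `|sg j' Z| ^+ q <= p%:R ^+ n) -> sg j0 Z != 0 ->
  1 <= `|sg j Z| ^+ q * p%:R ^+ (n * g.-1).
Proof.
move=> ZB Z0; have N1 := nr_norm_ge1 nrA Z0.
have H1 : 1 <= \prod_j `|sg j Z| ^+ q by rewrite prodrXl exprn_ege1.
apply: le_trans H1 _; rewrite (bigD1 j) //=; apply: ler_wpM2l; first exact: exprn_ge0.
have -> : p%:R ^+ (n * g.-1) = \prod_(i < g | i != j) p%:R ^+ n :> algC by rewrite prodr_const cardC1 card_ord exprM.
apply: ler_prod => i _; by rewrite exprn_ge0 //= ZB.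
Qed.

Definition ratio_root Z0 Z1 n := - (sg j0 Z1 * sg j0 G1 ^+ n / (sg j0 Z0 * sg j0 G0 ^+ n)).

(** If some conjugate of [G1/G0] exceeds 1 in modulus, the point is large at that embedding and the
    archimedean estimate applies. Otherwise [kronecker] shows that [G1/G0] is not integral, and the
    estimate is made in a valuation ring that excludes it. In both cases the norm of [Z1] limits how
    much the coefficients can spoil. *)
Lemma ratio_mult_bound p : prime p -> exists q zz n1, [/\ (0 < q)%N, (0 < zz)%N & forall n Z0 Z1, (n1 <= n)%N ->
  sg j0 Z0 != 0 -> sg j0 Z1 != 0 -> (forall j, `|sg j Z0| ^+ q <= p%:R ^+ n) ->
  (forall j, `|sg j Z1| ^+ q <= p%:R ^+ n) -> root_mult_bound (ratio_root Z0 Z1 n) n zz].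
Proof.
move=> pp; have p1 := prime_gt1 pp; have p0 := prime_gt0 pp.
have pn0 n : 0 <= p%:R ^+ n :> algC by rewrite exprn_ge0.
have g0 : (0 < g)%N by case: (g) j0 => [[]|].
have [[j1 Hj]|no] := classic (exists j, ~ `|sg j G1| <= `|sg j G0|).
  have {}Hj : `|sg j1 G0| < `|sg j1 G1| by rewrite real_ltNge ?normr_real //; apply/negP.
  have G0j : 0 < `|sg j1 G0| by rewrite normr_gt0; exact: (nr_neq0 nrA _ G00).
  (* The factor [p^g] absorbs the coefficients: one [p] for the size of [Z0] and [g - 1] for the
     lower bound on the conjugates of [Z1]. What is left is [|x|^q >= 4^n]. *)
  have [|q q0 Hq] := @expr_unbounded (`|sg j1 G1| / `|sg j1 G0|) (4 * p ^ g).
    by rewrite ltr_pdivlMr // mul1r.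
  exists q, q, q; split=> // n Z0 Z1 qn Z00 Z10 B0 B1 f t f0 fi Hdiv.
  have rE : ratio_root Z0 Z1 n = sg j0 (- (Z1 * G1 ^+ n)) / sg j0 (Z0 * G0 ^+ n).
    by rewrite rmorphN !rmorphM !rmorphXn mulNr.
  have b0 : sg j0 (Z0 * G0 ^+ n) != 0 by rewrite rmorphM rmorphXn mulf_neq0 ?expf_neq0.
  have Hdiv1 := conj_multiplicity nrA j1 b0 fi (eq_rect _ (fun x => ('X - x%:P) ^+ t %| f) Hdiv _ rE).
  set x := _ / _ in Hdiv1.
  have xE : `|x| = `|sg j1 Z1| / `|sg j1 Z0| * (`|sg j1 G1| / `|sg j1 G0|) ^+ n.
    rewrite /x rmorphN !rmorphM !rmorphXn normrM normrN normfV !normrM !normrX expr_div_n invfM; exact: mulrACA.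
  have Z0j : 0 < `|sg j1 Z0| ^+ q by rewrite exprn_gt0 // normr_gt0; exact: (nr_neq0 nrA _ Z00).
  have R1 : 4 ^+ n <= `|x| ^+ q.
    rewrite xE exprMn expr_div_n mulrAC ler_pdivlMr //.
    have H1 : 4 ^+ n * (p%:R ^+ (n * g.-1) * p%:R ^+ n) <= ((`|sg j1 G1| / `|sg j1 G0|) ^+ n) ^+ q.
      rewrite -exprD -mulnSr prednK // [(n * g)%N]mulnC exprM -exprMn -exprM mulnC exprM.
      by apply: lerXn2r => //; rewrite ?nnegrE ?exprn_ge0 ?divr_ge0 // ?mulr_ge0 // -natrX -natrM.
    have H2 := norm_lower_bound j1 B1 Z10.
    apply: le_trans (_ : _ <= 4 ^+ n * p%:R ^+ n * (`|sg j1 Z1| ^+ q * p%:R ^+ (n * g.-1))) _.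
      rewrite -[X in X <= _]mulr1; apply: ler_pM => //; rewrite ?mulr_ge0 ?exprn_ge0 //.
      by apply: ler_wpM2l => //; exact: exprn_ge0.
    have -> : 4 ^+ n * p%:R ^+ n * (`|sg j1 Z1| ^+ q * p%:R ^+ (n * g.-1)) =
       `|sg j1 Z1| ^+ q * (4 ^+ n * (p%:R ^+ (n * g.-1) * p%:R ^+ n)).
      by move: (4 ^+ n : algC) (p%:R ^+ n : algC) (`|_| ^+ q) (p%:R ^+ _) => a b c e; ring.
    by apply: ler_wpM2l => //; exact: exprn_ge0.
  have R4 : 4 <= `|x|.
    rewrite -(ler_pXn2r q0) ?nnegrE //; apply: le_trans R1.
    by rewrite -!natrX ler_nat leq_exp2l.
  have x1 : 1 <= `|x| by apply: le_trans R4; rewrite ler1n.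
  have x10 : 0 <= `|x| - 1 by rewrite subr_ge0.
  have R2 : 2 ^+ n <= (`|x| - 1) ^+ q.
    have q2 : 0 < 2 ^+ q :> algC by rewrite exprn_gt0.
    rewrite -(ler_pM2l q2) -exprMn; apply: le_trans (_ : _ <= `|x| ^+ q) _; last first.
      apply: lerXn2r; rewrite ?nnegrE ?mulr_ge0 //.
      rewrite -subr_ge0 (_ : _ - _ = `|x| - 2); last by ring.
      by rewrite subr_ge0; apply: le_trans R4; rewrite ler_nat.
    apply: le_trans R1; rewrite -[4]/((2 * 2)%:R) natrM exprMn; apply: ler_wpM2r; first exact: exprn_ge0.
    by rewrite -!natrX ler_nat leq_exp2l.
  rewrite mulnC exprM; apply: le_trans (_ : _ <= ((`|x| - 1) ^+ q) ^+ t) _.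
    by apply: lerXn2r; rewrite ?nnegrE ?exprn_ge0.
  rewrite -exprM mulnC exprM; apply: lerXn2r; rewrite ?nnegrE ?exprn_ge0 ?(@tnorm_ge0 1) //.
  have := coef_sum_root_power Hdiv1 x1; apply: le_trans; rewrite -[X in X <= _]mulr1; apply: ler_wpM2l.
    exact: exprn_ge0.
  by rewrite norm_intr_ge1 ?lead_coef_eq0 // lead_coefE; exact: (polyOverP fi).
have le j : `|sg j G1| <= `|sg j G0| by apply: NNPP => H; apply: no; exists j.
have rN := kronecker le; set rho := _ / _ in rN.
have [W vW NW] := valuation_ring_exists rN.
have [l lp Nl] := residue_prime vW NW; have [s s0 Hs] := residue_power vW lp Nl NW.
have l1 := prime_gt1 lp.
have l0 : l%:R != 0 :> algC by rewrite pnatr_eq0 -lt0n prime_gt0.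
(* This [q] forces the exponent [e] of [l] in the norm of [Z1] to satisfy [4 s e <= n], so at least
   half of the divisibility of [rho^-n] survives the division by [Z1]: that is [n <= 2 s n']. *)
pose q := (4 * s * (p * g))%N.
exists q, (2 * s)%N, (4 * s)%N; split; rewrite /q ?muln_gt0 ?s0 ?p0 ?g0 // -/q.
move=> n Z0 Z1 sn Z00 Z10 B0 B1 f t f0 fi Hdiv.
have [N HN] : exists N : int, \prod_j sg j Z1 = N%:~R by apply/intrP; exact: (nr_norm_int nrA).
have N0 : N != 0.
  by rewrite -(intr_eq0 algC) -HN; apply/prodf_neq0 => j _; exact: (nr_neq0 nrA _ Z10).
have aN0 : (0 < `|N|)%N by rewrite absz_gt0.
have [c cop EN] := pfactor_coprime lp aN0; set e := logn l `|N| in EN.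
have Ne : (q * e <= n * (p * g))%N.
  have H1 : `|N%:~R| ^+ q <= p%:R ^+ (n * g) :> algC.
    have -> : p%:R ^+ (n * g) = \prod_(i < g) p%:R ^+ n :> algC by rewrite prodr_const card_ord exprM.
    rewrite -HN normr_prod -prodrXl; apply: ler_prod => j _.
    by rewrite exprn_ge0 //= B1.
  have H2 : (2 ^ (q * e) <= 2 ^ (n * (p * g)))%N.
    rewrite -(ler_nat algC) !natrX; apply: le_trans (_ : _ <= `|N%:~R| ^+ q) _.
      rewrite mulnC exprM; apply: lerXn2r; rewrite ?nnegrE ?exprn_ge0 //.
      rewrite -intr_norm -natrX -[_%:R]/((Posz _)%:~R) ler_int -abszE lez_nat EN.
      apply: leq_trans (leq_pmull _ _); first by apply: leq_trans (_ : l ^ e <= _)%N => //; case: (e) => // k; rewrite leq_exp2r.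
      by rewrite lt0n; apply: contraTneq aN0 => c0; rewrite EN c0.
    apply: le_trans H1 _; rewrite -!natrX ler_nat (_ : n * (p * g) = p * (n * g))%N; last by ring.
    rewrite [X in (_ <= X)%N]expnM; case: (n * g)%N => // k; rewrite leq_exp2r //; exact: ltnW (ltn_expl _ _).
  by rewrite leq_exp2l in H2.
have e4 : (4 * s * e <= n)%N.
  by move: Ne; rewrite /q mulnAC leq_pmul2r // muln_gt0 p0.
pose n' := (n %/ s - e)%N.
have n'n : (n <= 2 * s * n')%N.
  have := divn_eq n s; have := ltn_pmod n s0; move: e4 sn; rewrite /n' mulnBr -!mulnA.
  rewrite [((n %/ s) * s)%N]mulnC; move: (s * e)%N (s * (n %/ s))%N (n %% s)%N; clear; lia.
have c0 : (0 < c)%N by rewrite lt0n; apply: contraTneq aN0 => c0; rewrite EN c0.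
have Wc : W (c%:R)^-1.
  have := @vr_coprime_unit W vW l lp Nl c; rewrite -[c%:~R]/(c%:R); apply.
  by rewrite dvdzE /= -prime_coprime.
have HZ : W (l%:R ^+ e / sg j0 Z1).
  have E : l%:R ^+ e / sg j0 Z1 = ((-1) ^+ (N < 0)%R * \prod_(j | j != j0) sg j Z1) * (c%:R)^-1.
    have := HN; rewrite (bigD1 j0) //= => HN'.
    have EN' : N%:~R = (-1) ^+ (N < 0)%R * (c%:R * l%:R ^+ e) :> algC.
      rewrite {1}[N]intEsign rmorphM rmorph_sign /= -[(Posz _)%:~R]/(_%:R) EN natrM natrX; done.
    have c0' : c%:R != 0 :> algC by rewrite pnatr_eq0 -lt0n.
    move: HN' EN'; rewrite -/(N%:~R); have := sqrr_sign algC (N < 0)%R; rewrite expr2.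
    move: ((-1) ^+ _) (\prod_(j | _) _) => sn' P ss HN' EN'; apply: (mulIf Z10); rewrite divfK //.
    transitivity (sn' * (sg j0 Z1 * P) / c%:R); first by rewrite HN' EN' [sn' * (sn' * _)]mulrA ss mul1r mulrC mulKf.
    by move: (c%:R^-1) (sg j0 Z1) => a b; ring.
  rewrite E; apply: (vrM vW) => //; apply: (vrM vW).
    by apply: (vr_int vW); exact: rpred_sign.
  apply: (vr_Aint vW); apply: rpred_prod => j _; exact: (nr_Aint nrA).
have Wr : W rho^-1 := vrV vW NW.
have Hn : W (rho^-1 ^+ n / l%:R ^+ (n %/ s)).
  rewrite {1}(divn_eq n s) exprD mulnC exprM mulrAC -expr_div_n.
  by apply: (vrM vW); exact: (vrX vW).
have x0 : ratio_root Z0 Z1 n != 0.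
  by rewrite /ratio_root oppr_eq0 !mulf_neq0 ?invr_eq0 ?mulf_neq0 ?expf_neq0.
have Hx : W ((ratio_root Z0 Z1 n)^-1 / l%:R ^+ n').
  apply: (@vr_div_le W l vW lp _ _ (n %/ s - e)%N) => //.
  have [le1|lt1] := leqP e (n %/ s)%N; last first.
    move: n'n; rewrite /n' (_ : (n %/ s - e = 0)%N) ?muln0 ?leqn0; last by apply/eqP; rewrite subn_eq0 ltnW.
    by move=> /eqP n0; move: sn; rewrite n0 leqn0 muln_eq0 /= => /eqP s00; move: s0; rewrite s00.
  have -> : (ratio_root Z0 Z1 n)^-1 / l%:R ^+ (n %/ s - e) =
      - (sg j0 Z0 * (l%:R ^+ e / sg j0 Z1) * (rho^-1 ^+ n / l%:R ^+ (n %/ s))).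
    have -> : l%:R ^+ (n %/ s) = l%:R ^+ (n %/ s - e) * l%:R ^+ e :> algC by rewrite -exprD subnK.
    have := expf_neq0 e l0; have := expf_neq0 (n %/ s - e) l0.
    rewrite /ratio_root /rho invf_div expr_div_n.
    have := expf_neq0 n G10; have := expf_neq0 n G00; move: Z00 Z10.
    move: (sg j0 Z0) (sg j0 Z1) (sg j0 G0 ^+ n) (sg j0 G1 ^+ n) (l%:R ^+ _) (l%:R ^+ _) => a b u v y z.
    by move=> a0 b0 u0 v0 y0 z0; field; rewrite a0 b0 u0 v0 y0 z0.
  apply: (vrN vW).
  by apply: (vrM vW) => //; apply: (vrM vW) => //; exact: (vr_sg nrA).
have := vr_root_power vW lp Nl f0 fi Hdiv x0 Hx => H.
apply: le_trans (_ : _ <= (l%:R ^+ (t * n')) ^+ (2 * s)) _; last first.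
  by apply: lerXn2r; rewrite ?nnegrE ?exprn_ge0 ?(@tnorm_ge0 1).
rewrite -exprM -!natrX ler_nat; apply: leq_trans (_ : 2 ^ (t * n' * (2 * s)) <= _)%N.
  by rewrite leq_exp2l // -mulnA leq_mul2l [(n' * _)%N]mulnC n'n orbT.
by case: (t * n' * (2 * s))%N => // k; rewrite leq_exp2r.
Qed.

End RatioMultiplicity.

(** * Counting small vectors in congruence classes *)

Record conjugation (A : comNzRingType) (g : nat) (sg : 'I_g -> {rmorphism A -> algC})
    (cj : 'I_g -> 'I_g) (ii : A) (kp : nat) : Prop := Conjugation {
  cj_inv : involutive cj;
  cj_sg : forall j a, sg (cj j) a = (sg j a)^*;
  kp_gt0 : (0 < kp)%N;
  ii_sg : forall j, sg j ii = 'i * kp%:R \/ sg j ii = - ('i * kp%:R) }.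

Definition cpart (b : bool) (x : algC) := if b then 'Re x else 'Im x.

Lemma cpart_real b x : cpart b x \is Num.real.
Proof. by case: b; [exact: Creal_Re | exact: Creal_Im]. Qed.

Lemma cpartB b x y : cpart b (x - y) = cpart b x - cpart b y.
Proof. by case: b; rewrite /cpart raddfB. Qed.

Lemma cpart_norm b x : `|cpart b x| <= `|x|.
Proof.
have n2 : `|2^-1 : algC| = 2^-1 by rewrite ger0_norm // invr_ge0.
have tw : `|x| = (`|x| + `|x|) / 2 by rewrite -mulr2n -[_ *+ 2]mulr_natr mulfK // pnatr_eq0.
case: b; rewrite /cpart ?ReE ?ImE ?normrM ?normCi ?mul1r ?normrM ?n2 tw;
  apply: ler_wpM2r; rewrite ?invr_ge0 //.
  by apply: le_trans (ler_normD _ _) _; rewrite norm_conjC.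
rewrite -?mulrA ?normrM ?normCi ?mul1r; apply: le_trans (ler_normB _ _) _; by rewrite norm_conjC.
Qed.

Lemma norm_le_cparts x : `|x| <= `|cpart true x| + `|cpart false x|.
Proof.
by rewrite {1}[x]Crect; apply: le_trans (ler_normD _ _) _; rewrite normrM normCi mul1r.
Qed.

Lemma truncn_eq_dist (x y : algC) : 0 <= x -> 0 <= y -> Num.truncn x = Num.truncn y -> `|x - y| < 1.
Proof.
move=> x0 y0 E; have /andP[x1 x2] := truncn_itv x0; have /andP[y1 y2] := truncn_itv y0.
rewrite -E -natr1 in y1 y2; rewrite -natr1 in x2; move: (_%:R) x1 x2 y1 y2 => t x1 x2 y1 y2.
rewrite real_ltr_norml ?rpredB ?ger0_real // ltrBlDr ltrBrDl; apply/andP; split.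
  by rewrite ltrBlDr; apply: lt_le_trans y2 _; rewrite lerD2r.
by apply: lt_le_trans x2 _; rewrite addrC lerD2l.
Qed.

Section Pigeonhole.
Variables (A : comNzRingType) (g : nat) (sg : 'I_g -> {rmorphism A -> algC}) (om : 'I_g -> A).
Hypothesis nrA : number_ring sg om.
Variables (cj : 'I_g -> 'I_g) (ii : A) (kp : nat).
Hypothesis cjA : conjugation sg cj ii kp.

(* As ['i] belongs to the field, every archimedean place is complex; this picks
   one of the two embeddings of each. *)
Definition half_place : finType := {j : 'I_g | sg j ii == 'i * kp%:R}.

Lemma half_place_conj j : (sg (cj j) ii == 'i * kp%:R) = ~~ (sg j ii == 'i * kp%:R).
Proof.
have k0 : 'i * kp%:R != 0 :> algC by rewrite mulf_neq0 ?neq0Ci // pnatr_eq0 -lt0n (kp_gt0 cjA).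
have ne : (- ('i * kp%:R) == 'i * kp%:R :> algC) = false.
  by apply/negbTE; rewrite eq_sym -addr_eq0 -mulr2n mulrn_eq0 negb_or.
have cE : ('i * kp%:R)^* = - ('i * kp%:R) :> algC by rewrite rmorphM /= conjCi conjC_nat mulNr.
rewrite (cj_sg cjA); have [->|->] := ii_sg cjA j; first by rewrite cE ne eqxx.
by rewrite rmorphN /= cE opprK eqxx ne.
Qed.

Lemma card_half_place : (#|half_place| * 2 = g)%N.
Proof.
rewrite card_sig; set P := fun j => _.
have E : #|[pred j | P j]| = #|[predC [pred j | P j]]|.
  rewrite -(card_image (can_inj (cj_inv cjA)) [pred j | P j]); apply: eq_card => j.
  rewrite !inE; apply/imageP/idP => [[j' Hj ->]|Hj].
    by rewrite /P half_place_conj negbK.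
  by exists (cj j); rewrite ?inE ?(cj_inv cjA) // /P half_place_conj.
have Hg : (#|[pred j | P j]| + #|[pred j | P j]| = g)%N by rewrite {2}E cardC card_ord.
by rewrite -[RHS]Hg muln2 addnn.
Qed.

Variables (O : algC -> Prop) (p : nat) (j0 : 'I_g) (s : nat).
Hypotheses (vO : valuation_ring O) (pp : prime p).
Hypothesis Hcl : forall k, exists cl : algC -> {ffun 'I_s -> 'I_(p ^ k).-1.+1}, forall x y,
    nr_frac sg j0 x -> O x -> nr_frac sg j0 y -> O y -> cl x = cl y -> O ((x - y) / p%:R ^+ k).

(** Box principle in the spirit of Minkowski's theorem: two vectors share the residue class modulo
    [p^n], one of [p^(s n)], and, for the real and imaginary parts at every place, the cell of side
    about [p^be]. Each complex place counts for two real dimensions, whence the factor 2; [C0]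
    absorbs [L0] and the basis. *)
Lemma small_congruent_vector k L0 : (0 < L0)%N -> exists C0, forall n (eta : 'I_k -> algC) (be : 'I_k * half_place -> nat),
  (forall i, O (eta i)) -> (forall i, nr_frac sg j0 (eta i)) ->
  (s * n + C0 < 2 * \sum_c be c)%N ->
  exists y : 'I_k -> A, [/\ exists i, sg j0 (y i) != 0, O (\sum_i sg j0 (y i) * eta i / p%:R ^+ n) &
    forall i (j : half_place), L0%:R * `|sg (val j) (y i)| < p%:R ^+ be (i, j)].
Proof.
move=> L00; pose Call := \sum_j \sum_l `|sg j (om l)|.
have Call0 : 0 <= Call by apply: sumr_ge0 => j _; apply: sumr_ge0.
have [C HC] : exists C : nat, Call < C%:R by exists (Num.Def.archi_bound Call); exact: archi_boundP.
pose C2 := (2 * C * (2 * L0)).+1; pose I : finType := ('I_k * half_place)%type.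
exists (C2 * (2 * #|I|))%N => n eta be Oeta Feta Hbe.
have [cl Hcl'] := Hcl n.
(* The integer coordinates range up to [p^B]; with [B] the total, no difference [B - be c] is
   truncated. *)
pose B := (\sum_c be c)%N; pose M := (p ^ B)%N.
have p0 : (0 < p)%N := prime_gt0 pp.
have M0 : (0 < M)%N by rewrite expn_gt0 p0.
pose S : finType := {ffun 'I_k * 'I_g -> 'I_M}.
pose y (z : S) i : A := \sum_l om l *+ z (i, l).
have yb z i j : `|sg j (y z i)| <= (C * M)%:R.
  rewrite rmorph_sum; apply: le_trans (ler_norm_sum _ _ _) _.
  rewrite natrM; apply: le_trans (_ : _ <= (\sum_l `|sg j (om l)|) * M%:R) _.
    rewrite mulr_suml; apply: ler_sum => l _; rewrite rmorphMn normrMn -[X in X <= _]mulr_natr.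
    by apply: ler_wpM2l => //; rewrite ler_nat ltnW.
  apply: ler_wpM2r => //; apply: le_trans (ltW HC); rewrite /Call [X in _ <= X](bigD1 j) //= lerDl.
  by apply: sumr_ge0 => i' _; apply: sumr_ge0.
pose u (b : bool) z i j := (cpart b (sg j (y z i)) + (C * M)%:R) * (2 * L0)%:R.
have u0 b z i j : 0 <= u b z i j.
  apply: mulr_ge0 => //; rewrite -lerBlDr sub0r lerNl.
  apply: le_trans (yb z i j); apply: le_trans (cpart_norm b _).
  by rewrite -normrN; apply: real_ler_norm; rewrite rpredN cpart_real.
have ub b z i j : u b z i j <= (2 * C * (2 * L0) * M)%:R.
  have -> : (2 * C * (2 * L0) * M)%:R = (C * M + C * M)%:R * (2 * L0)%:R :> algC.
    by rewrite -natrM; congr (_%:R); ring.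
  apply: ler_wpM2r => //; rewrite natrD lerD2r.
  apply: le_trans (yb z i j); apply: le_trans (cpart_norm b _).
  by apply: real_ler_norm; exact: cpart_real.
have beB c : (be c <= B)%N by rewrite /B (bigD1 c) //= leq_addr.
pose K c := (C2 * p ^ (B - be c))%N.
pose cell b z (c : I) := Num.truncn (u b z c.1 (val c.2) / p%:R ^+ be c).
have pb0 e : 0 < p%:R ^+ e :> algC by rewrite exprn_gt0 // ltr0n.
have cell0 b z (c : I) : 0 <= u b z c.1 (val c.2) / p%:R ^+ be c by rewrite divr_ge0 // ltW.
have cellK b z c : (cell b z c < K c)%N.
  rewrite truncn_lt_nat //; rewrite ltr_pdivrMr //; apply: le_lt_trans (ub _ _ _ _) _.
  rewrite -natrX -natrM ltr_nat /K -[X in (_ < X)%N]mulnA -expnD subnK // -/M ltn_mul2r M0 /=; exact: ltnSn.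
pose Km := (\max_c K c)%N.
have KKm c : (K c <= Km)%N by exact: leq_bigmax.
pose T2 : finType := {ffun I * bool -> 'I_Km}.
pose cellf z : T2 := [ffun x => Ordinal (leq_trans (cellK x.2 z x.1) (KKm x.1))].
pose xv z := \sum_i sg j0 (y z i) * eta i.
pose F z := (cl (xv z), cellf z).
have xvO z : O (xv z) by apply: (vr_sum vO) => i _; apply: (vrM vO) => //; exact: (vr_sg nrA).
have xvF z : nr_frac sg j0 (xv z).
  by apply: nr_frac_sum => i _; apply: nr_fracM => //; exact: nr_frac_alg.
have [z [z' [ne E]]] : exists z z', z != z' /\ F z = F z'.
  apply: NNPP => no; have inj : injective F.
    by move=> z z' E; apply/eqP/negPn/negP => ne; apply: no; exists z, z'.
  pose fam := family (fun x : I * bool => [pred v : 'I_Km | (v < K x.1)%N]).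
  have : (#|S| <= #|setX [set: {ffun 'I_s -> 'I_(p ^ n).-1.+1}] [set f | f \in fam]|)%N.
    rewrite -(card_imset predT inj); apply: subset_leq_card; apply/subsetP => _ /imsetP [z _ ->].
    rewrite in_setX in_setT in_set /=; apply/familyP => x; rewrite inE ffunE /=; exact: cellK.
  rewrite cardsX cardsT !card_ffun !card_prod !card_ord cardsE /fam card_family foldrE big_map big_enum /=.
  have pn0 : (0 < p ^ n)%N by rewrite expn_gt0 p0.
  rewrite prednK // -(pair_bigA _ (fun c (b : bool) => #|[pred v : 'I_Km | (v < K c)%N]|)) /=.
  have cK c : (#|[pred v : 'I_Km | (v < K c)%N]| <= K c)%N.
    have winj : {in [pred v : 'I_Km | (v < K c)%N] &, injective (fun v : 'I_Km => inord v : 'I_(K c).-1.+1)}.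
      move=> v w; rewrite !inE => Hv Hw /(congr1 val); have K0 := leq_ltn_trans (leq0n _) Hv.
      by rewrite /= !inordK ?prednK // => /val_inj.
    have K0 : (0 < K c)%N by rewrite /K muln_gt0 expn_gt0 p0.
    by rewrite -(card_in_image winj) -[X in (_ <= X)%N](prednK K0) -[X in (_ <= X)%N]card_ord; exact: max_card.
  have Hprod : (\prod_c \prod_(b : bool) #|[pred v : 'I_Km | (v < K c)%N]| <= C2 ^ (2 * #|I|) * p ^ (2 * (#|I| * B - B)))%N.
    apply: leq_trans (_ : \prod_c (C2 ^ 2 * p ^ (2 * (B - be c))) <= _)%N.
      apply: leq_prod => c _; rewrite big_bool.
      apply: leq_trans (leq_mul (cK c) (cK c)) _; rewrite /K mulnACA -!expnD addnn -mul2n.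
      by rewrite -[(C2 * C2)%N]/(C2 ^ 2)%N.
    rewrite big_split /= prod_nat_const -expnM leq_mul2l -expn_sum; apply/orP; right.
    by rewrite -big_distrr /= sumnB // sum_nat_const.
  move=> H1; have := leq_trans H1 (leq_mul (leqnn _) Hprod).
  have IBk : (k * g * B = 2 * (#|I| * B))%N by rewrite /I card_prod card_ord -card_half_place; ring.
  rewrite -!expnM [(B * (k * g))%N]mulnC IBk.
  have C2p : (C2 ^ (2 * #|I|) <= p ^ (C2 * (2 * #|I|)))%N.
    rewrite [X in (_ <= X)%N]expnM; case: (2 * #|I|)%N => // e; rewrite leq_exp2r //; apply: ltnW; apply: ltn_expl; exact: prime_gt1.
  move=> H2; have := leq_trans H2 (leq_mul (leqnn _) (leq_mul C2p (leqnn _))).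
  rewrite -!expnD leq_exp2l ?prime_gt1 // mulnBr leqNgt => /negP; apply.
  have [E0|I0] := posnP #|I|.
    exfalso; move: Hbe; rewrite big_pred0 // => c; have : (0 < #|I|)%N by apply/card_gt0P; exists c.
    by rewrite E0.
  have : (B <= #|I| * B)%N by rewrite leq_pmull.
  by move: Hbe; rewrite -/B [(n * s)%N]mulnC; move: (s * n)%N (#|I| * B)%N (C2 * _)%N; clear; lia.
have [E1 E2] : cl (xv z) = cl (xv z') /\ cellf z = cellf z' by case: E.
exists (fun i => y z i - y z' i); split.
- have [[i l] Hil] : exists x, z x != z' x.
    by apply: NNPP => no; move/eqP: ne; apply; apply/ffunP => x; apply/eqP/negPn/negP => H; apply: no; exists x.
  exists i; apply/eqP => H0.
  have Hj j : \sum_l ((z (i, l) : int) - (z' (i, l) : int))%:~R * sg j (om l) = 0.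
    rewrite -[RHS](nr_ker nrA j H0) rmorphB !rmorph_sum -sumrB; apply: eq_bigr => l' _.
    by rewrite !rmorphMn rmorphB mulrBl /= !mulr_natl.
  have HM : (\row_l ((z (i, l) : int) - (z' (i, l) : int))%:~R : 'rV[algC]_g) *m (\matrix_(l, j) sg j (om l)) = 0.
    by apply/rowP => j; rewrite !mxE -[RHS](Hj j); apply: eq_bigr => l' _; rewrite !mxE.
  have := congr1 (mulmxr (invmx (\matrix_(l, j) sg j (om l)))) HM.
  rewrite /= mulmxK ?(nr_unit nrA) // mul0mx => /rowP /(_ l); rewrite !mxE => /eqP.
  by rewrite intr_eq0 subr_eq0 eqz_nat => /eqP /val_inj /eqP; rewrite (negPf Hil).
- rewrite -mulr_suml; have -> : \sum_i sg j0 (y z i - y z' i) * eta i = xv z - xv z'.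
    by rewrite /xv -sumrB; apply: eq_bigr => i _; rewrite rmorphB mulrBl.
  exact: Hcl'.
move=> i j; pose c : I := (i, j).
have Hpart b : `|cpart b (sg (val j) (y z i - y z' i))| * (2 * L0)%:R < p%:R ^+ be (i, j).
  have Ec : cell b z c = cell b z' c.
    by have := congr1 (fun f : T2 => val (f (c, b))) E2; rewrite !ffunE.
  have := truncn_eq_dist (cell0 b z c) (cell0 b z' c) Ec; rewrite -mulrBl normrM normfV [`|p%:R ^+ _|]ger0_norm ?ltW //.
  rewrite ltr_pdivrMr // mul1r /u -mulrBl normrM normr_nat /=; apply: le_lt_trans.
  apply: ler_wpM2r => //; rewrite rmorphB cpartB opprD addrACA subrr addr0; exact: lexx.
have : L0%:R * `|sg (val j) (y z i - y z' i)| *+ 2 < p%:R ^+ be (i, j) *+ 2.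
  apply: le_lt_trans (_ : _ <= `|cpart true (sg (val j) (y z i - y z' i))| * (2 * L0)%:R +
     `|cpart false (sg (val j) (y z i - y z' i))| * (2 * L0)%:R) _; last by rewrite mulr2n ltrD.
  rewrite -mulrDl -mulr_natr mulrAC mulrC natrM [_ * 2%:R]mulrC [2%:R * _]mulrC; apply: ler_wpM2r; first by rewrite mulr_ge0.
  exact: norm_le_cparts.
by rewrite ltrMn2r.
Qed.

End Pigeonhole.

(** * Descent on the number of terms *)

Lemma infinite_pigeonhole (T : finType) (P : nat -> T -> Prop) :
  (forall N, exists n, (N <= n)%N /\ exists x, P n x) ->
  exists x, forall N, exists n, (N <= n)%N /\ P n x.
Proof.
move=> H; apply: NNPP => no.
have Hb x : exists N, forall n, (N <= n)%N -> ~ P n x.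
  apply: NNPP => Hx; apply: no; exists x => N; apply: NNPP => HN; apply: Hx; exists N => n Nn Pn.
  by apply: HN; exists n.
have [b Hb'] := fun_choice Hb.
have [n [Hn [x Px]]] := H (\max_x b x)%N.
by apply: (Hb' x n) Px; apply: leq_trans Hn; exact: leq_bigmax.
Qed.

Lemma det_column_bound k (N : 'M[algC]_k.+1) (z U : algC) (P : 'I_k.+1 -> algC) :
  (forall c, `|N ord0 c| <= z) -> (forall r c, `|N (lift ord0 r) c| <= P c) ->
  (forall c, \prod_(c' | c' != c) P c' <= U) -> `|\det N| <= (k.+1)`!%:R * (z * U).
Proof.
move=> Nz NP PU; have z0 : 0 <= z := le_trans (normr_ge0 _) (Nz ord0).
apply: le_trans (ler_norm_sum _ _ _) _.
rewrite -(card_Sn k.+1) mulr_natl -sumr_const; apply: ler_sum => /= S _.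
rewrite normrM normrX normrN1 expr1n mul1r normr_prod (bigD1 ord0) //=; apply: ler_pM => //.
  by apply: prodr_ge0.
apply: le_trans (PU (S ord0)); rewrite [X in _ <= X](reindex_inj (@perm_inj _ S)) /=.
rewrite [X in _ <= X](eq_bigl (fun i => i != ord0)); last by move=> i; rewrite (inj_eq perm_inj).
apply: ler_prod => i i0; rewrite normr_ge0 /=; by case: (unliftP ord0 i) i0 => [r|] ->.
Qed.

Lemma prod_lift n (R : comNzRingType) (i : 'I_n.+1) (Q : pred 'I_n.+1) (F : 'I_n.+1 -> R) :
  \prod_(c | Q (lift i c)) F (lift i c) = \prod_(x | Q x && (x != i)) F x.
Proof.
rewrite big_mkcond [RHS]big_mkcond (bigD1_ord i) //= eqxx andbF mul1r; apply: eq_bigr => c _.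
by rewrite eq_sym neq_lift andbT.
Qed.

(** The exponent of [p] in a cofactor with column [i] deleted. For [i] nonzero, the zeros below the
    corner force the first row into column 0, so the column sizes other than that of [i] remain. For
    [i = ord0], the first row takes some other column, about which only the lower bound [m0] is
    used. *)
Definition exponent_defect d (w : 'I_d.+1 -> nat) m0 (i : 'I_d.+2) : nat :=
  (\sum_c w c - if unlift ord0 i is Some c then w c else m0)%N.

Lemma adjugate_size d (p : nat) (M : 'M[algC]_d.+2) z (K : algC) (w : 'I_d.+1 -> nat) m0 i l :
  (0 < p)%N -> 0 <= K -> (forall c, m0 <= w c)%N -> l != ord0 ->
  (forall c, `|M ord0 c| <= z) -> (forall r, M (lift ord0 r) ord0 = 0) ->
  (forall r c, `|M (lift ord0 r) (lift ord0 c)| <= K * p%:R ^+ w c) ->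
  `|\adj M i l| <= (d.+1)`!%:R * (z * (K ^+ d * p%:R ^+ exponent_defect w m0 i)).
Proof.
move=> p0 K0 m0w l0 M0 Mz Mw.
pose P (x : 'I_d.+2) : algC := if unlift ord0 x is Some c then K * p%:R ^+ w c else 0.
have P0 : P ord0 = 0 by rewrite /P unlift_none.
have PS c : P (lift ord0 c) = K * p%:R ^+ w c by rewrite /P liftK.
have prodK c : \prod_(c' | c' != c) (K * p%:R ^+ w c') = K ^+ d * p%:R ^+ (\sum_c' w c' - w c).
  rewrite big_split /= prodr_const cardC1 card_ord prodrXr; congr (_ * _ ^+ _).
  by rewrite [in RHS](bigD1 c) //= addKn.
have pw e : 0 <= p%:R ^+ e :> algC by rewrite exprn_ge0.
have Kd : 0 <= K ^+ d by exact: exprn_ge0.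
rewrite mxE /cofactor normrM normrX normrN1 expr1n mul1r.
have li0 : lift l ord0 = ord0 by apply: val_inj; rewrite /= /bump leqn0 -val_eqE /= in l0 *; rewrite (negPf l0).
apply: (@det_column_bound d _ z _ (fun c => P (lift i c))).
- by move=> c; rewrite !mxE li0.
- move=> r c; rewrite !mxE; case: (unliftP ord0 (lift l (lift ord0 r))) => [r'|] E; last first.
    by have := @neq_lift _ ord0 r; rewrite -(inj_eq (@lift_inj _ l)) li0 E eqxx.
  by rewrite E /P; case: unliftP => [c'|] ->; rewrite ?Mz ?normr0.
move=> c; have -> : \prod_(c' | c' != c) P (lift i c') = \prod_(x | (x != lift i c) && (x != i)) P x.
  by rewrite -(prod_lift i (fun x => x != lift i c) P); apply: eq_bigl => c'; rewrite (inj_eq (@lift_inj _ i)).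
rewrite /exponent_defect.
case: (unliftP ord0 i) => [i'|] Ei.
  have [E0|ne] := eqVneq (lift i c) ord0; last first.
    rewrite (bigD1 ord0) /=; last by rewrite eq_sym ne Ei neq_lift.
    by rewrite P0 mul0r mulr_ge0.
  rewrite E0 (eq_bigl (fun x => (x != i) && (x != ord0))); last by move=> x; rewrite andbC.
  have -> : \prod_(x | (x != i) && (x != ord0)) P x = \prod_(c' | c' != i') P (lift ord0 c').
    rewrite -(prod_lift ord0 (fun x => x != i) P); apply: eq_bigl => c'; by rewrite Ei (inj_eq (@lift_inj _ ord0)).
  by rewrite (eq_bigr _ (fun c' _ => PS c')) prodK.
have Hc : exists c', lift i c = lift ord0 c' by exists c; rewrite Ei.
have [c' Ec] := Hc; rewrite Ec Ei.
have -> : \prod_(x | (x != lift ord0 c') && (x != ord0)) P x = \prod_(c'' | c'' != c') P (lift ord0 c'').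
  rewrite -(prod_lift ord0 (fun x => x != lift ord0 c') P); apply: eq_bigl => c''; by rewrite (inj_eq (@lift_inj _ ord0)).
rewrite (eq_bigr _ (fun c'' _ => PS c'')) prodK; apply: ler_wpM2l => //.
by rewrite -!natrX ler_nat; case: (p) p0 => // p' _; rewrite leq_pexp2l // leq_sub2l.
Qed.

(** The subtracted [m0] is the gain on which the whole descent rests. *)
Lemma sum_exponent_defect d (w : 'I_d.+1 -> nat) m0 : (forall c, m0 <= w c)%N ->
  (\sum_i exponent_defect w m0 i = d.+1 * \sum_c w c - m0)%N.
Proof.
move=> m0w; have wS c : (w c <= \sum_c w c)%N by rewrite (bigD1 c) //= leq_addr.
have ES (c : 'I_d.+1) : exponent_defect w m0 (lift ord0 c) = (\sum_c w c - w c)%N by rewrite /exponent_defect liftK.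
rewrite big_ord_recl (eq_bigr _ (fun i _ => ES i)) {1}/exponent_defect unlift_none.
rewrite sumnB; last by move=> c _; exact: wS.
rewrite sum_nat_const card_ord mulSn.
by have := wS ord0; have := m0w ord0; move: (\sum_c w c)%N (w ord0) (d * _)%N; clear; lia.
Qed.

Lemma small_exp_le (x : algC) p n q q' : (0 < p)%N -> (q' <= q)%N -> `|x| ^+ q <= p%:R ^+ n -> `|x| ^+ q' <= p%:R ^+ n.
Proof.
move=> p0 qq H; have [le|ge] := orP (real_leVge (normr_real x) (@real1 _)).
  apply: le_trans (_ : _ <= 1) _; first exact: exprn_ile1.
  by rewrite -natrX ler1n expn_gt0 p0.
by apply: le_trans H; apply: ler_weXn2l.
Qed.

Section CofactorCongruence.
Variables (O : algC -> Prop) (p : nat).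
Hypotheses (vO : valuation_ring O) (pp : prime p).

Lemma vr_det k (N : 'M[algC]_k) : (forall i j, O (N i j)) -> O (\det N).
Proof.
move=> H; apply: (vr_sum vO) => S _; apply: (vrM vO).
  by apply: (vr_int vO); exact: rpred_sign.
by apply: (vr_prod vO) => i _.
Qed.

(** The expression is the determinant of [M] with row [l] replaced by [eta i'] times the unit vector
    at [i] minus [eta i] times that at [i']. This matrix sends the vector [eta] into [p^n O], and
    since one entry of [eta] is a unit, its determinant lies in [p^n O]. *)
Lemma adjugate_congruence k (M : 'M[algC]_k) (eta : 'I_k -> algC) (n : nat) (o l i i' : 'I_k) :
  (forall i j, O (M i j)) -> (forall i, O (eta i)) -> O (eta o)^-1 -> eta o != 0 ->
  (forall r, r != l -> O ((\sum_c M r c * eta c) / p%:R ^+ n)) ->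
  O ((\adj M i l * eta i' - \adj M i' l * eta i) / p%:R ^+ n).
Proof.
move=> OM Oeta Oo o0 HM; pose M' := \matrix_(r, c) if r == l then eta i' * (c == i)%:R - eta i * (c == i')%:R else M r c.
have OM' r c : O (M' r c).
  rewrite mxE; case: eqP => _ //; apply: (vrB vO); apply: (vrM vO) => //; exact: (vr_nat vO).
have cofE c : cofactor M' l c = cofactor M l c.
  rewrite /cofactor; congr (_ * \det _); apply/matrixP => a b; rewrite !mxE eq_sym (negPf (neq_lift _ _)) //.
have -> : \adj M i l * eta i' - \adj M i' l * eta i = \det M'.
  rewrite (expand_det_row M' l); under eq_bigr => c _ do rewrite cofE mxE eqxx mulrBl.
  rewrite sumrB (bigD1 i) //= eqxx big1 ?addr0 => [|c /negPf ->]; last by rewrite mulr0 mul0r.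
  rewrite (bigD1 i') //= eqxx big1 ?addr0 => [|c /negPf ->]; last by rewrite mulr0 mul0r.
  by rewrite !mulr1 !mxE ![eta _ * _]mulrC.
have E : \det M' = (eta o)^-1 * \sum_r \adj M' o r * \sum_c M' r c * eta c.
  have H : (\adj M' *m (M' *m \col_c eta c)) o ord0 = \det M' * eta o.
    by rewrite mulmxA mul_adj_mx mul_scalar_mx !mxE.
  rewrite -[LHS](mulfK o0) -H mulrC [(\adj M' *m _) o ord0]mxE; congr (_ * _); apply: eq_bigr => r _.
  rewrite [(M' *m _) r ord0]mxE; congr (_ * _); apply: eq_bigr => c _; by rewrite [(\col_c _) _ _]mxE.
rewrite E -mulrA mulr_suml; apply: (vrM vO) => //; apply: (vr_sum vO) => r _; rewrite -mulrA; apply: (vrM vO).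
  rewrite mxE /cofactor; apply: (vrM vO); first by apply: (vr_int vO); exact: rpred_sign.
  by apply: vr_det => a b; rewrite !mxE; have := OM' (lift r a) (lift o b); rewrite mxE.
have [->|rl] := eqVneq r l; last first.
  by rewrite (eq_bigr (fun c => M r c * eta c)); [exact: HM | move=> c _; rewrite mxE (negPf rl)].
under eq_bigr => c _ do rewrite mxE eqxx mulrBl.
rewrite sumrB (bigD1 i) //= eqxx big1 ?addr0 => [|c /negPf ->]; last by rewrite mulr0 mul0r.
rewrite (bigD1 i') //= eqxx big1 ?addr0 => [|c /negPf ->]; last by rewrite mulr0 mul0r.
rewrite -[true%:R]/(1 : algC) !mulr1 [eta i' * eta i]mulrC subrr mul0r; exact: (vr0 vO).
Qed.

End CofactorCongruence.

Section Descent.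
Variables (A : comNzRingType) (g : nat) (sg : 'I_g -> {rmorphism A -> algC}) (om : 'I_g -> A).
Hypothesis nrA : number_ring sg om.
Variables (cj : 'I_g -> 'I_g) (ii : A) (kp : nat).
Hypothesis cjA : conjugation sg cj ii kp.
Variables (O : algC -> Prop) (p : nat) (j0 : 'I_g).
Hypotheses (vO : valuation_ring O) (pp : prime p) (Np : ~ O (p%:R)^-1).
Local Notation half_place := (half_place sg ii kp).

Definition admissible k (gam : 'I_k -> algC) := exists (G : 'I_k -> A) (Q : nat),
  [/\ (0 < Q)%N, forall i, sg j0 (G i) = Q%:R * gam i,
      forall i, [/\ O (gam i), O (gam i)^-1 & gam i != 0] &
      forall i i', i != i' -> ratio_root_free (gam i / gam i')].

Definition small_relation k (gam : 'I_k -> algC) q n (Z : 'I_k -> A) :=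
  [/\ exists i, sg j0 (Z i) != 0, forall i j, `|sg j (Z i)| ^+ q <= p%:R ^+ n &
      O ((\sum_i sg j0 (Z i) * gam i ^+ n) / p%:R ^+ n)].

Definition bad k (gam : 'I_k -> algC) := forall q N0, (0 < q)%N ->
  exists n, (N0 <= n)%N /\ exists Z, small_relation gam q n Z.

Lemma half_place_inh : half_place.
Proof.
case E : (sg j0 ii == 'i * kp%:R); first by exists j0.
by exists (cj j0); rewrite (half_place_conj cjA) E.
Qed.

Definition place_rep (j : 'I_g) : half_place :=
  insubd half_place_inh (if sg j ii == 'i * kp%:R then j else cj j).

Lemma place_rep_val j : val (place_rep j) = if sg j ii == 'i * kp%:R then j else cj j.
Proof.
rewrite /place_rep val_insubd; case: ifP => // /negbT.
by case: ifP => [->//|H]; rewrite (half_place_conj cjA) H.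
Qed.

Lemma place_rep_norm j a : `|sg (val (place_rep j)) a| = `|sg j a|.
Proof. by rewrite place_rep_val; case: ifP => // _; rewrite (cj_sg cjA) norm_conjC. Qed.

Lemma sum_place_rep (f : half_place -> nat) : (\sum_j f (place_rep j) = 2 * \sum_h f h)%N.
Proof.
have H : (\sum_(j | (sg j ii == 'i * kp%:R)%R) f (place_rep j) = \sum_h f h)%N.
  rewrite (reindex_onto val place_rep) /=; last by move=> j Pj; rewrite place_rep_val Pj.
  have E (h : half_place) : place_rep (val h) = h by apply: val_inj; rewrite place_rep_val (valP h).
  by apply: eq_big => h; rewrite E ?eqxx ?andbT //; exact: (valP h).
rewrite (bigID (fun j => (sg j ii == 'i * kp%:R)%R)) /= H mul2n -addnn; congr (_ + _)%N.
rewrite -[RHS]H (reindex_inj (can_inj (cj_inv cjA))) /=; apply: eq_big => j; first by rewrite (half_place_conj cjA) negbK.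
rewrite (half_place_conj cjA) negbK => Pj; congr f; apply: val_inj; rewrite !place_rep_val.
by rewrite (half_place_conj cjA) Pj /= (cj_inv cjA).
Qed.

Lemma not_bad0 (gam : 'I_0 -> algC) : ~ bad gam.
Proof. by move=> /(_ 1%N 0%N isT) [n [_ [Z [[[]]]]]]. Qed.

(** A single coefficient divisible by [p^n] has norm at least [p^(s(n-t))], whereas conjugates below
    [p^(n/(2g))] give a norm at most [p^(n/2)]. *)
Lemma not_bad1 (gam : 'I_1 -> algC) : admissible gam -> ~ bad gam.
Proof.
move=> [G [Q [_ _ Hg _]]] Hbad; have [s [t [s0 Hn _]]] := padic_norm_and_classes nrA j0 vO pp Np.
have g0 : (0 < g)%N by case: (g) j0 => [[]|].
have [|n [nt [Z [[i Zi] ZB ZO]]]] := Hbad (2 * g)%N (2 * t).+1; first by rewrite muln_gt0.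
have Z0 : sg j0 (Z ord0) != 0 by move: Zi; rewrite (ord1 i).
have [Og Og' g00] := Hg ord0.
have ZO' : O (sg j0 (Z ord0) / p%:R ^+ n).
  move: ZO; rewrite big_ord1 => H; have := vrM vO (vrX vO n Og') H; congr (O _).
  rewrite exprVn mulrA; congr (_ / _); rewrite mulrC mulfK // expf_neq0 //.
have H := Hn _ _ Z0 ZO'.
have H2 : p%:R ^+ (s * (n - t) * (2 * g)) <= p%:R ^+ (n * g) :> algC.
  have -> : p%:R ^+ (n * g) = \prod_(j < g) p%:R ^+ n :> algC by rewrite prodr_const card_ord exprM.
  rewrite exprM; apply: le_trans (_ : _ <= (\prod_j `|sg j (Z ord0)|) ^+ (2 * g)) _.
    by apply: lerXn2r => //; rewrite nnegrE ?exprn_ge0 // prodr_ge0.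
  by rewrite -prodrXl; apply: ler_prod => j _; rewrite exprn_ge0 //= ZB.
move: H2; rewrite -!natrX ler_nat leq_exp2l ?prime_gt1 // mulnA leq_pmul2r //.
have : ((n - t) * 2 <= s * (n - t) * 2)%N by rewrite -mulnA leq_pmull.
by move: nt; clear; lia.
Qed.

Lemma power_above (C : algC) : 0 <= C -> exists k, C < p%:R ^+ k.
Proof.
move=> C0; have [M HM] : exists M : nat, C < M%:R by exists (Num.Def.archi_bound C); exact: archi_boundP.
exists M; apply: lt_trans HM _; rewrite -natrX ltr_nat; apply: ltn_expl; exact: prime_gt1.
Qed.

Lemma uniform_not_bad d (gam : 'I_d.+2 -> algC) : (forall i, ~ bad (fun k => gam (lift i k))) ->
  exists q0 N0, [/\ (0 < q0)%N, (0 < N0)%N & forall i n Z, (N0 <= n)%N -> ~ small_relation (fun k => gam (lift i k)) q0 n Z].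
Proof.
move=> H; have H1 i : exists qN : nat * nat, (0 < qN.1)%N /\
    forall n Z, (qN.2 <= n)%N -> ~ small_relation (fun k => gam (lift i k)) qN.1 n Z.
  apply: NNPP => no; apply: (H i) => q N0 q0; apply: NNPP => no2; apply: no; exists (q, N0); split=> // n Z Hn HZ.
  by apply: no2; exists n; split=> //; exists Z.
have [qN HqN] := fun_choice H1.
exists (\sum_i (qN i).1)%N, (\sum_i (qN i).2).+1; split=> //.
  by rewrite (bigD1 ord0) //= addn_gt0; have [-> _] := HqN ord0.
move=> i n Z Hn [Z1 Z2 Z3]; have [_ Hi] := HqN i; apply: (Hi n Z).
  by apply: leq_trans (ltnW Hn); rewrite (bigD1 i) //= leq_addr.
split=> // k j; apply: small_exp_le (Z2 k j); first exact: prime_gt0.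
by rewrite (bigD1 i) //= leq_addr.
Qed.

(** * The inductive step: a relation in all the terms against a reduced basis *)

Section Step.
Variables (d : nat) (gam : 'I_d.+2 -> algC).
Hypothesis gamA : admissible gam.
Variables (q0 N0 : nat).
Hypotheses (q00 : (0 < q0)%N) (N00 : (0 < N0)%N).
Hypothesis Hq0 : forall i n Z, (N0 <= n)%N -> ~ small_relation (fun k => gam (lift i k)) q0 n Z.
Variables (s : nat).
Hypothesis Hcl : forall k, exists cl : algC -> {ffun 'I_s -> 'I_(p ^ k).-1.+1}, forall x y,
    nr_frac sg j0 x -> O x -> nr_frac sg j0 y -> O y -> cl x = cl y -> O ((x - y) / p%:R ^+ k).

Local Notation I := ('I_d.+1 * half_place)%type.
Let Rk := #|{: I}|.
Let K := Kred kp Rk.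

Let in_lattice n (y : 'I_d.+1 -> A) := O ((\sum_i sg j0 (y i) * gam (lift ord0 i) ^+ n) / p%:R ^+ n).

Let Og i n : O (gam i ^+ n).
Proof. by have [G [Q [_ _ H _]]] := gamA; have [H1 _ _] := H i; apply: (vrX vO). Qed.

Let vec (y : 'I_d.+1 -> A) : {ffun I -> algC^o} := [ffun c => sg (val c.2) (y c.1) : algC^o].

Let vec_neq0 y : vec y != 0 -> exists i, sg j0 (y i) != 0.
Proof.
move=> v0; apply: NNPP => no; move/eqP: v0; apply; apply/ffunP => c; rewrite !ffunE.
by apply: (nr_ker nrA (j := j0)); apply/eqP/negPn/negP => H; apply: no; exists c.1.
Qed.

(** The lattice consists of the relations among all terms but the first. The lower bound on [be] is
    the induction hypothesis, since a short lattice vector would be a small relation. For the upper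
    bound, a larger sum would let the box principle produce a lattice vector inside the box that the
    reduction leaves empty. *)
Lemma reduced_basis : exists C0, forall n, (N0 <= n)%N -> exists (be : I -> nat) (y : I -> 'I_d.+1 -> A),
  [/\ forall c, in_lattice n (y c),
      forall c c', `|sg (val c'.2) (y c c'.1)| <= K%:R * p%:R ^+ be c',
      forall v : {ffun I -> algC^o}, exists x : I -> algC, v = \sum_c x c *: vec (y c),
      forall c, (n < be c * q0)%N &
      (2 * \sum_c be c <= s * n + C0)%N].
Proof.
have p1 := prime_gt1 pp.
have Rk0 : (0 < Rk)%N by apply/card_gt0P; exists (ord0, half_place_inh).
have L00 : (0 < p * Rk * 2 ^ Rk)%N by rewrite !muln_gt0 (prime_gt0 pp) Rk0 expn_gt0.
have [C0 HC0] := small_congruent_vector nrA cjA vO pp Hcl d.+1 L00.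
pose Call := \sum_j \sum_l `|sg j (om l)|.
have Call0 : 0 <= Call by apply: sumr_ge0 => j _; apply: sumr_ge0.
have [C1 HC1] := power_above Call0.
exists C0 => n Nn.
pose L (v : {ffun I -> algC^o}) := exists2 y, v = vec y & in_lattice n y.
have LG v w q : L v -> L w -> gauss kp q -> L (v - q *: w).
  move=> [y -> Hy] [y' -> Hy'] [a [b ->]].
  exists (fun i => y i - (a%:~R + ii * b%:~R) * y' i).
    apply/ffunP => c; rewrite !ffunE rmorphB !rmorphM rmorphD rmorphM !rmorph_int (eqP (valP c.2)).
    by rewrite mulrA.
  rewrite /in_lattice; have -> : \sum_i sg j0 (y i - (a%:~R + ii * b%:~R) * y' i) * gam (lift ord0 i) ^+ n =
     \sum_i sg j0 (y i) * gam (lift ord0 i) ^+ n - sg j0 (a%:~R + ii * b%:~R) * \sum_i sg j0 (y' i) * gam (lift ord0 i) ^+ n.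
    rewrite mulr_sumr -sumrB; apply: eq_bigr => i _; by rewrite rmorphB rmorphM mulrBl mulrA.
  rewrite mulrBl -mulrA; apply: (vrB vO) => //; apply: (vrM vO) => //; exact: (vr_sg nrA).
have Lge1 v : L v -> v != 0 -> exists c, 1 <= `|v c|.
  move=> [y -> _] /vec_neq0 [i yi]; apply: NNPP => no.
  have lt1 j : `|sg j (y i)| < 1.
    rewrite -place_rep_norm real_ltNge ?normr_real //; apply/negP => H.
    by apply: no; exists (i, place_rep j); rewrite ffunE.
  suff H2 : \prod_j `|sg j (y i)| < 1 by have := le_lt_trans (nr_norm_ge1 nrA yi) H2; rewrite ltxx.
  rewrite (bigD1 j0) //=; apply: le_lt_trans (lt1 j0); rewrite -[X in _ <= X]mulr1; apply: ler_wpM2l => //.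
  by apply: prodr_ile1 => j _; rewrite normr_ge0 ltW.
have Lspan f : (exists c, f c != 0) -> exists v, [/\ L v, forall c : I, `|v c| < p%:R ^+ (n + C1) & \sum_c f c * v c != 0].
  move=> [c1]; case: c1 => i1 j1 Hij.
  have [l Hl] : exists l, \sum_(h : half_place) f (i1, h) * sg (val h) (om l) != 0.
    apply: NNPP => no; move/eqP: Hij; apply.
    pose F : 'cV[algC]_g := \col_j' (if insub j' is Some h then f (i1, h) else 0).
    have HF : (\matrix_(l, j') sg j' (om l)) *m F = 0.
      apply/colP => l; rewrite !mxE; apply/eqP/negPn/negP => H; apply: no; exists l; move: H; congr (_ != 0).
      rewrite (bigID (fun j' => (sg j' ii == 'i * kp%:R)%R)) /= [X in _ + X]big1 ?addr0 => [|j' Hj'].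
        rewrite (reindex_onto val place_rep) /=; last by move=> j' Pj; rewrite place_rep_val Pj.
        have E (h : half_place) : place_rep (val h) = h by apply: val_inj; rewrite place_rep_val (valP h).
        apply: eq_big => h; first by rewrite E eqxx andbT; exact: (valP h).
        by move=> _; rewrite !mxE valK; exact: mulrC.
      by rewrite !mxE insubN // mulr0.
    have := congr1 (mulmx (invmx (\matrix_(l, j') sg j' (om l)))) HF.
    by rewrite mulKmx ?(nr_unit nrA) // mulmx0 => /colP /(_ (val j1)); rewrite !mxE valK.
  exists (vec (fun i' => if i' == i1 then om l *+ (p ^ n) else 0)); split.
  - exists (fun i' => if i' == i1 then om l *+ (p ^ n) else 0) => //; rewrite /in_lattice (bigD1 i1) //= eqxx big1 ?addr0.
      rewrite rmorphMn -mulr_natr natrX mulrAC mulfK ?expf_neq0 ?pnatr_eq0 -?lt0n ?prime_gt0 //.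
      by apply: (vrM vO) => //; exact: (vr_sg nrA).
    by move=> i' /negPf ->; rewrite rmorph0 mul0r.
  - move=> c; rewrite ffunE; case: ifP => _; last by rewrite rmorph0 normr0 exprn_gt0 // ltr0n prime_gt0.
    rewrite rmorphMn normrMn -[X in X < _]mulr_natl natrX exprD ltr_pM2l ?exprn_gt0 ?ltr0n ?prime_gt0 //.
    apply: le_lt_trans HC1; rewrite /Call (bigD1 (val c.2)) //= (bigD1 l) //= -addrA lerDl.
    by apply: addr_ge0; [apply: sumr_ge0 | apply: sumr_ge0 => j' _; apply: sumr_ge0].
  have -> : \sum_c f c * vec (fun i' => if i' == i1 then om l *+ (p ^ n) else 0) c =
     (\sum_(h : half_place) f (i1, h) * sg (val h) (om l)) * (p ^ n)%:R.
    transitivity (\sum_i' \sum_(h : half_place) f (i', h) * vec (fun i' => if i' == i1 then om l *+ (p ^ n) else 0) (i', h)).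
      by rewrite pair_bigA; apply: eq_bigr => -[].
    rewrite (bigD1 i1) //= [X in _ + X]big1 ?addr0 => [|i' /negPf ne]; last first.
      by apply: big1 => h _; rewrite ffunE /= ne rmorph0 mulr0.
    rewrite mulr_suml; apply: eq_bigr => h _; rewrite ffunE /= eqxx rmorphMn -mulrA; congr (_ * _); exact/esym/mulr_natr.
  by rewrite mulf_neq0 // pnatr_eq0 -lt0n expn_gt0 prime_gt0.
have [be [Y [LY Yb Ys Yw Yz]]] := lattice_reduction p1 (kp_gt0 cjA) LG Lge1 Lspan.
have [y Hy] := fun_choice (fun c => let: ex_intro2 y E H := LY c in ex_intro (fun y => Y c = vec y /\ in_lattice n y) y (conj E H)).
exists be, y; split.
- by move=> c; have [] := Hy c.
- by move=> c c'; have := Yb c c'; have [-> _] := Hy c; rewrite ffunE.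
- move=> v; have [x ->] := Ys v; exists x; apply: eq_bigr => c _; by have [-> _] := Hy c.
- move=> c; rewrite ltnNge; apply/negP => Hc; have [_ [v [[y' Ev Hy'] v0 vb]]] := Yw c.
  apply: (Hq0 (i := ord0) (Z := y') Nn); split=> //; first by apply: vec_neq0; rewrite -Ev.
  move=> i j; have := vb (i, place_rep j); rewrite Ev ffunE /= place_rep_norm => Hb.
  apply: le_trans (_ : _ <= (p%:R ^+ be c) ^+ q0) _; first by rewrite lerXn2r ?nnegrE ?exprn_ge0 // ltW.
  by rewrite -exprM -!natrX ler_nat leq_exp2l.
rewrite leqNgt; apply/negP => Hlt.
have Feta i : nr_frac sg j0 (gam (lift ord0 i) ^+ n).
  have [G [Q [Q0 HG _ _]]] := gamA; apply: nr_fracX; exists (G (lift ord0 i)), Q; split=> //.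
  by rewrite HG mulrC.
have [y' [Hn Ho Hs]] := HC0 n (fun i => gam (lift ord0 i) ^+ n) be (fun i => Og _ n) Feta Hlt.
have [] := Yz (vec y').
- by exists y' => //; rewrite /in_lattice mulr_suml.
- have [i Hi] := Hn; apply/eqP => /ffunP /(_ (i, half_place_inh)).
  by rewrite !ffunE /= => /(nr_ker nrA j0) /eqP; rewrite (negPf Hi).
move=> [i j]; rewrite ffunE /= => H; have := Hs i j; rewrite real_ltNge ?rpredM ?rpredX ?realn ?normr_real //.
by rewrite H.
Qed.

(** The forms are cofactors of the matrix [M] with first row [Z] and, below it, lattice vectors
    preceded by 0. The product of [M] with its adjugate gives their orthogonality to [Z],
    [adjugate_congruence] their proportionality to the powers of [gam], and [adjugate_size] their
    sizes, whose sum is small enough thanks to the defect [m0]. *)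
Lemma step_package q1 zz n1 (G : 'I_d.+2 -> A) Q q2 w : (0 < Q)%N -> (forall i, sg j0 (G i) = Q%:R * gam i) ->
  (forall n Z0 Z1, (n1 <= n)%N -> sg j0 Z0 != 0 -> sg j0 Z1 != 0 -> (forall j, `|sg j Z0| ^+ q1 <= p%:R ^+ n) ->
    (forall j, `|sg j Z1| ^+ q1 <= p%:R ^+ n) ->
    root_mult_bound (ratio_root sg j0 (G ord0) (G (lift ord0 ord0)) Z0 Z1 n) n zz) ->
  (0 < q1)%N -> q2 = (6 * d.+2 * q0 * q1)%N -> 1 < w -> w ^+ q2 = p%:R ->
  exists n2, forall n Z, (n2 <= n)%N -> small_relation gam q2 n Z ->
    exists x : 'I_d.+2 -> 'I_g -> nat, (\sum_j \sum_i x i j < q2 * d.+1 * s)%N /\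
      exists Z be, package sg O p j0 gam w x zz n Z be.
Proof.
move=> Q0 HG Hmult q10 q2E w1 wq; have p0 := prime_gt0 pp.
have [C0 HC0] := reduced_basis.
have K0 : 0 <= K%:R :> algC by [].
have [k2 _ Hk2] := expr_unbounded ((d.+1)`! * K ^ d) w1.
have w0 : 0 <= w by exact: ltW (lt_trans ltr01 w1).
have g0 : (0 < g)%N by case: (g) j0 => [[]|].
have [G' [Q' [_ _ Hg _]]] := gamA.
exists (N0 + n1 + k2 + q2 * d.+1 * C0 + 2 * q0)%N.+1 => n Z Hn [Zn ZB ZO].
have nN0 : (N0 <= n)%N by apply: leq_trans Hn; lia.
have nn1 : (n1 <= n)%N by apply: leq_trans Hn; lia.
have nk2 : (k2 <= n)%N by apply: leq_trans Hn; lia.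
have n0 : (0 < n)%N by exact: leq_trans N00 nN0.
have qq0 : (q0 <= q2)%N by rewrite q2E mulnAC leq_pmull // !muln_gt0 q10.
have qq1 : (q1 <= q2)%N by rewrite q2E leq_pmull // !muln_gt0 q00.
(* If [Z i] were 0, the other coefficients would form a small relation with one term fewer. *)
have Zne i : sg j0 (Z i) != 0.
  apply/eqP => Zi; apply: (Hq0 (i := i) (Z := fun k => Z (lift i k)) nN0); split.
  - have [i' Hi'] := Zn; case: (unliftP i i') Hi' => [k|] -> Hi'; first by exists k.
    by rewrite Zi eqxx in Hi'.
  - by move=> k j; exact: small_exp_le p0 qq0 (ZB _ j).
  by move: ZO; rewrite (bigD1_ord i) //= Zi mul0r add0r.
have [be [y [yL yB ySp be_lo be_up]]] := HC0 n nN0.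
pose j1 := val half_place_inh.
(* The reduced vectors span the product over all half places, so their components at a single place
   have full rank. A determinant that is nonzero at one embedding is nonzero at all. *)
pose Wm := \matrix_(r < #|{: I}|, i < d.+1) sg j1 (y (enum_val r) i).
have Wf : row_full Wm.
  pose v i : {ffun I -> algC^o} := [ffun c => ((c.1 == i) && (c.2 == half_place_inh))%:R : algC^o].
  have [x Hx] := fun_choice (fun i => ySp (v i)).
  apply/row_fullP; exists (\matrix_(i, r) x i (enum_val r)); apply/matrixP => i i'; rewrite !mxE.
  have := congr1 (fun f : {ffun I -> algC^o} => f (i', half_place_inh)) (Hx i).
  rewrite !ffunE /= eqxx andbT sum_ffunE eq_sym => ->.
  rewrite (reindex (@enum_val _ {: I})) /=; last by apply: onW_bij; exact: enum_val_bij.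
  by apply: eq_bigr => r _; rewrite !mxE !ffunE.
pose f := fullrankfun Wf; pose Nm : 'M[A]_d.+1 := \matrix_(k, i) y (enum_val (f k)) i.
have dN j : sg j (\det Nm) != 0.
  apply: (nr_neq0 nrA j (j := j1)); rewrite -det_map_mx.
  have -> : map_mx (sg j1) Nm = rowsub f Wm by apply/matrixP => k i; rewrite !mxE.
  by rewrite -unitfE -[_ \is a _]/(rowsub f Wm \in unitmx); exact: fullrowsub_unit.
pose M : 'M[A]_d.+2 := \matrix_(k, i) if unlift ord0 k is Some k' then
   (if unlift ord0 i is Some i' then Nm k' i' else 0) else Z i.
have M_0 i : M ord0 i = Z i by rewrite mxE unlift_none.
have M_S0 k : M (lift ord0 k) ord0 = 0 by rewrite mxE liftK unlift_none.
have M_SS k i : M (lift ord0 k) (lift ord0 i) = Nm k i by rewrite mxE !liftK.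
have dM : \det M = Z ord0 * \det Nm.
  rewrite (expand_det_col M ord0) (bigD1 ord0) //= big1 ?addr0 => [|k k0]; last first.
    by case: (unliftP ord0 k) k0 => [k'|] -> // _; rewrite M_S0 mul0r.
  rewrite M_0; congr (_ * _); rewrite /cofactor addn0 expr0 mul1r; congr (\det _).
  by apply/matrixP => a b; rewrite 2!mxE M_SS.
(* Column [ord0] needs no congruence, so a unit vector replaces the adjugate column there; it has
   size 1 and keeps the forms independent because [Z ord0] is nonzero. *)
clearbody M; pose bet i l : A := if l == ord0 then (i == ord0)%:R else \adj M i l.
have MB : M *m \matrix_(i, l) bet i l = diag_mx (\row_l if l == ord0 then Z ord0 else \det M).
  apply/matrixP => k l; rewrite !mxE; have [->|l0] := eqVneq l ord0.
    rewrite (bigD1 ord0) //= !mxE /bet eqxx mulr1 big1 ?addr0 => [|i i0]; last by rewrite !mxE eqxx (negPf i0) mulr0.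
    by case: (unliftP ord0 k) => [k'|] ->; rewrite ?M_S0 ?M_0 ?eqxx ?mulr1n // eq_sym (negPf (neq_lift _ _)) mulr0n.
  have -> : (if k == ord0 then Z ord0 else \det M) *+ (k == l) = \det M *+ (k == l).
    by have [->|_] := eqVneq k l; [rewrite (negPf l0) | rewrite !mulr0n].
  have := congr1 (fun X : 'M_d.+2 => X k l) (mul_mx_adj M); rewrite !mxE => <-.
  by apply: eq_bigr => i _; congr (_ * _); rewrite mxE /bet (negPf l0).
pose ww (j : 'I_g) c := be (c, place_rep j).
pose m0 := (n %/ q0)%N.
have m0w j c : (m0 <= ww j c)%N.
  by rewrite /m0; have := be_lo (c, place_rep j); rewrite -ltn_divLR //; exact: ltnW.
(* One [n] pays for [|Z| <= w^n], the other for the constant [(d.+1)! K^d]; the factor [q2] converts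
   powers of [p] into powers of [w]. *)
pose Aij (i : 'I_d.+2) j := (2 * n + q2 * exponent_defect (ww j) m0 i)%N.
pose x (i : 'I_d.+2) j := (Aij i j %/ n).+1.
have Ax i j : (Aij i j <= x i j * n)%N by rewrite ltnW // ltn_ceil.
exists x; split.
  have sumA : (\sum_j \sum_i Aij i j + q2 * (g * m0) <= 2 * n * d.+2 * g + q2 * (d.+1 * (s * n + C0)))%N.
    have -> : (\sum_j \sum_i Aij i j = 2 * n * d.+2 * g + q2 * \sum_j (d.+1 * \sum_c ww j c - m0))%N.
      under eq_bigr => j _ do rewrite big_split /= sum_nat_const card_ord -big_distrr /= sum_exponent_defect //.
      by rewrite big_split /= sum_nat_const card_ord -big_distrr /=; congr (_ + _)%N; ring.
    rewrite -addnA leq_add2l -mulnDr leq_mul2l; apply/orP; right.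
    rewrite -[X in (X * m0)%N]card_ord -sum_nat_const -big_split /=.
    rewrite (eq_bigr (fun j => d.+1 * \sum_c ww j c)%N); last first.
      move=> j _; rewrite subnK //; apply: leq_trans (m0w j ord0) _.
      by rewrite mulSn (bigD1 ord0) //= -!addnA leq_addr.
    rewrite -big_distrr leq_mul2l /=; apply: leq_trans be_up.
    rewrite (sum_place_rep (fun h => \sum_c be (c, h))%N) leq_mul2l /= exchange_big /= pair_bigA /=.
    by apply: eq_leq; apply: eq_bigr => -[].
  have sumx : (n * \sum_j \sum_i x i j <= \sum_j \sum_i Aij i j + d.+2 * g * n)%N.
    rewrite big_distrr /=; apply: leq_trans (_ : \sum_(j < g) (\sum_i Aij i j + d.+2 * n) <= _)%N; last first.
      by rewrite big_split /= sum_nat_const card_ord; apply: eq_leq; congr (_ + _)%N; ring.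
    apply: leq_sum => j _; rewrite big_distrr /= -[X in (_ <= _ + X * n)%N]card_ord -sum_nat_const -big_split /=.
    by apply: leq_sum => i _; rewrite /x mulnS addnC leq_add2r mulnC leq_trunc_div.
  have Hm0 : (n <= q0 * m0 + q0)%N.
    by have := divn_eq n q0; have := ltn_pmod n q00; rewrite /m0 mulnC; move: (q0 * _)%N; lia.
  rewrite -(ltn_pmul2l n0); apply: leq_ltn_trans sumx _.
  (* Here the factor 6 of [q2] enters: the gain [q2 g m0] is about [6 d.+2 q1 g n], while the terms
     [2n] of [Aij] and the rounding in [x] lose only [3 d.+2 g n]. *)
  have H1 : (q2 * (g * m0) + 6 * d.+2 * q1 * g * q0 >= 6 * d.+2 * q1 * g * n)%N.
    have -> : (q2 * (g * m0) = 6 * d.+2 * q1 * g * (q0 * m0))%N by rewrite q2E; ring.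
    by rewrite -mulnDr leq_mul2l Hm0 orbT.
  have H2 : (q2 * d.+1 * C0 + 6 * d.+2 * q1 * g * q0 + 3 * d.+2 * g * n < 6 * d.+2 * q1 * g * n)%N.
    have gg : (1 <= 3 * d.+2 * g * q1)%N by rewrite !muln_gt0 g0 q10.
    have g3 : (3 * d.+2 * g * n <= 3 * d.+2 * g * q1 * n)%N by rewrite leq_mul2r leq_pmulr ?orbT.
    have -> : (6 * d.+2 * q1 * g * q0 = 3 * d.+2 * g * q1 * (2 * q0))%N by ring.
    have -> : (6 * d.+2 * q1 * g * n = 3 * d.+2 * g * q1 * n + 3 * d.+2 * g * q1 * n)%N by ring.
    apply: leq_trans (_ : (q2 * d.+1 * C0).+1 + 3 * d.+2 * g * q1 * (2 * q0) + 3 * d.+2 * g * q1 * n <= _)%N.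
      by rewrite -!addSn leq_add2l.
    rewrite leq_add2r; apply: leq_trans (_ : 3 * d.+2 * g * q1 * ((q2 * d.+1 * C0).+1 + 2 * q0) <= _)%N.
      by rewrite mulnDr leq_add2r leq_pmull.
    by rewrite leq_mul2l; apply/orP; right; apply: leq_trans Hn; lia.
  have E1 : (q2 * (d.+1 * (s * n + C0)) = n * (q2 * d.+1 * s) + q2 * d.+1 * C0)%N by ring.
  have E2 : (2 * n * d.+2 * g + d.+2 * g * n = 3 * d.+2 * g * n)%N by ring.
  move: sumA H1 H2; rewrite E1 -E2.
  move: (\sum_j \sum_i Aij i j)%N (q2 * (g * m0))%N (6 * d.+2 * q1 * g * q0)%N (6 * d.+2 * q1 * g * n)%N => a b e h.
  move: (n * (q2 * d.+1 * s))%N (q2 * d.+1 * C0)%N (2 * n * d.+2 * g)%N (d.+2 * g * n)%N; clear; lia.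
exists Z, bet; split=> //.
- move=> l l0; have := congr1 (fun X : 'M[A]_d.+2 => sg j0 (X ord0 l)) MB.
  rewrite !mxE eq_sym (negPf l0) mulr0n rmorph0 rmorph_sum => H; rewrite -[RHS]H; apply: eq_bigr => i _.
  by rewrite mxE rmorphM M_0.
- have := congr1 (fun X : 'M[A]_d.+2 => sg j0 (\det X)) MB; rewrite det_mulmx det_diag rmorphM rmorph_prod.
  rewrite -[sg j0 (\det (\matrix_(_, _) _))]det_map_mx => H.
  have E : map_mx (sg j0) (\matrix_(i, l) bet i l) = \matrix_(i, l) sg j0 (bet i l) by apply/matrixP => i l; rewrite !mxE.
  rewrite unitmxE unitfE -E; apply/eqP => H0; move: H; rewrite H0 mulr0 => /esym/eqP; apply/negP.
  apply/prodf_neq0 => l _; rewrite mxE; case: ifP => _ //; by rewrite dM rmorphM mulf_neq0.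
- split=> [i l j|i i' l l0].
    rewrite /bet; case: eqP => [_|/eqP l0].
      case: eqP => _; rewrite ?rmorph1 ?rmorph0 ?normr1 ?normr0 ?exprn_ege1 ?exprn_ge0 //; exact: ltW.
    have zB c : `|sg j (Z c)| <= w ^+ n.
      have q20 : (0 < q2)%N by exact: leq_trans q00 qq0.
      rewrite -(ler_pXn2r q20) ?nnegrE ?exprn_ge0 // -exprM mulnC exprM wq; exact: ZB.
    have := @adjugate_size d p (map_mx (sg j) M) (w ^+ n) K%:R (ww j) m0 i l p0 K0 (m0w j) l0.
    have -> : \adj (map_mx (sg j) M) i l = sg j (\adj M i l) by rewrite -map_mx_adj mxE.
    move=> H; apply: le_trans (H _ _ _) _.
    + by move=> c; rewrite mxE M_0.
    + by move=> r; rewrite mxE M_S0 rmorph0.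
    + move=> r c; rewrite mxE M_SS mxE -place_rep_norm.
      by have := yB (enum_val (f r)) (c, place_rep j).
    apply: le_trans (_ : _ <= w ^+ Aij i j) _; last by apply: ler_weXn2l => //; exact: ltW.
    rewrite /Aij mul2n -addnn !exprD exprM wq.
    have -> : (d.+1)`!%:R * (w ^+ n * (K%:R ^+ d * p%:R ^+ exponent_defect (ww j) m0 i)) =
       ((d.+1)`! * K ^ d)%:R * w ^+ n * p%:R ^+ exponent_defect (ww j) m0 i.
      by rewrite natrM natrX; move: (K%:R ^+ d) (p%:R ^+ _) (w ^+ n) (_%:R) => a b e h; ring.
    apply: ler_wpM2r; first by rewrite exprn_ge0.
    apply: ler_wpM2r; first by rewrite exprn_ge0.
    apply: le_trans Hk2 _; apply: ler_weXn2l => //; exact: ltW.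
  rewrite /bet (negPf l0).
  have adjE a : sg j0 (\adj M a l) = \adj (map_mx (sg j0) M) a l by rewrite -map_mx_adj [RHS]mxE.
  rewrite !adjE; have [Hg0 Hg0' Hg00] := Hg ord0.
  apply: (adjugate_congruence vO (M := map_mx (sg j0) M) (eta := fun a => gam a ^+ n) (o := ord0)).
  + by move=> a b; rewrite mxE; exact: (vr_sg nrA).
  + by move=> a; exact: Og.
  + by rewrite -exprVn; exact: (vrX vO).
  + exact: expf_neq0.
  move=> r _; case: (unliftP ord0 r) => [r'|] ->.
    rewrite (bigD1_ord ord0) //= mxE M_S0 rmorph0 mul0r add0r.
    have := yL (enum_val (f r')); rewrite /in_lattice; congr (O (_ / _)).
    by apply: eq_bigr => c _; rewrite [in RHS]mxE M_SS mxE.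
  by move: ZO; congr (O (_ / _)); apply: eq_bigr => c _; rewrite mxE M_0.
have -> : - (sg j0 (Z (lift ord0 ord0)) * gam (lift ord0 ord0) ^+ n / (sg j0 (Z ord0) * gam ord0 ^+ n)) =
   ratio_root sg j0 (G ord0) (G (lift ord0 ord0)) (Z ord0) (Z (lift ord0 ord0)) n.
  rewrite /ratio_root !HG !exprMn; have Qn : Q%:R ^+ n != 0 :> algC by rewrite expf_neq0 // pnatr_eq0 -lt0n.
  have [_ _ Hg00] := Hg ord0; have := expf_neq0 n Hg00; have := Zne ord0; move: Qn.
  move: (Q%:R ^+ n : algC) (sg j0 (Z ord0)) (sg j0 (Z (lift ord0 ord0))) (gam ord0 ^+ n) (gam (lift ord0 ord0) ^+ n) => a e b v u a0 e0 v0.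
  by field; rewrite a0 e0 v0.
by apply: Hmult => // j; apply: small_exp_le p0 qq1 (ZB _ j).
Qed.

End Step.

Lemma not_bad_step d (gam : 'I_d.+2 -> algC) : admissible gam -> (forall i, ~ bad (fun k => gam (lift i k))) -> ~ bad gam.
Proof.
move=> gamA Hsub Hbad; have [q0 [N0 [q00 N00 Hq0]]] := uniform_not_bad Hsub.
have [s [t [s0 Hnorm Hcl]]] := padic_norm_and_classes nrA j0 vO pp Np.
have [G [Q [Q0 HG Hg Hfree]]] := gamA.
have Gne i : sg j0 (G i) != 0.
  by have [_ _ g0] := Hg i; rewrite HG mulf_neq0 // pnatr_eq0 -lt0n.
have rfree : ratio_root_free (sg j0 (G (lift ord0 ord0)) / sg j0 (G ord0)).
  rewrite !HG -mulf_div mulfV ?pnatr_eq0 -?lt0n // mul1r; apply: Hfree; by rewrite eq_sym neq_lift.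
have [q1 [zz [n1 [q10 zz0 Hmult]]]] := ratio_mult_bound nrA (Gne ord0) (Gne (lift ord0 ord0)) rfree pp.
pose q2 := (6 * d.+2 * q0 * q1)%N; pose w : algC := q2.-root p%:R.
have q20 : (0 < q2)%N by rewrite !muln_gt0 q00 q10.
have w1 : 1 < w by rewrite rootC_gt1 // -[1]/(1%:R) ltr_nat prime_gt1.
have wq : w ^+ q2 = p%:R by exact: rootCK.
have [n2 Hn2] := step_package gamA q00 N00 Hq0 Hcl Q0 HG Hmult q10 (erefl q2) w1 wq.
(* The pattern [x] depends on [n] but ranges over a finite set, so one pattern recurs for
   arbitrarily large [n]. *)
pose T : finType := {ffun 'I_d.+2 * 'I_g -> 'I_(q2 * d.+1 * s).+1}.
have [x Hx] : exists x : T, forall N, exists n, (N <= n)%N /\ ((\sum_j \sum_i x (i, j) < q2 * d.+1 * s)%N /\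
      exists Z be, package sg O p j0 gam w (fun i j => x (i, j)) zz n Z be).
  apply: infinite_pigeonhole => N; have [n [Nn [Z HZ]]] := Hbad q2 (maxn N n2) q20.
  exists n; split; first by apply: leq_trans Nn; exact: leq_maxl.
  have [x [xS xP]] := Hn2 n Z (leq_trans (leq_maxr _ _) Nn) HZ.
  have xb i j : (x i j < (q2 * d.+1 * s).+1)%N.
    rewrite ltnS; apply: leq_trans (ltnW xS); rewrite (bigD1 j) //= (bigD1 i) //= -addnA leq_addr //.
  exists [ffun c => Ordinal (xb c.1 c.2)]; split.
    by under eq_bigr => j _ do under eq_bigr => i _ do rewrite ffunE.
  have -> : (fun i j => val ([ffun c : 'I_d.+2 * 'I_g => Ordinal (xb c.1 c.2)] (i, j))) = x; last exact: xP.
  by apply: boolp.funext => i; apply: boolp.funext => j; rewrite ffunE.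
have [n3 [_ [xS _]]] := Hx 0%N.
pose Call := \sum_j \sum_i `|sg j (G i)|.
have Call0 : 0 <= Call by apply: sumr_ge0 => j _; apply: sumr_ge0.
have [CG0 HCG0] : exists M : nat, Call < M%:R by exists (Num.Def.archi_bound Call); exact: archi_boundP.
have GB i j : `|sg j (G i)| <= 2 ^+ (CG0 + Q).
  apply: le_trans (_ : _ <= Call) _.
    rewrite /Call (bigD1 j) //= (bigD1 i) //= -addrA lerDl.
    by apply: addr_ge0; [apply: sumr_ge0 | apply: sumr_ge0 => j' _; apply: sumr_ge0].
  apply: le_trans (ltW HCG0) _; rewrite -natrX ler_nat; apply: ltnW.
  by apply: leq_trans (ltn_expl CG0 (isT : 1 < 2)%N) _; rewrite leq_exp2l // leq_addr.
have QB : (Q <= 2 ^ (CG0 + Q))%N.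
  by apply: leq_trans (ltnW (ltn_expl Q (isT : 1 < 2)%N)) _; rewrite leq_exp2l // leq_addl.
apply: (no_packages nrA vO pp Hnorm Q0 HG _ _ _ GB QB (ltW w1) wq xS (zz := zz)).
- by move=> i; have [] := Hg i.
- by move=> i; have [] := Hg i.
- by move=> i; have [] := Hg i.
by move=> N; have [n [Nn [_ Hp]]] := Hx N; exists n.
Qed.

Lemma admissible_sub k k' (gam : 'I_k -> algC) (f : 'I_k' -> 'I_k) : injective f -> admissible gam -> admissible (fun i => gam (f i)).
Proof.
move=> f_inj [G [Q [Q0 HG Hg Hf]]]; exists (fun i => G (f i)), Q; split=> //.
by move=> i i' ne; apply: Hf; rewrite (inj_eq f_inj).
Qed.

Lemma not_bad k (gam : 'I_k -> algC) : admissible gam -> ~ bad gam.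
Proof.
elim/ltn_ind: k gam => -[|[|d]] IH gam gamA; [exact: not_bad0 | exact: not_bad1 |].
apply: not_bad_step => // i; apply: IH => //; exact: admissible_sub (@lift_inj _ i) gamA.
Qed.

(** Fixed coefficients are eventually below [p^(n/q)] for each [q], so infinitely many relations
    would make [gam] bad. *)
Lemma finitely_many_relations k (gam : 'I_k -> algC) (Z : 'I_k -> A) : admissible gam -> (exists i, sg j0 (Z i) != 0) ->
  exists N, forall n, (N <= n)%N -> ~ O ((\sum_i sg j0 (Z i) * gam i ^+ n) / p%:R ^+ n).
Proof.
move=> gamA Zn; apply: NNPP => no; apply: (not_bad gamA) => q N0 q0.
pose Call := \sum_i \sum_j `|sg j (Z i)| ^+ q.
have Cj0 : 0 <= Call by apply: sumr_ge0 => j _; apply: sumr_ge0 => i _; exact: exprn_ge0.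
have [N1 HN1] := power_above Cj0.
apply: NNPP => no2; apply: no; exists (N0 + N1)%N => n Hn HO; apply: no2; exists n; split.
  by apply: leq_trans Hn; exact: leq_addr.
exists Z; split=> // i j; apply: le_trans (_ : _ <= Call) _.
  rewrite /Call (bigD1 i) //= (bigD1 j) //= -addrA lerDl.
  apply: addr_ge0; first by apply: sumr_ge0 => j' _; exact: exprn_ge0.
  by apply: sumr_ge0 => i' _; apply: sumr_ge0 => j' _; exact: exprn_ge0.
apply: le_trans (ltW HN1) _; rewrite -!natrX ler_nat leq_exp2l ?prime_gt1 //.
by apply: leq_trans Hn; exact: leq_addl.
Qed.

End Descent.

(** * Number rings generated by finitely many algebraic numbers *)

Definition int_eval (x : algC) : {rmorphism {poly int} -> algC} := horner_eval x \o map_poly intr.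

Lemma int_evalE x (a : {poly int}) : int_eval x a = (map_poly intr a).[x].
Proof. by []. Qed.

Lemma Aint_multiple (z : algC) : exists2 N : nat, (0 < N)%N & N%:R * z \in Aint.
Proof.
have [f [cf fz]] := primitive_int_poly z; have f0 : f != 0.
  by apply/eqP => f0; move: cf; rewrite f0 zcontents0.
pose n := (size f).-1; pose a := lead_coef f; have a0 : a != 0 by rewrite lead_coef_eq0.
have sz : size f = n.+1 by rewrite /n prednK // lt0n size_poly_eq0.
suff H : a%:~R * z \in Aint.
  exists `|a|%N; rewrite ?absz_gt0 // -[_%:R]/((Posz _)%:~R) abszE.
  have [_|_] := ger0P a; first by rewrite /= H.
  by rewrite rmorphN mulNr rpredN.
have [n0|n0] := posnP n.
  have : size f == 1%N by rewrite sz n0.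
  move/size_poly1P => [c c0 fE]; move: fz; rewrite fE map_polyC hornerC => /eqP.
  by rewrite intr_eq0 (negPf c0).
pose p := \poly_(i < n.+1) (if i == n then 1 else (f`_i * a ^+ (n.-1 - i))%:~R : algC).
apply: (@root_monic_Aint p).
- apply/rootP; rewrite horner_poly big_ord_recr /= eqxx mul1r.
  have Hz : a%:~R ^+ n.-1 * (map_poly intr f).[z] = 0 by rewrite fz mulr0.
  rewrite -[RHS]Hz (@horner_coef_wide _ n.+1) ?(leq_trans (size_poly _ _)) ?sz // big_ord_recr /= mulrDr mulr_sumr.
  congr (_ + _).
    apply: eq_bigr => i _; rewrite ltn_eqF // coef_map_id0 // intrM rmorphXn /= exprMn mulrCA !mulrA; congr (_ * _).
    have le : (i <= n.-1)%N by have := ltn_ord i; lia.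
    by rewrite mulrAC -exprD subnKC // mulrC.
  rewrite coef_map_id0 // -[f`_n]/(lead_coef f) -/a exprMn mulrA -exprSr prednK //.
- rewrite monicE lead_coefE size_poly_eq ?eqxx ?oner_eq0 // coef_poly ltnSn eqxx //.
by apply/polyOverP => i; rewrite coef_poly; case: (i < n.+1)%N; [case: (i == n); [exact: rpred1 | exact: intr_int] | exact: rpred0].
Qed.

Section ConjugateRoots.
Variables (th : algC) (q : {poly rat}).
Hypotheses (qE : minCpoly th = map_poly ratr q) (qm : q \is monic).
Hypothesis qP : forall r : {poly rat}, root (map_poly ratr r) th = (q %| r).

Lemma conj_root_dvd x : root (minCpoly th) x -> forall r : {poly rat}, root (map_poly ratr r) x = (q %| r).
Proof.
move=> rx; have [q' [q'E q'm] q'P] := minCpolyP x.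
have /dvdpP [r Er] : q' %| q by rewrite -q'P -qE.
have [Hd|Hd] : q %| q' \/ q %| r.
  rewrite -!qP; apply/orP; rewrite orbC -rootM -rmorphM -Er /= qP; exact: dvdpp.
  suff -> : q = q' by [].
  apply/eqP; rewrite -eqp_monic //; apply/andP; split=> //; by rewrite Er dvdp_mulIr.
exfalso; have r0 : r != 0 by apply: contraTneq qm => r0; rewrite Er r0 mul0r monicE lead_coef0 eq_sym oner_eq0.
have := dvdp_leq r0 Hd; rewrite Er size_mul //; last exact: monic_neq0.
have := size_minCpoly x; rewrite q'E size_map_poly.
by move: r0; rewrite -size_poly_gt0; move: (size r : nat) (size q' : nat) => u v; clear; lia.
Qed.

Lemma minCpoly_roots_uniq : exists2 rs : seq algC, uniq rs & minCpoly th = \prod_(x <- rs) ('X - x%:P).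
Proof.
have [rs Ers] := closed_field_poly_normal (minCpoly th).
rewrite (monicP (minCpoly_monic th)) scale1r in Ers; exists rs => //.
rewrite -separable_prod_XsubC -Ers unlock; apply: Pdiv.ClosedField.root_coprimep => x rx.
rewrite qE deriv_map -[_ == 0]/(root _ x) conj_root_dvd //; apply/negP => Hd.
have q0 : q != 0 := monic_neq0 qm.
have s1 : (1 < size q)%N by have := size_minCpoly th; rewrite qE size_map_poly.
have d0 : q^`() != 0.
  apply/eqP => d0; have := congr1 (fun r : {poly rat} => r`_(size q).-2) d0.
  have E : (size q).-2.+1 = (size q).-1 by move: s1; move: (size q : nat) => u; lia.
  rewrite coef_deriv coef0 E -lead_coefE (monicP qm) => /eqP; rewrite pnatr_eq0.
  by move: s1; move: (size q : nat) => u; lia.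
by have := dvdp_leq d0 Hd; rewrite leqNgt lt_size_deriv.
Qed.

End ConjugateRoots.

(** Elements are integer polynomials evaluated at the conjugates of an integral generator [th] of
    the field of [xs] and the imaginary unit. Conjugate roots annihilate the same polynomials, which
    is [nr_ker]; the powers of [th] span, and the Vandermonde determinant gives [nr_unit]. *)
Lemma number_ring_exists (xs : seq algC) : exists (g : nat) (sg : 'I_g -> {rmorphism {poly int} -> algC}) (om : 'I_g -> {poly int})
   (cj : 'I_g -> 'I_g) (ii : {poly int}) (kp : nat) (j0 : 'I_g),
   [/\ number_ring sg om, conjugation sg cj ii kp &
     forall x, x \in xs -> exists (a : {poly int}) (Q : nat), (0 < Q)%N /\ sg j0 a = Q%:R * x].
Proof.
have [z _ [ps Eps]] := algC_PET ('i :: xs).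
have [N N0 thA] := Aint_multiple z; set th := N%:R * z in thA.
have Nn0 : N%:R != 0 :> algC by rewrite pnatr_eq0 -lt0n.
have gen x : x \in 'i :: xs -> exists (a : {poly int}) (Q : nat), (0 < Q)%N /\ int_eval th a = Q%:R * x.
  rewrite Eps => /mapP [p _ ->]; have [a [c c0 Ec]] := rat_poly_scale (p \Po (N%:R^-1 *: 'X)).
  have E : (map_poly ratr p).[z] = c%:~R^-1 * int_eval th a.
    transitivity (map_poly ratr (p \Po (N%:R^-1 *: 'X))).[th].
      rewrite map_comp_poly horner_comp map_polyZ map_polyX hornerZ hornerX fmorphV /= rmorph_nat.
      by rewrite /th mulKf.
    rewrite Ec map_polyZ hornerZ fmorphV /= ratr_int; congr (_ * _).
    by rewrite /horner_eval -map_poly_comp; congr (_.[_]); apply: eq_map_poly => b /=; rewrite ratr_int.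
  have cc0 : c%:~R != 0 :> algC by rewrite intr_eq0.
  have H : int_eval th a = c%:~R * (map_poly ratr p).[z] by rewrite E mulVKf.
  have [cp|cn] := ger0P c.
    exists a, `|c|%N; rewrite absz_gt0; split=> //; by rewrite H -[_%:R]/((Posz _)%:~R) gez0_abs.
  exists (- a), `|c|%N; rewrite absz_gt0; split=> //.
  by rewrite rmorphN H -[`|c|%:R]/((Posz _)%:~R) ltz0_abs // rmorphN mulNr.
have [q [qE qm] qP] := minCpolyP th; have [rs rsu rsE] := minCpoly_roots_uniq qE qm qP.
have [f fE] := floorpP (thA : minCpoly th \is a polyOver Num.int).
have fm : f \is monic.
  have E : lead_coef (map_poly intr f) = (lead_coef f)%:~R :> algC by rewrite lead_coef_map_inj //; exact: intr_inj.
  by have := minCpoly_monic th; rewrite fE monicE E -[1]/(1%:~R) eqr_int monicE.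
pose g := size rs.
have szf : size f = g.+1.
  rewrite -(size_map_inj_poly (f := intr : int -> algC)) //; last exact: intr_inj.
  by rewrite -fE rsE size_prod_XsubC.
have rsP x : (x \in rs) = root (minCpoly th) x by rewrite rsE root_prod_XsubC.
pose rt (j : 'I_g) := rs`_j; have rtP j : root (minCpoly th) (rt j) by rewrite -rsP mem_nth.
pose sg j := int_eval (rt j).
have thrs : th \in rs by rewrite rsP root_minCpoly.
have j0P : (index th rs < g)%N by rewrite index_mem.
pose j0 := Ordinal j0P; have rt0 : rt j0 = th by rewrite /rt nth_index.
have cjP (j : 'I_g) : (index (rt j)^* rs < g)%N.
  rewrite index_mem rsP; have := rtP j; rewrite -(fmorph_root Num.conj) fE -map_poly_comp.
  by congr (is_true (root _ _)); apply: eq_map_poly => b /=; rewrite rmorph_int.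
pose cj j := Ordinal (cjP j).
have rt_cj j : rt (cj j) = (rt j)^* by rewrite /rt /= nth_index // -index_mem; exact: cjP.
have cjK : involutive cj.
  move=> j; apply: val_inj => /=; rewrite -/(rt _) rt_cj conjCK /rt index_uniq //.
have ratE (a : {poly int}) x : (map_poly intr a).[x] = (map_poly ratr (map_poly (intr : int -> rat) a)).[x] :> algC.
  by rewrite -map_poly_comp; congr (_.[_]); apply: eq_map_poly => b /=; rewrite ratr_int.
have ker j j' a : sg j a = 0 -> sg j' a = 0.
  rewrite /sg !int_evalE !ratE => /eqP; rewrite -rootE (conj_root_dvd qE qm qP (rtP j)) -(conj_root_dvd qE qm qP (rtP j')).
  by move/rootP.
have [ii [kp [kp0 iiE]]] := gen 'i (mem_head _ _).
have nr : number_ring sg (fun i => 'X^i).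
  split=> //.
  - move=> a; exists (fun i => (Pdiv.Ring.rmodp a f)`_i) => j.
    have Ha : sg j a = sg j (Pdiv.Ring.rmodp a f).
      have := congr1 (sg j) (Pdiv.RingMonic.rdivp_eq fm a); rewrite (rmorphD (sg j)) (rmorphM (sg j)) => ->.
      have -> : sg j f = 0 by rewrite /sg int_evalE -fE; apply/rootP; exact: rtP.
      by rewrite mulr0 add0r.
    rewrite Ha /sg int_evalE (@horner_coef_wide _ g); last first.
      apply: leq_trans (size_poly _ _) _; rewrite -ltnS -szf; apply: Pdiv.Ring.ltn_rmodpN0; exact: monic_neq0.
    by apply: eq_bigr => i _; rewrite coef_map_id0 // int_evalE map_polyXn hornerXn.
  - have -> : \matrix_(i, j) sg j 'X^i = Vandermonde g (\row_j rt j).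
      by apply/matrixP => i j; rewrite !mxE /sg int_evalE map_polyXn hornerXn.
    rewrite unitmxE det_Vandermonde unitfE; apply/prodf_neq0 => i _; apply/prodf_neq0 => j ij; rewrite !mxE subr_eq0.
    by rewrite /rt nth_uniq // gtn_eqF.
  move=> j a; rewrite /sg int_evalE; apply: rpred_horner; last first.
    by apply: (@root_monic_Aint _ _ (rtP j) (minCpoly_monic th)).
  apply/polyOverP => i; rewrite coef_map_id0 //; apply: Aint_int; exact: intr_int.
exists g, sg, (fun i => 'X^i), cj, ii, kp, j0; split=> //.
  split=> //.
  - move=> j a; rewrite /sg !int_evalE rt_cj.
    rewrite -horner_map -map_poly_comp; congr (_.[_]); apply: eq_map_poly => b /=; by rewrite rmorph_int.
  move=> j; have H0 : sg j (ii ^+ 2 + (kp ^ 2)%:R) = 0.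
    apply: (ker j0); have E : sg j0 ii = kp%:R * 'i by rewrite /sg rt0.
    by rewrite (rmorphD (sg j0)) (rmorphXn (sg j0)) (rmorph_nat (sg j0)) E exprMn sqrCi mulrN1 natrX addNr.
  have : (sg j ii - 'i * kp%:R) * (sg j ii + 'i * kp%:R) == 0.
    by rewrite -subr_sqr exprMn sqrCi mulN1r opprK -(rmorphXn (sg j)) -natrX -(rmorph_nat (sg j)) -(rmorphD (sg j)) H0 eqxx.
  by rewrite mulf_eq0 subr_eq0 addr_eq0 => /orP[] /eqP ->; [left | right].
move=> x xs_x; have [|a [Q [Q0 E]]] := gen x; first by rewrite inE xs_x orbT.
by exists a, Q; split=> //; rewrite /sg rt0.
Qed.

(** * Linear recurrences with infinitely many integral values *)

Lemma common_denominator (A : comNzRingType) (f : {rmorphism A -> algC}) (T : finType) (x : T -> algC) :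
  (forall i, exists (a : A) (Q : nat), (0 < Q)%N /\ f a = Q%:R * x i) ->
  exists (a : T -> A) (Q : nat), (0 < Q)%N /\ forall i, f (a i) = Q%:R * x i.
Proof.
move=> H; have [a Ha] := fun_choice H; have [Q HQ] := fun_choice Ha.
exists (fun i => (\prod_(j | j != i) Q j)%N%:R * a i), (\prod_j Q j)%N; split.
  by apply: prodn_gt0 => i; case: (HQ i).
move=> i; have [_ E] := HQ i; rewrite (rmorphM f) (rmorph_nat f) E mulrA -natrM; congr (_%:R * _).
by rewrite [RHS](bigD1 i) //= mulnC.
Qed.

Section IntegralValues.
Variables (O : algC -> Prop) (p : nat).
Hypotheses (vO : valuation_ring O) (pp : prime p) (Np : ~ O (p%:R)^-1).

Lemma finitely_many_relations_in (T : finType) (D : pred T) (gam c : T -> algC) :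
  (forall i, D i -> [/\ O (gam i), O (gam i)^-1 & gam i != 0]) ->
  (forall i i', D i -> D i' -> i != i' -> ratio_root_free (gam i / gam i')) ->
  (exists2 i, D i & c i != 0) ->
  exists N, forall n, (N <= n)%N -> ~ O ((\sum_(i | D i) c i * gam i ^+ n) / p%:R ^+ n).
Proof.
move=> gamU gamR [l Dl cl].
pose ev (h : 'I_#|D|) := enum_val h; have evD h : D (ev h) := enum_valP h.
have [g [sg [om [cj [ii [kp [j0 [nr cjg gen]]]]]]]] := number_ring_exists (codom gam ++ codom c).
have [|G [Q [Q0 GE]]] := @common_denominator _ (sg j0) _ (fun h => gam (ev h)).
  by move=> h; apply: gen; rewrite mem_cat codom_f.
have [|Z [R [R0 ZE]]] := @common_denominator _ (sg j0) _ (fun h => c (ev h)).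
  by move=> h; apply: gen; rewrite mem_cat codom_f orbT.
have adm : admissible sg O j0 (fun h => gam (ev h)).
  exists G, Q; split=> //; first by move=> h; apply: gamU.
  by move=> h h' hh; apply: gamR => //; rewrite (inj_eq enum_val_inj).
have [|N HN] := finitely_many_relations nr cjg vO pp Np (Z := Z) adm.
  exists (enum_rank_in (A := D) Dl l); rewrite ZE; apply: mulf_neq0; first by rewrite pnatr_eq0 -lt0n.
  by rewrite /ev enum_rankK_in.
exists N => n Nn HO; apply: (HN n Nn).
have -> : \sum_i sg j0 (Z i) * gam (ev i) ^+ n = R%:R * \sum_(i | D i) c i * gam i ^+ n.
  rewrite mulr_sumr; under eq_bigr => h _ do rewrite ZE -mulrA.
  by rewrite -(big_enum_val (A := D) (fun i => R%:R * (c i * gam i ^+ n))); exact: eq_bigl.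
by rewrite -mulrA; apply: (vrM vO) => //; exact: vr_nat.
Qed.

Lemma vr_dominant (T : finType) (D : pred T) (bet : T -> algC) l : (forall i, bet i != 0) -> D l ->
  exists2 b, D b & forall i, D i -> O (bet i / bet b).
Proof.
move=> bet0 Dl.
suff H (s : seq T) : l \in s -> exists2 b, D b & forall i, i \in s -> D i -> O (bet i / bet b).
  by have [b Db Hb] := H (enum T) (mem_enum _ _); exists b => // i; apply: Hb; rewrite mem_enum.
suff H' : exists2 b, D b & forall i, i \in s -> D i -> O (bet i / bet b) by [].
elim: s => [|i s [b Db Hb]]; first by exists l.
have [Di|Di] := boolP (D i); last first.
  by exists b => // j; rewrite inE => /orP[/eqP ->|]; [rewrite (negPf Di) | exact: Hb].
have [Hi|Hi] := classic (O (bet i / bet b)).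
  by exists b => // j; rewrite inE => /orP[/eqP ->|]; [| exact: Hb].
exists i => // j; rewrite inE => /orP[/eqP ->|js Dj]; first by rewrite divff // => _; exact: (vr1 vO).
have -> : bet j / bet i = bet j / bet b * (bet i / bet b)^-1 by rewrite invf_div mulrA mulfVK.
by apply: (vrM vO); [exact: Hb | exact: (vrV vO)].
Qed.

Lemma vr_padic_denominator c : exists e, O (p%:R ^+ e * c).
Proof.
have [N N0 cA] := Aint_multiple c.
have [e Hm EN] := pfactor_coprime pp N0; set m := logn p N in EN.
exists m; have mu : O (e%:R)^-1.
  rewrite -[_%:R]/((Posz e)%:~R); apply: (vr_coprime_unit vO pp Np).
  by rewrite -[_ \in _]/((p %| e)%N) -prime_coprime.
have -> : p%:R ^+ m * c = e%:R^-1 * (N%:R * c).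
  rewrite EN natrM natrX -mulrA mulKf // pnatr_eq0 -lt0n.
  by move: N0; rewrite EN muln_gt0 => /andP[].
by apply: (vrM vO) => //; exact: (vr_Aint vO).
Qed.

(** The square leaves a factor [p^m] to spare in the [m]-th power, enough to absorb the fixed
    denominators of the coefficients. *)
Lemma vr_powers_small (T : finType) (x : T -> algC) (D : pred T) :
  (forall i, D i -> O (x i) /\ ~ O (x i)^-1) -> exists2 k, (0 < k)%N & forall i, D i -> O (x i ^+ k / p%:R ^+ 2).
Proof.
move=> H; have Hs i : exists s, D i -> O (x i ^+ s / p%:R).
  have [Di|Di] := boolP (D i); last by exists 0%N.
  by have [_ Hi] := H i Di; have [s _ Hs] := residue_power vO pp Np Hi; exists s; rewrite invrK in Hs.
have [s Hs'] := fun_choice Hs; exists (2 * (\sum_i s i).+1)%N => // i Di.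
have [Oi _] := H i Di.
have le : (s i <= (\sum_i s i).+1)%N by apply: leqW; rewrite (bigD1 i) //= leq_addr.
rewrite mulnC exprM -expr_div_n; apply: (vrX vO).
rewrite -(subnK le) exprD -mulrA; apply: (vrM vO); first exact: (vrX vO).
exact: Hs'.
Qed.

(** Divide the sum by the power of a dominant [bet b] with nonzero coefficient, which is not in [O].
    On a residue class modulo [k] the integral total and all terms of smaller size become divisible
    by [p^m]; what is left is a relation between units with a nonzero coefficient, possible for
    finitely many [m] only. *)
Lemma nonintegral_coef_zero_vr (T : finType) (bet c : T -> algC) l : (forall i, bet i != 0) ->
  (forall i i', i != i' -> ratio_root_free (bet i / bet i')) -> ~ O (bet l) ->
  (forall N, exists n, (N <= n)%N /\ O (\sum_i c i * bet i ^+ n)) -> c l = 0.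
Proof.
move=> bet0 betR Ol Hinf; apply/eqP; apply: contraT => cl.
have [b cb Hb] := vr_dominant (D := fun i => c i != 0) bet0 cl.
have Ob : ~ O (bet b).
  by move=> Ob; apply: Ol; rewrite -(mulfVK (bet0 b) (bet l)); apply: (vrM vO) => //; exact: Hb.
pose D i := (c i != 0) && boolp.asbool (O (bet b / bet i)).
(* The value [None] stands for [1/bet b] itself: the integral sum, once divided, must become small
   along with the subordinate terms. *)
pose x (o : option T) := if o is Some i then bet i / bet b else (bet b)^-1.
pose E (o : option T) := if o is Some i then (c i != 0) && ~~ D i else true.
have [|k k0 Hk] := vr_powers_small (x := x) (D := E).
  case=> [i|] /= => [/andP[ci nD]|_]; last by rewrite invrK; split=> //; exact: (vrV vO).
  split; first exact: Hb.
  by rewrite invf_div => HO; move: nD; rewrite /D ci /= => /negP; apply; apply/boolp.asboolP.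
have [e He] : exists e, forall i, O (p%:R ^+ e * c i).
  have [e He] := fun_choice (fun i => vr_padic_denominator (c i)); exists (\sum_i e i)%N => i.
  rewrite (bigD1 i) //= addnC exprD -mulrA; apply: (vrM vO) => //.
  by apply: (vrX vO); exact: (vr_nat vO).
have [r Hr] : exists r : 'I_k, forall N, exists m, (N <= m)%N /\ O (\sum_i c i * bet i ^+ (k * m + r)).
  apply: infinite_pigeonhole => N; have [n [Nn On]] := Hinf (k * N)%N.
  exists (n %/ k)%N; split; first by rewrite leq_divRL // mulnC.
  by exists (Ordinal (ltn_pmod n k0)); rewrite /= mulnC -divn_eq.
pose d i := c i * (bet i / bet b) ^+ r; pose y i := (bet i / bet b) ^+ k.
have y0 i : y i != 0 by rewrite expf_neq0 // mulf_neq0 ?invr_eq0.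
have pn0 : p%:R != 0 :> algC by rewrite pnatr_eq0 -lt0n prime_gt0.
have [|||N HN] := @finitely_many_relations_in T D y d.
- move=> i /andP[ci /boolp.asboolP Oi]; split=> //; first by apply: (vrX vO); exact: Hb.
  by rewrite /y -exprVn invf_div; apply: (vrX vO).
- move=> i i' _ _ ii' t t0; rewrite /y -expr_div_n -exprM.
  have -> : bet i / bet b / (bet i' / bet b) = bet i / bet i' by rewrite invf_div mulrA mulfVK.
  by apply: betR => //; rewrite muln_gt0 k0.
- exists b; first by rewrite /D cb divff //; apply/boolp.asboolP; exact: (vr1 vO).
  by rewrite /d divff // expr1n mulr1.
have [m [Nm Om]] := Hr (N + e)%N; have em : (e <= m)%N by apply: leq_trans Nm; rewrite leq_addl.
have Nm' : (N <= m)%N by apply: leq_trans Nm; rewrite leq_addr.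
have sq z : O (z ^+ k / p%:R ^+ 2) -> O ((z ^+ k) ^+ m / p%:R ^+ (m + m)).
  by move=> Oz; rewrite addnn -mul2n exprM -expr_div_n; apply: (vrX vO).
case: (HN m Nm').
have Eall : \sum_i d i * y i ^+ m = (bet b)^-1 ^+ r * ((bet b)^-1 ^+ k) ^+ m * \sum_i c i * bet i ^+ (k * m + r).
  rewrite mulr_sumr; apply: eq_bigr => i _; rewrite /d /y !expr_div_n !exprVn -!exprM exprD.
  by move: (bet b ^+ r)^-1 (bet b ^+ (k * m))^-1 (bet i ^+ r) (bet i ^+ (k * m)) => u v w z; ring.
have -> : \sum_(i | D i) d i * y i ^+ m = \sum_i d i * y i ^+ m - \sum_(i | ~~ D i) d i * y i ^+ m.
  by rewrite [X in _ = X - _](bigID D) /= addrK.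
rewrite mulrBl; apply: (vrB vO).
  apply: (vr_div_le vO pp (leq_addr m m)); rewrite Eall -mulrA mulrAC -!mulrA; apply: (vrM vO).
    by apply: (vrX vO); exact: (vrV vO).
  by apply: (vrM vO) => //; rewrite mulrC; apply: (sq _ (Hk None isT)).
rewrite mulr_suml; apply: (vr_sum vO) => i nD; have [ci|ci] := eqVneq (c i) 0.
  by rewrite /d ci !mul0r; exact: (vr0 vO).
apply: (vr_div_le vO pp (_ : m <= m + m - e)%N); first by lia.
have -> : d i * y i ^+ m / p%:R ^+ (m + m - e) = (bet i / bet b) ^+ r * (p%:R ^+ e * c i) * (y i ^+ m / p%:R ^+ (m + m)).
  have E2 : p%:R ^+ (m + m) = p%:R ^+ (m + m - e) * p%:R ^+ e :> algC by rewrite -exprD subnK //; lia.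
  rewrite E2 invfM /d; have : p%:R ^+ e != 0 :> algC by rewrite expf_neq0.
  move: (p%:R ^+ e) ((p%:R ^+ (m + m - e))^-1) (y i ^+ m) ((bet i / bet b) ^+ r) => u v w z u0.
  by field.
apply: (vrM vO); first apply: (vrM vO) => //; first by apply: (vrX vO); exact: Hb.
by apply: sq; apply: (Hk (Some i)); rewrite /= ci nD.
Qed.

End IntegralValues.

Lemma nonintegral_coef_zero (T : finType) (bet c : T -> algC) : (forall i, bet i != 0) ->
  (forall i i', i != i' -> ratio_root_free (bet i / bet i')) ->
  (forall N, exists n, (N <= n)%N /\ \sum_i c i * bet i ^+ n \is a Num.int) ->
  forall l, bet l \notin Aint -> c l = 0.
Proof.
move=> bet0 betR Hinf l /valuation_ring_exists [O vO Ol].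
have [p pp Np] := residue_prime vO Ol.
apply: (nonintegral_coef_zero_vr vO pp Np bet0 betR Ol) => N; have [n [Nn Hn]] := Hinf N.
by exists n; split=> //; exact: (vr_int vO).
Qed.

(** * Embeddings of a number field and its trace *)

Section Embeddings.
Variable L : fieldExtType rat.
Implicit Types (s : {rmorphism L -> algC}) (f : {poly rat}).

Lemma rmorph_ratZ s c x : s (c *: x) = ratr c * s x.
Proof. by rewrite -[c *: x]mulr_algl rmorphM; congr (_ * _); exact: (fmorph_eq_rat (s \o GRing.in_alg L)). Qed.

Lemma rmorph_horner s f x : s (map_poly (GRing.in_alg L) f).[x] = (map_poly ratr f).[s x].
Proof.
rewrite -horner_map -map_poly_comp; congr (_.[_]); apply: eq_map_poly => c /=.
by rewrite rmorph_ratZ rmorph1 mulr1.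
Qed.

Lemma root_rmorph s s' f x : root (map_poly ratr f) (s x) = root (map_poly ratr f) (s' x).
Proof. by rewrite !rootE -!rmorph_horner !fmorph_eq0. Qed.

Lemma Aint_rmorph s s' x : s x \in Aint -> s' x \in Aint.
Proof.
have [q [qE qm] qP] := minCpolyP (s x); rewrite unfold_in qE => Hq.
apply: (@root_monic_Aint (map_poly ratr q)) => //; last by rewrite map_monic.
by rewrite (root_rmorph _ s) -qE root_minCpoly.
Qed.

Lemma Aint_expr (x : algC) t : (0 < t)%N -> x ^+ t \in Aint -> x \in Aint.
Proof.
move=> t0 xt; apply: contraT => /valuation_ring_exists [O vO]; case.
have [//|nO] := classic (O x); have /(vr_Aint vO) Ot := xt.
have x0 : x != 0 by apply: contra_not_neq nO => ->; exact: (vr0 vO).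
have -> : x = x ^+ t * x^-1 ^+ t.-1 by rewrite -{1}(prednK t0) exprSr exprVn mulrAC divff ?mul1r // expf_neq0.
by apply: (vrM vO) => //; apply: (vrX vO); exact: (vrV vO).
Qed.

Lemma primitive_element (iota : {rmorphism L -> algC}) :
  exists th, forall x, exists f, x = (map_poly (GRing.in_alg L) f).[th].
Proof.
pose b := vbasis {: L}; have [z [a zE] [ps psE]] := algC_PET [seq iota v | v <- b].
pose th := \sum_(i < size [seq iota v | v <- b]) b`_i *+ a i.
have zth : iota th = z.
  rewrite zE rmorph_sum; apply: eq_bigr => i _; rewrite rmorphMn (nth_map 0) //.
  by apply: leq_trans (ltn_ord i) _; rewrite size_map.
exists th; have Hb (i : 'I_(\dim {: L})) : exists f, b`_i = (map_poly (GRing.in_alg L) f).[th].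
  have : iota b`_i \in [seq iota v | v <- b] by rewrite map_f // mem_nth // size_tuple.
  rewrite psE => /mapP [f _]; rewrite -zth -rmorph_horner => /fmorph_inj E; by exists f.
have [f Hf] := fun_choice Hb => x; exists (\sum_i coord b i x *: f i).
rewrite {1}(coord_vbasis (memvf x)) rmorph_sum horner_sum; apply: eq_bigr => i _.
by rewrite /= map_polyZ hornerZ -Hf /= mulr_algl.
Qed.

Definition embedding_matrix d (sg : 'I_d -> {rmorphism L -> algC}) : 'M[algC]_(\dim {: L}, d) :=
  \matrix_(i, j) sg j (vbasis {: L})`_i.

(** The embeddings send a primitive element to the roots of its minimal polynomial, so their matrix
    is a change of basis times a Vandermonde matrix. A two-sided inverse [F] is carried along
    instead of an equality between [d] and the dimension, which avoids casts of matrix sizes. *)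
Lemma embeddings_exist (iota : {rmorphism L -> algC}) : exists d (sg : 'I_d -> {rmorphism L -> algC}) F,
  embedding_matrix sg *m F = 1%:M /\ F *m embedding_matrix sg = 1%:M.
Proof.
have [th /fun_choice [P HP]] := primitive_element iota.
have [q [qE qm] qP] := minCpolyP (iota th).
have [rs rsu rsE] := minCpoly_roots_uniq qE qm qP; set d := size rs.
have szq : size q = d.+1 by rewrite -(size_map_poly (ratr : {rmorphism rat -> algC})) -qE rsE size_prod_XsubC.
pose rt (j : 'I_d) := rs`_j.
have rtP j : root (minCpoly (iota th)) (rt j) by rewrite rsE root_prod_XsubC mem_nth.
have ev0 j f : (map_poly (GRing.in_alg L) f).[th] = 0 -> (map_poly ratr f).[rt j] = 0.
  move=> E; apply/rootP; rewrite (conj_root_dvd qE qm qP (rtP j)) -qP.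
  by rewrite rootE -rmorph_horner E rmorph0.
have evE j f f' : (map_poly (GRing.in_alg L) f).[th] = (map_poly (GRing.in_alg L) f').[th] ->
    (map_poly ratr f).[rt j] = (map_poly ratr f').[rt j].
  move=> E; apply/eqP; rewrite -subr_eq0 -hornerN -hornerD -rmorphB; apply/eqP/ev0.
  by rewrite rmorphB hornerD hornerN E subrr.
have sgex j : exists s : {rmorphism L -> algC}, forall f, s (map_poly (GRing.in_alg L) f).[th] = (map_poly ratr f).[rt j].
  pose h x := (map_poly ratr (P x)).[rt j].
  have hE f : h (map_poly (GRing.in_alg L) f).[th] = (map_poly ratr f).[rt j] by apply: evE; rewrite -HP.
  have hB : zmod_morphism h.
    by move=> x y; rewrite {1}(HP x) {1}(HP y) -hornerN -hornerD -rmorphB hE rmorphB hornerD hornerN.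
  have hM : monoid_morphism h.
    split; last by move=> x y; rewrite {1}(HP x) {1}(HP y) -hornerM -rmorphM hE rmorphM hornerM.
    by have := hE 1%:P; rewrite !map_polyC !hornerC /= scale1r rmorph1.
  pose mA := GRing.isZmodMorphism.Build L algC h hB; pose mM := GRing.isMonoidMorphism.Build L algC h hM.
  pose hr : {rmorphism L -> algC} := HB.pack h mA mM.
  by exists hr.
have [sg sgE] := fun_choice sgex.
have sgth j : sg j th = rt j by have := sgE j 'X; rewrite !map_polyX !hornerX.
pose b := vbasis {: L}; pose E := embedding_matrix sg.
pose C : 'M[algC]_(d, \dim {: L}) := \matrix_(k, i) ratr (coord b i (th ^+ k)).
pose B : 'M[algC]_(\dim {: L}, d) := \matrix_(i, k) ratr (P b`_i %% q)`_k.
pose V := Vandermonde d (\row_j rt j).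
have CE : C *m E = V.
  apply/matrixP => k j; rewrite !mxE -sgth -rmorphXn [in RHS](coord_vbasis (memvf (th ^+ k))) rmorph_sum.
  by apply: eq_bigr => i _; rewrite !mxE rmorph_ratZ.
have Pb i : (map_poly (GRing.in_alg L) (P b`_i %% q)).[th] = b`_i.
  rewrite [RHS]HP {2}(divp_eq (P b`_i) q) rmorphD rmorphM hornerD hornerM.
  suff -> : (map_poly (GRing.in_alg L) q).[th] = 0 by rewrite mulr0 add0r.
  by apply: (fmorph_inj iota); rewrite rmorph_horner rmorph0; apply/rootP; rewrite qP.
have szP (i : nat) : (size (P b`_i %% q)%R <= d)%N by rewrite -ltnS -szq ltn_modp monic_neq0.
have EB : E = B *m V.
  apply/matrixP => i j; rewrite !mxE -{1}(Pb i) sgE (@horner_coef_wide _ d) ?size_map_poly //.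
  by apply: eq_bigr => k _; rewrite !mxE coef_map.
have BC : B *m C = 1%:M.
  apply/matrixP => i i'; rewrite !mxE.
  transitivity (ratr (coord b i' b`_i) : algC); last by rewrite coord_free ?rmorph_nat // (basis_free (vbasisP _)).
  rewrite -[in RHS](Pb i) (@horner_coef_wide _ d) ?size_map_poly // linear_sum rmorph_sum.
  by apply: eq_bigr => k _; rewrite !mxE coef_map /= mulr_algl linearZ /= rmorphM.
have Vu : V \in unitmx.
  rewrite unitmxE det_Vandermonde unitfE; apply/prodf_neq0 => i _; apply/prodf_neq0 => j ij; rewrite !mxE subr_eq0.
  by rewrite /rt nth_uniq // gtn_eqF.
exists d, sg, (invmx V *m C); rewrite -/E; split; last by rewrite -mulmxA CE mulVmx.
by rewrite EB mulmxA mulmxK.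
Qed.

Section Trace.
Variables (d : nat) (sg : 'I_d -> {rmorphism L -> algC}) (F : 'M[algC]_(d, \dim {: L})).
Hypotheses (EF : embedding_matrix sg *m F = 1%:M) (FE : F *m embedding_matrix sg = 1%:M).

Let mulmat x : 'M[algC]_(\dim {: L}) := map_mx ratr (passmx.mxof (vbasis {: L}) (vbasis {: L}) (amulr x)).

Lemma mulmat_eigen s x (i : 'I_(\dim {: L})) : s (vbasis {: L})`_i * s x = \sum_k mulmat x i k * s (vbasis {: L})`_k.
Proof.
rewrite -rmorphM [X in s X](coord_vbasis (memvf _)) rmorph_sum; apply: eq_bigr => k _.
rewrite rmorph_ratZ /mulmat mxE /passmx.mxof mxE /= passmx.vecof_delta mxE.
by rewrite /amulr lfunE.
Qed.

Lemma mulmat_diag x : mulmat x *m embedding_matrix sg = embedding_matrix sg *m diag_mx (\row_j sg j x).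
Proof.
apply/matrixP => i j; rewrite mul_mx_diag !mxE mulmat_eigen.
by apply: eq_bigr => k _; rewrite [embedding_matrix _ _ _]mxE.
Qed.

(** The embedding matrix diagonalises multiplication by [x], with the values [sg j x] on the
    diagonal. *)
Lemma fieldTr_embeddings x : ratr (fieldTr x) = \sum_j sg j x.
Proof.
transitivity (\tr (mulmat x)); first by rewrite /fieldTr -trace_map_mx.
rewrite -[mulmat x]mulmx1 -EF mulmxA mulmat_diag -mulmxA mxtrace_mulC -mulmxA FE mulmx1 mxtrace_diag.
by apply: eq_bigr => j _; rewrite mxE.
Qed.

(** The hypothesis makes [r] a root of the characteristic polynomial of multiplication by [x], and
    by the diagonalisation every eigenvalue is some [sg j x]. *)
Lemma conjugate_embedding s x r :
  (forall f, root (map_poly ratr f) (s x) -> root (map_poly ratr f) r) -> exists j, sg j x = r.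
Proof.
move=> Hr; set M := passmx.mxof (vbasis {: L}) (vbasis {: L}) (amulr x).
have eigE (a : algC) : eigenvalue (mulmat x) a = root (map_poly ratr (char_poly M)) a.
  by rewrite eigenvalue_root_char map_char_poly.
have /eigenvalueP [u uE u0] : eigenvalue (mulmat x) r.
  rewrite eigE; apply: Hr; rewrite -eigE /eigenvalue /eigenspace kermx_eq0 row_free_unit.
  apply/negP => Mu; pose v : 'cV[algC]_(\dim {: L}) := \col_i s (vbasis {: L})`_i.
  have : (mulmat x - (s x)%:M) *m v = 0.
    apply/matrixP => i k; rewrite mulmxBl mul_scalar_mx !mxE mulrC mulmat_eigen.
    by apply/eqP; rewrite subr_eq0; apply/eqP; apply: eq_bigr => h _; rewrite [v _ _]mxE.
  move/(congr1 (mulmx (invmx (mulmat x - (s x)%:M)))); rewrite mulKmx // mulmx0 => v0.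
  have : s 1 = 0.
    rewrite (coord_vbasis (memvf 1)) rmorph_sum big1 // => i _; rewrite rmorph_ratZ.
    by have := congr1 (fun w : 'cV__ => w i 0) v0; rewrite !mxE => ->; rewrite mulr0.
  by move/eqP; rewrite rmorph1 oner_eq0.
apply: NNPP => no; case/eqP: u0.
rewrite -[u]mulmx1 -EF mulmxA; suff -> : u *m embedding_matrix sg = 0 by rewrite mul0mx.
apply/rowP => j; have := congr1 (fun w => (w *m embedding_matrix sg) 0 j) uE.
rewrite -mulmxA mulmat_diag mulmxA mul_mx_diag -scalemxAl.
rewrite [LHS]mxE [(\row_j sg j x) _ _]mxE [RHS]mxE [r * _]mulrC => E; rewrite [RHS]mxE; apply/eqP; apply: contraT => ne; case: no.
by exists j; apply: (mulfI ne).
Qed.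

(** Suppose [b < a]. By conjugation, every [sg j x] to the power [a] is some [sg j' x] to the power
    [b]. For a conjugate of largest size with respect to a valuation ring, the power [a - b] is then
    a power of a quotient lying in [O], which forces all conjugates into [O]. *)
Lemma conjugate_powers_eq (x : L) j1 j2 a b : sg j1 x \notin Aint ->
  sg j1 x ^+ a = sg j2 x ^+ b -> a = b.
Proof.
wlog ab : j1 j2 a b / (b < a)%N.
  move=> W xA E; have [ba|ab|//] := ltngtP b a; first exact: W ba xA E.
  by apply/esym; apply: (W j2 j1 b a ab) => //; apply: contra xA; exact: Aint_rmorph.
move=> xA E; exfalso.
have Hr j : exists j', sg j' x ^+ b = sg j x ^+ a.
  have [|j' Ej] := @conjugate_embedding (sg j) (x ^+ b) (sg j x ^+ a).
    by move=> f; rewrite (root_rmorph _ (sg j2)) rmorphXn -E -!rmorphXn (root_rmorph _ (sg j)).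
  by exists j'; rewrite -rmorphXn Ej.
have [O vO nO] := valuation_ring_exists xA.
have x0 j : sg j x != 0.
  by rewrite fmorph_eq0; apply: contra_notN nO => /eqP ->; rewrite rmorph0; exact: (vr0 vO).
have [m _ Hm] := vr_dominant vO (D := xpredT) (l := j1) x0 isT.
have Om : ~ O (sg m x).
  by move=> Om; apply: nO; rewrite -(mulfVK (x0 m) (sg j1 x)); apply: (vrM vO) => //; exact: Hm.
have [j' Ej] := Hr m; apply: Om.
have : O (sg m x ^+ (a - b)).
  have -> : sg m x ^+ (a - b) = (sg j' x / sg m x) ^+ b.
    by rewrite expr_div_n Ej -{2}(subnK (ltnW ab)) exprD mulfK // expf_neq0.
  by apply: (vrX vO); exact: Hm.
have : (0 < a - b)%N by rewrite subn_gt0.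
case: (a - b)%N => // t _ Ot; have [//|nOm] := classic (O (sg m x)).
have -> : sg m x = sg m x ^+ t.+1 * (sg m x)^-1 ^+ t by rewrite exprS exprVn mulfK // expf_neq0.
by apply: (vrM vO) => //; apply: (vrX vO); exact: (vrV vO).
Qed.

End Trace.
End Embeddings.

(** * Conclusion *)

Section Conclusion.
Variables (L : fieldExtType rat) (iota : {rmorphism L -> algC}) (x : L) (P : {poly L}).
Hypotheses (x0 : x != 0) (xA : iota x \notin Aint).
Variables (d : nat) (sg : 'I_d -> {rmorphism L -> algC}) (F : 'M[algC]_(d, \dim {: L})).
Hypotheses (EF : embedding_matrix sg *m F = 1%:M) (FE : F *m embedding_matrix sg = 1%:M).

Let T := ('I_d * 'I_(size P))%type.
Let rho (t : T) : algC := sg t.1 x ^+ t.2.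
Let a (t : T) : algC := sg t.1 P`_t.2.

Let sg0 j : sg j x != 0. Proof. by rewrite fmorph_eq0. Qed.
Let rho0 t : rho t != 0. Proof. exact: expf_neq0. Qed.

Lemma fieldTr_horner n : ratr (fieldTr P.[x ^+ n]) = \sum_t a t * rho t ^+ n.
Proof.
rewrite (fieldTr_embeddings EF FE) -(pair_big xpredT xpredT (fun j i => a (j, i) * rho (j, i) ^+ n)) /=.
apply: eq_bigr => j _; rewrite horner_coef rmorph_sum; apply: eq_bigr => i _.
by rewrite rmorphM !rmorphXn /a /rho /= -!exprM mulnC.
Qed.

Lemma fieldTr_coef (i : 'I_(size P)) n : ratr (fieldTr (P`_i * x ^+ (i * n))) = \sum_(t | t.2 == i) a t * rho t ^+ n.
Proof.
rewrite (fieldTr_embeddings EF FE).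
rewrite (eq_bigl (fun t : T => xpredT t.1 && (t.2 == i))) //.
rewrite -(pair_big xpredT (fun k => k == i) (fun j k => a (j, k) * rho (j, k) ^+ n)) /=.
apply: eq_bigr => j _; rewrite big_pred1_eq rmorphM rmorphXn /a /rho /= -exprM //.
Qed.

Lemma common_root_order : exists2 M, (0 < M)%N & forall t t', rho t ^+ M = rho t' ^+ M \/ ratio_root_free (rho t / rho t').
Proof.
have Hm (u : T * T) : exists m, (0 < m)%N /\ (rho u.1 ^+ m = rho u.2 ^+ m \/ ratio_root_free (rho u.1 / rho u.2)).
  have [H|H] := classic (ratio_root_free (rho u.1 / rho u.2)); first by exists 1%N; split=> //; right.
  apply: NNPP => no; apply: H => m m0; apply: contra_notN no => /eqP E; exists m; split=> //; left.
  by apply/eqP; rewrite -subr_eq0; apply/eqP; move: E; rewrite expr_div_n => /divr1_eq ->; rewrite subrr.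
have [m HM] := fun_choice Hm; exists (\prod_u m u)%N; first by apply: prodn_gt0 => u; case: (HM u).
move=> t t'; have [_ [E|]] := HM (t, t'); [left | by right].
by rewrite (bigD1 (t, t')) //= !exprM E.
Qed.

Lemma trace_coef_vanishes_infinitely_often :
  (forall N, exists n, (N <= n)%N /\ fieldTr P.[x ^+ n] \is a Num.int) ->
  forall i : 'I_(size P), (0 < i)%N -> infinitely_many (fun n => fieldTr (P`_i * x ^+ (i * n)) = 0).
Proof.
move=> Hinf i i0; have [M M0 HM] := common_root_order.
pose bs := codom (fun t => rho t ^+ M).
have bsP t : rho t ^+ M \in bs by exact: codom_f.
(* The list [bs] may repeat values; its subtype merges the terms whose [M]-th powers agree. *)
pose h t : seq_sub bs := SeqSub (bsP t).
have [r Hr] : exists r : 'I_M, forall N, exists m, (N <= m)%N /\ \sum_t a t * rho t ^+ (M * m + r) \is a Num.int.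
  apply: infinite_pigeonhole => N; have [n [Nn Hn]] := Hinf (M * N)%N.
  exists (n %/ M)%N; split; first by rewrite leq_divRL // mulnC.
  exists (Ordinal (ltn_pmod n M0)); rewrite /= mulnC -divn_eq -fieldTr_horner.
  by case/intrP: Hn => k ->; rewrite ratr_int intr_int.
pose c z := \sum_(t | h t == z) a t * rho t ^+ r.
have grp (Q : pred T) m : \sum_(t | Q t) a t * rho t ^+ (M * m + r)
    = \sum_z (\sum_(t | Q t && (h t == z)) a t * rho t ^+ r) * val z ^+ m.
  rewrite (partition_big h xpredT) //; apply: eq_bigr => z _; rewrite mulr_suml.
  by apply: eq_bigr => t /andP[_ /eqP <-] /=; rewrite exprD exprM mulrAC mulrA.
have hP z : exists t, h t = z.
  by case: z => b; rewrite /bs => bP; case/codomP: (bP) => t E; exists t; apply: val_inj.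
have c0 z : val z \notin Aint -> c z = 0.
  apply: (@nonintegral_coef_zero _ (fun z : seq_sub bs => val z)).
  - by move=> z'; have [t <-] := hP z'; rewrite expf_neq0.
  - move=> z1 z2; have [t1 <-] := hP z1; have [t2 <-] := hP z2 => ne k k0.
    have [E|H] := HM t1 t2; first by case/eqP: ne; apply: val_inj.
    by rewrite /= -expr_div_n -exprM; apply: H; rewrite muln_gt0 M0.
  by move=> N; have [m [Nm Hm]] := Hr N; exists m; split=> //; rewrite -[\sum_z _](grp xpredT).
move=> N; exists (M * N + r)%N; split.
  by apply: leq_trans (leq_addr _ _); rewrite leq_pmull.
suff E : ratr (fieldTr (P`_i * x ^+ (i * (M * N + r)))) = 0 :> algC.
  by apply: (fmorph_inj (ratr : {rmorphism rat -> algC})); rewrite rmorph0.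
rewrite fieldTr_coef grp big1 // => z _.
have [/existsP [t0 /andP[ti /eqP tz]]|no] := boolP [exists t : T, (t.2 == i) && (h t == z)]; last first.
  rewrite big_pred0 ?mul0r // => t; apply: contraNF no => Ht; apply/existsP; by exists t.
have zE : val z = sg t0.1 x ^+ (i * M) by rewrite -tz /= /rho (eqP ti) exprM.
have nA j : sg j x \notin Aint by apply: contra xA; exact: Aint_rmorph.
rewrite (eq_bigl (fun t => h t == z)).
  rewrite -/(c z) c0 ?mul0r // zE; apply: contra (nA t0.1); apply: Aint_expr; by rewrite muln_gt0 i0.
move=> t; rewrite andb_idl // => /eqP /(congr1 val); rewrite zE /= /rho -exprM.
move/(conjugate_powers_eq EF (nA _)) /eqP; rewrite eqn_pmul2r // => /eqP E.
Qed.

End Conclusion.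

(* L = Q(a_0, ..., a_k, alpha) is represented as an abstract number field
   L : fieldExtType rat with an embedding iota : L -> algC (= Qbar), together
   with preimages alphaL of alpha and PL of P (coefficientwise), such that
   L is generated over Q by alphaL and the coefficients of PL. *)
Theorem theorem2p5
  (alpha : algC) (P : {poly algC})
  (L : fieldExtType rat) (iota : {rmorphism L -> algC})
  (alphaL : L) (PL : {poly L}) :
  alpha != 0 ->
  (1 < size P)%N ->
  iota alphaL = alpha ->
  map_poly iota PL = P ->
  <<1 & alphaL :: polyseq PL>>%VS = fullv ->
  infinitely_many (fun n => fieldTr PL.[alphaL ^+ n] \is a Num.int
                            /\ fieldTr PL.[alphaL ^+ n] != 0) ->
  alpha \in Aint \/
  (forall i : nat, (1 <= i <= (size P).-1)%N ->
     infinitely_many (fun n => fieldTr (PL`_i * alphaL ^+ (i * n)) = 0)).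
Proof.
move=> a0 szP aE PE _ Hinf.
have [aA|aA] := boolP (alpha \in Aint); [by left | right => i /andP[i0 iP]].
have [d [sg [F [EF FE]]]] := embeddings_exist iota.
have iP' : (i < size PL)%N.
  by rewrite -(size_map_poly iota) PE -(ltn_predK szP) ltnS.
apply: (trace_coef_vanishes_infinitely_often _ (iota := iota) _ EF FE _ (i := Ordinal iP')) => //.
- by rewrite -(fmorph_eq0 iota) aE.
- by rewrite aE.
by move=> N; have [n [Nn [Hn _]]] := Hinf N; exists n.
Qed.
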